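(* Let $X$ be a $C^*$-correspondence over a $C^*$-algebra $A$, let $J$ be an ideal in $J(X)$, let $I$ be an $X$-invariant ideal in $A$, and let $\mathcal O(I)$ denote the ideal in $\mathcal O(J,X)$ generated by the image of $I$ under the universal representation. There are natural isomorphisms $$\mathcal O(I)\cong\mathcal O_X(I,J\cap I),\qquad \mathcal O(J,X)/\mathcal O(I)\cong\mathcal O(J/I,X/XI).\qquad( * )$$ The algebras $\mathcal O(I)$ and $\mathcal O(J\cap I,XI)$ are Morita equivalent, and if $\phi(I)X=XI$ then $\mathcal O(I)\cong\mathcal O_X(I,J\cap I)=\mathcal O(J\cap I,XI)$. Moreover, the $J$-saturation $S_J(I)$ of $I$ is $X$-invariant and $$S_J(I)=\iota_{0,0}^{-1}(\mathcal O(I)),$$ where $\iota_{0,0}:A\to\mathcal O(J,X)$ is the universal homomorphism. Thus $\mathcal O(I)=\mathcal O(S_J(I))$, and in the right-hand sides of $( * )$ the ideal $I$ may be replaced by the $X$-invariant and $J$-saturated ideal $S_J(I)$.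
   Context: Ideals in $C^*$-algebras are closed and two-sided. A $C^*$-correspondence $X$ over $A$ is a right Hilbert $A$-module with a $*$-homomorphism $\phi:A\to\mathcal L(X)$; $X^{\otimes0}=A$, $X^{\otimes n}$ the $n$-fold interior tensor product; $\mathcal K(Y,Z)=\overline{\mathrm{span}}\{\Theta_{z,y}\}$, $\Theta_{z,y}(w)=z\langle y,w\rangle_A$, $\mathcal K(Y)=\mathcal K(Y,Y)$. $J(X)=\phi^{-1}(\mathcal K(X))$. For an ideal $I$, $ZI=\{zi\}$ and $\mathcal K(Y,ZI)=\overline{\mathrm{span}}\{\Theta_{z,y}:y\in Y,z\in ZI\}\subset\mathcal K(Y,Z)$. $I$ is $X$-invariant if $\phi(I)X\subset XI$; then $X/XI$ is a $C^*$-correspondence over $A/I$ with the quotient structure, and $XI$ is a $C^*$-correspondence over $I$ (restricted actions). $J/I$ denotes the image of $J$ in $A/I$. A representation $(\pi,t)$ of $X$ in a $C^*$-algebra $B$: a $*$-homomorphism $\pi:A\to B$ and linear $t:X\to B$ with $t(xa)=t(x)\pi(a)$, $t(x)^*t(y)=\pi(\langle x,y\rangle_A)$, $t(\phi(a)x)=\pi(a)t(x)$. It induces $\pi_{1,1}:\mathcal K(X)\to B$, $\pi_{1,1}(\Theta_{x,y})=t(x)t(y)^*$. It is coisometric on an ideal $J\subset J(X)$ if $\pi(a)=\pi_{1,1}(\phi(a))$ for $a\in J$. $\mathcal O(J,X)$ is the universal $C^*$-algebra generated by a representation of $X$ coisometric on $J$ (relative Cuntz–Pimsner algebra). $\mathcal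 O_X(I,J')$, for ideals $I,J'$ of $A$ with $J'\subset J(XI)=\{a\in I:\phi(a)|_{XI}\in\mathcal K(XI)\}$: let $\mathcal K_X(I)(n,m)=\mathcal K(X^{\otimes m},X^{\otimes n}I)$, $n,m\in\mathbb N$, and similarly $\mathcal K_X(J')$. For $a\in\mathcal L(X^{\otimes m},X^{\otimes n})$ with $n,m\ge1$ put $(a\otimes1)(y\otimes x)=ay\otimes x$; for $a\in A=\mathcal K(A)$ put $a\otimes1=\phi(a)$; for $x\in X^{\otimes n}=\mathcal K(A,X^{\otimes n})$, $(x\otimes1)y=x\otimes y$; for $a\in\mathcal K(X^{\otimes n},A)$, $(a\otimes1)(y_1\otimes y_2)=\phi(a(y_1))y_2$; $\otimes1^k$ is the $k$-th iterate. A right tensor representation of $\mathcal K_X(I)$ in $B$ is a family of linear maps $\pi_{n,m}:\mathcal K_X(I)(n,m)\to B$ with $\pi_{n,m}(a)^*=\pi_{m,n}(a^* )$ and $\pi_{n,m}(a)\pi_{m+k,l}(b)=\pi_{n+k,l}((a\otimes1^k)b)$ for all $k,l,m,n\in\mathbb N$; it is coisometric on $\mathcal K_X(J')$ if $\pi_{n,m}(a)=\pi_{n+1,m+1}(a\otimes1)$ for $a\in\mathcal K_X(J')(n,m)$. $\mathcal O_X(I,J')$ is the universal $C^*$-algebra generated by a right tensor representation of $\mathcal K_X(I)$ coisometric on $\mathcal K_X(J')$. (For $I=A$ it is $\mathcal O(J',X)$.) An ideal $I$ is $J$-saturated if $a\in J$ and $\phi(a)X\subset XI$ imply $a\in I$.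 The $J$-saturation is $S_J(I)=\overline{\bigcup_kS_k}$ with $S_0=I$, $S_k=\{a\in J:\phi(a)X\subset XS_{k-1}\}+S_{k-1}$; it is the smallest $J$-saturated ideal containing $I$. *)

(* Defs.v *)
From HB Require Import structures.
From mathcomp Require Import all_boot all_order all_algebra.
From mathcomp Require Import boolp classical_sets functions reals topology.
From mathcomp Require Import normedtype complex.
Set Implicit Arguments.
Unset Strict Implicit.
Unset Printing Implicit Defensive.
Import Order.TTheory GRing.Theory Num.Theory numFieldNormedType.Exports.
Local Open Scope ring_scope.
Local Open Scope complex_scope.
Local Open Scope classical_set_scope.

(** * Conventions

  Scalars are the complex numbers [R[i]] over a [realType] [R]; norms are
  [R[i]]-valued, as for every [normedModType R[i]].

  Objects that are only determined up to canonical isomorphism (quotients,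
  ideals regarded as algebras, tensor powers, universal algebras) are presented
  by a carrier together with its structure maps and a predicate saying that
  they have the defining property; statements quantify over all such
  presentations.

  Operators between Hilbert modules are plain functions [Y -> Z].  The spaces
  of compact operators are sets of such functions, and maps defined on them are
  total functions of which only the restriction to these sets matters. *)

(** * C*-algebras (not necessarily unital) *)

Record cstarAlg (R : realType) := CstarAlg {
  cs_car :> completeNormedModType R[i];
  cmul : cs_car -> cs_car -> cs_car;
  cstar : cs_car -> cs_car;
  cmulA : forall a b c, cmul a (cmul b c) = cmul (cmul a b) c;
  cmul_linl : forall b, linear (fun a => cmul a b);
  cmul_linr : forall a, linear (cmul a);
  cstarK : involutive cstar;
  cstarD : forall a b, cstar (a + b) = cstar a + cstar b;
  cstarZ : forall (k : R[i]) a, cstar (k *: a) = k^* *: cstar a;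
  cstarM : forall a b, cstar (cmul a b) = cmul (cstar b) (cstar a);
  cnormM : forall a b, `|cmul a b| <= `|a| * `|b|;
  cnorm_star : forall a, `|cmul (cstar a) a| = `|a| ^+ 2 }.

Definition cpositive (R : realType) (A : cstarAlg R) (a : A) : Prop :=
  exists b : A, a = cmul (cstar b) b.

Record star_hom (R : realType) (A B : cstarAlg R) (f : A -> B) : Prop := StarHom {
  sh_lin : linear f;
  sh_mul : forall a b, f (cmul a b) = cmul (f a) (f b);
  sh_star : forall a, f (cstar a) = cstar (f a) }.

Definition star_iso (R : realType) (A B : cstarAlg R) (f : A -> B) : Prop :=
  star_hom f /\ bijective f.

Record cstar_ideal (R : realType) (A : cstarAlg R) (I : set A) : Prop := CstarIdeal {
  id_closed : closed I;
  id_0 : I 0;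
  id_add : forall a b, I a -> I b -> I (a + b);
  id_scale : forall (k : R[i]) a, I a -> I (k *: a);
  id_mull : forall a b, I b -> I (cmul a b);
  id_mulr : forall a b, I a -> I (cmul a b) }.

Definition ideal_gen (R : realType) (A : cstarAlg R) (S : set A) : set A :=
  [set a | forall K : set A, cstar_ideal K -> S `<=` K -> K a].

Record cstar_sub (R : realType) (A : cstarAlg R) (M : set A) : Prop := CstarSub {
  sub_closed : closed M;
  sub_0 : M 0;
  sub_add : forall a b, M a -> M b -> M (a + b);
  sub_scale : forall (k : R[i]) a, M a -> M (k *: a);
  sub_mul : forall a b, M a -> M b -> M (cmul a b);
  sub_star : forall a, M a -> M (cstar a) }.

Definition generated_by (R : realType) (A : cstarAlg R) (S : set A) : Prop :=
  forall M : set A, cstar_sub M -> S `<=` M -> M = setT.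

(** [e : E -> A] identifies the C*-algebra [E] with the ideal [I] of [A]. *)
Definition is_ideal_alg (R : realType) (A : cstarAlg R) (I : set A)
    (E : cstarAlg R) (e : E -> A) : Prop :=
  [/\ star_hom e, injective e & range e = I].

(** [q : A -> Q] is the quotient of [A] by the ideal [I]; the norm of [Q] is
    then the quotient norm, a C*-norm on a C*-algebra being unique. *)
Definition is_quotient_alg (R : realType) (A : cstarAlg R) (I : set A)
    (Q : cstarAlg R) (q : A -> Q) : Prop :=
  [/\ star_hom q, range q = setT & forall a, q a = 0 <-> I a].

(** * Hilbert modules and C*-correspondences *)

(** Right Hilbert modules; the inner product is linear in the second variable. *)
Record hilbMod (R : realType) (A : cstarAlg R) := HilbMod {
  hm_car :> completeNormedModType R[i];
  ract : hm_car -> A -> hm_car;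
  hip : hm_car -> hm_car -> A;
  ractA : forall x a b, ract x (cmul a b) = ract (ract x a) b;
  ract_linl : forall a, linear (fun x => ract x a);
  ract_linr : forall x, linear (ract x);
  hip_lin : forall x, linear (hip x);
  hip_ract : forall x y a, hip x (ract y a) = cmul (hip x y) a;
  hip_star : forall x y, cstar (hip x y) = hip y x;
  hip_pos : forall x, cpositive (hip x x);
  hip_norm : forall x, `|x| ^+ 2 = `|hip x x| }.

(** A--B correspondences: [lact_adj] says that [lact a] belongs to [L(X)], with
    adjoint [lact (cstar a)]; linearity of [lact a] follows. *)
Record corr (R : realType) (A B : cstarAlg R) := Corr {
  c_mod :> hilbMod B;
  lact : A -> c_mod -> c_mod;
  lact_lin : forall x, linear (fun a => lact a x);
  lactM : forall a b x, lact (cmul a b) x = lact a (lact b x);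
  lact_adj : forall a x y, hip (lact a x) y = hip x (lact (cstar a) y) }.

Section SelfCorr.
Variables (R : realType) (A : cstarAlg R).

Definition self_ip (a b : A) : A := cmul (cstar a) b.

Lemma self_ractA (x a b : A) : cmul x (cmul a b) = cmul (cmul x a) b.
Proof. exact: cmulA. Qed.

Lemma self_ip_lin (x : A) : linear (self_ip x).
Proof. exact: cmul_linr. Qed.

Lemma self_ip_ract (x y a : A) : self_ip x (cmul y a) = cmul (self_ip x y) a.
Proof. exact: cmulA. Qed.

Lemma self_ip_star (x y : A) : cstar (self_ip x y) = self_ip y x.
Proof. by rewrite /self_ip cstarM cstarK. Qed.

Lemma self_ip_pos (x : A) : cpositive (self_ip x x).
Proof. by exists x. Qed.

Lemma self_ip_norm (x : A) : `|x| ^+ 2 = `|self_ip x x|.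
Proof. by rewrite cnorm_star. Qed.

Definition self_hilbMod : hilbMod A :=
  @HilbMod R A (cs_car A) (@cmul R A) self_ip self_ractA (@cmul_linl R A)
    (@cmul_linr R A) self_ip_lin self_ip_ract self_ip_star self_ip_pos
    self_ip_norm.

Lemma self_lactM (a b x : A) : cmul (cmul a b) x = cmul a (cmul b x).
Proof. by rewrite cmulA. Qed.

Lemma self_lact_adj (a x y : A) :
  self_ip (cmul a x) y = self_ip x (cmul (cstar a) y).
Proof. by rewrite /self_ip cstarM cmulA. Qed.

(** [A] as a correspondence over itself. *)
Definition self_corr : corr A A :=
  @Corr R A A self_hilbMod (@cmul R A) (@cmul_linl R A) self_lactM self_lact_adj.

End SelfCorr.

(** * Adjointable and compact operators *)

Definition lspan (K : numDomainType) (V : lmodType K) (S : set V) : set V :=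
  [set v | exists (n : nat) (c : 'I_n -> K) (s : 'I_n -> V),
     (forall i, S (s i)) /\ v = \sum_(i < n) c i *: s i].

Definition is_adjoint (R : realType) (A : cstarAlg R) (Y Z : hilbMod A)
    (f : Y -> Z) (g : Z -> Y) : Prop :=
  forall y z, hip (f y) z = hip y (g z).

Definition adjointable (R : realType) (A : cstarAlg R) (Y Z : hilbMod A)
    (f : Y -> Z) : Prop := exists g, is_adjoint f g.

Definition theta (R : realType) (A : cstarAlg R) (Y Z : hilbMod A)
    (z : Z) (y : Y) : Y -> Z := fun w => ract z (hip y w).

Definition opbound (R : realType) (A : cstarAlg R) (Y Z : hilbMod A)
    (f : Y -> Z) (M : R[i]) : Prop := forall y, `|f y| <= M * `|y|.

(** Closure for the operator norm. *)
Definition opclosure (R : realType) (A : cstarAlg R) (Y Z : hilbMod A)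
    (F : set (Y -> Z)) : set (Y -> Z) :=
  [set f | forall eps : R[i], 0 < eps ->
     exists2 g, F g & opbound (fun y => f y - g y) eps].

(** The closed linear span of the [theta z y] with [z] in [W]; it is
    [K(Y, ZI)] for [W = ZI], and [K(Y, Z)] for [W = setT]. *)
Definition compacts (R : realType) (A : cstarAlg R) (Y Z : hilbMod A)
    (W : set Z) : set (Y -> Z) :=
  opclosure (lspan [set f : Y -> Z | exists z y, W z /\ f = theta z y]).

(** The submodule [ZI]. *)
Definition modI (R : realType) (A : cstarAlg R) (Z : hilbMod A) (I : set A) :
  set Z := [set z | exists (w : Z) (i : A), I i /\ z = ract w i].
Arguments modI {R A} Z I.

(** [J(X)], the preimage of the compact operators under the left action. *)
Definition Jideal (R : realType) (A : cstarAlg R) (X : corr A A) : set A :=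
  [set a | compacts setT (lact (c := X) a)].

Definition X_invariant (R : realType) (A : cstarAlg R) (X : corr A A)
    (I : set A) : Prop := forall a (x : X), I a -> modI X I (lact a x).

Definition J_saturated (R : realType) (A : cstarAlg R) (X : corr A A)
    (J I : set A) : Prop :=
  forall a, J a -> (forall x : X, modI X I (lact a x)) -> I a.

Fixpoint sat_step (R : realType) (A : cstarAlg R) (X : corr A A) (J I : set A)
    (k : nat) : set A :=
  if k is k'.+1 then
    [set a + b | a in [set a | J a /\ forall x : X,
                                 modI X (sat_step X J I k') (lact a x)]
               & b in sat_step X J I k']
  else I.

Definition saturation (R : realType) (A : cstarAlg R) (X : corr A A)
    (J I : set A) : set A := closure (\bigcup_k sat_step X J I k).

(** [p : X -> XQ] is the quotient correspondence [X/XI] over [q : A -> A/I]. *)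
Record is_quotient_corr (R : realType) (A : cstarAlg R) (X : corr A A)
    (I : set A) (Q : cstarAlg R) (q : A -> Q) (XQ : corr Q Q) (p : X -> XQ) :
    Prop := IsQuotientCorr {
  qc_lin : linear p;
  qc_surj : range p = setT;
  qc_ker : forall x, p x = 0 <-> modI X I x;
  qc_ip : forall x y, hip (p x) (p y) = q (hip x y);
  qc_ract : forall x a, p (ract x a) = ract (p x) (q a);
  qc_lact : forall a x, p (lact a x) = lact (q a) (p x) }.

(** [j : XI -> X] identifies the correspondence [XI] over [i : E -> A] with the
    submodule [modI X I] of [X], with restricted actions. *)
Record is_restricted_corr (R : realType) (A : cstarAlg R) (X : corr A A)
    (I : set A) (E : cstarAlg R) (i : E -> A) (XI : corr E E) (j : XI -> X) :
    Prop := IsRestrictedCorr {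
  rc_lin : linear j;
  rc_inj : injective j;
  rc_range : range j = modI X I;
  rc_ip : forall x y, i (hip x y) = hip (j x) (j y);
  rc_ract : forall x a, j (ract x a) = ract (j x) (i a);
  rc_lact : forall a x, j (lact a x) = lact (i a) (j x) }.

(** * Interior tensor products and tensor powers *)

(** [tau : Y x X -> Z] exhibits [Z] as the interior tensor product of [Y] and
    [X] with left action [phi_Y (-) (x) 1].  Balancedness of [tau] follows from
    [it_ip]. *)
Record is_interior_tensor (R : realType) (A B D : cstarAlg R) (Y : corr A B)
    (X : corr B D) (Z : corr A D) (tau : Y -> X -> Z) : Prop :=
    IsInteriorTensor {
  it_linl : forall x, linear (fun y => tau y x);
  it_linr : forall y, linear (tau y);
  it_ip : forall y x y' x',
    hip (tau y x) (tau y' x') = hip x (lact (hip y y') x');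
  it_ract : forall y x d, ract (tau y x) d = tau y (ract x d);
  it_lact : forall a y x, lact a (tau y x) = tau (lact a y) x;
  it_dense : closure (lspan [set z : Z | exists y x, z = tau y x]) = setT }.

(** [tpow_of X T n] is the [n]-th tensor power of [X]: it is literally [A] for
    [n = 0] and [X] for [n = 1], and it is [T k] for [n = k.+2]. *)
Definition tpow_of (R : realType) (A : cstarAlg R) (X : corr A A)
    (T : nat -> corr A A) (n : nat) : corr A A :=
  match n with 0 => self_corr A | 1 => X | k.+2 => T k end.

Record tensor_powers (R : realType) (A : cstarAlg R) (X : corr A A) :=
    TensorPowers {
  tp_obj : nat -> corr A A;
  tp_tau : forall k,
    tpow_of X tp_obj k.+1 -> X -> tpow_of X tp_obj k.+2;
  tp_tensor : forall k, is_interior_tensor (@tp_tau k) }.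

Section FockOperators.
Variables (R : realType) (A : cstarAlg R) (X : corr A A) (T : tensor_powers X).

Definition tpow (n : nat) : corr A A := tpow_of X (tp_obj T) n.

(** [y (x) x] in the [n.+1]-st power; for [y : A] this is [phi(y) x]. *)
Definition tens (n : nat) : tpow n -> X -> tpow n.+1 :=
  match n return tpow n -> X -> tpow n.+1 with
  | 0 => fun (a : A) (x : X) => lact a x
  | k.+1 => @tp_tau _ _ _ T k
  end.

(** An element of the [n]-th power, seen as an operator from [A]. *)
Definition vec (n : nat) (xi : tpow n) : tpow 0 -> tpow n :=
  fun a : A => ract xi a.

(** [K_X(I)(n, m)]. *)
Definition KX (I : set A) (n m : nat) : set (tpow m -> tpow n) :=
  compacts (modI (tpow n) I).

(** [g] is [f (x) 1].  For [m = 0] the operator [f] is [vec n xi], and [f (x) 1]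
    is [phi(xi)] if [n = 0] and [x |-> xi (x) x] if [n > 0]; it has to be
    described separately because [phi(A)X] need not be dense in [X].  For
    [m > 0], [f (x) 1] is determined by its values on elementary tensors. *)
Definition is_otimes1 (n m : nat) :
    (tpow m -> tpow n) -> (tpow m.+1 -> tpow n.+1) -> Prop :=
  match m return (tpow m -> tpow n) -> (tpow m.+1 -> tpow n.+1) -> Prop with
  | 0 => fun f g =>
      exists2 xi : tpow n, f = vec xi & forall x : X, g x = tens xi x
  | k.+1 => fun f g => adjointable g /\
      forall (y : tpow k.+1) (x : X), g (tens y x) = tens (f y) x
  end.

Definition otimes1 (n m : nat) (f : tpow m -> tpow n) :
    tpow m.+1 -> tpow n.+1 :=
  xget (fun _ : tpow m.+1 => 0 : tpow n.+1) [set g | is_otimes1 f g].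

Fixpoint otimes1k (n m : nat) (f : tpow m -> tpow n) (k : nat) :
    tpow (k + m) -> tpow (k + n) :=
  match k return tpow (k + m) -> tpow (k + n) with
  | 0 => f
  | k'.+1 => otimes1 (@otimes1k n m f k')
  end.
Arguments otimes1k {n m} f k.

(** * Right tensor representations *)

Definition linear_on (V W : lmodType R[i]) (K : set V) (f : V -> W) : Prop :=
  forall (c : R[i]) u v, K u -> K v -> f (c *: u + v) = c *: f u + f v.

Record is_rtr (I : set A) (B : cstarAlg R)
    (pi : forall n m, (tpow m -> tpow n) -> B) : Prop := IsRtr {
  rtr_lin : forall n m, linear_on (@KX I n m) (@pi n m);
  rtr_star : forall n m a b, @KX I n m a -> is_adjoint a b ->
    cstar (@pi n m a) = @pi m n b;
  rtr_mul : forall k l m n a b, @KX I n m a -> @KX I (k + m)%N l b ->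
    cmul (@pi n m a) (@pi (k + m)%N l b)
    = @pi (k + n)%N l (otimes1k a k \o b) }.

Definition rtr_coisometric (J' : set A) (B : cstarAlg R)
    (pi : forall n m, (tpow m -> tpow n) -> B) : Prop :=
  forall n m a, @KX J' n m a -> @pi n m a = @pi n.+1 m.+1 (otimes1 a).

(** [P], with [kappa], is the algebra [O_X(I, J')]. *)
Record is_OX (I J' : set A) (P : cstarAlg R)
    (kappa : forall n m, (tpow m -> tpow n) -> P) : Prop := IsOX {
  ox_rtr : is_rtr I kappa;
  ox_coiso : rtr_coisometric J' kappa;
  ox_gen : generated_by
    [set b | exists n m a, @KX I n m a /\ b = @kappa n m a];
  ox_univ : forall (B : cstarAlg R) (pi : forall n m, (tpow m -> tpow n) -> B),
    is_rtr I pi -> rtr_coisometric J' pi ->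
    exists2 h : P -> B, star_hom h &
      forall n m a, @KX I n m a -> h (@kappa n m a) = @pi n m a }.

End FockOperators.

(** * Representations and relative Cuntz--Pimsner algebras *)

Record is_rep (R : realType) (A : cstarAlg R) (X : corr A A) (B : cstarAlg R)
    (pi : A -> B) (t : X -> B) : Prop := IsRep {
  rep_hom : star_hom pi;
  rep_lin : linear t;
  rep_ract : forall x a, t (ract x a) = cmul (t x) (pi a);
  rep_ip : forall x y, cmul (cstar (t x)) (t y) = pi (hip x y);
  rep_lact : forall a x, t (lact a x) = cmul (pi a) (t x) }.

(** [p] is the induced map [pi_{1,1}] on [K(X)], i.e. the contractive linear
    map with [theta x y |-> t x (t y)^*]. *)
Record is_pi11 (R : realType) (A : cstarAlg R) (X : corr A A) (B : cstarAlg R)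
    (t : X -> B) (p : (X -> X) -> B) : Prop := IsPi11 {
  pi11_lin : linear_on (compacts setT) p;
  pi11_bound : forall a (M : R[i]), compacts setT a -> 0 <= M ->
    opbound a M -> `|p a| <= M;
  pi11_theta : forall x y, p (theta x y) = cmul (t x) (cstar (t y)) }.

Definition coisometric (R : realType) (A : cstarAlg R) (X : corr A A)
    (J : set A) (B : cstarAlg R) (pi : A -> B) (t : X -> B) : Prop :=
  exists2 p, is_pi11 t p & forall a, J a -> pi a = p (lact a).

(** [O], with [iA] and [iX], is the algebra [O(J, X)]. *)
Record is_relCP (R : realType) (A : cstarAlg R) (X : corr A A) (J : set A)
    (O : cstarAlg R) (iA : A -> O) (iX : X -> O) : Prop := IsRelCP {
  cp_rep : is_rep iA iX;
  cp_coiso : coisometric J iA iX;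
  cp_gen : generated_by (range iA `|` range iX);
  cp_univ : forall (B : cstarAlg R) (pi : A -> B) (t : X -> B),
    is_rep pi t -> coisometric J pi t ->
    exists2 h : O -> B, star_hom h &
      (forall a, h (iA a) = pi a) /\ (forall x, h (iX x) = t x) }.

(** [iota] is the right tensor representation of [K_X = K_X(A)] determined by
    the representation [(iA, iX)]: [iota_{0,0} = iA] and [iota_{1,0} = iX]
    under [A = K(A)] and [X = K(A, X)]. *)
Definition tensor_extension (R : realType) (A : cstarAlg R) (X : corr A A)
    (T : tensor_powers X) (O : cstarAlg R) (iA : A -> O) (iX : X -> O)
    (iota : forall n m, (tpow T m -> tpow T n) -> O) : Prop :=
  [/\ is_rtr setT iota,
      forall a : A, iota 0%N 0%N (@vec _ _ _ T 0 a) = iA a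
    & forall x : X, iota 1%N 0%N (@vec _ _ _ T 1 x) = iX x].

(** The natural isomorphism of [O_X(K, K')] onto the ideal [L] of [O(J, X)]:
    it sends the universal right tensor representation of [K_X(K)] to the
    restriction of [iota]. *)
Definition natural_iso_ideal (R : realType) (A : cstarAlg R) (X : corr A A)
    (T : tensor_powers X) (O : cstarAlg R)
    (iota : forall n m, (tpow T m -> tpow T n) -> O) (K K' : set A)
    (L : set O) : Prop :=
  forall (P : cstarAlg R) (kappa : forall n m, (tpow T m -> tpow T n) -> P),
    is_OX K K' kappa ->
    exists2 Psi : P -> O, is_ideal_alg L Psi &
      forall n m a, KX K a -> Psi (@kappa n m a) = @iota n m a.

(** The natural isomorphism of [O(J, X)/L] with [O(J/K, X/XK)]: it intertwines
    the universal representations.  Here [J/K] is the image [q @` J]. *)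
Definition natural_iso_quotient (R : realType) (A : cstarAlg R) (X : corr A A)
    (J : set A) (O : cstarAlg R) (iA : A -> O) (iX : X -> O) (K : set A)
    (L : set O) : Prop :=
  forall (Q : cstarAlg R) (q : A -> Q) (XQ : corr Q Q) (p : X -> XQ)
         (O' : cstarAlg R) (jA : Q -> O') (jX : XQ -> O')
         (D : cstarAlg R) (d : O -> D),
    is_quotient_alg K q -> is_quotient_corr K q p ->
    is_relCP (q @` J) jA jX -> is_quotient_alg L d ->
    exists2 Phi : D -> O', star_iso Phi &
      (forall a, Phi (d (iA a)) = jA (q a)) /\
      (forall x, Phi (d (iX x)) = jX (p x)).

(** * Morita equivalence *)

(** [M], with the left inner product [lip], is a [B]--[D] imprimitivity
    bimodule: a full right Hilbert [D]-module which is also a full left Hilbert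
    [B]-module, with compatible actions and inner products. *)
Record is_imprimitivity (R : realType) (B D : cstarAlg R) (M : corr B D)
    (lip : M -> M -> B) : Prop := IsImprimitivity {
  im_lin : forall y, linear (fun x => lip x y);
  im_lact : forall b x y, lip (lact b x) y = cmul b (lip x y);
  im_star : forall x y, cstar (lip x y) = lip y x;
  im_pos : forall x, cpositive (lip x x);
  im_norm : forall x, `|x| ^+ 2 = `|lip x x|;
  im_ract : forall x y d, lip (ract x d) y = lip x (ract y (cstar d));
  im_compat : forall x y z, lact (lip x y) z = ract x (hip y z);
  im_fulll : closure (lspan [set b : B | exists x y, b = lip x y]) = setT;
  im_fullr : closure (lspan [set d : D | exists x y : M, d = hip x y]) = setT }.

Definition morita_equivalent (R : realType) (B D : cstarAlg R) : Prop :=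
  exists (M : corr B D) (lip : M -> M -> B), is_imprimitivity lip.

(* Main.v *)
Require Import Defs.
From HB Require Import structures.
From mathcomp Require Import all_boot all_order all_algebra.
From mathcomp Require Import boolp classical_sets functions reals topology.
From mathcomp Require Import normedtype complex.
From mathcomp Require Import lra ring zify.
Set Implicit Arguments.
Unset Strict Implicit.
Unset Printing Implicit Defensive.
Import Order.TTheory GRing.Theory Num.Theory numFieldNormedType.Exports.
Local Open Scope ring_scope.
Local Open Scope complex_scope.
Local Open Scope classical_set_scope.

(** A representation [(pi, t)] extends to the spaces K(X^m, X^n) by [theta z y |-> t_n(z) t_m(y)^*]
    ([kap]; [tensor_rep] is the case of all of [A]). For invariant I, the closed span of the t_n(z)
    t_m(y)^* with z in X^n I is the ideal O(I) ([idspanE]). The closed span R3 of those with z and y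
    in the tensor powers of the correspondence XI is a subalgebra with R3 O R3 inside R3, and it
    generates O(I) as an ideal. Universal properties give homomorphisms of O_X(I, J cap I) onto the
    first span ([ox_iso]) and of O(J cap I, XI) onto the second ([embed3]). Once these are
    injective, the closure of O R3 is an imprimitivity bimodule ([corner_imprimitivity]), and
    phi(I)X = XI makes the two spans coincide ([corner_full]).

    Injectivity is a gauge-invariant uniqueness argument. [gauge_inj] averages over roots of unity
    and reduces it to isometry on the core, spanned by the degrees (k, k). The core is controlled by
    the Fock module F, the Hilbert sum of the X^n: modulo K(F, FJ) its creation representation is
    coisometric on J ([fock_coiso]), hence factors through O(J,X). Suppose that a finite sum of core
    elements acts on F by an operator in K(F, FJ). Its components on X^m then lie in K(X^m, X^m J)
    and tend to zero; passing from m to m + 1 tensors the component with 1 and adds the next term. A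
    coisometric representation does not see the tensoring, so its value on the sum equals its value
    on components of arbitrarily small norm, that is, zero ([csum_kill]). [core_bound] turns this
    into the norm estimate by cutting down a positive element.

    The quotient isomorphism ([quotient_iso]) comes from two mutually inverse homomorphisms given by
    universal properties; the point is that approximation by finite rank operators descends to X/XI
    without loss of norm ([quot_corr_bd]).

    For the saturation, the preimage in A of any ideal of O(J,X) is J-saturated ([preim_saturated]),
    which gives one inclusion. Conversely let S be invariant and saturated and let a have image in
    O(S). Dividing L(F) also by the operators with range in FS gives pi(a) = D + D' with D in K(F,
    FJ) and D' mapping into FS ([fock_decomp]). The components of D vanish at infinity, so for an
    element c close to the positive element under study, phi_m(c) maps X^m into X^m S for some m;
    saturation lowers m step by step ([descend]), and m = 0 says that c is in S ([sat_kernel]).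

    The underlying C*-theory rests on one device: the iteration for [y + y = x + y ** y], that is (1
    - y)^2 = 1 - x. Its limit lies in every closed subalgebra containing x, which replaces
    functional calculus. It yields contractivity of homomorphisms, positivity, approximate units,
    the factorization y = w k in Hilbert modules, and quotients. *)

(** * Real-valued norms, metric closures and Banach spaces *)

Section RealNorm.
Variable R : realType.
Local Notation C := R[i].

Definition cabs (k : C) : R := complex.Re `|k|.

Lemma cabsE (k : C) : `|k| = (cabs k)%:C.
Proof. by rewrite /cabs RRe_real // normr_real. Qed.

Lemma cabs_ge0 (k : C) : 0 <= cabs k.
Proof. by rewrite -lecR -cabsE normr_ge0. Qed.

Lemma cabs_real (x : R) : cabs x%:C = `|x|.
Proof.
by rewrite /cabs normc_def /= expr0n /= addr0 sqrtr_sqr.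
Qed.

Lemma cabsM (a b : C) : cabs (a * b) = cabs a * cabs b.
Proof. by apply: complexI; rewrite rmorphM /= -!cabsE normrM. Qed.

Lemma cabsJ (a : C) : cabs a^* = cabs a.
Proof. by rewrite /cabs !normc_def /=; case: a => x y /=; rewrite sqrrN. Qed.

(** Norms take values in [R[i]]; all estimates are carried out with this real version, so that real
    arithmetic can close them. *)
Definition nr (V : normedModType C) (x : V) : R := complex.Re `|x|.

Variable V : normedModType C.
Implicit Types (x y z : V).

Lemma nrE x : `|x| = (nr x)%:C.
Proof. by rewrite /nr RRe_real // normr_real. Qed.

Lemma nr_ge0 x : 0 <= nr x.
Proof. by rewrite -lecR -nrE normr_ge0. Qed.

Lemma nr0 : nr (0 : V) = 0.
Proof. by rewrite /nr normr0. Qed.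

Lemma nr0_eq0 x : nr x = 0 -> x = 0.
Proof. by move=> h; apply/eqP; rewrite -normr_eq0 nrE h. Qed.

Lemma nr_le0 x : nr x <= 0 -> x = 0.
Proof. by move=> h; apply: nr0_eq0; apply/eqP; rewrite eq_le h nr_ge0. Qed.

Lemma nrD x y : nr (x + y) <= nr x + nr y.
Proof. by rewrite -lecR rmorphD /= -!nrE ler_normD. Qed.

Lemma nrN x : nr (- x) = nr x.
Proof. by rewrite /nr normrN. Qed.

Lemma nrZ k x : nr (k *: x) = cabs k * nr x.
Proof. by apply: complexI; rewrite rmorphM /= -!nrE -cabsE normrZ. Qed.

Lemma nrZr (k : R) x : nr (k%:C *: x) = `|k| * nr x.
Proof. by rewrite nrZ cabs_real. Qed.

Lemma nrB x y : nr (x - y) <= nr x + nr y.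
Proof. by rewrite -(nrN y) nrD. Qed.

Lemma nrC x y : nr (x - y) = nr (y - x).
Proof. by rewrite -nrN opprB. Qed.

Lemma nr_tri y x z : nr (x - z) <= nr (x - y) + nr (y - z).
Proof. by rewrite (_ : x - z = (x - y) + (y - z)) ?nrD // addrA subrK. Qed.

Lemma nr_distl x y : nr x <= nr y + nr (x - y).
Proof. by have := nrD y (x - y); rewrite addrC subrK. Qed.

Lemma nr_sum (I : Type) (r : seq I) (P : pred I) (F : I -> V) :
  nr (\sum_(i <- r | P i) F i) <= \sum_(i <- r | P i) nr (F i).
Proof.
elim/big_rec2: _ => [|i a b _ h]; first by rewrite nr0.
by apply: le_trans (nrD _ _) _; rewrite lerD2l.
Qed.

Lemma eq_nr x y : (forall e : R, 0 < e -> nr (x - y) <= e) -> x = y.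
Proof.
move=> h; apply/eqP; rewrite -subr_eq0; apply/eqP; apply: nr_le0.
by apply/ler_addgt0Pr => e e0; rewrite add0r h.
Qed.

Definition nlim (u : nat -> V) (l : V) : Prop :=
  forall e : R, 0 < e -> exists N, forall n, (N <= n)%N -> nr (l - u n) <= e.

(** The closure of [S] in metric form ([closureP]), with non-strict bounds; approximation arguments
    then need no filters. *)
Definition approx (S : set V) (x : V) : Prop :=
  forall e : R, 0 < e -> exists2 y, S y & nr (x - y) <= e.

Lemma nlim_approx (S : set V) u l : nlim u l -> (forall n, S (u n)) -> approx S l.
Proof. by move=> ul Su e /ul[N hN]; exists (u N) => //; apply: hN. Qed.

Lemma approx_mem (S : set V) x : S x -> approx S x.
Proof. by move=> h e e0; exists x; rewrite // subrr nr0 ltW. Qed.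

Lemma approx_sub (S S' : set V) x : S `<=` S' -> approx S x -> approx S' x.
Proof. by move=> h a e /a[y /h Sy ?]; exists y. Qed.

Lemma nr_lt (x : V) (e : R) : (nr x < e) = (`|x| < e%:C).
Proof. by rewrite nrE ltcR. Qed.

Lemma real_gt0 (e : C) : 0 < e -> exists2 d : R, 0 < d & e = d%:C.
Proof.
move=> e0; exists (complex.Re e); last by rewrite RRe_real // realE ltW.
by have := e0; rewrite ltcE => /andP[].
Qed.

Lemma closureP (S : set V) : closure S = approx S.
Proof.
apply/seteqP; split => x.
  move=> cx e e0.
  have /cx[y [Sy]] : nbhs x (ball x (e%:C)) by apply: nbhsx_ballx; rewrite ltcR.
  by rewrite -ball_normE /= -nr_lt => /ltW h; exists y.
move=> ax B /nbhs_ballP[d /= d0]; rewrite -ball_normE => hB.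
have [r r0 dr] := real_gt0 d0.
have [|y Sy h] := ax (r / 2); first by rewrite divr_gt0.
exists y; split => //; apply: hB; rewrite /= dr -nr_lt; apply: le_lt_trans h _.
by rewrite ltr_pdivrMr // mulr_natr mulr2n ltrDl.
Qed.

Lemma closedP (S : set V) : closed S <-> approx S `<=` S.
Proof. by rewrite /closed -closureP. Qed.

End RealNorm.

Lemma nr_complete (R : realType) (V : completeNormedModType R[i]) (u : nat -> V) :
  (forall e : R, 0 < e -> exists N, forall n, (N <= n)%N -> nr (u n - u N) <= e) ->
  exists l, nlim u l.
Proof.
move=> hu.
have : cauchy (u @ \oo).
  apply/cauchy_ballP => e /= e0.
  have [r r0 ->] := real_gt0 e0.
  have [|N hN] := hu (r / 4); first by rewrite divr_gt0.
  exists ([set u n | n in [set n | (N <= n)%N]], [set u n | n in [set n | (N <= n)%N]]).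
    by split; exists N => // n /= Nn; exists n.
  move=> [_ _] /= [[n Nn <-] [m Nm <-]].
  rewrite -ball_normE /= -nr_lt.
  have h1 := hN _ Nn; have := hN _ Nm; rewrite nrC => h2.
  have := nr_tri (u N) (u n) (u m); lra.
move/cauchy_cvgP => /cvg_ex[l /= ul]; exists l => e e0.
have /ul[N _ hN] : nbhs l (ball l (e%:C)) by apply: nbhsx_ballx; rewrite ltcR.
by exists N => n /hN /=; rewrite -ball_normE /= -nr_lt => /ltW.
Qed.

(** The data that promote a bare module to a [completeNormedModType]: a real norm that is complete
    for sequences. It serves operators, quotients, subspaces and Hilbert sums. *)
Record banach_norm (R : realType) (V : lmodType R[i]) (N : V -> R) : Prop :=
  BanachNorm {
  bn_D : forall x y, N (x + y) <= N x + N y;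
  bn_Z : forall k x, N (k *: x) = cabs k * N x;
  bn_0 : forall x, N x = 0 -> x = 0;
  bn_complete : forall u : nat -> V,
    (forall e : R, 0 < e -> exists M, forall n, (M <= n)%N -> N (u n - u M) <= e) ->
    exists l, forall e : R, 0 < e -> exists M, forall n, (M <= n)%N -> N (l - u n) <= e }.

Definition banach_of (R : realType) (V : lmodType R[i]) (N : V -> R)
  (h : banach_norm N) : Type := V.

Section Banach.
Variables (R : realType) (V : lmodType R[i]) (N : V -> R) (h : banach_norm N).
Local Notation B := (banach_of h).

HB.instance Definition _ := GRing.Lmodule.on B.

Let norm (x : B) : R[i] := (N x)%:C.

Let normD (x y : B) : norm (x + y) <= norm x + norm y.
Proof. by rewrite /norm -rmorphD /= lecR; apply: (bn_D h). Qed.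

Let normZ (k : R[i]) (x : B) : norm (k *: x) = `|k| * norm x.
Proof. by rewrite /norm (bn_Z h) rmorphM /= cabsE. Qed.

Let norm0 (x : B) : norm x = 0 -> x = 0.
Proof. by move=> h0; apply: (bn_0 h); apply: complexI. Qed.

HB.instance Definition _ := Lmodule_isNormed.Build R[i] B normD normZ norm0.

Let nrB (x : B) : nr x = N x.
Proof. by []. Qed.

(** A Cauchy filter contains balls of radius [1/(n+1)]; their centres form a Cauchy sequence, whose
    limit is a limit of the filter. *)
Let complete (F : set_system B) : ProperFilter F -> cauchy F -> cvg F.
Proof.
move=> FF /cauchyP cF.
have /choice[x hx] : forall n : nat, exists x : B, F (ball x (n.+1%:R^-1 : R)%:C).
  move=> n; have [|x Fx] := cF ((n.+1%:R^-1 : R)%:C).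
    by rewrite ltcR invr_gt0 ltr0n.
  by exists x.
have hd n m : nr (x n - x m) <= n.+1%:R^-1 + m.+1%:R^-1.
  have [y] : exists y, ball (x n) (n.+1%:R^-1 : R)%:C y /\
      ball (x m) (m.+1%:R^-1 : R)%:C y.
    by apply: (@filter_ex _ F); apply: filterI.
  rewrite -!ball_normE /= -!nr_lt => -[h1' h2'].
  apply: le_trans (nr_tri (y : B) (x n) (x m)) _.
  by rewrite (nrC (y : B) (x m)) lerD // ltW.
have inv (e : R) : 0 < e -> exists M, forall n, (M <= n)%N -> (n.+1%:R^-1 : R) <= e.
  move=> e0; exists (Num.trunc e^-1) => n Mn.
  rewrite invf_ple ?posrE ?ltr0n //.
  apply: (le_trans (ltW (truncnS_gt _))).
  by rewrite ler_nat.
have [|l hl] := bn_complete h (u := x).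
  move=> e e0; have [|M hM] := inv (e / 2); first by rewrite divr_gt0.
  exists M => n Mn; apply: (le_trans (hd _ _)).
  by rewrite [leRHS]splitr lerD // hM.
apply/cvg_ex; exists l => A /nbhs_ballP[d /= d0]; rewrite -ball_normE => hA.
have [r r0 dr] := real_gt0 d0.
have [|M1 h1] := hl (r / 4); first by rewrite divr_gt0.
have [|M2 h2] := inv (r / 4); first by rewrite divr_gt0.
set n := maxn M1 M2.
have {}h1 : nr ((l : B) - x n) <= r / 4 by apply: h1; rewrite leq_maxl.
have {}h2 : (n.+1%:R^-1 : R) <= r / 4 by apply: h2; rewrite leq_maxr.
apply: filterS (hx n) => y; rewrite -ball_normE /= -nr_lt => h3.
apply: hA; rewrite /= dr -nr_lt.
apply: le_lt_trans (nr_tri (x n) (l : B) y) _.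
by apply: (le_lt_trans (lerD h1 (ltW (lt_le_trans h3 h2)))); lra.
Qed.

HB.instance Definition _ := Uniform_isComplete.Build B complete.

Definition banach : completeNormedModType R[i] := B.

Lemma nr_banach (x : banach) : nr x = N x.
Proof. by []. Qed.

End Banach.

(** * A reflexive decision procedure for linear identities *)

Section ModuleReflection.
Variables (K : comPzRingType) (V : lmodType K).

Inductive mexp : Type :=
  MVar of nat | MZero | MAdd of mexp & mexp | MOpp of mexp | MScale of K & mexp.

Fixpoint meval (s : seq V) (e : mexp) : V :=
  match e with
  | MVar n => nth 0 s n
  | MZero => 0
  | MAdd a b => meval s a + meval s b
  | MOpp a => - meval s a
  | MScale k a => k *: meval s a
  end.

Fixpoint mcoef (e : mexp) (i : nat) : K :=
  match e with
  | MVar n => if Nat.eqb n i then 1 else 0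
  | MZero => 0
  | MAdd a b => mcoef a i + mcoef b i
  | MOpp a => - mcoef a i
  | MScale k a => k * mcoef a i
  end.

Fixpoint mcombine (s : seq V) (c : nat -> K) (i : nat) : V :=
  if s is v :: s' then c i *: v + mcombine s' c i.+1 else 0.

(** The offset [i], realised by [i] zero atoms in front of [s], is what lets the induction on the
    list of atoms go through. *)
Lemma mcombineE s e i : mcombine s (mcoef e) i = meval (ncons i 0 s) e.
Proof.
have h0 s' c j : (forall n, c n = 0) -> mcombine s' c j = 0.
  by move=> c0; elim: s' j => //= v s' IH j; rewrite c0 scale0r add0r IH.
elim: e => [n||a IHa b IHb|a IHa|k a IHa] /=.
- elim: s i => [|v s IH] i /=.
    by rewrite -cat_nseq cats0 nth_nseq if_same.
  have := IH i.+1; rewrite -!cat_nseq !nth_cat !size_nseq => ->.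
  have -> : Nat.eqb n i = (n == i) by apply/idP/idP => [/PeanoNat.Nat.eqb_eq/eqP|/eqP/PeanoNat.Nat.eqb_eq].
  rewrite !nth_nseq !if_same; case: (ltngtP n i) => h.
  + by rewrite scale0r add0r (ltnW h : n < i.+1)%N.
  + by rewrite scale0r add0r ltnNge h /= -[(n - i)%N]prednK ?subn_gt0 //= subnS.
  + by rewrite h ltnS leqnn subnn scale1r addr0.
- by rewrite h0.
- rewrite -IHa -IHb; elim: (s) (i) => [|v s' IH] j /=; first by rewrite addr0.
  by rewrite IH scalerDl addrACA.
- rewrite -IHa; elim: (s) (i) => [|v s' IH] j /=; first by rewrite oppr0.
  by rewrite IH scaleNr opprD.
- rewrite -IHa; elim: (s) (i) => [|v s' IH] j /=; first by rewrite scaler0.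
  by rewrite IH scalerDr scalerA.
Qed.

Fixpoint mcheck (n i : nat) (e1 e2 : mexp) : Prop :=
  if n is n'.+1 then mcoef e1 i = mcoef e2 i /\ mcheck n' i.+1 e1 e2 else True.

Lemma mexpP s e1 e2 : mcheck (size s) 0 e1 e2 -> meval s e1 = meval s e2.
Proof.
rewrite -(mcombineE s e1 0) -(mcombineE s e2 0).
by elim: s 0%N => //= v s IH i [-> /IH ->].
Qed.
End ModuleReflection.

Ltac mod_index x s :=
  lazymatch s with
  | x :: _ => constr:(0%N)
  | _ :: ?s' => let n := mod_index x s' in constr:(S n)
  end.
Ltac mod_atoms s e :=
  lazymatch e with
  | (?a + ?b)%R => let s1 := mod_atoms s a in mod_atoms s1 b
  | (- ?a)%R => mod_atoms s a
  | (?k *: ?a)%R => mod_atoms s a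
  | (0)%R => s
  | _ => match s with
         | _ => let n := mod_index e s in s
         | _ => constr:(e :: s)
         end
  end.
Ltac mod_quote K s e :=
  lazymatch e with
  | (?a + ?b)%R => let a' := mod_quote K s a in let b' := mod_quote K s b in constr:(MAdd a' b')
  | (- ?a)%R => let a' := mod_quote K s a in constr:(MOpp a')
  | (?k *: ?a)%R => let a' := mod_quote K s a in constr:(@MScale K k a')
  | (0)%R => constr:(MZero K)
  | _ => let n := mod_index e s in constr:(MVar K n)
  end.
(** Both sides are read as linear combinations of the same atoms; one scalar equation per atom is
    left to [ring] or [field]. *)
Ltac lmodule R :=
  let K := constr:((R[i])%type : comPzRingType) in
  lazymatch goal with
  | |- @eq ?T ?a ?b =>
    let s0 := constr:(@nil T) in
    let s1 := mod_atoms s0 a in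
    let s2 := mod_atoms s1 b in
    let e1 := mod_quote K s2 a in
    let e2 := mod_quote K s2 b in
    let H := fresh in
    assert (H := @mexpP K _ s2 e1 e2); apply: H;
    lazy [mcheck mcoef Nat.eqb size];
    repeat (match goal with |- _ /\ _ => split | |- True => exact I end);
    first [by [] | ring | by (field; rewrite ?pnatr_eq0)]
  end.


Notation "a ** b" := (cmul a b) (at level 40, left associativity).

Lemma lin_on0 (K : pzRingType) (V W : lmodType K) (N : set V) (F : V -> W) : N 0 ->
  (forall c u v, N u -> N v -> F (c *: u + v) = c *: F u + F v) -> F 0 = 0.
Proof. by move=> N0 lF; have := lF 1 0 0 N0 N0; rewrite scaler0 addr0 scale1r -[LHS]addr0 => /addrI. Qed.

Section Linear.
Variables (K : pzRingType) (V W : lmodType K) (f : V -> W).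
Hypothesis hf : linear f.

Lemma lin0 : f 0 = 0.
Proof. by apply: (@lin_on0 _ _ _ setT) => // c u v _ _; exact: hf. Qed.

Lemma linZ k x : f (k *: x) = k *: f x.
Proof. by have := hf k x 0; rewrite addr0 lin0 addr0. Qed.

Lemma linD x y : f (x + y) = f x + f y.
Proof. by have := hf 1 x y; rewrite !scale1r. Qed.

Lemma linN x : f (- x) = - f x.
Proof. by rewrite -scaleN1r linZ scaleN1r. Qed.

Lemma linB x y : f (x - y) = f x - f y.
Proof. by rewrite linD linN. Qed.

End Linear.

Lemma eq_diff (V : zmodType) (p q u v : V) : p = q -> u - v = p - q -> u = v.
Proof. by move=> -> /eqP; rewrite subrr subr_eq0 => /eqP. Qed.

(** * C*-algebras and the square root of 1 - x *)

Section Cstar.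
Variables (R : realType) (A : cstarAlg R).
Implicit Types (a b c x y : A).
Local Notation C := R[i].

Lemma cmulDl a b c : (a + b) ** c = a ** c + b ** c.
Proof. exact: (linD (cmul_linl c)). Qed.
Lemma cmulDr a b c : c ** (a + b) = c ** a + c ** b.
Proof. exact: (linD (cmul_linr c)). Qed.
Lemma cmulBl a b c : (a - b) ** c = a ** c - b ** c.
Proof. exact: (linB (cmul_linl c)). Qed.
Lemma cmulBr a b c : c ** (a - b) = c ** a - c ** b.
Proof. exact: (linB (cmul_linr c)). Qed.
Lemma cmulNl a b : (- a) ** b = - (a ** b).
Proof. exact: (linN (cmul_linl b)). Qed.
Lemma cmulNr a b : a ** (- b) = - (a ** b).
Proof. exact: (linN (cmul_linr a)). Qed.
Lemma cmul0l a : 0 ** a = 0.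
Proof. exact: (lin0 (cmul_linl a)). Qed.
Lemma cmul0r a : a ** 0 = 0.
Proof. exact: (lin0 (cmul_linr a)). Qed.
Lemma cmulZl (k : C) a b : (k *: a) ** b = k *: (a ** b).
Proof. exact: (linZ (cmul_linl b)). Qed.
Lemma cmulZr (k : C) a b : a ** (k *: b) = k *: (a ** b).
Proof. exact: (linZ (cmul_linr a)). Qed.

Lemma cstar0 : cstar (0 : A) = 0.
Proof. by have := cstarD (0 : A) 0; rewrite addr0 -[LHS]addr0 => /addrI. Qed.
Lemma cstarN a : cstar (- a) = - cstar a.
Proof. by apply/eqP; rewrite -subr_eq0 opprK -cstarD addNr cstar0. Qed.
Lemma cstarB a b : cstar (a - b) = cstar a - cstar b.
Proof. by rewrite cstarD cstarN. Qed.
Lemma cstarZc (k : C) a : cstar (k *: a) = (conjc k) *: cstar a.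
Proof. exact: cstarZ. Qed.
Lemma cstarZr (r : R) a : cstar (r%:C *: a) = r%:C *: cstar a.
Proof. by rewrite cstarZc conjc_real. Qed.

Lemma nrM a b : nr (a ** b) <= nr a * nr b.
Proof. by rewrite -lecR rmorphM /= -!nrE cnormM. Qed.

Lemma nr_starM a : nr (cstar a ** a) = nr a ^+ 2.
Proof. by apply: complexI; rewrite rmorphXn /= -!nrE cnorm_star. Qed.

Lemma nr_star a : nr (cstar a) = nr a.
Proof.
suff h b : nr b <= nr (cstar b) by apply/eqP; rewrite eq_le h andbT -{2}(cstarK a) h.
have := nr_starM b; have := nrM (cstar b) b; move=> h1 h2.
have [b0|b0] := ltP 0 (nr b); last by rewrite (le_trans b0) // nr_ge0.
by move: h1; rewrite h2 expr2 ler_pM2r.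
Qed.

Lemma nr_sq a : cstar a = a -> nr (a ** a) = nr a ^+ 2.
Proof. by move=> h; rewrite -{1}h nr_starM. Qed.

Lemma eq_sub0 a b : nr (a - b) = 0 -> a = b.
Proof. by move=> /nr0_eq0 /eqP; rewrite subr_eq0 => /eqP. Qed.

(** Closed subalgebras, not assumed stable under the involution. Elements built by limits of
    polynomials lie in each [calg] containing the original element; ideals, *-subalgebras and
    commutants are all instances. *)
Record calg (M : set A) : Prop := Calg {
  ca_closed : approx M `<=` M;
  ca_0 : M 0;
  ca_D : forall a b, M a -> M b -> M (a + b);
  ca_Z : forall (k : C) a, M a -> M (k *: a);
  ca_M : forall a b, M a -> M b -> M (a ** b) }.

Lemma ideal_calg I : cstar_ideal I -> calg I.
Proof. by case=> cI i0 iD iZ il ir; split => //; [apply/closedP|move=> *; exact: il]. Qed.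

Lemma sub_calg I : cstar_sub I -> calg I.
Proof. by case=> cI i0 iD iZ il ir; split => //; apply/closedP. Qed.

Lemma calg_N M a : calg M -> M a -> M (- a).
Proof. by move=> hM Ma; rewrite -scaleN1r; apply: ca_Z. Qed.

Lemma calg_B M a b : calg M -> M a -> M b -> M (a - b).
Proof. by move=> hM Ma Mb; apply: (ca_D hM) => //; apply: calg_N. Qed.

Lemma calgT : calg setT. Proof. by split. Qed.

Lemma calg_comm b : calg [set a | a ** b = b ** a].
Proof.
split => /=.
- move=> x hx; apply: eq_nr => e e0.
  have d0 : 0 < e / (1 + 2 * nr b) by rewrite divr_gt0 // ltr_pwDl // mulr_ge0 ?nr_ge0.
  have [y /= hy hxy] := hx _ d0.
  rewrite (_ : _ - _ = (x - y) ** b - b ** (x - y)); last first.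
    by rewrite cmulBl cmulBr hy opprB addrA subrK.
  apply: (le_trans (nrB _ _)).
  apply: (le_trans (lerD (nrM _ _) (nrM _ _))).
  rewrite (mulrC (nr b)) -mulrDr.
  rewrite ler_pdivlMr in hxy; last by rewrite ltr_pwDl // mulr_ge0 ?nr_ge0.
  apply: le_trans hxy; apply: ler_wpM2l; first exact: nr_ge0.
  by have := nr_ge0 b; lra.
- by rewrite cmul0l cmul0r.
- by move=> u v hu hv; rewrite cmulDl cmulDr hu hv.
- by move=> k u hu; rewrite cmulZl cmulZr hu.
- by move=> u v hu hv; rewrite -cmulA hv !cmulA hu.
Qed.

Lemma approx_sa x : approx [set a : A | cstar a = a] x -> cstar x = x.
Proof.
move=> hx; apply: eq_nr => e e0; have [|y /= hy hxy] := hx (e / 2); first by rewrite divr_gt0.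
rewrite (_ : _ - _ = cstar (x - y) - (x - y)); last by rewrite cstarB hy opprB addrA subrK.
by apply: (le_trans (nrB _ _)); rewrite nr_star [leRHS]splitr lerD.
Qed.

Section Sqrt.
Variable x : A.
Hypothesis hx : nr x <= 1.

(** Picard iteration for [y + y = x + y ** y]. In a unitization [1 - y] is a square root of [1 - x],
    but neither the equation nor the iteration mentions a unit. *)
Fixpoint sqit n : A :=
  if n is k.+1 then ((2^-1 : R)%:C) *: (x + sqit k ** sqit k) else 0.

(** The same iteration for the scalar x = 1; it majorises both the norms and the increments of
    [sqit]. *)
Fixpoint eta n : R := if n is k.+1 then (1 + eta k ^+ 2) / 2 else 0.

Lemma eta01 n : 0 <= eta n <= 1.
Proof. by elim: n => [|n] /=; [rewrite lexx ler01|nra]. Qed.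

(** The limit 1 is a double root, so the deficit d obeys d' = d - d^2/2 and decays only like 2/n. *)
Lemma eta_rate n : 1 - eta n <= 2 / n.+2%:R.
Proof.
elim: n => [|n IH]; first by rewrite /= divff ?subr0 // pnatr_eq0.
rewrite /=; have := eta01 n; set d := eta n in IH *; move=> hd.
have -> : n.+3%:R = n.+2%:R + 1 :> R by rewrite -natr1.
have hm : 0 < n.+2%:R :> R by rewrite ltr0n.
move: (n.+2%:R : R) hm IH => m hm; rewrite !ler_pdivlMr //; last by lra.
have : 0 <= d ^+ 2 by apply: sqr_ge0.
move=> h2 IH; have : 0 <= (2 - (1 - d) * m) * (1 - (1 - d) / 2) by apply: mulr_ge0; lra.
have := sqr_ge0 (1 - d); nra.
Qed.

Lemma sqit_bd n : nr (sqit n) <= eta n.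
Proof.
elim: n => [|n IH] /=; first by rewrite nr0.
rewrite nrZr ger0_norm ?invr_ge0 // mulrC ler_pM2r ?invr_gt0 //.
apply: (le_trans (nrD _ _)); rewrite lerD // (le_trans (nrM _ _)) // expr2.
by apply: ler_pM => //; exact: nr_ge0.
Qed.

Lemma sqit_step n : nr (sqit n.+1 - sqit n) <= eta n.+1 - eta n.
Proof.
elim: n => [|n IH].
  by rewrite /= cmul0l expr0n /= !addr0 !subr0 nrZr ger0_norm ?invr_ge0 // mulrC ler_pM2r ?invr_gt0.
have -> : sqit n.+2 - sqit n.+1 = (2^-1 : R)%:C *:
   (sqit n.+1 ** (sqit n.+1 - sqit n) + (sqit n.+1 - sqit n) ** sqit n).
  rewrite [sqit n.+2]/= [X in _ - X]/= -scalerBr opprD addrACA subrr add0r; congr (_ *: _).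
  by rewrite -/(sqit n.+1) cmulBr cmulBl addrA subrK.
rewrite nrZr ger0_norm ?invr_ge0 //.
set a := nr (_ + _).
have : a <= (eta n.+1 + eta n) * (eta n.+1 - eta n).
  apply: (le_trans (nrD _ _)); apply: (le_trans (lerD (nrM _ _) (nrM _ _))).
  rewrite mulrDl; apply: lerD.
    by apply: ler_pM => //; rewrite ?nr_ge0 ?sqit_bd.
  by rewrite mulrC; apply: ler_pM => //; rewrite ?nr_ge0 ?sqit_bd.
have -> : eta n.+2 = (1 + eta n.+1 ^+ 2) / 2 by [].
have -> : eta n.+1 - eta n = (1 + eta n ^+ 2) / 2 - eta n by [].
have : eta n.+1 = (1 + eta n ^+ 2) / 2 by [].
move: (eta n.+1) (eta n) => p q -> h; lra.
Qed.

Lemma sqit_cauchy N n : (N <= n)%N -> nr (sqit n - sqit N) <= eta n - eta N.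
Proof.
move=> /subnK <-; elim: (n - N)%N => [|k IH]; first by rewrite add0n !subrr nr0.
rewrite addSn; apply: (le_trans (nr_tri (sqit (k + N)) _ _)).
by have := sqit_step (k + N); lra.
Qed.

Lemma rate_small (e : R) : 0 < e -> exists N, forall n, (N <= n)%N -> 2 / n.+2%:R <= e.
Proof.
move=> e0; exists (Num.trunc (2 / e)) => n Nn.
rewrite ler_pdivrMr ?ltr0n // mulrC -ler_pdivrMr //.
apply: (le_trans (ltW (truncnS_gt _))).
by rewrite ler_nat ltnS (leq_trans Nn).
Qed.

Lemma sqit_lim : exists y, [/\ nlim sqit y, y + y = x + y ** y & nr y <= 1].
Proof.
have [|y hy] := @nr_complete R A sqit.
  move=> e /rate_small[N hN]; exists N => n Nn.
  apply: (le_trans (sqit_cauchy Nn)); apply: le_trans (hN N (leqnn _)).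
  by move: (eta_rate N) (eta01 n); move: (2 / _) => r; lra.
have hy1 : nr y <= 1.
  apply/ler_addgt0Pr => e /hy[N /(_ N (leqnn _)) h].
  have := nr_distl y (sqit N); have := sqit_bd N; have := eta01 N; lra.
exists y; split => //; apply: eq_nr => e e0.
have [|N hN] := hy (e / 4); first by rewrite divr_gt0.
have h1 := hN _ (leqnSn N); have h2 := hN _ (leqnn N).
have eN : sqit N.+1 + sqit N.+1 = x + sqit N ** sqit N.
  by rewrite /= -scalerDl -rmorphD /= (_ : 2^-1 + 2^-1 = 1 :> R) ?scale1r //; lra.
have -> : y + y - (x + y ** y) = (y - sqit N.+1) + (y - sqit N.+1) - (y ** (y - sqit N) + (y - sqit N) ** sqit N).
  rewrite (_ : x = sqit N.+1 + sqit N.+1 - sqit N ** sqit N); last by rewrite eN addrK.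
  by rewrite cmulBr cmulBl; lmodule R.
apply: (le_trans (nrB _ _)); apply: (le_trans (lerD (nrD _ _) (nrD _ _))).
have := nrM y (y - sqit N); have := nrM (y - sqit N) (sqit N).
have h3 : nr (sqit N) <= 1 by have := sqit_bd N; have := eta01 N; lra.
have : nr y * nr (y - sqit N) <= 1 * nr (y - sqit N) by apply: ler_wpM2r => //; exact: nr_ge0.
have : nr (y - sqit N) * nr (sqit N) <= nr (y - sqit N) * 1 by apply: ler_wpM2l => //; exact: nr_ge0.
lra.
Qed.

End Sqrt.

Lemma calg_sqit x M n : calg M -> M x -> M (sqit x n).
Proof.
move=> hM Mx; elim: n => [|n IH] /=; first exact: ca_0.
by apply: (ca_Z hM); apply: (ca_D hM) => //; apply: ca_M.
Qed.

Lemma sqit_sa x n : cstar x = x -> cstar (sqit x n) = sqit x n.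
Proof.
by move=> hx; elim: n => [|n IH] /=; rewrite ?cstar0 // cstarZr cstarD cstarM hx IH.
Qed.

Lemma sqrt_one_minus x : cstar x = x -> nr x <= 1 ->
  exists y, [/\ cstar y = y, y + y = x + y ** y, nr y <= 1 &
    forall M, calg M -> M x -> M y].
Proof.
move=> xs /sqit_lim[y [ly yE y1]]; exists y; split => //.
  by apply: approx_sa; apply: (nlim_approx ly) => n; apply: sqit_sa.
by move=> M hM Mx; apply: (ca_closed hM); apply: (nlim_approx ly) => n; apply: calg_sqit.
Qed.

End Cstar.

(** * Contractivity of homomorphisms *)

Section Contractive.
Variables (R : realType) (A B : cstarAlg R).

(** Homomorphisms that are meaningful on a subset only. Several maps below, such as [chi], are total
    functions which are multiplicative just on a subalgebra. *)
Record hom_on (M : set A) (f : A -> B) : Prop := HomOn {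
  ho_lin : forall (k : R[i]) a b, M a -> M b -> f (k *: a + b) = k *: f a + f b;
  ho_mul : forall a b, M a -> M b -> f (a ** b) = f a ** f b;
  ho_star : forall a, M a -> f (cstar a) = cstar (f a) }.

Lemma hom_onT f : star_hom f -> hom_on setT f.
Proof. by case=> hl hm hs; split=> *; [exact: hl|exact: hm|exact: hs]. Qed.

Section HomOn.
Variables (M : set A) (f : A -> B).
Hypotheses (hM : cstar_sub M) (hf : hom_on M f).

Lemma ho0 : f 0 = 0.
Proof. exact: lin_on0 (sub_0 hM) (ho_lin hf). Qed.
Lemma hoZ (k : R[i]) a : M a -> f (k *: a) = k *: f a.
Proof. by move=> Ma; have := ho_lin hf k Ma (sub_0 hM); rewrite ho0 !addr0. Qed.
Lemma hoD a b : M a -> M b -> f (a + b) = f a + f b.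
Proof. by move=> Ma Mb; have := ho_lin hf 1 Ma Mb; rewrite !scale1r. Qed.

(** Choose [c] with (1 - c)^2 = 1 - a^2. Then 1 - f(c) + i f(a) and 1 - f(c) - i f(a) are formally
    unitary, so left multiplication by them is isometric on [B]. Half of their difference is
    multiplication by i f(a), hence [|f(a) b| <= |b|], and [b = f a] gives the bound. *)
Lemma contractive_sa1 a : M a -> cstar a = a -> nr a <= 1 -> nr (f a) <= 1.
Proof.
move=> Ma sa a1; have cM := sub_calg hM.
have [||c [cs cE _ cm]] := @sqrt_one_minus R A (a ** a).
- by rewrite cstarM sa.
- by rewrite nr_sq // expr_le1 // nr_ge0.
have Mc : M c by apply: cm => //; apply: (ca_M cM).
have cac : c ** a = a ** c.
  by apply: (cm [set u | u ** a = a ** u]) => /=; [exact: calg_comm|rewrite cmulA].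
have fas : cstar (f a) = f a by rewrite -(ho_star hf) // sa.
have fcs : cstar (f c) = f c by rewrite -(ho_star hf) // cs.
have fcE : f c + f c = f a ** f a + f c ** f c.
  have := congr1 f cE; rewrite !hoD ?(ho_mul hf) //; try by apply: (ca_M cM).
have fcac : f c ** f a = f a ** f c by rewrite -!(ho_mul hf) // cac.
have iso (s : R[i]) (b : B) : s^* * s = 1 -> s^* = - s ->
    nr (b - f c ** b + s *: (f a ** b)) = nr b.
  move=> s1 sN; apply/eqP; rewrite -(eqrXn2 (n := 2)) ?nr_ge0 // -!nr_starM; apply/eqP.
  congr nr; rewrite !cstarD cstarN cstarZc !cstarM fas fcs.
  rewrite !(cmulDl, cmulDr, cmulNl, cmulNr, cmulZl, cmulZr) !scalerA s1 scale1r sN -!cmulA.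
  rewrite [f a ** (f c ** b)]cmulA -fcac -cmulA.
  have hh : cstar b ** (f c ** b) + cstar b ** (f c ** b)
     = cstar b ** (f a ** (f a ** b)) + cstar b ** (f c ** (f c ** b)).
    by have := congr1 (fun u => cstar b ** (u ** b)) fcE; rewrite !cmulDl !cmulDr -!cmulA.
  apply: (eq_diff (esym hh)).
  lmodule R.
have bd b : nr (f a ** b) <= nr b.
  have i1 : nr (b - f c ** b + 'i *: (f a ** b)) = nr b.
    by apply: iso; rewrite /= ?mulrN; simpc.
  have i2 : nr (b - f c ** b + (- 'i) *: (f a ** b)) = nr b.
    by apply: iso; rewrite /= ?mulrN; simpc.
  have := nrB (b - f c ** b + 'i *: (f a ** b)) (b - f c ** b + (- 'i) *: (f a ** b)).
  rewrite i1 i2 opprD addrACA subrr add0r -scaleNr opprK -scalerDl nrZ.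
  have -> : cabs ('i + 'i : R[i]) = 2.
    by rewrite /cabs normc_def /= addr0 expr0n /= add0r sqrtr_sqr ger0_norm //; lra.
  lra.
have := bd (f a); rewrite nr_sq // => h; have := nr_ge0 (f a); nra.
Qed.

Lemma hom_on_contractive a : M a -> nr (f a) <= nr a.
Proof.
move=> Ma.
suff h b : M b -> cstar b = b -> nr (f b) <= nr b.
  have Mb : M (cstar a ** a) by apply: (sub_mul hM) => //; apply: (sub_star hM).
  have := h _ Mb; rewrite cstarM cstarK => /(_ erefl).
  rewrite (ho_mul hf) ?(ho_star hf) //; last exact: (sub_star hM).
  by rewrite !nr_starM ler_pXn2r ?nnegrE ?nr_ge0.
move=> Mb sb; apply/ler_addgt0Pr => e e0.
have t0 : 0 < nr b + e by rewrite ltr_wpDl ?nr_ge0.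
set k := (nr b + e)^-1; have k0 : 0 < k by rewrite invr_gt0.
have hk : k * (nr b + e) = 1 by rewrite mulVf // gt_eqF.
have : nr (f (k%:C *: b)) <= 1.
  apply: contractive_sa1; [exact: (sub_scale hM)|by rewrite cstarZr sb|].
  by rewrite nrZr (gtr0_norm k0) -hk ler_pM2l // lerDl ltW.
by rewrite hoZ // nrZr (gtr0_norm k0) -hk ler_pM2l.
Qed.

End HomOn.

Lemma cstar_subT (D : cstarAlg R) : cstar_sub [set: D].
Proof. by split => //; apply/closedP. Qed.

Lemma star_hom_contractive (f : A -> B) a : star_hom f -> nr (f a) <= nr a.
Proof. by move=> /hom_onT /(hom_on_contractive (cstar_subT A)); apply. Qed.

End Contractive.

Lemma frac_small (R : realType) (e y : R) : 0 <= e -> 0 <= y -> e / (1 + y) * y <= e.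
Proof.
move=> e0 y0; rewrite mulrAC ler_pdivrMr ?ltr_pwDl //.
by apply: ler_wpM2l => //; lra.
Qed.

(** * Hilbert modules and adjoints *)

Section Hilb.
Variables (R : realType) (A : cstarAlg R) (Y : hilbMod A).
Implicit Types (x y z : Y) (a b : A).
Local Notation C := R[i].

Lemma hipDr x y z : hip x (y + z) = hip x y + hip x z.
Proof. exact: (linD (hip_lin x)). Qed.
Lemma hipBr x y z : hip x (y - z) = hip x y - hip x z.
Proof. exact: (linB (hip_lin x)). Qed.
Lemma hipNr x y : hip x (- y) = - hip x y.
Proof. exact: (linN (hip_lin x)). Qed.
Lemma hipZr (k : C) x y : hip x (k *: y) = k *: hip x y.
Proof. exact: (linZ (hip_lin x)). Qed.
Lemma hip0r x : hip x 0 = 0.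
Proof. exact: (lin0 (hip_lin x)). Qed.
Lemma hipDl x y z : hip (x + y) z = hip x z + hip y z.
Proof. by rewrite -hip_star hipDr cstarD !hip_star. Qed.
Lemma hipNl x y : hip (- x) y = - hip x y.
Proof. by rewrite -hip_star hipNr cstarN !hip_star. Qed.
Lemma hipBl x y z : hip (x - y) z = hip x z - hip y z.
Proof. by rewrite hipDl hipNl. Qed.
Lemma hipZl (k : C) x y : hip (k *: x) y = (conjc k) *: hip x y.
Proof. by rewrite -hip_star hipZr cstarZc hip_star. Qed.
Lemma hip0l x : hip 0 x = 0.
Proof. by rewrite -hip_star hip0r cstar0. Qed.
Lemma hip_ractl x y a : hip (ract x a) y = cstar a ** hip x y.
Proof. by rewrite -hip_star hip_ract cstarM hip_star. Qed.

Lemma ractDl x y a : ract (x + y) a = ract x a + ract y a.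
Proof. exact: (linD (ract_linl a)). Qed.
Lemma ractBl x y a : ract (x - y) a = ract x a - ract y a.
Proof. exact: (linB (ract_linl a)). Qed.
Lemma ractZl (k : C) x a : ract (k *: x) a = k *: ract x a.
Proof. exact: (linZ (ract_linl a)). Qed.
Lemma ract0l a : ract (0 : Y) a = 0.
Proof. exact: (lin0 (ract_linl a)). Qed.
Lemma ractBr x a b : ract x (a - b) = ract x a - ract x b.
Proof. exact: (linB (ract_linr x)). Qed.
Lemma ractZr (k : C) x a : ract x (k *: a) = k *: ract x a.
Proof. exact: (linZ (ract_linr x)). Qed.

Lemma nr_hip x : nr (hip x x) = nr x ^+ 2.
Proof. by apply: complexI; rewrite rmorphXn /= -!nrE -hip_norm. Qed.

Lemma nr_ract x a : nr (ract x a) <= nr x * nr a.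
Proof.
rewrite -(ler_pXn2r (n := 2)) ?nnegrE ?mulr_ge0 ?nr_ge0 //.
rewrite -nr_hip hip_ract hip_ractl (le_trans (nrM _ _)) //.
have := nrM (cstar a) (hip x x); rewrite nr_star nr_hip => h.
have := nr_ge0 a; have := nr_ge0 x => h1 h2.
rewrite exprMn [X in _ <= _ * X]expr2 mulrA; apply: ler_wpM2r => //.
by rewrite mulrC in h; rewrite (le_trans h).
Qed.

Lemma hip_eq0 x : (forall y, hip y x = 0) -> x = 0.
Proof.
move=> /(_ x) h; have := nr_hip x; rewrite h nr0 => /esym/eqP.
by rewrite sqrf_eq0 => /eqP/nr0_eq0.
Qed.

Lemma hip_inj x y : (forall z, hip z x = hip z y) -> x = y.
Proof.
by move=> h; apply/eqP; rewrite -subr_eq0; apply/eqP/hip_eq0 => z; rewrite hipBr h subrr.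
Qed.

End Hilb.

Section Adjoint.
Variables (R : realType) (A : cstarAlg R) (Y Z : hilbMod A).
Variables (f : Y -> Z) (g : Z -> Y).
Hypothesis fg : is_adjoint f g.

Lemma adj_sym : is_adjoint g f.
Proof. by move=> z y; rewrite -hip_star -fg hip_star. Qed.

Lemma adj_lin : linear f.
Proof.
by move=> k u v; apply: hip_inj => z; rewrite hipDr hipZr -!adj_sym hipDr hipZr.
Qed.

Lemma adj_ract y a : f (ract y a) = ract (f y) a.
Proof. by apply: hip_inj => z; rewrite hip_ract -!adj_sym hip_ract. Qed.

Lemma adj_uniq g' : is_adjoint f g' -> g = g'.
Proof.
by move=> fg'; apply/funext => z; apply: hip_inj => y; rewrite -fg -fg'.
Qed.

End Adjoint.

(** * The C*-algebra of bounded adjointable operators *)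

Section LOp.
Variables (R : realType) (A : cstarAlg R) (Y : hilbMod A).
Hypothesis CS : forall x y : Y, nr (hip x y) <= nr x * nr y.
Local Notation C := R[i].

(** The construction takes Cauchy--Schwarz as a hypothesis. The general inequality relies on
    positivity, which in turn is obtained from [LOp] of [A] acting on itself, where Cauchy--Schwarz
    is immediate. *)
Definition lopP : {pred Y -> Y} := fun f =>
  `[< (exists g, is_adjoint f g) /\ exists M : R, forall y, nr (f y) <= M * nr y >].

Lemma lopP_submod : submod_closed lopP.
Proof.
split; first by apply/asboolP; split; [exists (fun=> 0) => y z; rewrite hip0l hip0r|exists 0 => y; rewrite nr0 mul0r].
move=> k f f' /asboolP[[g fg] [M hM]] /asboolP[[g' fg'] [M' hM']].
apply/asboolP; split.
  by exists (conjc k *: g + g') => y z; rewrite /= !hipDl hipZl !hipDr hipZr fg fg'.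
exists (cabs k * M + M') => y /=; rewrite (le_trans (nrD _ _)) // mulrDl lerD //.
by rewrite nrZ -mulrA ler_wpM2l // cabs_ge0.
Qed.

HB.instance Definition _ := GRing.isSubmodClosed.Build C (Y -> Y) lopP lopP_submod.

Record lop := LOpMk { lop_val : Y -> Y; _ : lop_val \in lopP }.
HB.instance Definition _ := [isSub for lop_val].
HB.instance Definition _ := [Choice of lop by <:].
HB.instance Definition _ := [SubChoice_isSubLmodule of lop by <:].

Implicit Types (S T : lop).

Lemma lop_ext S T : lop_val S =1 lop_val T -> S = T.
Proof. by move=> h; apply: val_inj; apply/funext. Qed.

Lemma lop_adj T : exists g, is_adjoint (lop_val T) g.
Proof. by case: T => f /= /asboolP[]. Qed.

Lemma lop_bd T : exists M : R, forall y, nr (lop_val T y) <= M * nr y.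
Proof. by case: T => f /= /asboolP[]. Qed.

Definition lopN T : R := sup [set nr (lop_val T y) | y in [set y : Y | nr y <= 1]].

Let hsup T : has_sup [set nr (lop_val T y) | y in [set y : Y | nr y <= 1]].
Proof.
split; first by exists (nr (lop_val T 0)), 0; rewrite //= nr0.
have [M hM] := lop_bd T; exists `|M| => _ [y /= hy <-].
have h0 := nr_ge0 y; have := hM y; have := ler_norm M; have := normr_ge0 M; nra.
Qed.

Lemma lopN_le T y : nr (lop_val T y) <= lopN T * nr y.
Proof.
have [y0|y0] := ltP 0 (nr y); last first.
  by rewrite (nr_le0 y0) nr0 mulr0 (lin0 (adj_lin (proj2_sig (cid (lop_adj T))))) nr0.
rewrite -ler_pdivrMr // mulrC.
have -> : (nr y)^-1 * nr (lop_val T y) = nr (lop_val T (((nr y)^-1)%:C *: y)).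
  by rewrite (linZ (adj_lin (proj2_sig (cid (lop_adj T))))) nrZr gtr0_norm ?invr_gt0.
apply: (ub_le_sup (hsup T).2); eexists; last reflexivity.
by rewrite /= nrZr gtr0_norm ?invr_gt0 // mulVf // gt_eqF.
Qed.

Lemma lopN_bound T (M : R) : 0 <= M -> (forall y, nr (lop_val T y) <= M * nr y) -> lopN T <= M.
Proof.
move=> M0 h; apply: (sup_le_ub (hsup T).1) => _ [y /= y1 <-].
by apply: (le_trans (h y)); rewrite -[leRHS]mulr1 ler_wpM2l.
Qed.

Lemma lopN_ge0 T : 0 <= lopN T.
Proof.
by apply: (le_trans (nr_ge0 (lop_val T 0))); apply: (ub_le_sup (hsup T).2); exists 0; rewrite //= nr0.
Qed.

Lemma adj_bd (f g : Y -> Y) (M : R) : 0 <= M -> is_adjoint f g ->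
  (forall y, nr (f y) <= M * nr y) -> forall y, nr (g y) <= M * nr y.
Proof.
move=> M0 fg hM y.
have [y0|y0] := ltP 0 (nr (g y)); last by rewrite (le_trans y0) // mulr_ge0 // nr_ge0.
rewrite -(ler_pM2r y0) -expr2 -nr_hip -fg (le_trans (CS _ _)) //.
by rewrite mulrAC ler_wpM2r ?nr_ge0.
Qed.

Definition lop_adjf T : Y -> Y := proj1_sig (cid (lop_adj T)).

Lemma lop_adjfP T : is_adjoint (lop_val T) (lop_adjf T).
Proof. exact: (proj2_sig (cid (lop_adj T))). Qed.

Lemma lop_adjf_in T : lop_adjf T \in lopP.
Proof.
apply/asboolP; split; first by exists (lop_val T); apply: adj_sym (lop_adjfP T).
exists (lopN T); apply: (adj_bd _ (lop_adjfP T)); first exact: lopN_ge0.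
exact: lopN_le.
Qed.

Definition lop_star T : lop := LOpMk (lop_adjf_in T).

Lemma lop_comp_in S T : lop_val S \o lop_val T \in lopP.
Proof.
apply/asboolP; split.
  by exists (lop_adjf T \o lop_adjf S) => y z /=; rewrite !(lop_adjfP S, lop_adjfP T).
exists (lopN S * lopN T) => y /=; rewrite -mulrA (le_trans (lopN_le _ _)) //.
by rewrite ler_wpM2l ?lopN_ge0 ?lopN_le.
Qed.

Definition lop_mul S T : lop := LOpMk (lop_comp_in S T).

Lemma lop_lin T : linear (lop_val T).
Proof. exact: adj_lin (lop_adjfP T). Qed.

(** An adjoint has the same bound as the operator, so along a Cauchy sequence both the operators and
    their adjoints converge pointwise; the limits are adjoint to each other, and the Cauchy estimate
    passes to the limit uniformly. *)
Lemma lop_banach : banach_norm lopN.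
Proof.
split.
- move=> S T; apply: lopN_bound; first by rewrite addr_ge0 ?lopN_ge0.
  by move=> y; rewrite /= mulrDl (le_trans (nrD _ _)) // lerD ?lopN_le.
- move=> k T; apply/eqP; rewrite eq_le; apply/andP; split.
    apply: lopN_bound; first by rewrite mulr_ge0 ?lopN_ge0 ?cabs_ge0.
    by move=> y; rewrite /= nrZ -mulrA ler_wpM2l ?cabs_ge0 ?lopN_le.
  have [k0|k0] := ltP 0 (cabs k); last first.
    by rewrite (@le_trans _ _ 0) ?lopN_ge0 // mulr_le0_ge0 ?lopN_ge0.
  rewrite mulrC -ler_pdivlMr //; apply: lopN_bound.
    by rewrite divr_ge0 ?lopN_ge0 // ltW.
  move=> y; rewrite mulrAC ler_pdivlMr // mulrC -nrZ.
  exact: (lopN_le (k *: T)).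
- move=> T h; apply: lop_ext => y; apply: nr_le0.
  by have := lopN_le T y; rewrite h mul0r.
- move=> u hu.
  have pc y : exists l, nlim (fun n => lop_val (u n) y) l.
    apply: nr_complete => e e0.
    have d0 : 0 < e / (1 + nr y) by rewrite divr_gt0 // ltr_pwDl // nr_ge0.
    have [N hN] := hu _ d0; exists N => n Nn.
    have := lopN_le (u n - u N) y; rewrite /= => h; apply: (le_trans h).
    apply: (le_trans (ler_wpM2r (nr_ge0 y) (hN _ Nn))).
    by apply: frac_small; rewrite ?nr_ge0 // ltW.
  have /choice[f hf] := pc.
  have pc' y : exists l, nlim (fun n => lop_adjf (u n) y) l.
    apply: nr_complete => e e0.
    have d0 : 0 < e / (1 + nr y) by rewrite divr_gt0 // ltr_pwDl // nr_ge0.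
    have [N hN] := hu _ d0; exists N => n Nn.
    have ad : is_adjoint (lop_val (u n - u N)) (lop_adjf (u n) - lop_adjf (u N)).
      by move=> v w; rewrite /= hipBl hipBr !lop_adjfP.
    have := adj_bd (lopN_ge0 _) ad (lopN_le _) y; rewrite /= => h; apply: (le_trans h).
    apply: (le_trans (ler_wpM2r (nr_ge0 y) (hN _ Nn))).
    by apply: frac_small; rewrite ?nr_ge0 // ltW.
  have /choice[g hg] := pc'.
  have fg : is_adjoint f g.
    move=> y z; apply: eq_nr => e e0.
    have d1 : 0 < e / 2 / (1 + nr z) by rewrite !divr_gt0 // ltr_pwDl // nr_ge0.
    have d2 : 0 < e / 2 / (1 + nr y) by rewrite !divr_gt0 // ltr_pwDl // nr_ge0.
    have [N1 h1] := hf y _ d1; have [N2 h2] := hg z _ d2.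
    pose n := maxn N1 N2.
    have {}h1 := h1 n (leq_maxl _ _); have {}h2 := h2 n (leq_maxr _ _).
    have -> : hip (f y) z - hip y (g z) = hip (f y - lop_val (u n) y) z - hip y (g z - lop_adjf (u n) z).
      by rewrite hipBl hipBr lop_adjfP; lmodule R.
    apply: (le_trans (nrB _ _)); rewrite [leRHS]splitr; apply: lerD; apply: (le_trans (CS _ _)).
      apply: (le_trans (ler_wpM2r (nr_ge0 z) h1)).
      by apply: frac_small; rewrite ?nr_ge0 // ltW // divr_gt0.
    rewrite mulrC; apply: (le_trans (ler_wpM2r (nr_ge0 y) h2)).
    by apply: frac_small; rewrite ?nr_ge0 // ltW // divr_gt0.
  have bd N e y : (forall n, (N <= n)%N -> lopN (u n - u N) <= e) -> nr (f y - lop_val (u N) y) <= e * nr y.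
    move=> hN; apply/ler_addgt0Pr => d d0; have [M hM] := hf y _ d0.
    pose n := maxn N M; apply: (le_trans (nr_tri (lop_val (u n) y) _ _)).
    rewrite addrC; apply: lerD; last by apply: hM; rewrite leq_maxr.
    apply: (le_trans (lopN_le (u n - u N) y)).
    by rewrite ler_wpM2r ?nr_ge0 // hN // leq_maxl.
  have fP : f \in lopP.
    apply/asboolP; split; first by exists g.
    have [N hN] := hu 1 ltr01; exists (lopN (u N) + 1) => y.
    rewrite mulrDl (le_trans (nr_distl _ (lop_val (u N) y))) // lerD ?lopN_le //.
    exact: bd.
  exists (LOpMk fP) => e e0; have [|N hN] := hu (e / 2); first by rewrite divr_gt0.
  exists N => n Nn; apply: lopN_bound; first exact: ltW.
  move=> y /=; apply: (le_trans (nr_tri (lop_val (u N) y) _ _)).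
  rewrite [e]splitr mulrDl lerD ?bd // nrC.
  by rewrite (le_trans (lopN_le (u n - u N) y)) // ler_wpM2r ?nr_ge0 ?hN.
Qed.

Definition lop_car := banach lop_banach.

Lemma LOp_car_nr (T : lop_car) : nr T = lopN T.
Proof. exact: nr_banach. Qed.

Lemma lop_adj_eq T g : is_adjoint (lop_val T) g -> lop_val (lop_star T) = g.
Proof. by move=> h; rewrite -(adj_uniq (lop_adjfP T) h). Qed.

Lemma lop_norm_star T : lopN (lop_mul (lop_star T) T) = lopN T ^+ 2.
Proof.
apply/eqP; rewrite eq_le; apply/andP; split.
  apply: lopN_bound; first by rewrite exprn_ge0 ?lopN_ge0.
  move=> y /=; rewrite expr2 -mulrA.
  have := adj_bd (lopN_ge0 T) (lop_adjfP T) (lopN_le T) (lop_val T y) => h.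
  by rewrite (le_trans h) // ler_wpM2l ?lopN_ge0 ?lopN_le.
set M := lopN (lop_mul _ _); have M0 : 0 <= M := lopN_ge0 _.
suff h : lopN T <= Num.sqrt M by rewrite -(sqr_sqrtr M0) ler_pXn2r ?nnegrE ?lopN_ge0 ?sqrtr_ge0.
apply: lopN_bound; first exact: sqrtr_ge0.
move=> y; rewrite -(ler_pXn2r (n := 2)) ?nnegrE ?mulr_ge0 ?nr_ge0 ?sqrtr_ge0 //.
rewrite exprMn sqr_sqrtr // -nr_hip lop_adjfP (le_trans (CS _ _)) // expr2 mulrCA mulrA.
rewrite -mulrA ler_wpM2l ?nr_ge0 //; exact: (lopN_le (lop_mul (lop_star T) T)).
Qed.

Let LA (a b c : lop_car) : lop_mul a (lop_mul b c) = lop_mul (lop_mul a b) c.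
Proof. by apply: lop_ext. Qed.
Let Llinl (b : lop_car) : linear (fun a : lop_car => lop_mul a b : lop_car).
Proof. by move=> k u v; apply: lop_ext. Qed.
Let Llinr (a : lop_car) : linear (lop_mul a : lop_car -> lop_car).
Proof. by move=> k u v; apply: lop_ext => y /=; rewrite lop_lin. Qed.
Let LstarK : involutive (lop_star : lop_car -> lop_car).
Proof.
by move=> T; apply: lop_ext => y; rewrite (@lop_adj_eq _ (lop_val T)) //; apply: adj_sym (lop_adjfP T).
Qed.
Let LstarD (a b : lop_car) : lop_star (a + b) = lop_star a + lop_star b :> lop_car.
Proof.
apply: lop_ext => y; rewrite (@lop_adj_eq _ (lop_adjf a + lop_adjf b)) // => v w.
by rewrite /= hipDl hipDr !lop_adjfP.
Qed.
Let LstarZ (k : C) (a : lop_car) : lop_star (k *: a) = k^* *: (lop_star a : lop_car) :> lop_car.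
Proof.
apply: lop_ext => y; rewrite (@lop_adj_eq _ (conjc k *: lop_adjf a)) // => v w.
by rewrite /= hipZl hipZr !lop_adjfP.
Qed.
Let LstarM (a b : lop_car) : lop_star (lop_mul a b) = lop_mul (lop_star b) (lop_star a).
Proof.
apply: lop_ext => y; rewrite (@lop_adj_eq _ (lop_adjf b \o lop_adjf a)) // => v w.
by rewrite /= !lop_adjfP.
Qed.
Let LnM (a b : lop_car) : `|lop_mul a b : lop_car| <= `|a| * `|b|.
Proof.
rewrite !nrE -rmorphM /= lecR; apply: lopN_bound.
  by rewrite mulr_ge0 ?nr_ge0.
move=> y; rewrite /= -mulrA (le_trans (lopN_le _ _)) //.
by rewrite ler_wpM2l ?lopN_ge0 ?lopN_le.
Qed.
Let Lns (a : lop_car) : `|lop_mul (lop_star a) a : lop_car| = `|a| ^+ 2.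
Proof. by rewrite !nrE -rmorphXn /= LOp_car_nr lop_norm_star. Qed.

Definition LOp : cstarAlg R :=
  @CstarAlg R lop_car lop_mul lop_star LA Llinl Llinr LstarK LstarD LstarZ LstarM LnM Lns.

Definition lapp (T : LOp) : Y -> Y := lop_val T.

Lemma lapp_ext (S T : LOp) : lapp S =1 lapp T -> S = T.
Proof. exact: lop_ext. Qed.
Lemma lappM (S T : LOp) y : lapp (S ** T) y = lapp S (lapp T y).
Proof. by []. Qed.
Lemma lappD (S T : LOp) y : lapp (S + T) y = lapp S y + lapp T y.
Proof. by []. Qed.
Lemma lappB (S T : LOp) y : lapp (S - T) y = lapp S y - lapp T y.
Proof. by []. Qed.
Lemma lapp0 y : lapp (0 : LOp) y = 0.
Proof. by []. Qed.
Lemma lappZ k (T : LOp) y : lapp (k *: T) y = k *: lapp T y.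
Proof. by []. Qed.
Lemma lapp_adj (T : LOp) : is_adjoint (lapp T) (lapp (cstar T)).
Proof. exact: lop_adjfP. Qed.
Lemma lapp_lin (T : LOp) : linear (lapp T).
Proof. exact: lop_lin. Qed.
Lemma lapp_le (T : LOp) y : nr (lapp T y) <= nr T * nr y.
Proof. exact: lopN_le. Qed.
Lemma lapp_bound (T : LOp) (M : R) : 0 <= M -> (forall y, nr (lapp T y) <= M * nr y) -> nr T <= M.
Proof. exact: lopN_bound. Qed.

Lemma LOp_mk (f g : Y -> Y) (M : R) : is_adjoint f g -> (forall y, nr (f y) <= M * nr y) ->
  exists T : LOp, lapp T = f.
Proof.
move=> fg hM; have h : f \in lopP by apply/asboolP; split; [exists g|exists M].
by exists (LOpMk h).
Qed.

Lemma lop_id_in : (fun y : Y => y) \in lopP.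
Proof. by apply/asboolP; split; [exists (fun y => y)|exists 1 => y; rewrite mul1r]. Qed.

Definition idL : LOp := LOpMk lop_id_in.

End LOp.

(** * Positivity in a unital C*-algebra *)

Section Unital.
Variables (R : realType) (U : cstarAlg R) (e : U).
Hypothesis eu : forall a, e ** a = a /\ a ** e = a.
Let el a : e ** a = a := (eu a).1.
Let er a : a ** e = a := (eu a).2.
Implicit Types (a b c x y : U).

Lemma unit_sa : cstar e = e.
Proof. by have h := el (cstar e); have := congr1 (@cstar _ U) h; rewrite cstarM cstarK h. Qed.

Lemma unit_nr : nr e <= 1.
Proof.
have := nr_starM e; rewrite unit_sa el => /eqP; rewrite expr2 -subr_eq0 -[X in X - _]mulr1 -mulrBr mulf_eq0.
by case/orP => /eqP h; [rewrite h ler01|lra].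
Qed.

Lemma nr_re (r : R) : 0 <= r -> nr (r%:C *: e) <= r.
Proof. by move=> r0; rewrite nrZr ger0_norm // -[leRHS]mulr1 ler_wpM2l // unit_nr. Qed.

(** The orbit of [sqit] at the scalar x = (1 - p^2) e, with limit 1 - p. *)
Fixpoint lam (p : R) n : R := if n is k.+1 then (1 - p ^+ 2 + lam p k ^+ 2) / 2 else 0.

Lemma lam_rate p n : 0 <= p <= 1 -> 0 <= 1 - p - lam p n <= 2 / n.+2%:R /\ 0 <= lam p n.
Proof.
move=> hp; elim: n => [|n [IH IH0]]; first by rewrite /= divff ?subr0 ?pnatr_eq0 // lexx; split => //; lra.
rewrite /=; set d := lam p n in IH IH0 *.
have -> : n.+3%:R = n.+2%:R + 1 :> R by rewrite -natr1.
have hm : 0 < n.+2%:R :> R by rewrite ltr0n.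
move: (n.+2%:R : R) hm IH => m hm /andP[h0]; rewrite ler_pdivlMr // => IH.
split; last by have := sqr_ge0 d; nra.
apply/andP; split; first by have := mulr_ge0 h0 IH0; nra.
rewrite ler_pdivlMr; last by lra.
set q := 1 - p - d in h0 IH *.
have -> : 1 - p - (1 - p ^+ 2 + d ^+ 2) / 2 = q * (2 * (1 - p) - q) / 2 by rewrite /q; field.
have q1 : q <= 1 by rewrite /q; lra.
have : 0 <= (2 - q * m) * (1 - q / 2) by apply: mulr_ge0; lra.
have h3 : 0 <= q * p * (m + 1) by rewrite mulr_ge0 ?mulr_ge0 //; lra.
have := sqr_ge0 q; nra.
Qed.

(** Subtracting the scalar orbit [lam] keeps the iteration inside [M], although [M] need not contain
    the unit. It plays the role of functional calculus for a function vanishing at a point other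
    than 0, and is what later keeps (b - eps)_+ in the non-unital algebra. *)
Lemma sqit_shift x y M p : calg M -> 0 <= p <= 1 -> M (x - (1 - p ^+ 2)%:C *: e) ->
  nlim (sqit x) y -> M (y - (1 - p)%:C *: e).
Proof.
move=> hM hp Mx ly; apply: (ca_closed hM).
apply: (@nlim_approx _ _ _ (fun n => sqit x n - (lam p n)%:C *: e)) => [d d0|n].
  have [|N1 h1] := ly (d / 2); first by rewrite divr_gt0.
  have [|N2 h2] := @rate_small R (d / 2); first by rewrite divr_gt0.
  exists (maxn N1 N2) => n hn.
  have {}h1 := h1 n (leq_trans (leq_maxl _ _) hn).
  have {}h2 := h2 n (leq_trans (leq_maxr _ _) hn).
  have -> : y - (1 - p)%:C *: e - (sqit x n - (lam p n)%:C *: e) =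
    (y - sqit x n) - ((1 - p - lam p n)%:C *: e).
    by rewrite [in RHS]rmorphB; lmodule R.
  have [/andP[h3 h4] _] := lam_rate n hp.
  apply: (le_trans (nrB _ _)); rewrite [leRHS]splitr lerD //.
  by apply: le_trans (nr_re h3) _; apply: le_trans h2.
elim: n => [|n IH] /=; first by rewrite scale0r subr0; exact: ca_0.
set s := sqit x n in IH *; set l := lam p n in IH *.
have -> : (2^-1)%:C *: (x + s ** s) - ((1 - p ^+ 2 + l ^+ 2) / 2)%:C *: e =
  (2^-1)%:C *: ((x - (1 - p ^+ 2)%:C *: e) + (s - l%:C *: e) ** (s - l%:C *: e)
      + (l + l)%:C *: (s - l%:C *: e)).
  rewrite !(cmulBl, cmulBr, cmulZl, cmulZr, el, er).
  by rewrite !(rmorphM, rmorphD, rmorphB, rmorphXn, rmorph1) /=; lmodule R.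
by apply: (ca_Z hM); apply: (ca_D hM); [apply: (ca_D hM) => //; apply: (ca_M hM)|apply: (ca_Z hM)].
Qed.

(** Positivity by a norm criterion: for self-adjoint [a] the inequality says that the spectrum lies
    in [0, 2t]. *)
Definition upos a := cstar a = a /\ exists2 t : R, 0 <= t & nr (t%:C *: e - a) <= t.

Lemma upos_up a t t' : nr (t%:C *: e - a) <= t -> t <= t' -> nr (t'%:C *: e - a) <= t'.
Proof.
move=> h tt'; have -> : t'%:C *: e - a = (t%:C *: e - a) + (t' - t)%:C *: e.
  by rewrite rmorphB; lmodule R.
apply: (le_trans (nrD _ _)).
have := @nr_re (t' - t); rewrite subr_ge0 => /(_ tt'); lra.
Qed.

Lemma upos_sqrt a r : upos a -> 0 <= r -> exists s, [/\ cstar s = s, s ** s = a, upos s &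
  forall M p, calg M -> 0 <= p <= r -> M (a - (p ^+ 2)%:C *: e) -> M (s - p%:C *: e)].
Proof.
move=> [sa [t0 t00 ht0]] r0.
(* [t] is enlarged so as to be positive and to satisfy [r <= q]; then [p / q] lies in [0, 1], as
   [sqit_shift] requires. *)
set q := Num.sqrt (t0 + 1 + r ^+ 2); pose t := q ^+ 2.
have r2 := sqr_ge0 r.
have tE : t = t0 + 1 + r ^+ 2 by rewrite /t /q sqr_sqrtr //; lra.
have tp : 0 < t by rewrite tE; lra.
have q0 : 0 < q by rewrite /q sqrtr_gt0; lra.
have qr : r <= q by rewrite -(ler_pXn2r (n := 2)) ?nnegrE ?(ltW q0) // -/t tE; lra.
have ht : nr (t%:C *: e - a) <= t by apply: upos_up ht0 _; rewrite tE; lra.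
have tC : t%:C != 0 by rewrite (fmorph_eq0 (real_complex R)) gt_eqF.
pose x := e - (t^-1)%:C *: a.
have xE : x = (t^-1)%:C *: (t%:C *: e - a).
  by rewrite /x scalerBr scalerA -rmorphM /= mulVf ?scale1r // gt_eqF.
have xs : cstar x = x by rewrite /x cstarB cstarZr unit_sa sa.
have x1 : nr x <= 1 by rewrite xE nrZr gtr0_norm ?invr_gt0 // ler_pdivrMl // mulr1.
have [y [ly yE y1]] := sqit_lim x1.
have ys : cstar y = y by apply: approx_sa; apply: (nlim_approx ly) => n; apply: sqit_sa.
exists (q%:C *: (e - y)); split.
- by rewrite cstarZr cstarB unit_sa ys.
- rewrite cmulZl cmulZr scalerA -rmorphM /= -expr2 -/t.
  rewrite cmulBl !cmulBr !el !er.
  have h : (t%:C) *: ((t^-1)%:C *: a) = a by rewrite scalerA -rmorphM /= divff ?scale1r // gt_eqF.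
  rewrite -[RHS]h; congr (_ *: _).
  by apply: (eq_diff (esym yE)); rewrite /x; lmodule R.
- split; first by rewrite cstarZr cstarB unit_sa ys.
  exists q; first exact: ltW.
  rewrite (_ : _ - _ = q%:C *: y); last by lmodule R.
  by rewrite nrZr gtr0_norm // -[leRHS]mulr1 ler_wpM2l // ltW.
- move=> M p hM /andP[p0 pr] Mp.
  have qC : q%:C != 0 by rewrite (fmorph_eq0 (real_complex R)) gt_eqF.
  have -> : q%:C *: (e - y) - p%:C *: e = (- q)%:C *: (y - (1 - p / q)%:C *: e).
    rewrite (_ : p = q * (p / q)); last by rewrite mulrC divfK // gt_eqF.
    rewrite [q * (p / q)]mulrC mulfK ?gt_eqF // mulrC.
    by rewrite rmorphM rmorphB rmorph1 rmorphN /=; lmodule R.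
  apply: (ca_Z hM); apply: (sqit_shift hM _ _ ly).
    by rewrite divr_ge0 ?(ltW q0) //= ler_pdivrMr // mul1r (le_trans pr).
  have -> : x - (1 - (p / q) ^+ 2)%:C *: e = (- t^-1)%:C *: (a - (p ^+ 2)%:C *: e).
    rewrite /x expr_div_n -/t !(rmorphM, rmorphB, rmorph1, rmorphN, rmorphXn) /=; lmodule R.
  exact: (ca_Z hM).
Qed.

(** The element u = s + i g is normal with [cstar u ** u = l e], a multiple of a unitary, and [s] is
    its real part. *)
Lemma unitary_trick s g (l : R) : cstar s = s -> cstar g = g -> s ** g = g ** s ->
  0 <= l -> s ** s + g ** g = l%:C *: e -> nr s ^+ 2 <= l.
Proof.
move=> ss gs sg l0 h; pose u := s + 'i *: g.
have us : cstar u = s - 'i *: g.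
  by rewrite /u cstarD cstarZc ss gs; congr (_ + _); rewrite -scaleNr; congr (_ *: _); simpc.
have h1 : nr u ^+ 2 <= l.
  rewrite -nr_starM us /u !(cmulDl, cmulDr, cmulBl, cmulNl, cmulZl, cmulZr) sg.
  rewrite !scalerA (_ : 'i * 'i = -1 :> R[i]); last by simpc.
  rewrite (_ : _ + _ = s ** s + g ** g); last by lmodule R.
  by rewrite h nr_re.
suff h2 : nr s <= nr u by apply: le_trans h1; rewrite ler_pXn2r ?nnegrE ?nr_ge0.
have -> : s = (2^-1)%:C *: (u + cstar u).
  by rewrite us /u (_ : (2^-1)%:C = 2^-1) ?fmorphV ?rmorph_nat //; lmodule R.
rewrite nrZr ger0_norm ?invr_ge0 // ler_pdivrMl //.
by apply: (le_trans (nrD _ _)); rewrite nr_star; lra.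
Qed.

Lemma upos_comm a b s r (hr : 0 <= r) :
  (forall M p, calg M -> 0 <= p <= r -> M (a - (p ^+ 2)%:C *: e) -> M (s - p%:C *: e)) ->
  a ** b = b ** a -> s ** b = b ** s.
Proof.
move=> h ab; have := h [set u | u ** b = b ** u] 0 (calg_comm b).
by rewrite lexx hr expr0n /= !scale0r !subr0 => /(_ isT ab).
Qed.

Lemma upos_le a l : upos a -> upos (l%:C *: e - a) -> 0 <= l -> nr a <= l.
Proof.
move=> pa pb l0.
have [s [ss sE _ sM]] := upos_sqrt pa (lexx 0).
have [g [gs gE _ gM]] := upos_sqrt pb (lexx 0).
rewrite -sE nr_sq //; apply: (@unitary_trick s g) => //; last first.
  by rewrite sE gE; lmodule R.
apply: (upos_comm (lexx 0) sM); apply/esym/(upos_comm (lexx 0) gM).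
by rewrite cmulBl cmulBr cmulZl cmulZr el er.
Qed.

(** The difference is a square [c ** c] of an element commuting with [b], and c^2 + b^2 is scalar,
    so [unitary_trick] bounds [c]. *)
Lemma sq_bound b : cstar b = b -> nr ((nr b ^+ 2)%:C *: e - b ** b) <= nr b ^+ 2.
Proof.
move=> bs; set t := nr b ^+ 2.
have [t0|t0] := ltP 0 t; last first.
  have b0 : b = 0.
    by apply: nr0_eq0; apply/eqP; rewrite -sqrf_eq0 -/t eq_le t0 /t sqr_ge0.
  by rewrite b0 cmul0l subr0 nr_re // /t sqr_ge0.
have [||y [ys yE _ yM]] := @sqrt_one_minus R U ((t^-1)%:C *: (b ** b)).
- by rewrite cstarZr cstarM bs.
- by rewrite nrZr gtr0_norm ?invr_gt0 // nr_sq // mulVf // gt_eqF.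
have yb : y ** b = b ** y.
  apply: (yM [set u | u ** b = b ** u] (calg_comm b)) => /=.
  by rewrite cmulZl cmulZr cmulA.
have h : (e - y) ** (e - y) = e - (t^-1)%:C *: (b ** b).
  by rewrite cmulBl !cmulBr !el !er; apply: (eq_diff (esym yE)); lmodule R.
have q2 : Num.sqrt t ^+ 2 = t by rewrite sqr_sqrtr // ltW.
pose c := (Num.sqrt t)%:C *: (e - y).
have cE : c ** c = t%:C *: e - b ** b.
  rewrite cmulZl cmulZr scalerA -rmorphM /= -expr2 q2 h scalerBr scalerA -rmorphM /=.
  by rewrite divff ?scale1r // gt_eqF.
have cs : cstar c = c by rewrite cstarZr cstarB unit_sa ys.
rewrite -cE nr_sq //; apply: (@unitary_trick c b) => //; last by rewrite cE subrK.
- by rewrite cmulZl cmulZr cmulBl cmulBr el er yb.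
- exact: ltW.
Qed.

Lemma sq_upos b : cstar b = b -> upos (b ** b).
Proof.
move=> bs; split; first by rewrite cstarM bs.
by exists (nr b ^+ 2); [exact: sqr_ge0|exact: sq_bound].
Qed.

Lemma uposD a b : upos a -> upos b -> upos (a + b).
Proof.
move=> [sa [t t0 ht]] [sb [t' t0' ht']]; split; first by rewrite cstarD sa sb.
exists (t + t'); first exact: addr_ge0.
rewrite rmorphD (_ : _ - _ = (t%:C *: e - a) + (t'%:C *: e - b)); last by lmodule R.
by apply: (le_trans (nrD _ _)); exact: lerD.
Qed.

Lemma uposZ a r : upos a -> 0 <= r -> upos (r%:C *: a).
Proof.
move=> [sa [t t0 ht]] r0; split; first by rewrite cstarZr sa.
exists (r * t); first exact: mulr_ge0.
rewrite rmorphM /= -scalerA -scalerBr nrZr ger0_norm //; exact: ler_wpM2l.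
Qed.

Lemma upos0 : upos 0.
Proof. by split; [rewrite cstar0|exists 0; rewrite // scale0r subr0 nr0]. Qed.

Lemma upos_norm a t : upos a -> nr a <= t -> nr (t%:C *: e - a) <= t.
Proof.
move=> pa; have [s [ss sE _ _]] := upos_sqrt pa (lexx 0).
rewrite -sE nr_sq //; exact: upos_up (sq_bound ss).
Qed.

Lemma upos_comp a t : upos a -> nr a <= t -> upos (t%:C *: e - a).
Proof.
move=> pa at_; split; first by rewrite cstarB cstarZr unit_sa (proj1 pa).
exists t; first exact: le_trans (nr_ge0 _) at_.
by rewrite opprB addrC subrK.
Qed.

Lemma upos_anti a : upos a -> upos (- a) -> a = 0.
Proof.
by move=> pa pna; apply: nr_le0; apply: upos_le => //; rewrite scale0r add0r.
Qed.

Lemma upos_comm_re x : upos (x ** cstar x + cstar x ** x).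
Proof.
pose p := x + cstar x; pose q := 'i *: (x - cstar x).
have ps : cstar p = p by rewrite cstarD cstarK addrC.
have qs : cstar q = q.
  rewrite cstarZc cstarB cstarK (_ : conjc 'i = - 'i); last by simpc.
  by rewrite scaleNr -scalerN opprB.
have -> : x ** cstar x + cstar x ** x = (2^-1)%:C *: (p ** p + q ** q).
  rewrite /p /q !(cmulDl, cmulDr, cmulNl, cmulNr, cmulZl, cmulZr) !(scalerDr, scalerN, scalerA).
  rewrite (_ : (2^-1)%:C = 2^-1); last by rewrite fmorphV rmorph_nat.
  rewrite -!mulrA (_ : 'i * 'i = -1 :> R[i]); last by simpc.
  lmodule R.
by apply: uposZ; [apply: uposD; apply: sq_upos|rewrite invr_ge0].
Qed.

(** Put c = - x^* x and q = x x^*. Since q + x^* x is positive, q is positive as well. With s^2 = c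
    and x1 = x s one has x1 x1^* = - q^2 and x1^* x1 = - c^2, while their sum is positive by
    [upos_comm_re]; hence q^2 + c^2 = 0. Spectra of x^* x and x x^* are never compared. *)
Lemma neg_star_eq0 x : upos (- (cstar x ** x)) -> x = 0.
Proof.
move=> pc; set c := - _ in pc.
have pq : upos (x ** cstar x).
  rewrite (_ : _ ** _ = (x ** cstar x + cstar x ** x) + c); last by rewrite /c addrK.
  by apply: uposD => //; exact: upos_comm_re.
have [s [ss sE _ _]] := upos_sqrt pc (lexx 0).
set q := x ** cstar x in pq.
have qs : cstar q = q by rewrite cstarM cstarK.
have cs : cstar c = c by rewrite cstarN cstarM cstarK.
pose x1 := x ** s.
have e1 : x1 ** cstar x1 = - (q ** q).
  rewrite cstarM ss -!cmulA [s ** (s ** _)]cmulA sE /c /q.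
  by rewrite cmulNl cmulNr !cmulA.
have e2 : cstar x1 ** x1 = - (c ** c).
  rewrite cstarM ss -!cmulA [cstar x ** (x ** s)]cmulA.
  have -> : cstar x ** x = - c by rewrite opprK.
  by rewrite cmulNl cmulNr -sE -!cmulA.
have h0 : q ** q + c ** c = 0.
  apply: upos_anti; first by apply: uposD; apply: sq_upos.
  rewrite (_ : - _ = x1 ** cstar x1 + cstar x1 ** x1); first exact: upos_comm_re.
  by rewrite e1 e2 opprD.
have c0 : c ** c = 0.
  apply: upos_anti; first exact: sq_upos.
  rewrite (_ : - _ = q ** q); first exact: sq_upos.
  by apply/esym/eqP; rewrite -addr_eq0 h0.
have : c = 0.
  by apply: nr0_eq0; apply/eqP; rewrite -sqrf_eq0 -nr_sq // c0 nr0.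
move/eqP; rewrite oppr_eq0 => /eqP h; apply: nr0_eq0; apply/eqP.
by rewrite -sqrf_eq0 -nr_starM h nr0.
Qed.

(** With b = a^* a, p = |b| and m = p - b, twice the negative part of b, one has m b = - m p. Hence
    - (a m)^* (a m) = m p m is positive, so a m = 0 by [neg_star_eq0]. Then m b = 0, which forces m
    = 0 and b = p. *)
Lemma star_upos a : upos (cstar a ** a).
Proof.
set b := _ ** _; have bs : cstar b = b by rewrite cstarM cstarK.
have [p [ps pE pp pM]] := upos_sqrt (sq_upos bs) (lexx 0).
have [r [rs rE _ rM]] := upos_sqrt pp (lexx 0).
have pb : p ** b = b ** p by apply: (upos_comm (lexx 0) pM); rewrite cmulA.
have rb : r ** b = b ** r by apply: (upos_comm (lexx 0) rM).
have rp : r ** p = p ** r by rewrite -rE cmulA.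
pose m := p - b.
have ms : cstar m = m by rewrite cstarB ps bs.
have mb : m ** b = - (m ** p).
  by rewrite /m !cmulBl pE opprB pb.
have rm : r ** m = m ** r by rewrite /m cmulBl cmulBr rb rp.
have x0 : a ** m = 0.
  apply: neg_star_eq0; rewrite cstarM ms.
  have -> : - (m ** cstar a ** (a ** m)) = (m ** r) ** (m ** r).
    rewrite -!cmulA [cstar a ** (a ** m)]cmulA -/b [m ** (b ** m)]cmulA mb cmulNl opprK.
    by rewrite -rE -!cmulA rm.
  by apply: sq_upos; rewrite cstarM ms rs.
have bm : b ** m = 0 by rewrite /b -cmulA x0 cmul0r.
have mb0 : m ** b = 0 by rewrite -[RHS](cstar0 U) -bm cstarM ms bs.
have m0 : m = 0.
  apply: nr0_eq0; apply/eqP; rewrite -sqrf_eq0 -nr_sq // {2}/m cmulBr mb0 subr0.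
  by move: mb; rewrite mb0 => /eqP; rewrite eq_sym oppr_eq0 => /eqP ->; rewrite nr0.
suff -> : b = p by [].
by apply/esym/eqP; rewrite -subr_eq0 -/m m0.
Qed.

End Unital.

(** * Positivity without a unit, and Cauchy--Schwarz *)

Section Transfer.
Variables (R : realType) (A : cstarAlg R).
Implicit Types (a b c h v : A).

Lemma self_CS (x y : self_hilbMod A) : nr (hip x y) <= nr x * nr y.
Proof. by apply: (le_trans (nrM (cstar (x : A)) y)); rewrite nr_star. Qed.

(** A unital C*-algebra containing [A] isometrically, through left multiplication ([emb]); it stands
    in for a unitization. *)
Definition UA : cstarAlg R := LOp self_CS.
Definition uone : UA := idL self_CS.

Lemma uonel (a : UA) : uone ** a = a. Proof. exact: lapp_ext. Qed.
Lemma uoner (a : UA) : a ** uone = a. Proof. exact: lapp_ext. Qed.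

Lemma uoneU (a : UA) : uone ** a = a /\ a ** uone = a.
Proof. by rewrite uonel uoner. Qed.

Lemma emb_ex a : exists T : UA, lapp T = (fun b : A => a ** b).
Proof.
apply: (@LOp_mk _ _ _ self_CS _ (fun b : A => cstar a ** b) (nr a)); last exact: nrM.
by move=> y z /=; rewrite /self_ip cstarM cmulA.
Qed.

Definition emb a : UA := proj1_sig (cid (emb_ex a)).

Lemma embE a b : lapp (emb a) b = a ** b.
Proof. by rewrite /emb; case: cid => T /= ->. Qed.

Lemma emb_hom : star_hom emb.
Proof.
split.
- by move=> k u v; apply: lapp_ext => y; rewrite lappD lappZ !embE cmulDl cmulZl.
- by move=> a b; apply: lapp_ext => y; rewrite lappM !embE cmulA.
- move=> a; apply: lapp_ext => y; rewrite embE.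
  suff <- : (fun b : A => cstar a ** b) = lapp (cstar (emb a)) by [].
  apply: (adj_uniq (f := lapp (emb a))); last exact: lapp_adj.
  by move=> u v; rewrite embE /= /self_ip cstarM cmulA.
Qed.

Lemma embM a b : emb (a ** b) = emb a ** emb b. Proof. exact: (sh_mul emb_hom). Qed.
Lemma emb_star a : emb (cstar a) = cstar (emb a). Proof. exact: (sh_star emb_hom). Qed.
Lemma embD a b : emb (a + b) = emb a + emb b. Proof. exact: (linD (sh_lin emb_hom)). Qed.
Lemma embB a b : emb (a - b) = emb a - emb b. Proof. exact: (linB (sh_lin emb_hom)). Qed.
Lemma embZ k a : emb (k *: a) = k *: emb a. Proof. exact: (linZ (sh_lin emb_hom)). Qed.
Lemma emb0 : emb 0 = 0. Proof. exact: (lin0 (sh_lin emb_hom)). Qed.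

Lemma emb_nr a : nr (emb a) = nr a.
Proof.
apply/eqP; rewrite eq_le; apply/andP; split.
  by apply: lapp_bound; [exact: nr_ge0|move=> y; rewrite embE nrM].
have [a0|a0] := ltP 0 (nr a); last by rewrite (le_trans a0) // nr_ge0.
have h := lapp_le (emb a) (cstar a : self_hilbMod A).
have e1 : nr (a ** cstar a) = nr a ^+ 2 by rewrite -{1}(cstarK a) nr_starM nr_star.
have e2 : nr (lapp (emb a) (cstar a : self_hilbMod A)) = nr a ^+ 2 by rewrite embE.
have e3 : nr (cstar a : self_hilbMod A) = nr a by exact: nr_star.
by rewrite e2 e3 expr2 ler_pM2r in h.
Qed.

Lemma emb_inj a b : emb a = emb b -> a = b.
Proof. by move=> h; apply: eq_sub0; rewrite -emb_nr embB h subrr nr0. Qed.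

Lemma emb_calg (M : set A) : calg M -> calg [set emb a | a in M].
Proof.
move=> hM; split.
- move=> T hT.
  have /choice[u hu] : forall n : nat, exists a, M a /\ nr (T - emb a) <= (n.+1%:R^-1 : R).
    move=> n; have [|_ [a Ma <-] h] := hT (n.+1%:R^-1); first by rewrite invr_gt0 ltr0n.
    by exists a.
  have rs (e : R) : 0 < e -> exists N, forall n, (N <= n)%N -> n.+1%:R^-1 <= e.
    move=> e0; exists (Num.trunc e^-1) => n Mn.
    rewrite invf_ple ?posrE ?ltr0n //.
    by apply: (le_trans (ltW (truncnS_gt _))); rewrite ler_nat.
  have [|l hl] := @nr_complete R A u.
    move=> e e0; have [|N hN] := rs (e / 2); first by rewrite divr_gt0.
    exists N => n Nn; rewrite -emb_nr embB (le_trans (nr_tri T _ _)) // nrC [leRHS]splitr.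
    by apply: lerD; apply: (le_trans (hu _).2); apply: hN.
  exists l; first by apply: (ca_closed hM); apply: (nlim_approx hl) => n; exact: (hu n).1.
  apply: eq_nr => e e0; have [|N1 h1] := hl (e / 2); first by rewrite divr_gt0.
  have [|N2 h2] := rs (e / 2); first by rewrite divr_gt0.
  pose n := maxn N1 N2.
  rewrite (le_trans (nr_tri (emb (u n)) _ _)) // -embB emb_nr [leRHS]splitr.
  apply: lerD; first by apply: h1; rewrite leq_maxl.
  by rewrite nrC (le_trans (hu n).2) // h2 // leq_maxr.
- by exists 0; [exact: ca_0|exact: emb0].
- by move=> _ _ [a Ma <-] [b Mb <-]; exists (a + b); [apply: (ca_D hM)|rewrite embD].
- by move=> k _ [a Ma <-]; exists (k *: a); [apply: (ca_Z hM)|rewrite embZ].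
- by move=> _ _ [a Ma <-] [b Mb <-]; exists (a ** b); [apply: (ca_M hM)|rewrite embM].
Qed.

Local Notation up := (upos uone).

Lemma cpos_up a : cpositive a -> up (emb a).
Proof. by move=> [b ->]; rewrite embM emb_star; apply: (star_upos uoneU). Qed.

Lemma up_sqrt_in a : up (emb a) -> exists s, [/\ cstar s = s, s ** s = a, up (emb s) &
  forall M, calg M -> M a -> M s].
Proof.
move=> pa; have [S [Ss SE Sp SM]] := upos_sqrt uoneU pa (lexx 0).
have h M : calg M -> M a -> exists2 s, M s & emb s = S.
  move=> hM Ma; have := SM _ 0 (emb_calg hM); rewrite lexx expr0n /= !scale0r !subr0.
  by move=> /(_ isT) []; [exists a|move=> s ? ?; exists s].
have [s _ sS] := h setT (@calgT _ _) I.
exists s; split.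
- by apply: emb_inj; rewrite emb_star sS.
- by apply: emb_inj; rewrite embM sS.
- by rewrite sS.
- by move=> M hM Ma; have [s' Ms'] := h M hM Ma; rewrite -sS => /emb_inj <-.
Qed.

Lemma up_cpos a : up (emb a) -> cpositive a.
Proof. by move=> /up_sqrt_in[s [ss sE _ _]]; exists s; rewrite ss. Qed.

Lemma cpos_sqrt a : cpositive a -> exists s, [/\ cstar s = s, s ** s = a, cpositive s &
  forall M, calg M -> M a -> M s].
Proof.
by move=> /cpos_up /up_sqrt_in[s [ss sE sp sM]]; exists s; split => //; apply: up_cpos.
Qed.

Lemma cpos_sa a : cpositive a -> cstar a = a.
Proof. by move=> [b ->]; rewrite cstarM cstarK. Qed.

Lemma cposD a b : cpositive a -> cpositive b -> cpositive (a + b).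
Proof.
by move=> /cpos_up pa /cpos_up pb; apply: up_cpos; rewrite embD; apply: (uposD pa pb).
Qed.

Lemma cposZ a (r : R) : 0 <= r -> cpositive a -> cpositive (r%:C *: a).
Proof. by move=> r0 /cpos_up pa; apply: up_cpos; rewrite embZ; apply: uposZ. Qed.

Lemma cpos0 : cpositive (0 : A). Proof. by exists 0; rewrite cmul0r. Qed.

Lemma cpos_sq a : cstar a = a -> cpositive (a ** a). Proof. by move=> h; exists a; rewrite h. Qed.

Lemma cpos_le a b : cpositive a -> cpositive (b - a) -> nr a <= nr b.
Proof.
move=> pa pba; have pb : cpositive b by rewrite -(subrK a b); apply: cposD.
rewrite -(emb_nr a); apply: (upos_le uoneU (cpos_up pa)); last exact: nr_ge0.
have -> : (nr b)%:C *: uone - emb a = ((nr b)%:C *: uone - emb b) + emb (b - a).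
  by rewrite embB; lmodule R.
apply: uposD; last exact: cpos_up.
by apply: (upos_comp uoneU (cpos_up pb)); rewrite emb_nr.
Qed.

(** With g a square root of |a| - a in [UA], the element is (g c)^* (g c). *)
Lemma cpos_conj_le a c : cpositive a -> cpositive ((nr a)%:C *: (cstar c ** c) - cstar c ** a ** c).
Proof.
move=> pa; apply: up_cpos.
have : nr (emb a) <= nr a by rewrite emb_nr.
move=> /(upos_comp uoneU (cpos_up pa)).
move=> /(upos_sqrt uoneU) /(_ (lexx 0)) [g [gs gE _ _]].
have -> : emb ((nr a)%:C *: (cstar c ** c) - cstar c ** a ** c) = cstar (g ** emb c) ** (g ** emb c).
  rewrite cstarM gs -!cmulA [g ** (g ** _)]cmulA gE embB embZ !embM emb_star.
  by rewrite cmulBl cmulBr cmulZl cmulZr uonel !cmulA.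
exact: (star_upos uoneU).
Qed.

Lemma cpos_closed a : approx (@cpositive R A) a -> cpositive a.
Proof.
move=> h; apply: up_cpos; split.
  rewrite -emb_star; congr emb; apply: approx_sa; apply: approx_sub h.
  by move=> b /= /cpos_sa.
exists (nr a + 1); first by rewrite addr_ge0 ?nr_ge0.
apply/ler_addgt0Pr => e e0; have [|b pb hb] := h (Num.min e 1).
  by rewrite lt_min e0 ltr01.
rewrite (le_trans (nr_tri (emb b) _ _)) // ?lerD //; last first.
  by rewrite -embB emb_nr nrC (le_trans hb) // ge_min lexx.
apply: (upos_norm uoneU (cpos_up pb)); rewrite emb_nr.
rewrite (le_trans (nr_distl _ a)) // lerD2l nrC (le_trans hb) // ge_min lexx orbT //.
Qed.

Lemma cpos_shift h v : cpositive h -> nr ((nr h)%:C *: v - h ** v) <= nr h * nr v.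
Proof.
move=> /cpos_up ph; rewrite -emb_nr embB embZ embM.
rewrite (_ : _ - _ = ((nr h)%:C *: uone - emb h) ** emb v); last first.
  by rewrite cmulBl cmulZl uonel.
rewrite (le_trans (nrM _ _)) // emb_nr ler_wpM2r ?nr_ge0 //.
by apply: (upos_norm uoneU ph); rewrite emb_nr.
Qed.

End Transfer.

(** With a = <y, x>, t = |y|^2 and v = t x - y a, expanding <v, v> shows that t^2 <x, x> - t a^* a
    is <v, v> plus the positive element of [cpos_conj_le] for <y, y>. Comparing norms gives |a|^2 <=
    t |x|^2. *)
Lemma CS (R : realType) (A : cstarAlg R) (Y : hilbMod A) (x y : Y) :
  nr (hip x y) <= nr x * nr y.
Proof.
have [y0|y0] := ltP 0 (nr y); last by rewrite (nr_le0 y0) hip0r !nr0 mulr0.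
pose t := nr y ^+ 2; pose a := hip y x; pose v := t%:C *: x - ract y a.
have t0 : 0 < t by rewrite /t exprn_gt0.
have py := hip_pos y.
have nt : nr (hip y y) = t by rewrite nr_hip.
have pv : cpositive ((t ^+ 2)%:C *: hip x x - t%:C *: (cstar a ** a)).
  have -> : (t ^+ 2)%:C *: hip x x - t%:C *: (cstar a ** a) =
     hip v v + ((nr (hip y y))%:C *: (cstar a ** a) - cstar a ** hip y y ** a).
    rewrite nt /v !(hipBl, hipBr, hipZl, hipZr, hip_ract, hip_ractl) -/a -(hip_star y x) -/a.
    by rewrite conjc_real cmulBr cmulZr !cmulA !rmorphXn /=; lmodule R.
  by apply: cposD; [exact: hip_pos|exact: cpos_conj_le].
have pa : cpositive (t%:C *: (cstar a ** a)) by apply: cposZ; [exact: ltW|exists a].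
have := cpos_le pa pv; rewrite !nrZr nr_starM nr_hip !ger0_norm ?sqr_ge0 ?(ltW t0) //.
move=> h; have {h} : nr a ^+ 2 <= t * nr x ^+ 2.
  rewrite -subr_ge0 -(pmulr_rge0 _ t0).
  have -> : t * (t * nr x ^+ 2 - nr a ^+ 2) = t ^+ 2 * nr x ^+ 2 - t * nr a ^+ 2 by ring.
  by rewrite subr_ge0.
rewrite /t -exprMn ler_pXn2r ?nnegrE ?mulr_ge0 ?nr_ge0 //.
by rewrite -(hip_star y x) nr_star mulrC.
Qed.

(** * Approximate units and factorization *)

Section ApproxUnit.
Variables (R : realType) (A : cstarAlg R).
Implicit Types (a b c h v e k : A).
Local Notation up := (upos (@uone R A)).

Lemma expr_small (q d : R) : 0 <= q < 1 -> 0 < d -> exists N, forall n, (N <= n)%N -> q ^+ n <= d.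
Proof.
move=> /andP[q0 q1] d0; have [h|h] := leP q 0.
  by exists 1%N => -[|n] // _; rewrite exprS (le_trans _ (ltW d0)) // mulr_le0_ge0 // exprn_ge0.
have c0 : 0 < q^-1 - 1 by rewrite subr_gt0 invf_gt1.
have bern n : n%:R * (q^-1 - 1) <= q^-1 ^+ n.
  elim: n => [|n IH]; first by rewrite mul0r expr0.
  rewrite exprS; set X := q^-1 in c0 IH *.
  have X1 : 1 <= X ^+ n by apply: exprn_ege1; move: c0; rewrite subr_gt0 => /ltW.
  rewrite -natr1; nra.
exists (Num.trunc (d^-1 / (q^-1 - 1))).+1 => n hn.
rewrite -[leLHS]invrK -exprVn invf_ple ?posrE ?exprn_gt0 ?invr_gt0 //.
apply: le_trans (bern n); rewrite -ler_pdivrMr //.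
by apply: (le_trans (ltW (truncnS_gt _))); rewrite ler_nat.
Qed.

Lemma contraction_fix (V : completeNormedModType R[i]) (F : V -> V) (q : R) : 0 <= q < 1 ->
  (forall u v : V, nr (F u - F v) <= q * nr (u - v)) ->
  exists2 l, nlim (fun n => iter n F 0) l & F l = l.
Proof.
move=> hq hF; have /andP[q0 q1] := hq.
pose x n := iter n F 0; pose d := nr (F 0).
have st n : nr (x n.+1 - x n) <= q ^+ n * d.
  elim: n => [|n IH]; first by rewrite /x /= subr0 expr0 mul1r.
  by rewrite exprS -mulrA (le_trans (hF _ _)) // ler_wpM2l.
have ca N n : (N <= n)%N -> (1 - q) * nr (x n - x N) <= (q ^+ N - q ^+ n) * d.
  move=> /subnK <-; elim: (n - N)%N => [|k IH]; first by rewrite !subrr nr0 mulr0 mul0r.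
  rewrite addSn; apply: (le_trans (ler_wpM2l _ (nr_tri (x (k + N)%N) _ _))); first by lra.
  rewrite mulrDr; have := ler_wpM2l (x := 1 - q) _ (st (k + N)%N).
  rewrite exprS => /(_ _); have -> : 0 <= 1 - q by lra.
  by move=> /(_ isT); move: IH; nra.
have d0 : 0 <= d := nr_ge0 _.
have ca2 N n : (N <= n)%N -> nr (x n - x N) <= q ^+ N * (d / (1 - q)).
  move=> /ca h; rewrite mulrA ler_pdivlMr; last by lra.
  rewrite mulrC (le_trans h) // ler_wpM2r // lerBlDr lerDl exprn_ge0 //.
have [|l hl] := @nr_complete R V x.
  move=> e e0; have p0 : 0 < e / (1 + d / (1 - q)).
    by rewrite divr_gt0 // ltr_pwDl // divr_ge0 //; lra.
  have [N hN] := expr_small hq p0; exists N => n /ca2 h; apply: (le_trans h).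
  have dq : 0 <= d / (1 - q) by rewrite divr_ge0 //; lra.
  by apply: (le_trans (ler_wpM2r dq (hN N (leqnn _)))); apply: frac_small => //; exact: ltW.
exists l => //; apply: eq_nr => e e0; have [|N hN] := hl (e / 2); first by rewrite divr_gt0.
apply: (le_trans (nr_tri (x N.+1) _ _)); rewrite [leRHS]splitr; apply: lerD.
  by rewrite (le_trans (hF _ _)) // (le_trans _ (hN N (leqnn _))) // ler_piMl ?nr_ge0 // ltW.
by rewrite nrC hN.
Qed.

(** Here e is h (h + d)^-1, obtained without inverses as the fixed point of v |-> (|h| + d)^-1 (h +
    |h| v - h v), a contraction by [cpos_shift]. In [UA] the element 1 - e = d (h + d)^-1 lies
    between 0 and 1, which gives the two norm bounds. *)
Lemma approx_unit_cpos h (d : R) : cpositive h -> 0 < d -> exists e,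
  [/\ cstar e = e, h = d%:C *: e + h ** e, h ** e = e ** h, nr e <= 1 &
      (forall v, nr (v - e ** v) <= nr v) /\ (forall M, calg M -> M h -> M e)].
Proof.
move=> ph d0; pose K := nr h; have K0 : 0 <= K := nr_ge0 h.
have Kd : 0 < K + d by rewrite ltr_wpDl.
pose F v := ((K + d)^-1)%:C *: (h + (K%:C *: v - h ** v)).
pose q := K / (K + d).
have hq : 0 <= q < 1.
  by rewrite /q divr_ge0 ?(ltW Kd) //= ltr_pdivrMr // mul1r ltrDl.
have hF u v : nr (F u - F v) <= q * nr (u - v).
  have -> : F u - F v = ((K + d)^-1)%:C *: (K%:C *: (u - v) - h ** (u - v)).
    by rewrite /F cmulBr; lmodule R.
  rewrite nrZr gtr0_norm ?invr_gt0 // /q mulrAC [leRHS]mulrC ler_pM2l ?invr_gt0 //.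
  exact: cpos_shift.
have [e el Fe] := contraction_fix hq hF.
have KC : (K + d)%:C != 0 by rewrite (fmorph_eq0 (real_complex R)) gt_eqF.
have fixE v : F v = v <-> h = d%:C *: v + h ** v.
  have e1 : (K + d)%:C *: F v = h + (K%:C *: v - h ** v).
    by rewrite /F scalerA -rmorphM /= divff ?scale1r // gt_eqF.
  split=> hv.
    rewrite hv rmorphD /= in e1; apply: (eq_diff (esym e1)); lmodule R.
  apply: (scalerI KC); rewrite e1 {1}hv rmorphD /=; lmodule R.
have eM M : calg M -> M h -> M e.
  move=> hM Mh; apply: (ca_closed hM); apply: (nlim_approx el) => n.
  elim: n => [|n IH] /=; first exact: ca_0.
  apply: (ca_Z hM); apply: (ca_D hM) => //; apply: (calg_B hM); first exact: (ca_Z hM).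
  exact: (ca_M hM).
have eE : h = d%:C *: e + h ** e by apply/fixE.
have hs := cpos_sa ph.
have he : h ** e = e ** h.
  by apply/esym/(eM [set u | u ** h = h ** u] (calg_comm h)).
have es : cstar e = e.
  have Fs : F (cstar e) = cstar e.
    apply/fixE; have := congr1 (@cstar _ A) eE.
    by rewrite cstarD cstarZr he cstarM hs.
  have := hF (cstar e) e; rewrite Fs Fe => h1; apply: eq_sub0; apply/eqP; rewrite eq_le nr_ge0 andbT.
  have /andP[_ q1] := hq; have := nr_ge0 (cstar e - e); nra.
pose f : UA A := uone A - emb e.
have [ul ur] : (forall a : UA A, uone A ** a = a) /\ (forall a : UA A, a ** uone A = a).
  by split=> a; rewrite ?uonel ?uoner.
have fE : emb h ** f + d%:C *: f = d%:C *: uone A.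
  rewrite /f cmulBr ur -embM; have := congr1 (@emb R A) eE; rewrite embD embZ => h1.
  by apply: (eq_diff h1); lmodule R.
have f1 : nr f <= 1.
  have h1 : (K + d)%:C *: f = d%:C *: uone A + (K%:C *: uone A - emb h) ** f.
    by rewrite -fE cmulBl cmulZl ul rmorphD /=; lmodule R.
  have h2 : nr (K%:C *: uone A - emb h) <= K.
    by apply: (upos_norm (@uoneU R A) (cpos_up ph)); rewrite emb_nr.
  have := congr1 (@nr R _) h1; rewrite nrZr gtr0_norm // => h3.
  have h4 := nrD (d%:C *: uone A) ((K%:C *: uone A - emb h) ** f).
  have h5 := nr_re (@uoneU R A) (ltW d0).
  have h6 := nrM (K%:C *: uone A - emb h) f.
  have h7 := ler_wpM2r (nr_ge0 f) h2.
  by nra.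
have fs : cstar f = f by rewrite /f cstarB -emb_star es (unit_sa (@uoneU R A)).
have pf : up f.
  have -> : f = (d^-1)%:C *: (f ** emb h ** f + d%:C *: (f ** f)).
    have -> : f ** emb h ** f + d%:C *: (f ** f) = d%:C *: f.
      by rewrite -cmulA -cmulZr -cmulDr fE cmulZr ur.
    by rewrite scalerA -rmorphM /= mulVf ?scale1r // gt_eqF.
  apply: uposZ; last by rewrite invr_ge0 ltW.
  apply: uposD; last by apply: uposZ; [exact: (sq_upos (@uoneU R A))|exact: ltW].
  have [s [ss <- _ _]] := cpos_sqrt ph.
  have -> : f ** emb (s ** s) ** f = cstar (emb s ** f) ** (emb s ** f).
    by rewrite cstarM fs -emb_star ss embM !cmulA.
  exact: (star_upos (@uoneU R A)).
have pe : up (emb e).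
  split; first by rewrite -emb_star es.
  by exists 1; [exact: ler01|rewrite scale1r; exact: f1].
exists e; split; [exact: es|exact: eE|exact: he| |split; last exact: eM].
- rewrite -emb_nr; apply: (upos_le (@uoneU R A) pe); last exact: ler01.
  by rewrite scale1r; exact: pf.
- move=> v; rewrite -emb_nr embB embM.
  have -> : emb v - emb e ** emb v = f ** emb v by rewrite /f cmulBl ul.
  by rewrite (le_trans (nrM _ _)) // emb_nr ler_piMl // nr_ge0.
Qed.

Lemma nr_ract_sub (Y : hilbMod A) (y : Y) e (d : R) : cstar e = e -> nr e <= 1 ->
  hip y y = d%:C *: e + hip y y ** e -> hip y y ** e = e ** hip y y -> 0 <= d ->
  nr (y - ract y e) ^+ 2 <= 2 * d.
Proof.
move=> es e1 hE he d0; rewrite -nr_hip !(hipBl, hipBr, hip_ract, hip_ractl) es.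
have h1 : hip y y - hip y y ** e = d%:C *: e by rewrite {1}hE addrK.
have h2 := congr1 (fun u => e ** u) h1; rewrite /= cmulBr cmulZr cmulA in h2.
rewrite h1 h2 -scalerBr.
rewrite nrZr ger0_norm // mulrC ler_wpM2r //.
have := nrB e (e ** e); have := nrM e e; have := nr_ge0 e; nra.
Qed.

Lemma approx_unit (Y : hilbMod A) (y : Y) (d : R) : 0 < d -> exists e,
  [/\ cstar e = e, nr e <= 1, nr (y - ract y e) <= d,
   (forall v, nr (v - e ** v) <= nr v) & (forall M, calg M -> M (hip y y) -> M e)].
Proof.
move=> d0; have d2 : 0 < d ^+ 2 / 2 by rewrite divr_gt0 // exprn_gt0.
have [e [es eE he e1 [ev eM]]] := approx_unit_cpos (hip_pos y) d2.
exists e; split => //; rewrite -(ler_pXn2r (n := 2)) ?nnegrE ?nr_ge0 ?(ltW d0) //.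
apply: (le_trans (nr_ract_sub es e1 eE he (ltW d2))).
lra.
Qed.

(* With [k^4 = <y, y>] the vectors [y e_n], [e_n ~ k (k + 1/n)^-1], divided by [k] converge. *)
Lemma factorization (Y : hilbMod A) (y : Y) : exists w k, [/\ y = ract w k, cstar k = k,
  (forall M, calg M -> M (hip y y) -> M k) &
  forall (N : set Y) (P : set A), approx N `<=` N -> (forall u v : Y, N u -> N v -> N (u + v)) ->
    (forall (c : R[i]) u, N u -> N (c *: u)) -> calg P -> P (hip y y) ->
    (forall u a, N u -> P a -> N (ract u a)) -> N y -> N w].
Proof.
set h := hip y y.
have [k2 [k2s k2E k2p k2M]] := cpos_sqrt (hip_pos y).
have [k [ks kE kp kM]] := cpos_sqrt k2p.
pose ep n : R := n.+1%:R^-1.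
have ep0 n : 0 < ep n by rewrite invr_gt0 ltr0n.
have epS (d : R) : 0 < d -> exists N, forall n, (N <= n)%N -> ep n <= d.
  move=> d0; exists (Num.trunc d^-1) => n Mn.
  rewrite invf_ple ?posrE ?ltr0n //.
  by apply: (le_trans (ltW (truncnS_gt _))); rewrite ler_nat.
have /choice[e he] : forall n, exists e, [/\ cstar e = e, k = (ep n)%:C *: e + k ** e, k ** e = e ** k, nr e <= 1 &
      (forall v, nr (v - e ** v) <= nr v) /\ (forall M, calg M -> M k -> M e)].
  by move=> n; apply: approx_unit_cpos.
pose w n := (n.+1%:R)%:C *: (y - ract y (e n)).
have epK n : (n.+1%:R)%:C * (ep n)%:C = 1 :> R[i] by rewrite -rmorphM /= divff // pnatr_eq0.
have ke n : (n.+1%:R)%:C *: (k - k ** e n) = e n.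
  have [_ kE' _ _ _] := he n; rewrite {1}kE' addrK scalerA.
  by rewrite epK scale1r.
have k4 : (k ** k) ** (k ** k) = h by rewrite kE k2E.
(* As <y, y> = k^4, the inner square of [w n - w m] is z^* z with z = k^2 (al - v) formally, and the
   relations [ke] collapse z to [ep m e_m - ep n e_n]. *)
have nw n m : nr (w n - w m) <= ep n + ep m.
  pose al : R := n.+1%:R - m.+1%:R.
  pose v := (n.+1%:R)%:C *: e n - (m.+1%:R)%:C *: e m.
  have [ens knE enk en1 _] := he n; have [ems kmE emk em1 _] := he m.
  have vs : cstar v = v by rewrite /v cstarB !cstarZr ens ems.
  have wE : w n - w m = al%:C *: y - ract y v.
    by rewrite /w /al /v ractBr !ractZr rmorphB /=; lmodule R.
  pose z := al%:C *: (k ** k) - (k ** k) ** v.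
  have hz : hip (w n - w m) (w n - w m) = cstar z ** z.
    rewrite wE /z !(hipBl, hipBr, hipZl, hipZr, hip_ract, hip_ractl) -/h -k4 !conjc_real.
    rewrite vs cstarB cstarZr !cstarM ks vs.
    by rewrite !(cmulBl, cmulBr, cmulZl, cmulZr) !cmulA; lmodule R.
  have zE : z = (ep m)%:C *: e m - (ep n)%:C *: e n.
    have -> : z = k ** ((n.+1%:R)%:C *: (k - k ** e n) - (m.+1%:R)%:C *: (k - k ** e m)).
      by rewrite /z /al /v !(cmulBl, cmulBr, cmulZl, cmulZr) !cmulA rmorphB /=; lmodule R.
    rewrite !ke cmulBr; have -> : k ** e n = k - (ep n)%:C *: e n by rewrite {2}knE addrAC subrr add0r.
    have -> : k ** e m = k - (ep m)%:C *: e m by rewrite {2}kmE addrAC subrr add0r.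
    by lmodule R.
  have : nr (w n - w m) = nr z.
    by apply/eqP; rewrite -(eqrXn2 (n := 2)) ?nr_ge0 // -nr_hip hz nr_starM.
  move=> ->; rewrite zE (le_trans (nrB _ _)) // !nrZr !(gtr0_norm (ep0 _)) addrC.
  by rewrite lerD // ger_pMr.
have [|l hl] := @nr_complete R Y w.
  move=> d d0; have [|N hN] := epS (d / 2); first by rewrite divr_gt0.
  by exists N => n Nn; rewrite (le_trans (nw _ _)) // [leRHS]splitr lerD // hN.
exists l, k; split => //.
- apply: eq_nr => d d0.
  have d1 : 0 < d / 2 / (1 + nr k) by rewrite !divr_gt0 // ltr_pwDl // nr_ge0.
  have [N1 h1] := hl _ d1.
  have [N2 h2] := epS _ d1.
  pose n := maxn N1 N2; have {}h1 := h1 n (leq_maxl _ _); have {}h2 := h2 n (leq_maxr _ _).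
  have [ens knE enk en1 _] := he n.
  have wk : ract (w n) k = ract y (e n).
    have -> : ract (w n) k = ract y ((n.+1%:R)%:C *: (k - k ** e n)).
      by rewrite /w ractZl ractBl -ractA -enk ractZr ractBr.
    by rewrite ke.
  have ye : nr (y - ract y (e n)) <= ep n * nr k.
    rewrite -(ler_pXn2r (n := 2)) ?nnegrE ?mulr_ge0 ?nr_ge0 ?(ltW (ep0 _)) //.
    rewrite -nr_hip !(hipBl, hipBr, hip_ract, hip_ractl) -/h -k4 ens.
    pose z := (k ** k) - (k ** k) ** e n.
    have -> : k ** k ** (k ** k) - k ** k ** (k ** k) ** e n -
      (e n ** (k ** k ** (k ** k)) - e n ** (k ** k ** (k ** k)) ** e n) = cstar z ** z.
      by rewrite /z cstarB !cstarM ks ens !(cmulBl, cmulBr) !cmulA; lmodule R.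
    rewrite nr_starM ler_pXn2r ?nnegrE ?mulr_ge0 ?nr_ge0 ?(ltW (ep0 _)) //.
    have -> : z = (ep n)%:C *: (k ** e n).
      by rewrite /z -cmulA -cmulBr {2}knE addrK cmulZr.
    rewrite nrZr gtr0_norm // ler_wpM2l ?(ltW (ep0 _)) // (le_trans (nrM _ _)) //.
    by rewrite ler_piMr // nr_ge0.
  apply: (le_trans (nr_tri (ract y (e n)) _ _)); rewrite [leRHS]splitr; apply: lerD.
    apply: (le_trans ye); apply: (le_trans (ler_wpM2r (nr_ge0 k) h2)).
    by apply: frac_small; rewrite ?nr_ge0 // ltW // divr_gt0.
  rewrite -wk -ractBl (le_trans (nr_ract _ _)) // nrC (le_trans (ler_wpM2r (nr_ge0 k) h1)) //.
  by apply: frac_small; rewrite ?nr_ge0 // ltW // divr_gt0.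
- by move=> M hM Mh; apply: kM => //; apply: k2M.
- move=> N P cN ND NZ cP Ph Nr Ny; apply: cN; apply: (nlim_approx hl) => n.
  apply: (NZ); apply: ND => //; rewrite -scaleN1r; apply: NZ; apply: Nr => //.
  have [_ _ _ _ [_ eM]] := he n; apply: eM => //; apply: kM => //; exact: k2M.
Qed.

End ApproxUnit.

(** * Ideals and the submodules ZI *)

Section Ideals.
Variables (R : realType) (A : cstarAlg R).
Implicit Types (a b c e : A) (I J K : set A).

Lemma idl_N I a : cstar_ideal I -> I a -> I (- a).
Proof. by move=> /ideal_calg; apply: calg_N. Qed.
Lemma idl_B I a b : cstar_ideal I -> I a -> I b -> I (a - b).
Proof. by move=> /ideal_calg; apply: calg_B. Qed.
Lemma idl_approx I : cstar_ideal I -> approx I `<=` I.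
Proof. by move=> /ideal_calg; apply: ca_closed. Qed.

(** This is [factorization] in [A] as a module over itself, with both invariant sets equal to
    [I]. *)
Lemma ideal_fact I a : cstar_ideal I -> I a -> exists b c, [/\ I b, I c, cstar c = c & a = b ** c].
Proof.
move=> hI Ia; have [w [k [wE ks kM NM]]] := factorization (a : self_hilbMod A).
have Ih : I (hip (a : self_hilbMod A) a) by apply: (id_mull hI).
exists w, k; split; [|exact: (kM _ (ideal_calg hI))|by []|exact: wE].
apply: (NM I I) => //; [exact: idl_approx|exact: (id_add hI)|exact: (id_scale hI)|exact: ideal_calg|].
by move=> u v Iu _; apply: (id_mulr hI).
Qed.

(** The ideal axioms do not mention the involution; the self-adjoint right factor c of a = b c gives
    a^* = c b^*. *)
Lemma ideal_star I a : cstar_ideal I -> I a -> I (cstar a).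
Proof. by move=> hI /(ideal_fact hI)[b [c [_ Ic cs ->]]]; rewrite cstarM cs; apply: (id_mulr hI). Qed.

Lemma ideal_sub I : cstar_ideal I -> cstar_sub I.
Proof.
move=> hI; split; [exact: (id_closed hI)|exact: (id_0 hI)|exact: (id_add hI)|exact: (id_scale hI)| |].
- by move=> a b _; apply: (id_mull hI).
- by move=> a; apply: ideal_star.
Qed.

Lemma ideal_sq I a : cstar_ideal I -> I (cstar a ** a) -> I a.
Proof.
move=> hI Ih; have [w [k [wE ks kM _]]] := factorization (a : self_hilbMod A).
by rewrite [a]wE; apply: (id_mull hI); apply: kM => //; exact: ideal_calg.
Qed.

Lemma ideal_unit I a (d : R) : cstar_ideal I -> I a -> 0 < d -> exists e,
  [/\ I e, cstar e = e, nr e <= 1, nr (a - a ** e) <= d & forall v, nr (v - v ** e) <= nr v].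
Proof.
move=> hI Ia d0; have [e [es e1 ae ve eM]] := approx_unit (a : self_hilbMod A) d0.
exists e; split=> //; first by apply: (eM _ (ideal_calg hI)); apply: (id_mull hI).
by move=> v; rewrite -(nr_star v) -nr_star cstarB cstarM es.
Qed.

Lemma idealI I J : cstar_ideal I -> cstar_ideal J -> cstar_ideal (I `&` J).
Proof.
move=> hI hJ; split.
- by apply: closedI; [exact: (id_closed hI)|exact: (id_closed hJ)].
- by split; [exact: (id_0 hI)|exact: (id_0 hJ)].
- by move=> a b [? ?] [? ?]; split; [exact: (id_add hI)|exact: (id_add hJ)].
- by move=> k a [? ?]; split; [exact: (id_scale hI)|exact: (id_scale hJ)].
- by move=> a b [? ?]; split; [exact: (id_mull hI)|exact: (id_mull hJ)].
- by move=> a b [? ?]; split; [exact: (id_mulr hI)|exact: (id_mulr hJ)].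
Qed.

Lemma idealT : cstar_ideal [set: A].
Proof. by split. Qed.

Lemma approx_approx (V : normedModType R[i]) (S : set V) x : approx (approx S) x -> approx S x.
Proof.
move=> h e e0; have e2 : 0 < e / 2 by rewrite divr_gt0.
have [y hy h1] := h _ e2; have [z Sz h2] := hy _ e2.
by exists z; rewrite // (le_trans (nr_tri y _ _)) // [leRHS]splitr lerD.
Qed.

Lemma ideal_closure I : I 0 -> (forall a b, I a -> I b -> I (a + b)) ->
  (forall (k : R[i]) a, I a -> I (k *: a)) -> (forall a b, I b -> I (a ** b)) ->
  (forall a b, I a -> I (a ** b)) -> cstar_ideal (closure I).
Proof.
move=> h0 hD hZ hl hr; rewrite closureP; split.
- by apply/closedP => x; apply: approx_approx.
- exact: approx_mem.
- move=> a b ha hb e e0; have e2 : 0 < e / 2 by rewrite divr_gt0.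
  have [x Ix hx] := ha _ e2; have [y Iy hy] := hb _ e2.
  exists (x + y); first exact: hD.
  by rewrite opprD addrACA (le_trans (nrD _ _)) // [leRHS]splitr lerD.
- move=> k a ha e e0; have d0 : 0 < e / (1 + cabs k) by rewrite divr_gt0 // ltr_pwDl // cabs_ge0.
  have [x Ix hx] := ha _ d0; exists (k *: x); first exact: hZ.
  rewrite -scalerBr nrZ mulrC (le_trans (ler_wpM2r (cabs_ge0 _) hx)) //.
  by apply: frac_small; rewrite ?cabs_ge0 // ltW.
- move=> a b hb e e0; have d0 : 0 < e / (1 + nr a) by rewrite divr_gt0 // ltr_pwDl // nr_ge0.
  have [x Ix hx] := hb _ d0; exists (a ** x); first exact: hl.
  rewrite -cmulBr (le_trans (nrM _ _)) // mulrC (le_trans (ler_wpM2r (nr_ge0 _) hx)) //.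
  by apply: frac_small; rewrite ?nr_ge0 // ltW.
- move=> a b ha e e0; have d0 : 0 < e / (1 + nr b) by rewrite divr_gt0 // ltr_pwDl // nr_ge0.
  have [x Ix hx] := ha _ d0; exists (x ** b); first exact: hr.
  rewrite -cmulBl (le_trans (nrM _ _)) // (le_trans (ler_wpM2r (nr_ge0 _) hx)) //.
  by apply: frac_small; rewrite ?nr_ge0 // ltW.
Qed.

Lemma halves (e : R) : 0 < e -> forall n, 0 < e / 2 ^+ n.
Proof. by move=> e0 n; rewrite divr_gt0 // exprn_gt0. Qed.

Lemma halfS (e : R) n : e / 2 ^+ n.+1 = e / 2 ^+ n / 2.
Proof. by rewrite exprSr invfM mulrA. Qed.

Lemma half_small (e d : R) : 0 < d -> 0 <= e -> exists N, forall n, (N <= n)%N -> e / 2 ^+ n <= d.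
Proof.
move=> d0 e0; have d1 : 0 < d / (1 + e) by rewrite divr_gt0 // ltr_pwDl.
have [|N hN] := @expr_small R 2^-1 _ _ d1; first by lra.
exists N => n /hN; rewrite exprVn => h; rewrite mulrC.
by apply: (le_trans (ler_wpM2r e0 h)); apply: frac_small => //; exact: ltW.
Qed.

(* A telescoping sum of the increments [d n] converges. *)
Lemma telescope_lim (V : completeNormedModType R[i]) (d : nat -> V) (C : R) : 0 <= C ->
  (forall n, nr (d n) <= C / 2 ^+ n) ->
  exists l, nlim (fun n => \sum_(i < n) d i) l.
Proof.
move=> C0 hd; have ca N n : (N <= n)%N ->
    nr (\sum_(i < n) d i - \sum_(i < N) d i) <= 2 * (C / 2 ^+ N) - 2 * (C / 2 ^+ n).
  move=> /subnK <-; elim: (n - N)%N => [|k IH]; first by rewrite !subrr nr0.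
  rewrite addSn big_ord_recr /= addrAC (le_trans (nrD _ _)) //.
  have := hd (k + N)%N; rewrite halfS; lra.
have [|l hl] := @nr_complete R V (fun n => \sum_(i < n) d i); last by exists l.
move=> e e0; have [||N hN] := @half_small (2 * C) e; rewrite ?mulr_ge0 //.
exists N => n /ca h; apply: (le_trans h).
have h1 : 0 <= C / 2 ^+ n by rewrite divr_ge0 // exprn_ge0.
have := hN N (leqnn _); rewrite -mulrA; lra.
Qed.

(* Approximate units give small representatives: [i + j = (i - i e) + (j + i e)]. *)
Lemma ideal_sum I J : cstar_ideal I -> cstar_ideal J ->
  cstar_ideal [set a + b | a in I & b in J].
Proof.
move=> hI hJ; pose S := [set a + b | a in I & b in J].
have hS : S = closure S; last first.
  have -> : [set a + b | a in I & b in J] = closure S by rewrite -hS.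
  apply: ideal_closure.
  - by exists 0; [exact: (id_0 hI)|exists 0; [exact: (id_0 hJ)|rewrite addr0]].
  - move=> _ _ [a Ia [b Jb <-]] [a' Ia' [b' Jb' <-]].
    by exists (a + a'); [exact: (id_add hI)|exists (b + b'); [exact: (id_add hJ)|rewrite addrACA]].
  - move=> k _ [a Ia [b Jb <-]].
    by exists (k *: a); [exact: (id_scale hI)|exists (k *: b); [exact: (id_scale hJ)|rewrite scalerDr]].
  - move=> c _ [a Ia [b Jb <-]].
    by exists (c ** a); [exact: (id_mull hI)|exists (c ** b); [exact: (id_mull hJ)|rewrite cmulDr]].
  - move=> _ c [a Ia [b Jb <-]].
    by exists (a ** c); [exact: (id_mulr hI)|exists (b ** c); [exact: (id_mulr hJ)|rewrite cmulDl]].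
rewrite closureP; apply/seteqP; split=> [x /approx_mem //|x hx].
have small (d : R) u : 0 < d -> S u -> nr u <= d -> exists i j, [/\ I i, J j, u = i + j, nr i <= 3 * d & nr j <= 2 * d].
  move=> d0 [i Ii [j Jj uE]] ud.
  have [e [Je es e1 je ve]] := ideal_unit hJ Jj d0.
  exists (i - i ** e), (j + i ** e); split.
  - by apply: (idl_B hI) => //; apply: (id_mulr hI).
  - by apply: (id_add hJ) => //; apply: (id_mull hJ).
  - by rewrite -uE; lmodule R.
  - have -> : i - i ** e = (u - u ** e) - (j - j ** e) by rewrite -uE cmulDl; lmodule R.
    by rewrite (le_trans (nrB _ _)) //; have := ve u; lra.
  - have -> : j + i ** e = (j - j ** e) + u ** e by rewrite -uE cmulDl; lmodule R.
    rewrite (le_trans (nrD _ _)) //; have := nrM u e.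
    have := ler_wpM2l (nr_ge0 u) e1; lra.
(* Approximants are taken at geometric rate, so that the increments split by [small] into summable
   pieces of [I] and of [J], and the two series are summed separately. *)
have /choice[s hs] n : exists s, S s /\ nr (x - s) <= 1 / 2 ^+ n.
  by have [s Ss h] := hx (1 / 2 ^+ n) (halves ltr01 n); exists s.
have SB u v : S u -> S v -> S (u - v).
  move=> [a Ia [b Jb <-]] [a' Ia' [b' Jb' <-]].
  exists (a - a'); first exact: (idl_B hI).
  by exists (b - b'); [exact: (idl_B hJ)|lmodule R].
have /choice[f hf] n : exists p : A * A, [/\ I p.1, J p.2, s n.+1 - s n = p.1 + p.2, nr p.1 <= 6 / 2 ^+ n & nr p.2 <= 6 / 2 ^+ n].
  have d0 : 0 < 2 / 2 ^+ n :> R by apply: halves.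
  have [||i [j [Ii Jj E hi hj]]] := @small _ (s n.+1 - s n) d0.
  - by apply: SB; [exact: (hs _).1|exact: (hs _).1].
  - apply: (le_trans (nr_tri x _ _)); rewrite nrC.
    have := (hs n).2; have := (hs n.+1).2; rewrite halfS.
    have : 0 < 1 / 2 ^+ n :> R by apply: halves.
    have -> : 2 / 2 ^+ n = 2 * (1 / 2 ^+ n) :> R by rewrite mulrA mulr1.
    lra.
  exists (i, j); split => //=.
    by apply: (le_trans hi); rewrite mulrA -natrM.
  by apply: (le_trans hj); rewrite mulrA -natrM ler_pM2r ?invr_gt0 ?exprn_gt0 // ler_nat.
have [//||li hli] := @telescope_lim A (fun n => (f n).1) 6; first by move=> n; have [] := hf n.
have [//||lj hlj] := @telescope_lim A (fun n => (f n).2) 6; first by move=> n; have [] := hf n.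
have [i0 Ii0 [j0 Jj0 s0E]] := (hs 0%N).1.
have sumI n : I (\sum_(i < n) (f i).1).
  by elim: n => [|n IH]; rewrite ?big_ord0 ?big_ord_recr /=; [exact: (id_0 hI)|apply: (id_add hI) => //; have [] := hf n].
have sumJ n : J (\sum_(i < n) (f i).2).
  by elim: n => [|n IH]; rewrite ?big_ord0 ?big_ord_recr /=; [exact: (id_0 hJ)|apply: (id_add hJ) => //; have [] := hf n].
have Ili : I li by apply: (idl_approx hI); apply: (nlim_approx hli).
have Jlj : J lj by apply: (idl_approx hJ); apply: (nlim_approx hlj).
exists (i0 + li); first exact: (id_add hI).
exists (j0 + lj); first exact: (id_add hJ).
have sE n : s n = s 0%N + \sum_(i < n) (f i).1 + \sum_(i < n) (f i).2.
  elim: n => [|n IH]; first by rewrite !big_ord0 !addr0.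
  have -> : \sum_(i < n.+1) (f i).1 = \sum_(i < n) (f i).1 + (f n).1 by apply: big_ord_recr.
  have -> : \sum_(i < n.+1) (f i).2 = \sum_(i < n) (f i).2 + (f n).2 by apply: big_ord_recr.
  have [_ _ E _ _] := hf n; apply: (eq_diff E); rewrite IH; move: (\sum_(i < n) _) (\sum_(i < n) _) => p q.
  lmodule R.
apply/esym; apply: eq_nr => e e0.
have e3 : 0 < e / 3 by rewrite divr_gt0.
have [N1 h1] := hli _ e3; have [N2 h2] := hlj _ e3.
have [//|N3 h3] := @half_small 1 _ e3.
pose n := maxn N1 (maxn N2 N3).
have {}h1 := h1 n (leq_maxl _ _).
have {}h2 : nr (lj - \sum_(i < n) (f i).2) <= e / 3 by apply: h2; rewrite /n !leq_max leqnn !orbT.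
have {}h3 : 1 / 2 ^+ n <= e / 3 by apply: h3; rewrite /n !leq_max leqnn !orbT.
have -> : x - (i0 + li + (j0 + lj)) = (x - s n) - (li - \sum_(i < n) (f i).1) - (lj - \sum_(i < n) (f i).2).
  by rewrite sE -s0E; lmodule R.
have := nrB (x - s n - (li - \sum_(i < n) (f i).1)) (lj - \sum_(i < n) (f i).2).
have := nrB (x - s n) (li - \sum_(i < n) (f i).1).
have := (hs n).2; lra.
Qed.

End Ideals.

Section ModI.
Variables (R : realType) (A : cstarAlg R) (Z : hilbMod A) (I : set A).
Hypothesis hI : cstar_ideal I.
Implicit Types (z w : Z) (a i : A).

(** The right factor of z = w k lies in the closed algebra generated by <z, z>. This makes ZI,
    defined as a plain set of products, a closed submodule. *)
Lemma modI_hip z : modI Z I z <-> I (hip z z).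
Proof.
split=> [[w [i [Ii ->]]]|h]; first by rewrite hip_ract; apply: (id_mull hI).
have [w [k [wE _ kM _]]] := factorization z.
by exists w, k; split => //; apply: kM => //; exact: ideal_calg.
Qed.

Lemma modIP z : modI Z I z <-> forall w, I (hip w z).
Proof.
split=> [[w [i [Ii ->]]] w'|h]; first by rewrite hip_ract; apply: (id_mull hI).
by apply/modI_hip.
Qed.

Lemma modIPl z : modI Z I z <-> forall w, I (hip z w).
Proof.
split=> [/modIP h w|h]; first by rewrite -hip_star; apply: (ideal_star hI).
by apply/modI_hip.
Qed.

Lemma modI0 : modI Z I 0.
Proof. by apply/modIP => w; rewrite hip0r; exact: (id_0 hI). Qed.

Lemma modID z w : modI Z I z -> modI Z I w -> modI Z I (z + w).
Proof. by move=> /modIP h /modIP h'; apply/modIP => u; rewrite hipDr; apply: (id_add hI). Qed.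

Lemma modIZ (k : R[i]) z : modI Z I z -> modI Z I (k *: z).
Proof. by move=> /modIP h; apply/modIP => u; rewrite hipZr; apply: (id_scale hI). Qed.

Lemma modI_ract z a : modI Z I z -> modI Z I (ract z a).
Proof. by move=> /modIP h; apply/modIP => u; rewrite hip_ract; apply: (id_mulr hI). Qed.

Lemma modI_ractI z i : I i -> modI Z I (ract z i).
Proof. by move=> Ii; exists z, i. Qed.

Lemma modI_closed : approx (modI Z I) `<=` modI Z I.
Proof.
move=> z hz; apply/modIP => w; apply: (idl_approx hI) => e e0.
have d0 : 0 < e / (1 + nr w) by rewrite divr_gt0 // ltr_pwDl // nr_ge0.
have [y Iy hy] := hz _ d0; exists (hip w y); first by move/modIP: Iy.
rewrite -hipBr (le_trans (CS _ _)) // mulrC (le_trans (ler_wpM2r (nr_ge0 _) hy)) //.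
by apply: frac_small; rewrite ?nr_ge0 // ltW.
Qed.

(* A closed [I]-submodule [N] contained in [ZI] satisfies [N = NI]. *)
Lemma modI_fact (N : set Z) z : approx N `<=` N -> (forall u v, N u -> N v -> N (u + v)) ->
  (forall (c : R[i]) u, N u -> N (c *: u)) -> (forall u a, N u -> I a -> N (ract u a)) ->
  modI Z I z -> N z -> exists w i, [/\ N w, I i, cstar i = i & z = ract w i].
Proof.
move=> cN ND NZ Nr /modI_hip Iz Nz; have [w [k [wE ks kM NM]]] := factorization z.
exists w, k; split => //; last by apply: kM => //; exact: ideal_calg.
by apply: (NM N I) => //; exact: ideal_calg.
Qed.

Lemma modI_fact2 z : modI Z I z -> exists w i, [/\ modI Z I w, I i, cstar i = i & z = ract w i].
Proof.
move=> Iz; apply: modI_fact => //; [exact: modI_closed|exact: modID|exact: modIZ|].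
by move=> u a h _; apply: modI_ract.
Qed.

End ModI.

(** * Quotients of Banach spaces and of C*-algebras *)

Section BanachQuotient.
Variables (R : realType) (V : completeNormedModType R[i]) (W : set V).
Hypotheses (cW : approx W `<=` W) (W0 : W 0)
  (WD : forall u v, W u -> W v -> W (u + v)) (WZ : forall (c : R[i]) u, W u -> W (c *: u)).

Let WN u : W u -> W (- u). Proof. by move=> h; rewrite -scaleN1r; apply: WZ. Qed.
Let WB u v : W u -> W v -> W (u - v). Proof. by move=> h h'; apply: WD => //; apply: WN. Qed.

(** A chosen representative depending only on the class of [v]; the quotient is the subtype of its
    fixed points, so that equality of classes is plain equality. *)
Definition qrep (v : V) : V := xget 0 [set u | W (u - v)].

Lemma qrepP v : W (qrep v - v).
Proof. by rewrite /qrep; case: xgetP => [u _ //|/(_ v)]; rewrite /= subrr. Qed.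

Lemma qrep_eq u v : W (u - v) -> qrep u = qrep v.
Proof.
move=> h; rewrite /qrep; congr xget; apply/seteqP; split=> w /= hw.
  by rewrite (_ : w - v = (w - u) + (u - v)); [exact: WD|lmodule R].
by rewrite (_ : w - u = w - v - (u - v)); [apply: WB|lmodule R].
Qed.

Record bquot := BQuot { bq_val : V; _ : qrep bq_val == bq_val }.
HB.instance Definition _ := [isSub for bq_val].
HB.instance Definition _ := [Choice of bquot by <:].

Lemma qrepK v : qrep (qrep v) == qrep v.
Proof. by apply/eqP; apply: qrep_eq; exact: qrepP. Qed.

Definition bpi (v : V) : bquot := BQuot (qrepK v).

Lemma bpi_eq u v : bpi u = bpi v <-> W (u - v).
Proof.
split=> [[h]|h]; last by apply: val_inj; exact: qrep_eq.
have -> : u - v = (qrep v - v) - (qrep u - u) by rewrite h; lmodule R.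
by apply: WB; exact: qrepP.
Qed.

Lemma bpi_val x : bpi (bq_val x) = x.
Proof. by apply: val_inj; case: x => v /= /eqP. Qed.

Lemma bval_pi v : W (bq_val (bpi v) - v). Proof. exact: qrepP. Qed.

Let add (x y : bquot) := bpi (bq_val x + bq_val y).
Let opp (x : bquot) := bpi (- bq_val x).
Let scale (k : R[i]) (x : bquot) := bpi (k *: bq_val x).

Let addE u v : add (bpi u) (bpi v) = bpi (u + v).
Proof.
apply/bpi_eq; rewrite (_ : _ - _ = (bq_val (bpi u) - u) + (bq_val (bpi v) - v)); last by lmodule R.
by apply: WD; exact: bval_pi.
Qed.
Let oppE u : opp (bpi u) = bpi (- u).
Proof.
apply/bpi_eq; rewrite (_ : _ - _ = - (bq_val (bpi u) - u)); last by lmodule R.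
by apply: WN; exact: bval_pi.
Qed.
Let scaleE k u : scale k (bpi u) = bpi (k *: u).
Proof.
apply/bpi_eq; rewrite (_ : _ - _ = k *: (bq_val (bpi u) - u)); last by lmodule R.
by apply: WZ; exact: bval_pi.
Qed.

Let addA : associative add.
Proof. by move=> x y z; rewrite -(bpi_val x) -(bpi_val y) -(bpi_val z) !addE addrA. Qed.
Let addC : commutative add.
Proof. by move=> x y; rewrite -(bpi_val x) -(bpi_val y) !addE addrC. Qed.
Let add0 : left_id (bpi 0) add.
Proof. by move=> x; rewrite -(bpi_val x) addE add0r. Qed.
Let addN : left_inverse (bpi 0) opp add.
Proof. by move=> x; rewrite -(bpi_val x) oppE addE addNr. Qed.

HB.instance Definition _ := GRing.isZmodule.Build bquot addA addC add0 addN.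

Let scA a b (x : bquot) : scale a (scale b x) = scale (a * b) x.
Proof. by rewrite -(bpi_val x) !scaleE scalerA. Qed.
Let sc1 : left_id 1 scale.
Proof. by move=> x; rewrite -(bpi_val x) scaleE scale1r. Qed.
Let scDr : right_distributive scale +%R.
Proof. by move=> k x y; rewrite -(bpi_val x) -(bpi_val y) [bpi _ + _]addE !scaleE [RHS]addE scalerDr. Qed.
Let scDl (x : bquot) : {morph scale^~ x : a b / a + b}.
Proof. by move=> a b; rewrite -(bpi_val x) !scaleE [RHS]addE scalerDl. Qed.

HB.instance Definition _ := GRing.Zmodule_isLmodule.Build R[i] bquot scA sc1 scDr scDl.

Lemma bpiD u v : bpi (u + v) = bpi u + bpi v. Proof. by rewrite -addE. Qed.
Lemma bpiZ k u : bpi (k *: u) = k *: bpi u. Proof. by rewrite -scaleE. Qed.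
Lemma bpi_lin : linear bpi. Proof. by move=> k u v; rewrite bpiD bpiZ. Qed.
Lemma bpi0 u : bpi u = 0 <-> W u.
Proof. by rewrite -[X in W X]subr0 -bpi_eq. Qed.

Definition bqN (x : bquot) : R := inf [set nr v | v in [set v | bpi v = x]].

Let hinf x : has_inf [set nr v | v in [set v | bpi v = x]].
Proof.
split; first by exists (nr (bq_val x)), (bq_val x) => //=; exact: bpi_val.
by exists 0 => _ [v _ <-]; exact: nr_ge0.
Qed.

Lemma bqN_le v : bqN (bpi v) <= nr v.
Proof. by apply: (ge_inf (hinf _).2); exists v. Qed.

Lemma bqN_ge0 x : 0 <= bqN x.
Proof. by apply: lb_le_inf; [exact: (hinf x).1|move=> _ [v _ <-]; exact: nr_ge0]. Qed.

Lemma bqN_lift x e : 0 < e -> exists2 v, bpi v = x & nr v <= bqN x + e.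
Proof. by move=> e0; have [_ [v vx <-] h] := inf_adherent e0 (hinf x); exists v => //; exact: ltW. Qed.

Lemma bq_banach : banach_norm bqN.
Proof.
have N0 x : bqN x = 0 -> x = 0.
  move=> h; rewrite -(bpi_val x); apply/bpi0; apply: cW => e e0.
  have [v vx hv] := bqN_lift x e0; exists (bq_val x - v); last first.
    by rewrite opprB addrC subrK -(add0r e) -h.
  by apply/bpi_eq; rewrite bpi_val.
have Zle k x : bqN (k *: x) <= cabs k * bqN x.
  apply/ler_addgt0Pr => e e0; have d0 : 0 < e / (1 + cabs k) by rewrite divr_gt0 // ltr_pwDl // cabs_ge0.
  have [v <- hv] := bqN_lift x d0; rewrite -bpiZ (le_trans (bqN_le _)) // nrZ.
  rewrite (le_trans (ler_wpM2l (cabs_ge0 k) hv)) // mulrDr lerD //.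
  by rewrite mulrC; apply: frac_small; rewrite ?cabs_ge0 // ltW.
split=> //.
- move=> x y; apply/ler_addgt0Pr => e e0; have e2 : 0 < e / 2 by rewrite divr_gt0.
  have [u <- hu] := bqN_lift x e2; have [v <- hv] := bqN_lift y e2.
  rewrite -bpiD (le_trans (bqN_le _)) // (le_trans (nrD _ _)) //; lra.
- move=> k x; apply/eqP; rewrite eq_le Zle /=.
  have [->|k0] := eqVneq k 0; first by rewrite cabs_real normr0 mul0r bqN_ge0.
  have kp : 0 < cabs k.
    by rewrite -ltcR -cabsE normr_gt0.
  have := Zle k^-1 (k *: x); rewrite scalerA mulVf // scale1r => h.
  rewrite mulrC -ler_pdivlMr //; apply: (le_trans h).
  rewrite mulrC ler_wpM2l ?bqN_ge0 //.
  by rewrite -(ler_pM2l kp) -cabsM divff // mulfV ?gt_eqF // cabs_real normr1.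
- move=> x hx.
  have /choice[M hM] n : exists M, forall m, (M <= m)%N -> bqN (x m - x M) <= 1 / 2 ^+ n.
    by apply: hx; apply: halves.
  (* A nondecreasing sequence of indices along which the increments are at most [2 / 2^n]; these
     lift to a convergent series in [V]. *)
  pose K := fix K n := if n is k.+1 then maxn (K k) (M n) else M 0%N.
  have KM n : (M n <= K n)%N by case: n => [|n] //=; rewrite leq_maxr.
  have KS n : (K n <= K n.+1)%N by rewrite /= leq_maxl.
  have dK n : bqN (x (K n.+1) - x (K n)) <= 2 / 2 ^+ n.
    have -> : x (K n.+1) - x (K n) = (x (K n.+1) - x (M n)) + (-1) *: (x (K n) - x (M n)).
      by lmodule R.
    have BD u v : bqN (u + v) <= bqN u + bqN v.
      apply/ler_addgt0Pr => e e0; have e2 : 0 < e / 2 by rewrite divr_gt0.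
      have [u' <- hu] := bqN_lift u e2; have [v' <- hv] := bqN_lift v e2.
      rewrite -bpiD (le_trans (bqN_le _)) // (le_trans (nrD _ _)) //; lra.
    apply: (le_trans (BD _ _)).
    have h1 := hM n _ (leq_trans (KM n) (KS n)).
    have := Zle (-1) (x (K n) - x (M n)); rewrite (_ : cabs (-1) = 1); last first.
      by rewrite -[-1](rmorphN1 (real_complex R)) cabs_real normrN1.
    have := hM n _ (KM n); rewrite mul1r; move: h1.
    have -> : 2 / 2 ^+ n = 1 / 2 ^+ n + 1 / 2 ^+ n :> R by lra.
    lra.
  have /choice[d hd] n : exists v, bpi v = x (K n.+1) - x (K n) /\ nr v <= 3 / 2 ^+ n.
    have [v vE hv] := bqN_lift (x (K n.+1) - x (K n)) (halves ltr01 n).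
    exists v; split=> //; apply: (le_trans hv); have := dK n; lra.
  have [//||l hl] := @telescope_lim R V d 3; first by move=> n; exact: (hd n).2.
  exists (bpi (bq_val (x (K 0%N)) + l)) => e e0.
  have e2 : 0 < e / 2 by rewrite divr_gt0.
  have [N1 h1] := hl _ e2; have [//|N2 h2] := @half_small R (4 : R) _ e2 .
  pose n := maxn N1 N2; exists (M n) => m hm.
  have xK j : x (K j) = bpi (bq_val (x (K 0%N)) + \sum_(i < j) d i).
    elim: j => [|j IH]; first by rewrite big_ord0 addr0 bpi_val.
    by rewrite big_ord_recr /= addrA bpiD -IH (hd j).1 addrC subrK.
  have -> : bpi (bq_val (x (K 0%N)) + l) - x m =
     bpi (l - \sum_(i < n) d i) + (x (K n) - x (M n)) + (-1) *: (x m - x (M n)).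
    by rewrite (xK n) !bpiD (linN bpi_lin); lmodule R.
  have BD u v : bqN (u + v) <= bqN u + bqN v.
    apply/ler_addgt0Pr => d1 d0; have d2 : 0 < d1 / 2 by rewrite divr_gt0.
    have [u' <- hu] := bqN_lift u d2; have [v' <- hv] := bqN_lift v d2.
    rewrite -bpiD (le_trans (bqN_le _)) // (le_trans (nrD _ _)) //; lra.
  apply: (le_trans (BD _ _)); apply: (le_trans (lerD (BD _ _) (Zle _ _))).
  rewrite (_ : cabs (-1) = 1); last first.
    by rewrite -[-1](rmorphN1 (real_complex R)) cabs_real normrN1.
  have := hM n _ (KM n); have := hM n _ hm.
  have := bqN_le (l - \sum_(i < n) d i); have := h1 n (leq_maxl _ _).
  have := h2 n (leq_maxr _ _).
  have -> : 4 / 2 ^+ n = 4 * (1 / 2 ^+ n) :> R by lra.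
  have : 0 < 1 / 2 ^+ n :> R by apply: halves.
  lra.
Qed.

Lemma banach_quotient : exists (Q : completeNormedModType R[i]) (p : V -> Q),
  [/\ linear p, forall y, exists v, p v = y, forall v, p v = 0 <-> W v,
      forall v, nr (p v) <= nr v &
      forall v (e : R), 0 < e -> exists2 w, W w & nr (v - w) <= nr (p v) + e].
Proof.
exists (banach bq_banach), bpi; split.
- exact: bpi_lin.
- by move=> y; exists (bq_val y); exact: bpi_val.
- exact: bpi0.
- exact: bqN_le.
- move=> v e e0; have [u uE hu] := bqN_lift (bpi v) e0.
  by exists (v - u); [apply/bpi_eq|rewrite opprB addrC subrK].
Qed.

End BanachQuotient.

Section QuotientAlg.
Variables (R : realType) (B : cstarAlg R) (K : set B).
Hypothesis hK : cstar_ideal K.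

(** The C*-identity for the quotient norm: if k in K nearly realises the norm of the class of b^* b
    and e is an approximate unit for k, then b and b - b e have the same class, and |b - b e|^2 is
    at most |b^* b - k| up to the error of e. *)
Theorem quotient_alg : exists (D : cstarAlg R) (q : B -> D), is_quotient_alg K q /\
  forall b (e : R), 0 < e -> exists2 k, K k & nr (b - k) <= nr (q b) + e.
Proof.
have [Q [p [plin psurj pker ple plift]]] := banach_quotient (idl_approx hK) (id_0 hK) (id_add hK) (id_scale hK).
have /choice[s hs] := psurj.
have pE u v : p u = p v <-> K (u - v).
  by rewrite -pker (linB plin); split=> [->|/eqP]; rewrite ?subrr // subr_eq0 => /eqP.
have sK v : K (s (p v) - v) by apply/pE; rewrite hs.
pose mul x y := p (s x ** s y); pose star x := p (cstar (s x)).
have mulE u v : mul (p u) (p v) = p (u ** v).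
  apply/pE; rewrite (_ : _ - _ = (s (p u) - u) ** s (p v) + u ** (s (p v) - v)); last first.
    by rewrite cmulBl cmulBr; lmodule R.
  by apply: (id_add hK); [apply: (id_mulr hK)|apply: (id_mull hK)].
have starE u : star (p u) = p (cstar u).
  by apply/pE; rewrite -cstarB; apply: (ideal_star hK).
have mA x y z : mul x (mul y z) = mul (mul x y) z.
  by rewrite -(hs x) -(hs y) -(hs z) !mulE cmulA.
have mll y : linear (fun x => mul x y).
  by move=> k u v; rewrite -(hs u) -(hs v) -(hs y) -plin !mulE cmul_linl plin.
have mlr y : linear (mul y).
  by move=> k u v; rewrite -(hs u) -(hs v) -(hs y) -plin !mulE cmul_linr plin.
have stK : involutive star by move=> x; rewrite -(hs x) !starE cstarK.
have stD x y : star (x + y) = star x + star y.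
  by rewrite -(hs x) -(hs y) -(linD plin) !starE cstarD (linD plin).
have stZ (k : R[i]) x : star (k *: x) = k^* *: star x.
  by rewrite -(hs x) -(linZ plin) !starE cstarZc (linZ plin).
have stM x y : star (mul x y) = mul (star y) (star x).
  by rewrite -(hs x) -(hs y) !(mulE, starE) cstarM.
have nM' x y : nr (mul x y) <= nr x * nr y.
  have h (e : R) : 0 < e -> nr (mul x y) <= (nr x + e) * (nr y + e).
    move=> e0; have [u Ku hu] := plift (s x) e e0; have [v Kv hv] := plift (s y) e e0.
    rewrite hs in hu; rewrite hs in hv.
    have <- : p (s x - u) = x by rewrite -[RHS]hs; apply/pE; rewrite addrAC subrr add0r; apply: (idl_N hK).
    have <- : p (s y - v) = y by rewrite -[RHS]hs; apply/pE; rewrite addrAC subrr add0r; apply: (idl_N hK).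
    rewrite mulE (le_trans (ple _)) // (le_trans (nrM _ _)) //.
    rewrite (linB plin) hs (pker u).2 // subr0 (linB plin) hs (pker v).2 // subr0.
    by apply: ler_pM; rewrite ?nr_ge0.
  apply/ler_addgt0Pr => d d0; pose t := nr x + nr y + 1.
  have t0 : 0 < t by rewrite ltr_wpDl // addr_ge0 // nr_ge0.
  pose e := Num.min 1 (d / t).
  have e0 : 0 < e by rewrite lt_min ltr01 divr_gt0.
  have e1 : e <= 1 by rewrite ge_min lexx.
  have e2 : e * t <= d by rewrite -ler_pdivlMr // ge_min lexx orbT.
  have := h e e0; have := nr_ge0 x; have := nr_ge0 y; rewrite /t in e2; nra.
have nS x : nr (star x) <= nr x.
  apply/ler_addgt0Pr => e e0; have [u Ku hu] := plift (s x) e e0; rewrite hs in hu.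
  apply: le_trans hu; rewrite -nr_star -[X in nr X <= _](_ : p (cstar (s x - u)) = star x) ?ple //.
  rewrite -(hs x) starE; apply/pE; rewrite cstarB (hs x) addrAC subrr add0r.
  by apply: (idl_N hK); apply: (ideal_star hK).
have nE x : nr (mul (star x) x) = nr x ^+ 2.
  apply/eqP; rewrite eq_le; apply/andP; split.
    by rewrite (le_trans (nM' _ _)) // expr2 ler_wpM2r // nr_ge0.
  apply/ler_addgt0Pr => d d0; have d2 : 0 < d / 2 by rewrite divr_gt0.
  pose b := s x; pose T := cstar b ** b.
  have xE : mul (star x) x = p T by rewrite -(hs x) starE mulE.
  have [k Kk hk] := plift T _ d2; rewrite xE.
  have [e [Ke es e1 ke ve]] := ideal_unit hK Kk d2.
  have -> : x = p (b - b ** e).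
    rewrite -[LHS]hs; apply/pE; rewrite opprB addrC subrK; exact: (id_mull hK).
  apply: (@le_trans _ _ (nr (b - b ** e) ^+ 2)); first by rewrite ler_pXn2r ?nnegrE ?nr_ge0 ?ple.
  rewrite -nr_starM.
  have -> : cstar (b - b ** e) ** (b - b ** e) = (T - T ** e) - e ** (T - T ** e).
    by rewrite /T cstarB cstarM es !(cmulBl, cmulBr) !cmulA; lmodule R.
  have ve' v : nr (v - e ** v) <= nr v by rewrite -(nr_star v) -nr_star cstarB cstarM es.
  apply: (le_trans (ve' _)).
  have -> : T - T ** e = ((T - k) - (T - k) ** e) + (k - k ** e) by rewrite cmulBl; lmodule R.
  rewrite (le_trans (nrD _ _)) //; have := ve (T - k); lra.
have nM x y : `|mul x y| <= `|x| * `|y| by rewrite !nrE -rmorphM lecR.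
have nE' x : `|mul (star x) x| = `|x| ^+ 2 by rewrite !nrE -rmorphXn nE.
exists (@CstarAlg R Q mul star mA mll mlr stK stD stZ stM nM nE'), p; split; last first.
  by move=> b e e0; exact: plift.
split; [split=> //= | |exact: pker].
- by apply/seteqP; split=> // y _; have [v <-] := psurj y; exists v.
Qed.

End QuotientAlg.

(** * Cutting down a positive element *)

Section Cut.
Variables (R : realType).

Section Unital.
Variables (U : cstarAlg R) (e : U).
Hypothesis eu : forall a, e ** a = a /\ a ** e = a.

(** Pointwise, m (p - m) >= 0 with p >= 0 leaves no room for m < 0. With q = |m| and w = q - m one
    has w m = - w q, and - (m w)^* (m w) = w q p w + w (p m - m^2) w is positive, so m w = 0 by
    [neg_star_eq0] and then w = 0. *)
Lemma upos_of_dom m p : cstar m = m -> upos e p -> p ** m = m ** p ->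
  upos e (p ** m - m ** m) -> upos e m.
Proof.
move=> ms pp pm ppos.
have [q [qs qE qp qM]] := upos_sqrt eu (sq_upos eu ms) (lexx 0).
have [r [rs rE rp rM]] := upos_sqrt eu pp (lexx 0).
have [t [ts tE tp tM]] := upos_sqrt eu qp (lexx 0).
have qm : q ** m = m ** q by apply: (upos_comm (lexx 0) qM); rewrite cmulA.
have rm : r ** m = m ** r by apply: (upos_comm (lexx 0) rM).
have pq : p ** q = q ** p.
  by apply/esym/(upos_comm (lexx 0) qM); rewrite -cmulA -pm cmulA -pm !cmulA.
have rq : r ** q = q ** r by apply: (upos_comm (lexx 0) rM).
pose w := q - m.
have ws : cstar w = w by rewrite cstarB qs ms.
have wm : w ** m = - (w ** q) by rewrite /w !cmulBl qE opprB qm.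
have wq : w ** q = q ** w by rewrite /w cmulBl cmulBr qm.
have rw : r ** w = w ** r by rewrite /w cmulBl cmulBr rm rq.
have tm : t ** m = m ** t by apply: (upos_comm (lexx 0) tM).
have tq : t ** q = q ** t by rewrite -tE cmulA.
have tw : t ** w = w ** t by rewrite /w cmulBl cmulBr tm tq.
have rt : r ** t = t ** r by apply/esym/(upos_comm (lexx 0) tM).
have tr : t ** r = r ** t by [].
have mw0 : m ** w = 0.
  apply: (neg_star_eq0 eu); rewrite cstarM ws ms.
  have -> : - (w ** m ** (m ** w)) = cstar (t ** r ** w) ** (t ** r ** w) + w ** (p ** m - m ** m) ** w.
    rewrite !cstarM ws rs ts cmulBr cmulBl.
    rewrite -!cmulA [t ** (t ** _)]cmulA tE [r ** (q ** _)]cmulA rq -cmulA [r ** (r ** _)]cmulA rE.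
    by rewrite [p ** (m ** w)]cmulA pm -cmulA [w ** (m ** (p ** w))]cmulA wm cmulNl -cmulA; lmodule R.
  apply: uposD; first exact: (star_upos eu).
  have [g [gs gE _ _]] := upos_sqrt eu ppos (lexx 0).
  rewrite -gE (_ : _ ** _ = cstar (g ** w) ** (g ** w)); last by rewrite cstarM ws gs !cmulA.
  exact: (star_upos eu).
have wm0 : w ** m = 0 by rewrite -[RHS](cstar0 U) -mw0 cstarM ms ws.
have w0 : w = 0.
  apply: nr0_eq0; apply/eqP; rewrite -sqrf_eq0 -nr_sq // {2}/w cmulBr wm0 subr0.
  by move: wm; rewrite wm0 => /eqP; rewrite eq_sym oppr_eq0 => /eqP ->; rewrite nr0.
suff -> : m = q by [].
by apply/esym/eqP; rewrite -subr_eq0 -/w w0.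
Qed.

End Unital.

Variables (A : cstarAlg R).
Implicit Types (a b c : A).

(* [c] plays the role of [(b - eps)_+]. *)
Lemma cut_down b (eps : R) : cpositive b -> 0 < eps -> exists c,
  [/\ cpositive c, c ** b = c ** c + eps%:C *: c, nr (b - c) <= eps &
      forall M, calg M -> M b -> M c].
Proof.
move=> pb e0; have eu := @uoneU R A; set u := uone A in eu.
have ul x : u ** x = x := (eu x).1; have ur x : x ** u = x := (eu x).2.
pose B := emb b; have pB : upos u B := cpos_up pb.
have Bs : cstar B = B := proj1 pB.
have [d dE] : exists d, d = B - eps%:C *: u by exists (B - eps%:C *: u).
have us : cstar u = u := unit_sa eu.
have ds : cstar d = d by rewrite dE cstarB cstarZr Bs us.
have [p [ps pE pp pM]] := upos_sqrt eu (sq_upos eu ds) (ltW e0).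
have dp : p ** d = d ** p.
  apply: (@upos_comm R (UA A) u (d ** d) d p eps (ltW e0)) => //; by rewrite cmulA.
have half_pos m : cstar m = m -> m ** m = d ** d -> p ** m = m ** p -> upos u (p + m).
  move=> ms mm pm; apply: (@upos_of_dom (UA A) u eu (p + m) (2%:C *: p)).
  - by rewrite cstarD ps ms.
  - by apply: uposZ.
  - by rewrite cmulZl cmulZr cmulDl cmulDr pm.
  - have -> : 2%:C *: p ** (p + m) - (p + m) ** (p + m) = 0; last exact: upos0.
    rewrite !(cmulDl, cmulDr, cmulZl) mm pE pm (_ : 2%:C = 1 + 1); last by rewrite rmorph_nat.
    lmodule R.
have h1 : upos u (p + d) by apply: half_pos.
have h2 : upos u (p + - d) by apply: half_pos; rewrite ?cmulNl ?cmulNr ?cstarN ?ds ?opprK ?dp.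
have h0 : d ** d - (eps ^+ 2)%:C *: u = B ** B - (2 * eps)%:C *: B.
  rewrite expr2 !rmorphM rmorph_nat dE !(cmulBl, cmulBr, cmulZl, cmulZr) !(ul, ur). lmodule R.
(* d^2 - eps^2 is a combination of b^2 and b, so it lies in the image of [M]; by the last clause of
   [upos_sqrt] so does |d| - eps, although |d| itself need not. Half of b + (|d| - eps) is the
   positive part of b - eps. *)
have inM M : calg M -> M b -> exists2 c, M c & emb c = (2^-1)%:C *: (p + d).
  move=> hM Mb; have hE := emb_calg hM.
  have MB : [set emb a | a in M] B by exists b.
  have := pM _ eps hE; rewrite lexx (ltW e0) => /(_ isT) [|c' Mc' c'E].
    by rewrite h0; apply: (calg_B hE); [apply: (ca_M hE)|apply: (ca_Z hE)].
  exists ((2^-1)%:C *: (b + c')); first by apply: (ca_Z hM); apply: (ca_D hM).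
  by rewrite embZ embD c'E -/B dE; congr (_ *: _); lmodule R.
have [c _ cE] := inM _ (@calgT _ _) I.
have two : (2^-1)%:C = 2^-1 :> R[i] by rewrite fmorphV rmorph_nat.
have pc : upos u (emb c) by rewrite cE; apply: uposZ => //; rewrite invr_ge0.
have cBE : emb c ** B = emb c ** emb c + eps%:C *: emb c.
  have BE : B = d + eps%:C *: u by rewrite dE subrK.
  have h3 : emb c ** d = emb c ** emb c.
    rewrite cE !(cmulZl, cmulZr, cmulDl, cmulDr) pE dp two.
    by rewrite !scalerDr !scalerA; lmodule R.
  by rewrite BE cmulDr cmulZr ur h3.
have cb : c ** b = c ** c + eps%:C *: c by apply: emb_inj; rewrite embD embZ !embM.
have cs : cstar c = c := cpos_sa (up_cpos pc).
have bs : cstar b = b := cpos_sa pb.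
have cbc : c ** b = b ** c.
  by have := congr1 (@cstar R A) cb; rewrite cstarD cstarZr !cstarM cs bs => ->.
have pD : upos u (B - emb c).
  apply: (@upos_of_dom (UA A) u eu _ B) => //.
  - by rewrite cstarB Bs (proj1 pc).
  - by rewrite cmulBl cmulBr -!embM cbc.
  - have -> : B ** (B - emb c) - (B - emb c) ** (B - emb c) = eps%:C *: emb c.
      by rewrite !(cmulBl, cmulBr) cBE -!embM -cbc !embM -/B cBE; lmodule R.
    by apply: uposZ => //; exact: ltW.
exists c; split.
- exact: up_cpos.
- exact: cb.
- rewrite -emb_nr embB; apply: (upos_le eu pD); last exact: ltW.
  have -> : eps%:C *: u - (emb b - emb c) = (2^-1)%:C *: (p + - d).
    by rewrite cE -/B dE two; lmodule R.
  by apply: uposZ; rewrite ?invr_ge0.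
- by move=> M hM Mb; have [c' Mc' E] := inM _ hM Mb; rewrite -cE in E; rewrite -(emb_inj E).
Qed.

(** The relation on c gives 0 <= eps rho(c) <= rho(c) rho(b); taking norms, |rho(b)| < eps forces
    rho(c) = 0. *)
Lemma cut_hom (B : cstarAlg R) (rho : A -> B) b c (eps : R) : star_hom rho ->
  cpositive c -> c ** b = c ** c + eps%:C *: c -> nr (rho b) < eps -> rho c = 0.
Proof.
move=> hr [c1 c1E] cb hb; have e0 : 0 < eps := le_lt_trans (nr_ge0 _) hb.
have pc : cpositive (rho c) by exists (rho c1); rewrite c1E (sh_mul hr) (sh_star hr).
have h : rho c ** rho b = rho c ** rho c + eps%:C *: rho c.
  by rewrite -!(sh_mul hr) cb (linD (sh_lin hr)) (linZ (sh_lin hr)) (sh_mul hr).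
have : nr (eps%:C *: rho c) <= nr (rho c ** rho b).
  apply: cpos_le; first by apply: cposZ => //; exact: ltW.
  by rewrite h addrK; apply: cpos_sq; exact: cpos_sa.
rewrite nrZr gtr0_norm // => h1; have := nrM (rho c) (rho b) => h2.
apply: nr_le0; rewrite leNgt; apply/negP => p0; have := nr_ge0 (rho b); nra.
Qed.

(** [cut_hom] modulo [K]. Its use: if rho(b) is only near an ideal, then b is near an element c
    whose image is exactly in that ideal. *)
Lemma cut_ideal (B : cstarAlg R) (rho : A -> B) (K : set B) b c r (eps : R) : star_hom rho ->
  cstar_ideal K -> cpositive c -> c ** b = c ** c + eps%:C *: c ->
  K (rho b - r) -> nr r < eps -> K (rho c).
Proof.
move=> hr hK pc cb Kr re; have [D [q [[hq _ kq] _]]] := quotient_alg hK.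
apply/kq; apply: (@cut_hom D (q \o rho) b c eps) => //.
  split=> /=; [|by move=> x y; rewrite (sh_mul hr) (sh_mul hq)|by move=> x; rewrite (sh_star hr) (sh_star hq)].
  by move=> k x y /=; rewrite (sh_lin hr) (sh_lin hq).
have -> : (q \o rho) b = q r.
  by apply/eqP; rewrite -subr_eq0 /= -(linB (sh_lin hq)); apply/eqP/kq.
exact: le_lt_trans (star_hom_contractive r hq) re.
Qed.

End Cut.

(** * Spans, extension by density, and compact operators *)

Section Span.
Variables (K : numDomainType) (V : lmodType K).
Implicit Types (S : set V) (v : V).

Lemma lspan_ind S (P : V -> Prop) : P 0 -> (forall c s v, S s -> lspan S v -> P v -> P (c *: s + v)) ->
  forall v, lspan S v -> P v.
Proof.
move=> P0 Pc v [n [c [s [Ss ->]]]].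
suff [] : lspan S (\sum_(i < n) c i *: s i) /\ P (\sum_(i < n) c i *: s i) by [].
elim: n c s Ss => [|n IH] c s Ss.
  rewrite big_ord0; split=> //; exists 0%N, c, s; split; by [case|rewrite big_ord0].
rewrite big_ord_recl; split; first by exists n.+1, c, s; split; rewrite ?big_ord_recl.
by apply: Pc => //; have [] := IH (fun i => c (lift ord0 i)) (fun i => s (lift ord0 i)) (fun i => Ss _).
Qed.

Lemma lspan0 S : lspan S 0.
Proof. by exists 0%N, (fun=> 0), (fun=> 0); split; [case|rewrite big_ord0]. Qed.

Lemma lspan_cons S c s v : S s -> lspan S v -> lspan S (c *: s + v).
Proof.
move=> hs [n [d [t [ht ->]]]].
exists n.+1, (fun i => if unlift ord0 i is Some j then d j else c),
  (fun i => if unlift ord0 i is Some j then t j else s); split.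
  by move=> i; case: unliftP => [j _|_].
rewrite big_ord_recl unlift_none; congr (_ + _); apply: eq_bigr => i _.
by rewrite liftK.
Qed.

Lemma lspan_gen S s : S s -> lspan S s.
Proof. by move=> hs; rewrite -[s]addr0 -[s]scale1r; apply: lspan_cons => //; exact: lspan0. Qed.

Lemma lspanD S u v : lspan S u -> lspan S v -> lspan S (u + v).
Proof.
move=> hu hv; elim/lspan_ind: hu => [|c s w hs _ hw]; first by rewrite add0r.
by rewrite -addrA; apply: lspan_cons.
Qed.

Lemma lspanZ S k v : lspan S v -> lspan S (k *: v).
Proof.
elim/lspan_ind => [|c s w hs _ hw]; first by rewrite scaler0; exact: lspan0.
by rewrite scalerDr scalerA; apply: lspan_cons.
Qed.

Lemma lspanB S u v : lspan S u -> lspan S v -> lspan S (u - v).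
Proof. by move=> hu hv; apply: lspanD => //; rewrite -scaleN1r; apply: lspanZ. Qed.

Lemma lspan_sub S (P : set V) : P 0 -> (forall u v, P u -> P v -> P (u + v)) ->
  (forall c u, P u -> P (c *: u)) -> S `<=` P -> lspan S `<=` P.
Proof. by move=> P0 PD PZ SP v; elim/lspan_ind => // c s w /SP hs _ hw; apply/PD/hw/PZ. Qed.

End Span.

Section Extension.
Variables (R : realType) (V : lmodType R[i]) (W : completeNormedModType R[i]).
Variables (bd : V -> R -> Prop) (S : set (V * W)%type).
Hypotheses (bd0 : bd 0 0) (bdD : forall u v M N, bd u M -> bd v N -> bd (u + v) (M + N))
  (bdZ : forall k u M, bd u M -> bd (k *: u) (cabs k * M))
  (bdW : forall u M N, bd u M -> M <= N -> bd u N)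
  (hS : forall x, lspan S x -> forall M, 0 <= M -> bd x.1 M -> nr x.2 <= M).

Definition ext_dom (v : V) := forall e : R, 0 < e -> exists2 x, lspan S x & bd (v - x.1) e.

Definition is_ext (p : V -> W) := forall v, ext_dom v -> forall e : R, 0 < e ->
  exists x, [/\ lspan S x, bd (v - x.1) e & nr (p v - x.2) <= e].

Let bdN u M : bd u M -> bd (- u) M.
Proof.
move=> /(bdZ (-1)); rewrite scaleN1r (_ : cabs (-1) = 1) ?mul1r //.
by rewrite -[-1](rmorphN1 (real_complex R)) cabs_real normrN1.
Qed.

Let close x y v e d : lspan S x -> lspan S y -> bd (v - x.1) e -> bd (v - y.1) d ->
  0 <= e -> 0 <= d -> nr (x.2 - y.2) <= e + d.
Proof.
move=> Sx Sy bx by_ e0 d0; have /= h := hS (lspanB Sx Sy); rewrite (addrC e d).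
apply: h; first exact: addr_ge0.
by rewrite (_ : x.1 - y.1 = (v - y.1) + - (v - x.1)); [apply: bdD => //; exact: bdN|lmodule R].
Qed.

Lemma ext_exists : exists p, is_ext p.
Proof.
suff h v : exists w, ext_dom v -> forall e : R, 0 < e ->
    exists x, [/\ lspan S x, bd (v - x.1) e & nr (w - x.2) <= e].
  by have /choice[p hp] := h; exists p.
have [dv|ndv] := pselect (ext_dom v); last by exists 0 => /ndv.
have /choice[x hx] n : exists x, lspan S x /\ bd (v - x.1) (1 / 2 ^+ n).
  by have [x Sx hx] := dv _ (halves ltr01 n); exists x.
have h0 n : 0 < 1 / 2 ^+ n :> R by apply: halves.
have mono N n : (N <= n)%N -> 1 / 2 ^+ n <= 1 / 2 ^+ N :> R.
  move=> /subnK <-; elim: (n - N)%N => [|k IH] //; rewrite addSn halfS.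
  have := h0 (k + N)%N; lra.
have [|w hw] := @nr_complete R W (fun n => (x n).2).
  move=> e e0; have e2 : 0 < e / 2 by rewrite divr_gt0.
  have [//|N hN] := @half_small R 1 _ e2.
  exists N => n Nn; apply: (le_trans (close (hx n).1 (hx N).1 (hx n).2 (hx N).2 (ltW (h0 _)) (ltW (h0 _)))).
  rewrite [leRHS]splitr; apply: lerD; exact: hN.
exists w => _ e e0; have [N1 h1] := hw e e0; have [//|N2 h2] := @half_small R 1 _ e0.
pose n := maxn N1 N2; exists (x n); split; [exact: (hx n).1| |by apply: h1; rewrite leq_maxl].
by apply: (bdW (hx n).2); apply: h2; rewrite leq_maxr.
Qed.

Variable p : V -> W.
Hypothesis hp : is_ext p.

Lemma ext_close v x (e : R) : ext_dom v -> lspan S x -> 0 <= e -> bd (v - x.1) e -> nr (p v - x.2) <= e.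
Proof.
move=> dv Sx e0 bx; apply/ler_addgt0Pr => d d0; have d2 : 0 < d / 2 by rewrite divr_gt0.
have [y [Sy by_ hy]] := hp dv d2.
have := close Sx Sy bx by_ e0 (ltW d2); rewrite nrC => h.
apply: (le_trans (nr_tri y.2 _ _)); lra.
Qed.

Lemma ext_gen v w : S (v, w) -> p v = w.
Proof.
move=> hs; have hx := lspan_gen hs; have b0 : bd (v - v) 0 by rewrite subrr.
apply/eqP; rewrite -subr_eq0; apply/eqP/nr_le0.
apply: (ext_close (x := (v, w))) => // e e0; exists (v, w) => //=.
exact: (bdW b0 (ltW e0)).
Qed.

Lemma ext_dom_lin k u v : ext_dom u -> ext_dom v -> ext_dom (k *: u + v).
Proof.
move=> du dv e e0; have e2 : 0 < e / 2 by rewrite divr_gt0.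
have d0 : 0 < e / 2 / (1 + cabs k) by rewrite divr_gt0 // ltr_pwDl // cabs_ge0.
have [x Sx hx] := du _ d0; have [y Sy hy] := dv _ e2.
exists (k *: x + y); first by apply: lspanD => //; exact: lspanZ.
rewrite (_ : _ - _ = k *: (u - x.1) + (v - y.1)) /=; last by lmodule R.
apply: (@bdW _ (cabs k * (e / 2 / (1 + cabs k)) + e / 2)); first by apply: bdD => //; exact: bdZ.
rewrite [leRHS]splitr lerD2r mulrC; apply: frac_small; [exact: ltW|exact: cabs_ge0].
Qed.

Lemma ext_lin k u v : ext_dom u -> ext_dom v -> p (k *: u + v) = k *: p u + p v.
Proof.
move=> du dv; apply: eq_nr => e e0; have e4 : 0 < e / 4 by rewrite divr_gt0.
have d0 : 0 < e / 4 / (1 + cabs k) by rewrite divr_gt0 // ltr_pwDl // cabs_ge0.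
have [x [Sx bx hx]] := hp du d0; have [y [Sy by_ hy]] := hp dv e4.
have ck : cabs k * (e / 4 / (1 + cabs k)) <= e / 4.
  by rewrite mulrC; apply: frac_small; [exact: ltW|exact: cabs_ge0].
have h : nr (p (k *: u + v) - (k *: x.2 + y.2)) <= e / 4 + e / 4.
  apply: (@ext_close _ (k *: x + y)); first exact: ext_dom_lin.
  - by apply: lspanD => //; exact: lspanZ.
  - by rewrite addr_ge0 // ltW.
  - rewrite (_ : _ - _ = k *: (u - x.1) + (v - y.1)) /=; last by lmodule R.
    by apply: (bdW (bdD (bdZ k bx) by_)); rewrite lerD2r.
apply: (le_trans (nr_tri (k *: x.2 + y.2) _ _)).
have -> : k *: x.2 + y.2 - (k *: p u + p v) = - (k *: (p u - x.2) + (p v - y.2)) by lmodule R.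
rewrite nrN; have := nrD (k *: (p u - x.2)) (p v - y.2); rewrite nrZ.
have := ler_wpM2l (cabs_ge0 k) hx; lra.
Qed.

Lemma ext_bd v M : ext_dom v -> 0 <= M -> bd v M -> nr (p v) <= M.
Proof.
move=> dv M0 bv; apply/ler_addgt0Pr => e e0; have e2 : 0 < e / 2 by rewrite divr_gt0.
have [x [Sx bx hx]] := hp dv e2; apply: (le_trans (nr_distl _ x.2)).
have : nr x.2 <= M + e / 2.
  apply: (hS Sx); first by rewrite addr_ge0 // ltW.
  by rewrite (_ : x.1 = v + - (v - x.1)); [apply: bdD => //; exact: bdN|lmodule R].
lra.
Qed.

End Extension.

Section SpectralBound.
Variables (R : realType) (B : cstarAlg R).

(** For self-adjoint q the norm of q^(2^k) is exactly |q|^(2^k), so the growth rate of the powers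
    bounds |q|, whatever the constant [C]. *)
Lemma spectral_bound (q : B) (C L : R) : cstar q = q -> 0 <= C -> 0 <= L ->
  (forall n, nr (iter n (cmul q) q) <= C * L ^+ n) -> nr q <= L.
Proof.
move=> qs C0 L0 h; rewrite leNgt; apply/negP => Lr; set r := nr q in Lr.
have r0 : 0 < r := le_lt_trans L0 Lr.
(* [iter n (cmul q) q] is q^(n+1), so [w k = 2^k - 1] indexes the power 2^k. *)
pose w := fix w k := if k is j.+1 then (w j + w j).+1 else 0%N.
have wk k : (k <= w k)%N by elim: k => //= k IH; rewrite ltnS (leq_trans IH) // leq_addr.
have pw n m : iter (n + m).+1 (cmul q) q = iter n (cmul q) q ** iter m (cmul q) q.
  elim: n => [|n IH]; first by rewrite add0n.
  by rewrite addSn [LHS]iterS IH [in RHS]iterS cmulA.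
have cq n : q ** iter n (cmul q) q = iter n (cmul q) q ** q.
  by elim: n => [|n IH] //=; rewrite {1}IH cmulA.
have sa n : cstar (iter n (cmul q) q) = iter n (cmul q) q.
  by elim: n => [|n IH] //=; rewrite cstarM IH qs cq.
have nw k : nr (iter (w k) (cmul q) q) = r ^+ (w k).+1.
  elim: k => [|k IH]; first by rewrite expr1.
  have -> : iter (w k.+1) (cmul q) q = iter (w k) (cmul q) q ** iter (w k) (cmul q) q by exact: pw.
  by rewrite nr_sq // IH -exprM; congr (_ ^+ _); rewrite /=; lia.
have hq : 0 <= L / r < 1 by rewrite divr_ge0 ?(ltW r0) //= ltr_pdivrMr // mul1r.
have d0 : 0 < r / (2 * (C + 1)) by rewrite divr_gt0 // mulr_gt0 // ltr_wpDl.
have [N hN] := expr_small hq d0.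
have := h (w N); rewrite nw exprS => h1.
have := hN (w N) (wk N); rewrite expr_div_n ler_pdivrMr ?exprn_gt0 // => h2.
have rn : 0 < r ^+ w N by apply: exprn_gt0.
have h3 : r * r ^+ w N <= C * (r / (2 * (C + 1))) * r ^+ w N.
  by apply: (le_trans h1); rewrite -mulrA ler_wpM2l.
rewrite ler_pM2r // in h3.
have : C * (r / (2 * (C + 1))) < r.
  rewrite mulrA ltr_pdivrMr ?mulr_gt0 ?ltr_wpDl //; nra.
lra.
Qed.

End SpectralBound.

Section OperatorBound.
Variables (R : realType) (A : cstarAlg R) (Y Z : hilbMod A).
Implicit Types (f g : Y -> Z) (M : R).

Definition obd f M := forall y, nr (f y) <= M * nr y.

Lemma opboundP f M : opbound f (M%:C) <-> obd f M.
Proof. by split=> h y; have := h y; rewrite !nrE -rmorphM lecR. Qed.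

Lemma obd0 : obd 0 0. Proof. by move=> y /=; rewrite nr0 mul0r. Qed.
Lemma obdD f g M N : obd f M -> obd g N -> obd (f + g) (M + N).
Proof. by move=> hf hg y /=; rewrite mulrDl (le_trans (nrD _ _)) // lerD. Qed.
Lemma obdZ (k : R[i]) f M : obd f M -> obd (k *: f) (cabs k * M).
Proof. by move=> hf y /=; rewrite nrZ -mulrA ler_wpM2l ?cabs_ge0. Qed.
Lemma obdW f M N : obd f M -> M <= N -> obd f N.
Proof. by move=> hf MN y; rewrite (le_trans (hf y)) // ler_wpM2r ?nr_ge0. Qed.
Lemma obdN f M : obd f M -> obd (- f) M.
Proof. by move=> hf y /=; rewrite nrN. Qed.
Lemma obdB f g M N : obd f M -> obd g N -> obd (f - g) (M + N).
Proof. by move=> hf hg; apply: obdD => //; exact: obdN. Qed.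

Lemma obd_adj f (g : Z -> Y) M : 0 <= M -> is_adjoint f g -> obd f M -> forall z, nr (g z) <= M * nr z.
Proof.
move=> M0 fg hM z.
have [y0|y0] := ltP 0 (nr (g z)); last by rewrite (le_trans y0) // mulr_ge0 // nr_ge0.
rewrite -(ler_pM2r y0) -expr2 -nr_hip -fg (le_trans (CS _ _)) //.
by rewrite mulrAC ler_wpM2r ?nr_ge0.
Qed.

(* [K(NY, NZ)] for subsets [NY], [NZ] of Hilbert modules. *)
Definition kgen (NZ : set Z) (NY : set Y) : set (Y -> Z) :=
  [set f | exists z y, [/\ NZ z, NY y & f = theta z y]].
Definition kset (NZ : set Z) (NY : set Y) : set (Y -> Z) :=
  [set f | forall e : R, 0 < e -> exists2 g, lspan (kgen NZ NY) g & obd (f - g) e].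

Lemma compactsE (NZ : set Z) : compacts NZ = kset NZ setT.
Proof.
rewrite /compacts; have -> : [set f : Y -> Z | exists z y, NZ z /\ f = theta z y] = kgen NZ setT.
  by apply/seteqP; split=> f [z [y]]; [move=> [? ?]|move=> [? _ ?]]; exists z, y.
apply/seteqP; split=> f hf e e0.
  have [|g gS hg] := hf (e%:C); first by rewrite ltcR.
  by exists g => //; apply/opboundP.
have [d d0 ->] := real_gt0 e0; have [g gS hg] := hf d d0.
by exists g => //; apply/opboundP.
Qed.

Variables (NZ : set Z) (NY : set Y).

Lemma kset_span f : lspan (kgen NZ NY) f -> kset NZ NY f.
Proof. by move=> hf e e0; exists f; rewrite // subrr; apply: obdW obd0 (ltW e0). Qed.

Lemma kset_theta z y : NZ z -> NY y -> kset NZ NY (theta z y).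
Proof. by move=> hz hy; apply/kset_span/lspan_gen; exists z, y. Qed.

Lemma kset_closed f : (forall e : R, 0 < e -> exists2 g, kset NZ NY g & obd (f - g) e) -> kset NZ NY f.
Proof.
move=> h e e0; have e2 : 0 < e / 2 by rewrite divr_gt0.
have [g hg bg] := h _ e2; have [k hk bk] := hg _ e2.
exists k => //; rewrite [e]splitr (_ : f - k = (f - g) + (g - k)); first exact: obdD.
by rewrite addrA subrK.
Qed.

Lemma kset0 : kset NZ NY 0. Proof. exact/kset_span/lspan0. Qed.

Lemma ksetD f g : kset NZ NY f -> kset NZ NY g -> kset NZ NY (f + g).
Proof.
move=> hf hg e e0; have e2 : 0 < e / 2 by rewrite divr_gt0.
have [f' f'S bf] := hf _ e2; have [g' g'S bg] := hg _ e2.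
exists (f' + g'); first exact: lspanD.
by rewrite opprD addrACA [e]splitr; exact: obdD.
Qed.

Lemma ksetZ (k : R[i]) f : kset NZ NY f -> kset NZ NY (k *: f).
Proof.
move=> hf e e0; have d0 : 0 < e / (1 + cabs k) by rewrite divr_gt0 // ltr_pwDl // cabs_ge0.
have [f' f'S bf] := hf _ d0; exists (k *: f'); first exact: lspanZ.
rewrite -scalerBr; apply: obdW (obdZ k bf) _; rewrite mulrC.
by apply: frac_small; [exact: ltW|exact: cabs_ge0].
Qed.

End OperatorBound.

Lemma kset_sub (R : realType) (A : cstarAlg R) (Y Z : hilbMod A) (NZ NZ' : set Z) (NY NY' : set Y) f :
  NZ `<=` NZ' -> NY `<=` NY' -> kset NZ NY f -> kset NZ' NY' f.
Proof.
move=> hZ hY hf e e0; have [g gS bg] := hf _ e0; exists g => //.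
elim/lspan_ind: gS => [|c s v [z [y [/hZ ? /hY ? ->]]] _]; first exact: lspan0.
by move=> h; apply: lspan_cons => //; exists z, y.
Qed.

Section KsetAdjoint.
Variables (R : realType) (A : cstarAlg R).

Lemma theta_adj (Y Z : hilbMod A) (z : Z) (y : Y) : is_adjoint (theta z y) (theta y z).
Proof. by move=> u v; rewrite /theta hip_ract hip_ractl hip_star. Qed.

Lemma theta_bd (Y Z : hilbMod A) (z : Z) (y : Y) : obd (theta z y) (nr z * nr y).
Proof.
move=> w; rewrite /theta (le_trans (nr_ract _ _)) // -mulrA ler_wpM2l ?nr_ge0 //.
exact: CS.
Qed.

Lemma span_adj (Y Z : hilbMod A) (NZ : set Z) (NY : set Y) f : lspan (kgen NZ NY) f ->
  exists f', [/\ lspan (kgen NY NZ) f', is_adjoint f f' & exists2 M, 0 <= M & obd f M].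
Proof.
elim/lspan_ind => [|c s v [z [y [hz hy ->]]] _ [v' [v'S vv' [M M0 hM]]]].
  exists 0; split; [exact: lspan0|by move=> u w /=; rewrite hip0l hip0r|exists 0 => //; exact: obd0].
exists (conjc c *: theta y z + v'); split.
- by apply: lspan_cons => //; exists y, z.
- by move=> u w; rewrite /= hipDl hipDr hipZl hipZr theta_adj vv'.
- exists (cabs c * (nr z * nr y) + M); first by rewrite addr_ge0 // !mulr_ge0 ?nr_ge0 ?cabs_ge0.
  by apply: obdD => //; apply: obdZ; exact: theta_bd.
Qed.

Lemma kset_bd (Y Z : hilbMod A) (NZ : set Z) (NY : set Y) f : kset NZ NY f -> exists2 M, 0 <= M & obd f M.
Proof.
move=> hf; have [g /span_adj[g' [_ _ [M M0 hM]]] bg] := hf 1 ltr01.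
exists (1 + M); first by rewrite addr_ge0.
by rewrite -(subrK g f); exact: obdD.
Qed.

(** Elements of [kset] are bare functions, so an adjoint has to be produced: the adjoints of the
    approximants in the span satisfy the same Cauchy estimate and converge pointwise. *)
Lemma kset_adj (Y Z : hilbMod A) (NZ : set Z) (NY : set Y) f : kset NZ NY f ->
  exists2 f', kset NY NZ f' & is_adjoint f f'.
Proof.
move=> hf.
have /choice[g hg] n : exists p : (Y -> Z) * (Z -> Y), [/\ lspan (kgen NZ NY) p.1, lspan (kgen NY NZ) p.2,
    is_adjoint p.1 p.2 & obd (f - p.1) (1 / 2 ^+ n)].
  have [g gS bg] := hf _ (halves ltr01 n); have [g' [g'S gg' _]] := span_adj gS.
  by exists (g, g').
have h0 n : 0 <= 1 / 2 ^+ n :> R by apply: ltW; apply: halves.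
have mono N n : (N <= n)%N -> 1 / 2 ^+ n <= 1 / 2 ^+ N :> R.
  move=> /subnK <-; elim: (n - N)%N => [|k IH] //; rewrite addSn halfS.
  have := h0 (k + N)%N; lra.
have cg N n : (N <= n)%N -> forall z, nr ((g n).2 z - (g N).2 z) <= 2 / 2 ^+ N * nr z.
  move=> Nn; have [_ _ an bn] := hg n; have [_ _ aN bN] := hg N.
  have ad : is_adjoint ((g n).1 - (g N).1) ((g n).2 - (g N).2).
    by move=> u v; rewrite /= hipBl hipBr an aN.
  apply: (obd_adj _ ad); first by have := h0 N; lra.
  rewrite (_ : (g n).1 - (g N).1 = - (f - (g n).1) + (f - (g N).1)); last by lmodule R.
  apply: obdW (obdD (obdN bn) bN) _; have := mono _ _ Nn; lra.
have pc z : exists l, nlim (fun n => (g n).2 z) l.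
  apply: nr_complete => e e0; have [|N hN] := @half_small R (2 * nr z) e e0; first by rewrite mulr_ge0 ?nr_ge0.
  exists N => n Nn; apply: (le_trans (cg _ _ Nn z)); rewrite mulrAC; exact: hN.
have /choice[f' hf'] := pc.
have bf' N : obd (f' - (g N).2) (2 / 2 ^+ N).
  move=> z /=; apply/ler_addgt0Pr => e e0; have [M hM] := hf' z e e0.
  pose n := maxn N M; apply: (le_trans (nr_tri ((g n).2 z) _ _)); rewrite addrC lerD //.
    by apply: cg; rewrite leq_maxl.
  by apply: hM; rewrite leq_maxr.
exists f'.
  move=> e e0; have [//|N hN] := @half_small R 2 e e0.
  by exists (g N).2; [have [] := hg N|apply: obdW (bf' N) (hN _ (leqnn _))].
move=> y z; apply: eq_nr => e e0.
have [|N hN] := @half_small R (3 * (nr y * nr z)) e e0; first by rewrite !mulr_ge0 ?nr_ge0.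
have [_ _ aN bN] := hg N; apply: le_trans (hN N (leqnn _)).
rewrite (_ : hip (f y) z - hip y (f' z) = hip ((f - (g N).1) y) z - hip y ((f' - (g N).2) z)); last first.
  by rewrite /= hipBl hipBr aN; lmodule R.
apply: (le_trans (nrB _ _)); apply: (le_trans (lerD (CS _ _) (CS _ _))).
have := ler_wpM2r (nr_ge0 z) (bN y); have := ler_wpM2l (nr_ge0 y) (bf' N z).
lra.
Qed.

End KsetAdjoint.

Section ApproxSpan.
Variables (R : realType) (V : normedModType R[i]).
Implicit Types (S : set V).

Lemma approx_lspan_D S (a b : V) : approx (lspan S) a -> approx (lspan S) b -> approx (lspan S) (a + b).
Proof.
move=> ha hb e e0; have e2 : 0 < e / 2 by rewrite divr_gt0.
have [u uS hu] := ha _ e2; have [v vS hv] := hb _ e2; exists (u + v); first exact: lspanD.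
by rewrite opprD addrACA (le_trans (nrD _ _)) // [leRHS]splitr lerD.
Qed.

Lemma approx_lspan_Z S (k : R[i]) (a : V) : approx (lspan S) a -> approx (lspan S) (k *: a).
Proof.
move=> ha e e0; have d0 : 0 < e / (1 + cabs k) by rewrite divr_gt0 // ltr_pwDl // cabs_ge0.
have [u uS hu] := ha _ d0; exists (k *: u); first exact: lspanZ.
rewrite -scalerBr nrZ mulrC (le_trans (ler_wpM2r (cabs_ge0 _) hu)) //.
by apply: frac_small; rewrite ?cabs_ge0 // ltW.
Qed.

Lemma span_agree (W : normedModType R[i]) S (F G : V -> W) (C D : R) : let N := approx (lspan S) in
  (forall (c : R[i]) u v, N u -> N v -> F (c *: u + v) = c *: F u + F v) ->
  (forall (c : R[i]) u v, N u -> N v -> G (c *: u + v) = c *: G u + G v) ->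
  (forall u, N u -> nr (F u) <= C * nr u) -> (forall u, N u -> nr (G u) <= D * nr u) ->
  (forall u, S u -> F u = G u) -> forall u, N u -> F u = G u.
Proof.
move=> N lF lG bF bG FG z hz; apply: eq_nr => e e0.
have N0 : N 0 by apply: approx_mem; exact: lspan0.
pose c := `|C| + `|D|.
have d0 : 0 < e / (1 + c) by rewrite divr_gt0 // ltr_pwDl // addr_ge0.
have [u uS hu] := hz _ d0; have Nu : N u by exact: approx_mem.
have FGu : F u = G u.
  elim/lspan_ind: uS {hu Nu} => [|k s v Ss vS IH]; first by rewrite (lin_on0 N0 lF) (lin_on0 N0 lG).
  have Ns : N s by exact/approx_mem/lspan_gen.
  have Nv : N v by exact: approx_mem.
  by rewrite lF // lG // FG // IH.
have NB : N (z - u) by rewrite -scaleN1r; apply: approx_lspan_D => //; exact: approx_lspan_Z.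
have sB (H : V -> W) : (forall (c : R[i]) u v, N u -> N v -> H (c *: u + v) = c *: H u + H v) -> H z = H (z - u) + H u.
  by move=> lH; have := lH 1 (z - u) u NB Nu; rewrite !scale1r subrK.
have -> : F z - G z = F (z - u) - G (z - u) by rewrite (sB F) // (sB G) // FGu; lmodule R.
apply: (le_trans (nrB _ _)); apply: (le_trans (lerD (bF _ NB) (bG _ NB))).
rewrite -mulrDl; apply: (@le_trans _ _ (c * nr (z - u))).
  by rewrite ler_wpM2r ?nr_ge0 // lerD ?ler_norm.
rewrite mulrC (le_trans (ler_wpM2r _ hu)) ?addr_ge0 //.
by apply: frac_small; rewrite ?addr_ge0 // ltW.
Qed.

End ApproxSpan.

Section Hadj.
Variables (R : realType) (A : cstarAlg R).

(** The adjoint as a total function of the operator, so that the map f |-> f^* can be fed to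
    [kc_eq]. *)
Definition hadj (Y Z : hilbMod A) (f : Y -> Z) : Z -> Y := xget (fun=> 0) [set g | is_adjoint f g].

Lemma hadjE (Y Z : hilbMod A) (f : Y -> Z) g : is_adjoint f g -> hadj f = g.
Proof. by move=> fg; rewrite /hadj; case: xgetP => [h _ fh|/(_ g)//]; exact: (adj_uniq (fh : is_adjoint f h) fg). Qed.

End Hadj.

Section KCont.
Variables (R : realType) (A : cstarAlg R) (Y Z : hilbMod A) (NZ : set Z) (NY : set Y).
Variables (W : normedModType R[i]).

(** Linear and bounded on [kset], with any constant. Such maps are determined by their values on
    rank-one operators ([kc_eq]), which is how most identities on compact operators are verified. *)
Record kcont (F : (Y -> Z) -> W) : Prop := KCont {
  kc_lin : forall (k : R[i]) f g, kset NZ NY f -> kset NZ NY g -> F (k *: f + g) = k *: F f + F g;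
  kc_bd : exists2 C : R, 0 <= C & forall f M, kset NZ NY f -> 0 <= M -> obd f M -> nr (F f) <= C * M }.

Lemma kc_eq F G : kcont F -> kcont G ->
  (forall z y, NZ z -> NY y -> F (theta z y) = G (theta z y)) -> forall f, kset NZ NY f -> F f = G f.
Proof.
move=> [Fl [C C0 FC]] [Gl [D D0 GD]] FG.
have F0 := lin_on0 (@kset0 _ _ _ _ _ _) Fl.
have G0 := lin_on0 (@kset0 _ _ _ _ _ _) Gl.
have hS f : lspan (kgen NZ NY) f -> F f = G f.
  elim/lspan_ind => [|c s v [z [y [hz hy ->]]] vS IH]; first by rewrite F0 G0.
  have kt := kset_theta hz hy; have kv := kset_span vS.
  by rewrite Fl // Gl // FG // IH.
move=> f kf; apply: eq_nr => e e0.
have d0 : 0 < e / 2 / (1 + (C + D)) by rewrite !divr_gt0 // ltr_pwDl // addr_ge0.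
have [g gS bg] := kf _ d0; have kg := kset_span gS.
have kfg : kset NZ NY (f - g) by rewrite addrC -scaleN1r; apply: ksetD => //; exact: ksetZ.
have Fd : F f - G f = F (f - g) - G (f - g).
  have := Fl 1 (f - g) g kfg kg; have := Gl 1 (f - g) g kfg kg.
  by rewrite !scale1r subrK => -> ->; rewrite (hS g) //; lmodule R.
rewrite Fd (le_trans (nrB _ _)) //.
apply: (le_trans (lerD (FC _ _ kfg (ltW d0) bg) (GD _ _ kfg (ltW d0) bg))).
rewrite -mulrDl mulrC; apply: (@le_trans _ _ (e / 2)); last by lra.
by apply: frac_small; rewrite ?addr_ge0 // ltW // divr_gt0.
Qed.

End KCont.

Lemma kc_comp (R : realType) (A : cstarAlg R) (Y Z : hilbMod A) (NZ : set Z) (NY : set Y)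
  (W W' : normedModType R[i]) (F : (Y -> Z) -> W) (L : W -> W') (D : R) : kcont NZ NY F ->
  linear L -> 0 <= D -> (forall w, nr (L w) <= D * nr w) -> kcont NZ NY (fun f => L (F f)).
Proof.
move=> [Fl [C C0 FC]] hL D0 hD; split=> [k f g kf kg|]; first by rewrite Fl // hL.
exists (D * C) => [|f M kf M0 fM]; first exact: mulr_ge0.
by rewrite (le_trans (hD _)) // -mulrA ler_wpM2l // FC.
Qed.

Lemma kc_mull (R : realType) (A B : cstarAlg R) (Y Z : hilbMod A) (NZ : set Z) (NY : set Y)
  (F : (Y -> Z) -> B) (b : B) : kcont NZ NY F -> kcont NZ NY (fun f => b ** F f).
Proof.
move=> hF; apply: (kc_comp (L := cmul b) (D := nr b) hF); [exact: cmul_linr|exact: nr_ge0|exact: nrM].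
Qed.

Lemma kc_mulr (R : realType) (A B : cstarAlg R) (Y Z : hilbMod A) (NZ : set Z) (NY : set Y)
  (F : (Y -> Z) -> B) (b : B) : kcont NZ NY F -> kcont NZ NY (fun f => F f ** b).
Proof.
move=> hF; apply: (kc_comp (L := fun x => cmul x b) (D := nr b) hF); [exact: cmul_linl|exact: nr_ge0|].
by move=> w; rewrite mulrC nrM.
Qed.

Lemma kc_hom (R : realType) (A B D : cstarAlg R) (Y Z : hilbMod A) (NZ : set Z) (NY : set Y)
  (F : (Y -> Z) -> B) (h : B -> D) : star_hom h -> kcont NZ NY F -> kcont NZ NY (fun f => h (F f)).
Proof.
move=> hh hF; apply: (kc_comp (L := h) (D := 1) hF); [exact: (sh_lin hh)|exact: ler01|].
by move=> w; rewrite mul1r star_hom_contractive.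
Qed.

(** * Maps on compact operators induced by covariant maps *)

Section ModRep.
Variables (R : realType) (A B : cstarAlg R) (I : set A) (pi : A -> B).

(* A closed submodule [N] of [YI] with a map [s] covariant for [pi]. *)
Record modrep (Y : hilbMod A) (N : set Y) (s : Y -> B) : Prop := ModRep {
  mr_0 : N 0;
  mr_D : forall u v, N u -> N v -> N (u + v);
  mr_Z : forall (k : R[i]) u, N u -> N (k *: u);
  mr_cl : approx N `<=` N;
  mr_r : forall u a, N u -> I a -> N (ract u a);
  mr_I : forall u v, N u -> N v -> I (hip u v);
  mr_lin : forall (k : R[i]) u v, N u -> N v -> s (k *: u + v) = k *: s u + s v;
  mr_ract : forall u a, N u -> I a -> s (ract u a) = s u ** pi a;
  mr_ip : forall u v, N u -> N v -> cstar (s u) ** s v = pi (hip u v) }.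

Hypotheses (hI : cstar_ideal I) (hpi : hom_on I pi).

Lemma mr_N (Y : hilbMod A) (N : set Y) s u : modrep N s -> N u -> N (- u).
Proof. by move=> h hu; rewrite -scaleN1r; apply: (mr_Z h). Qed.

Lemma mr_s0 (Y : hilbMod A) (N : set Y) s : modrep N s -> s 0 = 0.
Proof. by move=> h; exact: lin_on0 (mr_0 h) (mr_lin h). Qed.

Lemma mr_sZ (Y : hilbMod A) (N : set Y) s k u : modrep N s -> N u -> s (k *: u) = k *: s u.
Proof. by move=> h hu; have := mr_lin h k hu (mr_0 h); rewrite (mr_s0 h) !addr0. Qed.

Lemma mr_sD (Y : hilbMod A) (N : set Y) s u v : modrep N s -> N u -> N v -> s (u + v) = s u + s v.
Proof. by move=> h hu hv; have := mr_lin h 1 hu hv; rewrite !scale1r. Qed.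

Lemma mr_sB (Y : hilbMod A) (N : set Y) s u v : modrep N s -> N u -> N v -> s (u - v) = s u - s v.
Proof.
move=> h hu hv; rewrite -scaleN1r (mr_sD h) ?(mr_sZ _ h) ?scaleN1r //.
exact: mr_N h hv.
Qed.

Lemma mr_nr (Y : hilbMod A) (N : set Y) s u : modrep N s -> N u -> nr (s u) <= nr u.
Proof.
move=> h hu; rewrite -(ler_pXn2r (n := 2)) ?nnegrE ?nr_ge0 //.
rewrite -nr_starM (mr_ip h) // -nr_hip.
exact: (hom_on_contractive (ideal_sub hI) hpi (mr_I h hu hu)).
Qed.

(* A closed submodule is its own product with [I]. *)
Lemma mr_fact (Y : hilbMod A) (N : set Y) s u : modrep N s -> N u -> exists w i,
  [/\ N w, I i, cstar i = i & u = ract w i].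
Proof.
move=> h hu; apply: (modI_fact hI) => //; [exact: (mr_cl h)|exact: (mr_D h)|exact: (mr_Z h)|exact: (mr_r h)|].
by apply/modI_hip => //; apply: (mr_I h).
Qed.

Section KMap.
Variables (Y Z : hilbMod A) (NY : set Y) (NZ : set Z) (sY : Y -> B) (sZ : Z -> B).
Hypotheses (hY : modrep NY sY) (hZ : modrep NZ sZ).

Lemma kset_maps f y : kset NZ NY f -> NY y -> NZ (f y).
Proof.
move=> kf hy; apply: (mr_cl hZ) => e e0.
have d0 : 0 < e / (1 + nr y) by rewrite divr_gt0 // ltr_pwDl // nr_ge0.
have [g gS bg] := kf _ d0; exists (g y); last first.
  apply: (le_trans (bg y)); apply: frac_small; [exact: ltW|exact: nr_ge0].
elim/lspan_ind: gS => [|c s v [z [y' [hz hy' ->]]] _ IH] /=; first exact: (mr_0 hZ).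
by apply: (mr_D hZ) => //; apply: (mr_Z hZ); apply: (mr_r hZ) => //; apply: (mr_I hY).
Qed.

Let pairs : set ((Y -> Z) * B)%type :=
  [set x | exists z y, [/\ NZ z, NY y & x = (theta z y, sZ z ** cstar (sY y))]].

Let spanP x : lspan pairs x -> exists f', [/\ is_adjoint x.1 f', forall y, NY y -> NZ (x.1 y),
  forall z, NZ z -> NY (f' z), forall y, NY y -> x.2 ** sY y = sZ (x.1 y) &
  forall z, NZ z -> cstar x.2 ** sZ z = sY (f' z)].
Proof.
elim/lspan_ind => [|c s v [z [y [hz hy ->]]] _ [f' [af m m' e e']]].
  exists 0; split=> /= [u w|u hu|u hu|u hu|u hu].
  - by rewrite hip0l hip0r.
  - exact: (mr_0 hZ).
  - exact: (mr_0 hY).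
  - by rewrite cmul0l (mr_s0 hZ).
  - by rewrite cstar0 cmul0l (mr_s0 hY).
exists (conjc c *: theta y z + f'); split=> /= [u w|u hu|u hu|u hu|u hu].
- by rewrite hipDl hipDr hipZl hipZr theta_adj af.
- by apply: (mr_D hZ); [apply: (mr_Z hZ); apply: (mr_r hZ) => //; apply: (mr_I hY)|exact: m].
- by apply: (mr_D hY); [apply: (mr_Z hY); apply: (mr_r hY) => //; apply: (mr_I hZ)|exact: m'].
- have hI' : I (hip y u) by apply: (mr_I hY).
  rewrite cmulDl cmulZl e // -cmulA (mr_ip hY) // -(mr_ract hZ) //.
  rewrite (mr_lin hZ) //; last exact: m.
  exact: (mr_r hZ).
- have hI' : I (hip z u) by apply: (mr_I hZ).
  rewrite cstarD cstarZc cstarM cstarK cmulDl cmulZl e' // -cmulA (mr_ip hZ) // -(mr_ract hY) //.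
  rewrite (mr_lin hY) //; last exact: m'.
  exact: (mr_r hY).
Qed.

(** Contractivity of the assignment theta z y |-> sZ(z) sY(y)^*, hence also its being well defined.
    For b = [x.2] and q = b^* b, the element q acts on the vectors sY(y) as F = f' f, of bound M^2.
    As b^* is a finite sum of terms sY(y) sZ(z)^*, the products q^n b^* grow at most like a constant
    times M^(2n), so the same holds for q^(n+1) = q^n b^* b, and [spectral_bound] gives |q| <=
    M^2. *)
Let main x : lspan pairs x -> forall M, 0 <= M -> obd x.1 M -> nr x.2 <= M.
Proof.
move=> hx M M0 bM; have [f' [af m m' e e']] := spanP hx.
have bM' := obd_adj M0 af bM.
set b := x.2 in e e' *; pose q := cstar b ** b; pose F := f' \o x.1.
have qE y : NY y -> q ** sY y = sY (F y) by move=> hy; rewrite /q -cmulA e // e' //; exact: m.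
have FN y n : NY y -> NY (iter n F y).
  by move=> hy; elim: n => //= n IH; apply: m'; apply: m.
have Fb y n : nr (iter n F y) <= (M ^+ 2) ^+ n * nr y.
  elim: n => [|n IH]; first by rewrite expr0 mul1r.
  rewrite iterS exprS -mulrA /F /= (le_trans (bM' _)) // expr2 -mulrA ler_wpM2l //.
  by rewrite (le_trans (bM _)) // ler_wpM2l.
have iter_lin n (k : R[i]) u v : iter n (cmul q) (k *: u + v) = k *: iter n (cmul q) u + iter n (cmul q) v.
  by elim: n => //= n ->; rewrite cmul_linr.
have iterM n u v : iter n (cmul q) (u ** v) = iter n (cmul q) u ** v.
  by elim: n => //= n ->; rewrite cmulA.
have iterY n y : NY y -> iter n (cmul q) (sY y) = sY (iter n F y).
  by move=> hy; elim: n => //= n ->; rewrite qE //; exact: FN.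
have [C C0 hC] : exists2 C : R, 0 <= C & forall n, nr (iter n (cmul q) (cstar b)) <= C * (M ^+ 2) ^+ n.
  rewrite /b; elim/lspan_ind: hx => [|c s v [z [y [hz hy ->]]] _ [C C0 hC]] /=.
    exists 0 => // n; rewrite cstar0 mul0r (_ : iter n (cmul q) 0 = 0) ?nr0 //.
    by elim: n => //= n ->; rewrite cmul0r.
  exists (cabs c * (nr y * nr z) + C); first by rewrite addr_ge0 // !mulr_ge0 ?nr_ge0 ?cabs_ge0.
  move=> n; rewrite cstarD cstarZc cstarM cstarK iter_lin iterM iterY //.
  rewrite mulrDl (le_trans (nrD _ _)) // lerD // nrZ cabsJ -!mulrA ler_wpM2l ?cabs_ge0 //.
  rewrite (le_trans (nrM _ _)) // nr_star.
  have -> : nr y * (nr z * (M ^+ 2) ^+ n) = ((M ^+ 2) ^+ n * nr y) * nr z by ring.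
  apply: ler_pM; rewrite ?nr_ge0 ?(mr_nr hZ) //.
  by rewrite (le_trans (mr_nr hY _)) //; exact: FN.
have nq : nr q <= M ^+ 2.
  apply: (@spectral_bound R B q (C * nr b)); first by rewrite cstarM cstarK.
  - by rewrite mulr_ge0 ?nr_ge0.
  - exact: sqr_ge0.
  - move=> n; rewrite {2}/q iterM (le_trans (nrM _ _)) // mulrAC ler_wpM2r ?nr_ge0 //.
by rewrite nr_starM ler_pXn2r ?nnegrE ?nr_ge0 in nq.
Qed.

Lemma kmap_exists : exists p : (Y -> Z) -> B, [/\ kcont NZ NY p,
  forall f M, kset NZ NY f -> 0 <= M -> obd f M -> nr (p f) <= M &
  forall z y, NZ z -> NY y -> p (theta z y) = sZ z ** cstar (sY y)].
Proof.
have b0 := @obd0 R A Y Z.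
have [p hp] := @ext_exists R (Y -> Z) B (@obd R A Y Z) pairs (@obdD R A Y Z) (@obdZ R A Y Z) (@obdW R A Y Z) main.
have dom f : kset NZ NY f -> ext_dom (@obd R A Y Z) pairs f.
  move=> kf e e0; have [g gS bg] := kf e e0.
  suff [x xS xg] : exists2 x, lspan pairs x & x.1 = g by exists x; rewrite ?xg.
  elim/lspan_ind: gS {bg} => [|c s v [z [y [hz hy ->]]] _ [x xS <-]]; first by exists 0; [exact: lspan0|].
  exists (c *: ((theta z y, sZ z ** cstar (sY y)) : (Y -> Z) * B) + x)%R => //.
  by apply: lspan_cons => //; exists z, y.
have bd f M : kset NZ NY f -> 0 <= M -> obd f M -> nr (p f) <= M.
  by move=> kf M0 fM; apply: (ext_bd (@obdD R A Y Z) (@obdZ R A Y Z) main hp) => //; exact: dom.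
exists p; split=> //.
- split; last by exists 1 => // f M kf M0 fM; rewrite mul1r; exact: bd.
  by move=> k f g kf kg; apply: (ext_lin (@obdD R A Y Z) (@obdZ R A Y Z) (@obdW R A Y Z) main hp); exact: dom.
- move=> z y hz hy; apply: (ext_gen b0 (@obdD R A Y Z) (@obdZ R A Y Z) (@obdW R A Y Z) main hp).
  by exists z, y.
Qed.

Definition kmap : (Y -> Z) -> B := proj1_sig (cid kmap_exists).

Lemma kmap_cont : kcont NZ NY kmap.
Proof. by rewrite /kmap; case: cid => p []. Qed.
Lemma kmap_bd f M : kset NZ NY f -> 0 <= M -> obd f M -> nr (kmap f) <= M.
Proof. by rewrite /kmap; case: cid => p [? h ?]; exact: h. Qed.
Lemma kmap_theta z y : NZ z -> NY y -> kmap (theta z y) = sZ z ** cstar (sY y).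
Proof. by rewrite /kmap; case: cid => p [? ? h]; exact: h. Qed.

Lemma mr_eval y : NY y -> kcont NZ NY (fun f => sZ (f y)).
Proof.
move=> hy; split=> [k f g kf kg|].
  by rewrite (mr_lin hZ) //; exact: kset_maps.
exists (nr y) => [|f M kf M0 fM]; first exact: nr_ge0.
by rewrite mulrC (le_trans (mr_nr hZ _)) //; exact: kset_maps.
Qed.

Lemma kmap_act f y : kset NZ NY f -> NY y -> kmap f ** sY y = sZ (f y).
Proof.
move=> kf hy; apply: (@kc_eq _ _ _ _ NZ NY _ (fun f => kmap f ** sY y) (fun f => sZ (f y))) => //.
- exact: kc_mulr kmap_cont.
- exact: mr_eval.
- move=> z y' hz hy'; rewrite kmap_theta // -cmulA (mr_ip hY) // /theta (mr_ract hZ) //.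
  exact: (mr_I hY).
Qed.

End KMap.

Lemma kmap_star (Y Z : hilbMod A) (NY : set Y) (NZ : set Z) (sY : Y -> B) (sZ : Z -> B)
  (hY : modrep NY sY) (hZ : modrep NZ sZ) f f' : kset NZ NY f -> is_adjoint f f' ->
  cstar (kmap hY hZ f) = kmap hZ hY f'.
Proof.
move=> kf ff'; rewrite -(hadjE ff') -[RHS]cstarK; congr cstar.
have ks g : kset NZ NY g -> kset NY NZ (hadj g) /\ is_adjoint g (hadj g).
  by move=> /kset_adj[g' kg' gg']; rewrite (hadjE gg').
apply: (@kc_eq _ _ _ _ NZ NY _ (kmap hY hZ) (fun g => cstar (kmap hZ hY (hadj g)))) => //.
- exact: kmap_cont.
- split=> [k u v /ks[ku au] /ks[kv av]|].
    have -> : hadj (k *: u + v) = conjc k *: hadj u + hadj v.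
      by apply: hadjE => y z; rewrite /= hipDl hipDr hipZl hipZr au av.
    by rewrite (kc_lin (kmap_cont hZ hY)) // cstarD cstarZc conjcK.
  exists 1 => // g M /ks[kg ag] M0 gM; rewrite mul1r nr_star; apply: kmap_bd => //.
  exact: obd_adj M0 ag gM.
- move=> z y hz hy; rewrite (hadjE (@theta_adj _ _ _ _ z y)) !kmap_theta //.
  by rewrite cstarM cstarK.
Qed.

(** The operator f is not assumed compact: it is enough that some b in [B] implements it on the
    vectors sZ(z). This is needed for f = a (x) 1^k. *)
Lemma kmap_mul (Y Z U : hilbMod A) (NY : set Y) (NZ : set Z) (NU : set U) (sY : Y -> B) (sZ : Z -> B)
  (sU : U -> B) (hY : modrep NY sY) (hZ : modrep NZ sZ) (hU : modrep NU sU) (f : Z -> U) (b : B) g :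
  (forall z, NZ z -> NU (f z)) -> (exists2 M, 0 <= M & obd f M) -> adjointable f ->
  (forall z, NZ z -> b ** sZ z = sU (f z)) -> kset NZ NY g ->
  kset NU NY (f \o g) /\ b ** kmap hY hZ g = kmap hY hU (f \o g).
Proof.
move=> fN [M M0 fM] [f' ff'] fb.
have fl := adj_lin ff'.
have ft z y : f \o theta z y = theta (f z) y.
  by apply/funext => w; rewrite /theta /= (adj_ract ff').
have kf h : kset NZ NY h -> kset NU NY (f \o h).
  move=> kh e e0; have d0 : 0 < e / (1 + M) by rewrite divr_gt0 // ltr_pwDl.
  have [h' hS bh] := kh _ d0; exists (f \o h'); last first.
    move=> y; rewrite (_ : ((f \o h) - (f \o h')) y = f ((h - h') y)); last by rewrite /= (linB fl).
    rewrite (le_trans (fM _)) //.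
    rewrite (le_trans (ler_wpM2l M0 (bh y))) // mulrA ler_wpM2r ?nr_ge0 // mulrC.
    by apply: frac_small => //; exact: ltW.
  elim/lspan_ind: hS {bh} => [|c s v [z [y [hz hy ->]]] _ IH].
    by rewrite (_ : f \o 0 = 0); [exact: lspan0|apply/funext => y /=; exact: lin0 fl].
  rewrite (_ : f \o (c *: theta z y + v) = c *: theta (f z) y + (f \o v)).
    by apply: lspan_cons => //; exists (f z), y; split=> //; exact: fN.
  by rewrite -ft; apply/funext => w; rewrite /= fl.
move=> kg; split; first exact: kf.
apply: (@kc_eq _ _ _ _ NZ NY _ (fun g => b ** kmap hY hZ g) (fun g => kmap hY hU (f \o g))) => //.
- exact/kc_mull/kmap_cont.
- split=> [k u v ku kv|].
    have -> : f \o (k *: u + v) = k *: (f \o u) + (f \o v) by apply/funext => w; rewrite /= fl.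
    by rewrite (kc_lin (kmap_cont hY hU)) //; exact: kf.
  exists M => // h N kh N0 hN; apply: kmap_bd; [exact: kf|exact: mulr_ge0|].
  by move=> y /=; rewrite (le_trans (fM _)) // -mulrA ler_wpM2l.
- move=> z y hz hy; rewrite ft !kmap_theta //; last exact: fN.
  by rewrite cmulA fb.
Qed.

End ModRep.

(** * Correspondences, tensor powers and amplification *)

Section CorrFacts.
Variables (R : realType) (A B : cstarAlg R) (X : corr A B).
Implicit Types (a : A) (x y : X).

Lemma lact_is_adj a : is_adjoint (lact (c := X) a) (lact (cstar a)).
Proof. by move=> x y; exact: lact_adj. Qed.

Lemma lact_linr a : linear (lact (c := X) a).
Proof. exact: adj_lin (lact_is_adj a). Qed.

Lemma lact_ract a x b : lact a (ract x b) = ract (lact a x) b.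
Proof. exact: (adj_ract (lact_is_adj a)). Qed.

Lemma lactDl a a' x : lact (a + a') x = lact a x + lact a' x.
Proof. exact: (linD (lact_lin x)). Qed.
Lemma lactBl a a' x : lact (a - a') x = lact a x - lact a' x.
Proof. exact: (linB (lact_lin x)). Qed.
Lemma lactZl (k : R[i]) a x : lact (k *: a) x = k *: lact a x.
Proof. exact: (linZ (lact_lin x)). Qed.
Lemma lact0l x : lact (0 : A) x = 0.
Proof. exact: (lin0 (lact_lin x)). Qed.

(* If [1 - a*a = (1 - y)^2] then [<x, x> - <ax, ax> = <x - yx, x - yx>] is positive. *)
Lemma lact_bd a x : nr (lact a x) <= nr a * nr x.
Proof.
suff h1 b : nr b <= 1 -> nr (lact b x) <= nr x.
  apply/ler_addgt0Pr => e e0; pose t := nr a + e / (1 + nr x).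
  have d0 : 0 < e / (1 + nr x) by rewrite divr_gt0 // ltr_pwDl // nr_ge0.
  have t0 : 0 < t by rewrite ltr_wpDl // nr_ge0.
  have := h1 ((t^-1)%:C *: a); rewrite lactZl !nrZr gtr0_norm ?invr_gt0 // ler_pdivrMl // mulr1.
  rewrite ler_pdivrMl // => /(_ _) h; apply: (le_trans (h _)); first by rewrite lerDl ltW.
  rewrite mulrDl lerD2l; apply: frac_small; [exact: ltW|exact: nr_ge0].
move=> b1; have [||y [ys yE _ _]] := @sqrt_one_minus R A (cstar b ** b).
- by rewrite cstarM cstarK.
- by rewrite nr_starM expr_le1 // nr_ge0.
have e1 : hip (lact b x) (lact b x) = hip x x - hip (x - lact y x) (x - lact y x).
  rewrite lact_adj -lactM !(hipBl, hipBr) !lact_adj ys -lactM.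
  have := congr1 (fun u => hip x (lact u x)) yE; rewrite !lactDl !hipDr => h.
  by apply: (eq_diff (esym h)); lmodule R.
rewrite -(ler_pXn2r (n := 2)) ?nnegrE ?nr_ge0 // -!nr_hip.
by apply: cpos_le; [exact: hip_pos|rewrite e1 opprB addrC subrK; exact: hip_pos].
Qed.

End CorrFacts.

Section Tensor.
Variables (R : realType) (A : cstarAlg R) (X : corr A A) (T : tensor_powers X).
Local Notation E := (tpow T).
Local Notation tn := (@tens R A X T).
Implicit Types (x : X).

Lemma tens_linl n x : linear (fun y : E n => tn y x).
Proof. by case: n => [|n]; [exact: lact_lin|exact: (it_linl (tp_tensor T n))]. Qed.
Lemma tens_linr n (y : E n) : linear (tn y).
Proof. by case: n y => [|n] y; [exact: lact_linr|exact: (it_linr (tp_tensor T n))]. Qed.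
Lemma tens_ip n (y y' : E n) x x' : hip (tn y x) (tn y' x') = hip x (lact (hip y y') x').
Proof.
case: n y y' => [|n] y y'; last exact: (it_ip (tp_tensor T n)).
by rewrite /= lact_adj -lactM.
Qed.
Lemma tens_ract n (y : E n) x a : ract (tn y x) a = tn y (ract x a).
Proof.
case: n y => [|n] y; last exact: (it_ract (tp_tensor T n)).
by rewrite /= lact_ract.
Qed.
Lemma tens_lact n (y : E n) x a : lact a (tn y x) = tn (lact a y) x.
Proof.
case: n y => [|n] y; last exact: (it_lact (tp_tensor T n)).
by rewrite /= -lactM.
Qed.
Lemma tens_bal n (y : E n) x a : tn (ract y a) x = tn y (lact a x).
Proof.
apply/eqP; rewrite -subr_eq0; apply/eqP/nr0_eq0/eqP; rewrite -sqrf_eq0 -nr_hip.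
rewrite !(hipBl, hipBr, tens_ip, hip_ract, hip_ractl) !lactM !lact_adj.
by rewrite !subrr nr0.
Qed.
Lemma tens_nr n (y : E n) x : nr (tn y x) <= nr y * nr x.
Proof.
rewrite -(ler_pXn2r (n := 2)) ?nnegrE ?mulr_ge0 ?nr_ge0 //.
rewrite -nr_hip tens_ip (le_trans (CS _ _)) // exprMn mulrC.
rewrite -nr_hip [leRHS]mulrC expr2 [leRHS]mulrC mulrA ler_wpM2r ?nr_ge0 //.
exact: lact_bd.
Qed.

Definition elem n : set (E n.+1) := [set z | exists y x, z = tn y x].

Lemma elem_dense n (z : E n.+2) : approx (lspan (elem (n := n.+1))) z.
Proof. by rewrite -closureP (it_dense (tp_tensor T n)). Qed.

Lemma dense_eq n (W : normedModType R[i]) (F G : E n.+2 -> W) (C D : R) :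
  linear F -> linear G -> (forall z, nr (F z) <= C * nr z) -> (forall z, nr (G z) <= D * nr z) ->
  (forall y x, F (tn y x) = G (tn y x)) -> F =1 G.
Proof.
move=> lF lG bF bG FG z; apply: (span_agree (fun c u v _ _ => lF c u v) (fun c u v _ _ => lG c u v) (fun u _ => bF u) (fun u _ => bG u) _ (elem_dense z)).
by move=> _ [y [x ->]]; exact: FG.
Qed.

Lemma hip_lin_bd (Y : hilbMod A) (v : Y) : linear (hip v) /\ forall z, nr (hip v z) <= nr v * nr z.
Proof. by split; [exact: hip_lin|move=> z; exact: CS]. Qed.

Lemma dense_eq_adj n (Y : hilbMod A) (g h : E n.+2 -> Y) : adjointable g -> adjointable h ->
  (forall y x, g (tn y x) = h (tn y x)) -> g = h.
Proof.
move=> [g' gg'] [h' hh'] e; apply/funext => z; apply: hip_inj => w.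
rewrite -(adj_sym gg') -(adj_sym hh'); have [l1 b1] := hip_lin_bd (g' w); have [l2 b2] := hip_lin_bd (h' w).
apply: (dense_eq l1 l2 b1 b2) => y x.
by rewrite (adj_sym gg') (adj_sym hh') e.
Qed.

Lemma vec_adj n (xi : E n) : is_adjoint (@vec _ _ _ T n xi) (fun z => hip xi z).
Proof. by move=> a z; rewrite /vec hip_ractl. Qed.

Lemma vec_lin n (k : R[i]) (xi eta : E n) : vec (k *: xi + eta) = k *: vec xi + vec eta.
Proof. by apply/funext => a; rewrite /vec /= ractDl ractZl. Qed.

(* [h = <xi, xi>] is tested on itself: [|xi h|^2 = |h^3| = |h|^3]. *)
Lemma vec_nr n (xi : E n) (M : R) : 0 <= M -> obd (vec xi) M -> nr xi <= M.
Proof.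
move=> M0 hM; pose h := hip xi xi; have hs : cstar h = h by rewrite hip_star.
have h3 : nr h ^+ 3 <= nr (h ** h ** h).
  have [h0|h0] := ltP 0 (nr h); last by rewrite (nr_le0 h0) !cmul0l nr0 expr0n.
  have : nr h ^+ 4 <= nr (h ** h ** h) * nr h.
    rewrite -[4%N]/(2 * 2)%N exprM -!nr_sq ?cstarM ?hs // cmulA.
    exact: nrM.
  by rewrite exprSr ler_pM2r.
have := hM h; rewrite /vec => h1.
have {}h1 : nr (ract xi h) ^+ 2 <= (M * nr h) ^+ 2.
  by rewrite ler_pXn2r ?nnegrE ?mulr_ge0 ?nr_ge0.
rewrite -nr_hip hip_ract hip_ractl -/h hs in h1.
have h4 : nr h ^+ 3 <= M ^+ 2 * nr h ^+ 2 by rewrite -exprMn (le_trans h3).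
rewrite -(ler_pXn2r (n := 2)) ?nnegrE ?nr_ge0 // -nr_hip -/h.
have [h0|h0] := ltP 0 (nr h); last by rewrite (le_trans h0) // sqr_ge0.
by rewrite exprS ler_pM2r ?exprn_gt0 in h4.
Qed.

Lemma vec_bd n (xi : E n) : obd (vec xi) (nr xi).
Proof. by move=> a; exact: nr_ract. Qed.

Lemma vec_inj n : injective (@vec _ _ _ T n).
Proof.
move=> u v uv; apply/eqP; rewrite -subr_eq0; apply/eqP/nr_le0; apply: vec_nr => // a.
by rewrite mul0r /vec ractBl -/(vec u a) uv subrr nr0.
Qed.

Lemma otimes1_vec n (xi : E n) : otimes1 (@vec _ _ _ T n xi) = tn xi.
Proof.
rewrite /otimes1; case: xgetP => [g _ /= [eta /vec_inj <- h]|/(_ (tn xi)) []]; last by exists xi.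
exact/funext.
Qed.

Lemma otimes1_S m n (f : E m.+1 -> E n) g : adjointable g ->
  (forall y x, g (tn y x) = tn (f y) x) -> otimes1 f = g.
Proof.
move=> ag hg; rewrite /otimes1; case: xgetP => [h _ /= [ah hh]|/(_ g) []]; last by split.
by apply: (dense_eq_adj ah ag) => y x; rewrite hg; exact: hh.
Qed.

(** An adjointable operator out of X^0 = A need not be given by a vector, and [otimes1] is only
    determined for those that are. [adm] collects the operators on which amplification behaves well,
    with the condition on both f and its adjoint. *)
Definition isvec m n : (E m -> E n) -> Prop :=
  match m return (E m -> E n) -> Prop with
  | 0 => fun f => exists xi, f = vec xi
  | _ => fun _ => True
  end.

Definition adm m n (f : E m -> E n) (f' : E n -> E m) : Prop :=
  [/\ is_adjoint f f', exists2 M, 0 <= M & obd f M, isvec f & isvec f'].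

Lemma adm_sym m n (f : E m -> E n) f' : adm f f' -> adm f' f.
Proof.
move=> [ff' [M M0 hM] v v']; split=> //; first exact: adj_sym.
by exists M => // z; exact: obd_adj hM z.
Qed.

(** Let g = 1 - Y be the square root of 1 - M^-2 f^* f. Then <y, y'> = M^-2 <f y, f y'> + <g y, g
    y'>, an identity that survives tensoring with X; for a sum of elementary tensors it shows that
    its inner square dominates M^-2 times that of its image under f (x) 1. *)
Lemma tensor_bound m n (f : E m -> E n) f' (M : R) : is_adjoint f f' -> 0 <= M -> obd f M ->
  forall u, lspan [set p | exists y x, p = (tn y x, tn (f y) x)] u -> nr u.2 <= M * nr u.1.
Proof.
move=> ff' M0 hM u uS; have fl := adj_lin ff'.
have [Mp|Mz] := ltP 0 M; last first.
  have {Mz M0} M0 : M = 0 by apply/eqP; rewrite eq_le Mz M0.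
  have f0 y : f y = 0 by apply: nr_le0; rewrite (le_trans (hM y)) // M0 mul0r.
  rewrite M0 mul0r; suff -> : u.2 = 0 by rewrite nr0.
  elim/lspan_ind: uS => [//|c s v [y [x ->]] _ IH] /=.
  by rewrite f0 IH (lin0 (tens_linl x)) scaler0 addr0.
have [F FE] : exists F : LOp (@CS R A (E m)), lapp F = (fun y => ((M ^+ 2)^-1)%:C *: f' (f y)).
  apply: (@LOp_mk _ _ _ (@CS R A (E m)) _ (fun y => ((M ^+ 2)^-1)%:C *: f' (f y)) 1).
    by move=> y z; rewrite hipZl hipZr conjc_real (adj_sym ff') ff'.
  move=> y; rewrite nrZr gtr0_norm ?invr_gt0 ?exprn_gt0 // ler_pdivrMl ?exprn_gt0 // mul1r.
  by rewrite (le_trans (obd_adj M0 ff' hM _)) // expr2 -mulrA ler_wpM2l.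
have [||Y [Ys YE _ _]] := @sqrt_one_minus R (LOp (@CS R A (E m))) F.
- apply: lapp_ext => y; congr (_ y); apply: (adj_uniq (lapp_adj F)).
  by rewrite FE => v w; rewrite hipZl hipZr conjc_real (adj_sym ff') ff'.
- apply: lapp_bound => // y; rewrite FE mul1r nrZr gtr0_norm ?invr_gt0 ?exprn_gt0 //.
  rewrite ler_pdivrMl ?exprn_gt0 //.
  by rewrite (le_trans (obd_adj M0 ff' hM _)) // expr2 -mulrA ler_wpM2l.
pose g y := y - lapp Y y.
have gip y y' : hip (g y) (g y') = hip y y' - ((M ^+ 2)^-1)%:C *: hip (f y) (f y').
  have aY := lapp_adj Y; rewrite Ys in aY.
  rewrite /g !(hipBl, hipBr) ff' -hipZr -[X in _ = _ - hip y X](congr1 (fun h => h y') FE).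
  have := congr1 (fun Q => hip y (lapp Q y')) YE; rewrite !lappD lappM !hipDr !aY => h.
  by apply: (eq_diff (esym h)); lmodule R.
(* Triples carry the images under f and under g of one and the same sum, so that the identity [gip]
   extends sesquilinearly without f (x) 1 or g (x) 1 being defined yet. *)
pose S3 : set (E m.+1 * (E n.+1 * E m.+1))%type :=
  [set p | exists y x, p = (tn y x, (tn (f y) x, tn (g y) x))].
have key p q : lspan S3 p -> lspan S3 q ->
    hip p.1 q.1 = ((M ^+ 2)^-1)%:C *: hip p.2.1 q.2.1 + hip p.2.2 q.2.2.
  move=> hp hq; elim/lspan_ind: hp => [|c s v [y [x ->]] _ IH]; first by rewrite !hip0l scaler0 addr0.
  rewrite /= !hipDl !hipZl IH {IH}.
  suff e1 : hip (tn y x) q.1 = ((M ^+ 2)^-1)%:C *: hip (tn (f y) x) q.2.1 + hip (tn (g y) x) q.2.2.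
    by rewrite e1 !scalerDr !scalerA mulrC addrACA.
  elim/lspan_ind: hq => [|d t w [y' [x' ->]] _ IH]; first by rewrite /= !hip0r scaler0 addr0.
  have e1 : hip (tn y x) (tn y' x') = ((M ^+ 2)^-1)%:C *: hip (tn (f y) x) (tn (f y') x') + hip (tn (g y) x) (tn (g y') x').
    by rewrite !tens_ip gip lactBl lactZl hipBr hipZr; lmodule R.
  by rewrite /= !hipDr !hipZr e1 IH; rewrite !scalerDr !scalerA mulrC addrACA.
have [p pS [p1 p2]] : exists2 p, lspan S3 p & p.1 = u.1 /\ p.2.1 = u.2.
  elim/lspan_ind: uS => [|c s v [y [x ->]] _ [p pS [p1 p2]]]; first by exists 0; [exact: lspan0|].
  exists (c *: ((tn y x, (tn (f y) x, tn (g y) x)) : E m.+1 * (E n.+1 * E m.+1)) + p)%R; last by rewrite /= p1 p2.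
  by apply: lspan_cons => //; exists y, x.
have := key _ _ pS pS; rewrite p1 p2 => h.
rewrite -(ler_pXn2r (n := 2)) ?nnegrE ?mulr_ge0 ?nr_ge0 // exprMn -!nr_hip.
rewrite -ler_pdivrMl ?exprn_gt0 // -[leLHS](_ : nr (((M ^+ 2)^-1)%:C *: hip u.2 u.2) = _); last first.
  by rewrite nrZr gtr0_norm ?invr_gt0 ?exprn_gt0.
apply: cpos_le; first by apply: cposZ; [rewrite invr_ge0 exprn_ge0|exact: hip_pos].
by rewrite h addrC addKr; exact: hip_pos.
Qed.

Lemma otimes_exists m n (f : E m.+1 -> E n) f' (M : R) : is_adjoint f f' -> 0 <= M -> obd f M ->
  exists p : E m.+2 -> E n.+1, [/\ linear p, forall N, 0 <= N -> obd f N -> obd p N &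
    forall y x, p (tn y x) = tn (f y) x].
Proof.
move=> ff' M0 hM.
pose S : set (E m.+2 * E n.+1)%type := [set p | exists y x, p = (tn y x, tn (f y) x)].
pose bd (v : E m.+2) (N : R) := M * nr v <= N.
have b0 : bd 0 0 by rewrite /bd nr0 mulr0.
have bD u v K N : bd u K -> bd v N -> bd (u + v) (K + N).
  by rewrite /bd => h h'; rewrite (le_trans (ler_wpM2l M0 (nrD _ _))) // mulrDr lerD.
have bZ k u K : bd u K -> bd (k *: u) (cabs k * K).
  by rewrite /bd => h; rewrite nrZ mulrCA ler_wpM2l ?cabs_ge0.
have bW u K N : bd u K -> K <= N -> bd u N by rewrite /bd => h h'; exact: le_trans h h'.
have hS (x : E m.+2 * E n.+1) : lspan S x -> forall N, 0 <= N -> bd x.1 N -> nr x.2 <= N.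
  by move=> xS N N0; apply: le_trans; exact: (tensor_bound ff' M0 hM).
have [p hp] := ext_exists bD bZ bW hS.
have dom v : ext_dom bd S v.
  move=> e e0; have d0 : 0 < e / (1 + M) by rewrite divr_gt0 // ltr_pwDl.
  have [u uS hu] := @elem_dense m v _ d0.
  have [x xS xu] : exists2 x : E m.+2 * E n.+1, lspan S x & x.1 = u.
    elim/lspan_ind: uS {hu} => [|c s w [y [x ->]] _ [q qS <-]]; first by exists 0; [exact: lspan0|].
    exists (c *: ((tn y x, tn (f y) x) : E m.+2 * E n.+1) + q)%R => //.
    by apply: lspan_cons => //; exists y, x.
  exists x => //; rewrite /bd xu mulrC (le_trans (ler_wpM2r M0 hu)) //.
  by apply: frac_small => //; exact: ltW.
have pl : linear p by move=> k u v; apply: (ext_lin bD bZ bW hS hp).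
have pe y x : p (tn y x) = tn (f y) x.
  by apply: (ext_gen b0 bD bZ bW hS hp); exists y, x.
exists p; split=> // N N0 hN v; apply/ler_addgt0Pr => e e0.
have d0 : 0 < e / (1 + (N + M)) by rewrite divr_gt0 // ltr_pwDl // addr_ge0.
have [u uS hu] := @elem_dense m v _ d0.
have pu : nr (p u) <= N * nr u.
  suff h : lspan S (u, p u) by exact: (tensor_bound ff' N0 hN h).
  elim/lspan_ind: uS {hu} => [|c s w [y [x ->]] _ IH].
    by rewrite (lin0 pl); exact: lspan0.
  by rewrite pl pe; apply: (lspan_cons c (s := (tn y x, tn (f y) x)) _ IH); exists y, x.
have pb : nr (p (v - u)) <= M * nr (v - u).
  apply: (ext_bd bD bZ hS hp); [exact: dom|by rewrite mulr_ge0 ?nr_ge0|by rewrite /bd].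
have e1 : (N + M) * nr (v - u) <= e.
  rewrite mulrC (le_trans (ler_wpM2r _ hu)) ?addr_ge0 //.
  by apply: frac_small; [exact: ltW|exact: addr_ge0].
have := nr_distl (p v) (p u); rewrite -(linB pl) => h1.
have := ler_wpM2l N0 (nr_distl u v); rewrite nrC; lra.
Qed.

(** The cases are whether source or target is A. In positive source degree f (x) 1 is extended from
    elementary tensors; from degree 0 it is x |-> xi (x) x, whose adjoint is the amplification of
    <xi, ->. Both of degree 0 is the left action of A. *)
Lemma otimes1_adm m n (f : E m -> E n) f' : adm f f' ->
  [/\ adm (otimes1 f) (otimes1 f'), forall y x, otimes1 f (tn y x) = tn (f y) x &
      forall M, 0 <= M -> obd f M -> obd (otimes1 f) M].
Proof.
have half m' n' (g : E m'.+1 -> E n') g' : adm g g' ->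
  [/\ is_adjoint (otimes1 g) (otimes1 g'), forall y x, otimes1 g (tn y x) = tn (g y) x &
      forall M, 0 <= M -> obd g M -> obd (otimes1 g) M].
  move=> hg; have [gg' [M M0 hM] _ v'] := hg; have [_ [M' M0' hM'] _ _] := adm_sym hg.
  have [p [pl pb pe]] := otimes_exists gg' M0 hM; have pM := pb _ M0 hM.
  suff [p' p'E pp'] : exists2 p', otimes1 g' = p' & is_adjoint p p'.
    by rewrite (otimes1_S _ pe) ?p'E //; exists p'.
  case: n' g g' hg gg' hM v' hM' p pl pb pe pM => [|n'] g g' hg gg' hM v' hM' p pl pb pe pM.
    have [xi g'E] := v'; exists (tn xi); first by rewrite g'E otimes1_vec.
    have gE y : g y = hip xi y.
      by apply: (@hip_inj _ _ (self_hilbMod A)) => a; rewrite -(adj_sym gg') g'E vec_adj.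
    move=> u w; rewrite -[LHS]hip_star -[RHS]hip_star; congr cstar.
    have [l1 b1] := hip_lin_bd w; have [l2 b2] := hip_lin_bd (tn xi w).
    apply: (@dense_eq _ _ (fun u => hip w (p u)) (hip (tn xi w)) (nr w * M) (nr (tn xi w))) => //.
    + by move=> k s t; rewrite pl l1.
    + by move=> z; rewrite (le_trans (b1 _)) // -mulrA ler_wpM2l ?nr_ge0 //; exact: pM.
    + by move=> y x; rewrite pe tens_ip gE.
  have [p' [pl' pb' pe']] := otimes_exists (adj_sym gg') M0' hM'; have pM' := pb' _ M0' hM'.
  have pp' : is_adjoint p p'.
    move=> u w; rewrite -[LHS]hip_star -[RHS]hip_star; congr cstar.
    have [l1 b1] := hip_lin_bd w; have [l2 b2] := hip_lin_bd (p' w).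
    apply: (@dense_eq _ _ (fun u => hip w (p u)) (hip (p' w)) (nr w * M) (nr (p' w))) => //.
    + by move=> k s t; rewrite pl l1.
    + by move=> z; rewrite (le_trans (b1 _)) // -mulrA ler_wpM2l ?nr_ge0 //; exact: pM.
    move=> y x; rewrite pe -[LHS]hip_star -[RHS]hip_star; congr cstar.
    have [l3 b3] := hip_lin_bd (tn (g y) x); have [l4 b4] := hip_lin_bd (tn y x).
    apply: (@dense_eq _ _ (hip (tn (g y) x)) (fun w => hip (tn y x) (p' w)) (nr (tn (g y) x)) (nr (tn y x) * M')) => //.
    + by move=> k s t; rewrite pl' l4.
    + by move=> z; rewrite (le_trans (b4 _)) // -mulrA ler_wpM2l ?nr_ge0 //; exact: pM'.
    + by move=> y' x'; rewrite pe' !tens_ip gg'.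
  exists p' => //; apply: otimes1_S => //; exists p; exact: adj_sym.
have iv m' n' (g : E m'.+1 -> E n') : isvec g by [].
case: m f f' => [|m] f f' hf; last first.
  have [a e b] := half _ _ _ _ hf; split=> //; have [_ [M M0 hM] _ _] := hf.
  by split=> //; exists M => //; exact: b.
have [ff' [M M0 hM] [xi fE] v'] := hf.
have bE N : 0 <= N -> obd f N -> obd (otimes1 f) N.
  move=> N0 hN y; rewrite fE otimes1_vec (le_trans (tens_nr _ _)) // ler_wpM2r ?nr_ge0 //.
  by apply: vec_nr => //; rewrite -fE.
have eE y x : otimes1 f (tn y x) = tn (f y) x.
  by rewrite fE otimes1_vec /vec tens_bal.
split=> //; split=> //; last by exists M => //; exact: bE.
case: n f f' hf ff' hM xi fE v' bE eE => [|n] f f' hf ff' hM xi fE v' bE eE; last first.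
  by apply: adj_sym; have [] := half _ _ _ _ (adm_sym hf).
have [eta f'E] := v'; rewrite fE f'E !otimes1_vec => u w /=.
have -> : eta = cstar (xi : A).
  apply: (@vec_inj 0%N); rewrite -f'E; apply: (adj_uniq ff'); rewrite fE => a b.
  by rewrite vec_adj /vec /= /self_ip.
exact: lact_adj.
Qed.

End Tensor.

Section AdmFacts.
Variables (R : realType) (A : cstarAlg R) (X : corr A A) (T : tensor_powers X).
Local Notation E := (tpow T).
Local Notation tn := (@tens R A X T).

Lemma adm_vec n (xi : E n) : adm (vec xi) (hip xi).
Proof.
split; [exact: vec_adj|by exists (nr xi); [exact: nr_ge0|exact: vec_bd]|by exists xi|].
by case: n xi => // xi; exists (cstar (xi : A)).
Qed.

Lemma isvec_comp m n l (g : E m -> E n) (f : E n -> E l) : isvec g -> adjointable f -> isvec (f \o g).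
Proof.
case: m g => // g [xi ->] [f' ff']; exists (f xi); apply/funext => a.
by rewrite /vec /= (adj_ract ff').
Qed.

Lemma adm_comp m n l (g : E m -> E n) g' (f : E n -> E l) f' : adm f f' -> adm g g' ->
  adm (f \o g) (g' \o f').
Proof.
move=> [ff' [M M0 hM] v v'] [gg' [N N0 hN] w w']; split.
- by move=> y z; rewrite /= ff' gg'.
- exists (M * N) => [|y]; first exact: mulr_ge0.
  by rewrite /= (le_trans (hM _)) // -mulrA ler_wpM2l.
- by apply: isvec_comp => //; exists f'.
- by apply: isvec_comp => //; exists g; exact: adj_sym.
Qed.

Lemma adm_lin m n (k : R[i]) (f g : E m -> E n) f' g' : adm f f' -> adm g g' ->
  adm (k *: f + g) (conjc k *: f' + g').
Proof.
move=> [ff' [M M0 hM] v v'] [gg' [N N0 hN] w w']; split.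
- by move=> y z; rewrite /= hipDl hipDr hipZl hipZr ff' gg'.
- exists (cabs k * M + N); first by rewrite addr_ge0 // mulr_ge0 // cabs_ge0.
  by apply: obdD => //; exact: obdZ.
- case: m f g v w {ff' gg' v' w' hM hN f' g'} => // f g [xi ->] [eta ->].
  by exists (k *: xi + eta); rewrite vec_lin.
- case: n f' g' v' w' {ff' gg' v w hM hN f g} => // f' g' [xi ->] [eta ->].
  by exists (conjc k *: xi + eta); rewrite vec_lin.
Qed.

Lemma otimes1_comp m n l (g : E m -> E n) g' (f : E n -> E l) f' : adm f f' -> adm g g' ->
  otimes1 (f \o g) = otimes1 f \o otimes1 g.
Proof.
move=> hf hg; have [hf1 fe _] := otimes1_adm hf; have [hg1 ge _] := otimes1_adm hg.
case: m g g' hg hg1 ge => [|m] g g' hg hg1 ge; last first.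
  apply: otimes1_S => [|y x]; last by rewrite /= ge fe.
  by have [h _ _ _] := adm_comp hf1 hg1; exists (otimes1 g' \o otimes1 f').
have [_ _ [xi gE] _] := hg; have [ff' _ _ _] := hf.
rewrite gE (_ : f \o vec xi = vec (f xi)); last by apply/funext => a; rewrite /vec /= (adj_ract ff').
by rewrite !otimes1_vec; apply/funext => x; rewrite /= fe.
Qed.

Lemma otimes1_lin m n (k : R[i]) (f g : E m -> E n) f' g' : adm f f' -> adm g g' ->
  otimes1 (k *: f + g) = k *: otimes1 f + otimes1 g.
Proof.
move=> hf hg; have [hf1 fe _] := otimes1_adm hf; have [hg1 ge _] := otimes1_adm hg.
case: m f g f' g' hf hg hf1 hg1 fe ge => [|m] f g f' g' hf hg hf1 hg1 fe ge; last first.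
  apply: otimes1_S => [|y x]; first by have [h _ _ _] := adm_lin k hf1 hg1; eexists; exact: h.
  have -> : (k *: otimes1 f + otimes1 g) (tn y x) = k *: otimes1 f (tn y x) + otimes1 g (tn y x) by [].
  by rewrite ge fe; exact/esym/(tens_linl x).
have [_ _ [xi fE] _] := hf; have [_ _ [eta gE] _] := hg.
rewrite fE gE -vec_lin !otimes1_vec; apply/funext => x /=.
by rewrite (tens_linl x).
Qed.

Lemma otimes1k_adm m n (f : E m -> E n) f' k : adm f f' -> adm (otimes1k f (k := k)) (otimes1k f' (k := k)).
Proof. by move=> hf; elim: k => //= k IH; have [] := otimes1_adm IH. Qed.

Lemma otimes1_theta m n (z : E n) (y : E m) :
  otimes1 (theta z y) = (tn z : X -> E n.+1) \o otimes1 (hip y : E m -> E 0).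
Proof. by rewrite -(otimes1_vec z) -(otimes1_comp (adm_vec z) (adm_sym (adm_vec y))). Qed.

Lemma tens_adj n (y : E n) : is_adjoint (tn y : X -> E n.+1) (otimes1 (hip y : E n -> E 0)).
Proof. by have [[h _ _ _] _ _] := otimes1_adm (adm_vec y); rewrite otimes1_vec in h. Qed.

Lemma tens_theta m n (z : E n) (y : E m) (x x' : X) :
  (tn z : X -> E n.+1) \o theta x x' \o otimes1 (hip y : E m -> E 0) = theta (tn z x) (tn y x').
Proof.
by apply/funext => w; rewrite /theta [RHS]tens_ract (tens_adj y).
Qed.

Lemma theta_vec n (z : E n) (y : E 0) : theta z y = vec (ract z (cstar (y : A))).
Proof. by apply/funext => a; rewrite /theta /vec /= -ractA. Qed.

(** A rank-one operator out of A is [vec] of a vector, and [vec] is isometric ([vec_nr]), so the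
    vectors of the approximants converge. *)
Lemma kset_vec n (NZ : set (E n)) (NY : set (E 0)) (V : set (E n)) f : approx V `<=` V ->
  V 0 -> (forall u v, V u -> V v -> V (u + v)) -> (forall (k : R[i]) u, V u -> V (k *: u)) ->
  (forall z (y : A), NZ z -> NY y -> V (ract z (cstar y))) ->
  kset NZ NY f -> exists2 xi, V xi & f = vec xi.
Proof.
move=> Vc V0 VD VZ VNN hf.
have h0 k : 0 < 1 / 2 ^+ k :> R by apply: halves.
have /choice[xi hxi] k : exists xi, V xi /\ obd (f - vec xi) (1 / 2 ^+ k).
  have [g gS bg] := hf _ (h0 k); suff [xi Vx gE] : exists2 xi, V xi & g = vec xi by exists xi; rewrite -gE.
  elim/lspan_ind: gS {bg} => [|c s v [z [y [hz hy ->]]] _ [eta Ve ->]].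
    by exists 0 => //; apply/funext => a; rewrite /vec ract0l.
  exists (c *: ract z (cstar (y : A)) + eta); last by rewrite theta_vec vec_lin.
  by apply: VD => //; apply: VZ; apply: VNN.
have cx N k : (N <= k)%N -> nr (xi k - xi N) <= 2 / 2 ^+ N.
  move=> Nk; have [_ bk] := hxi k; have [_ bN] := hxi N.
  have mono : 1 / 2 ^+ k <= 1 / 2 ^+ N :> R.
    rewrite ler_pM2l // lef_pV2 ?posrE ?exprn_gt0 // ler_eXn2l ?ltr1n //.
  apply: vec_nr; first by rewrite divr_ge0 ?exprn_ge0.
  have -> : vec (xi k - xi N) = - (f - vec (xi k)) + (f - vec (xi N)).
    have -> : vec (xi k - xi N) = vec (xi k) - vec (xi N) by apply/funext => a; exact: ractBl.
    by rewrite opprB addrA subrK.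
  by apply: obdW (obdD (obdN bk) bN) _; have := mono; lra.
have [l hl] : exists l, nlim xi l.
  apply: nr_complete => e e0; have [//|N hN] := @half_small R 2 e e0.
  by exists N => k Nk; apply: (le_trans (cx _ _ Nk)); exact: hN.
exists l; first by apply: Vc; apply: (nlim_approx hl) => k; have [] := hxi k.
apply/funext => a; apply: eq_nr => e e0.
have d0 : 0 < e / 2 / (1 + nr a) by rewrite !divr_gt0 // ltr_pwDl // nr_ge0.
have [N1 h1] := hl _ d0; have [//|N2 h2] := @half_small R 1 _ d0.
pose k := maxn N1 N2; apply: (le_trans (nr_tri (vec (xi k) a) _ _)).
have fr : e / 2 / (1 + nr a) * nr a <= e / 2 by apply: frac_small; rewrite ?nr_ge0 // ltW // divr_gt0.
rewrite [leRHS]splitr lerD //.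
  have [_ bk] := hxi k; apply: (le_trans (bk a)); apply: le_trans fr; rewrite ler_wpM2r ?nr_ge0 //.
  by apply: h2; rewrite leq_maxr.
rewrite /vec -ractBl (le_trans (nr_ract _ _)) //; apply: le_trans fr; rewrite ler_wpM2r ?nr_ge0 //.
by rewrite nrC; exact: (h1 k (leq_maxl _ _)).
Qed.

Lemma kset_isvec m n (NZ : set (E n)) (NY : set (E m)) f : kset NZ NY f -> isvec f.
Proof.
case: m NY f => // NY f kf.
have [xi _ ->] : exists2 xi, setT xi & f = vec xi by exact: (@kset_vec n NZ NY).
by exists xi.
Qed.

Lemma kset_adm m n (NZ : set (E n)) (NY : set (E m)) f : kset NZ NY f ->
  exists2 f', kset NY NZ f' & adm f f'.
Proof.
move=> kf; have [f' kf' ff'] := kset_adj kf; exists f' => //.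
by split; [exact: ff'|exact: kset_bd kf|exact: kset_isvec kf|exact: kset_isvec kf'].
Qed.

(* [(theta (z j) y) (x) 1 = T_z phi(j) T_y^*], with [T_z x = z (x) x]. *)
Lemma otimes1_thetaJ m n (z : E n) (y : E m) (j : A) :
  otimes1 (theta (ract z j) y) =
  (tn z : X -> E n.+1) \o lact (c := X) j \o otimes1 (hip y : E m -> E 0).
Proof.
by rewrite otimes1_theta; congr (_ \o _); apply/funext => x; rewrite /= tens_bal.
Qed.

Lemma tens_kset m n (NX NX' : set X) (NZ : set (E n.+1)) (NY : set (E m.+1)) (z : E n) (y : E m) k :
  (forall x, NX x -> NZ (tn z x)) -> (forall x, NX' x -> NY (tn y x)) -> kset NX NX' k ->
  kset NZ NY ((tn z : X -> E n.+1) \o k \o otimes1 (hip y : E m -> E 0)).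
Proof.
move=> hz hy hk e e0; pose c := nr z * nr y.
have c0 : 0 <= c by rewrite mulr_ge0 ?nr_ge0.
have d0 : 0 < e / (1 + c) by rewrite divr_gt0 // ltr_pwDl.
have [g gS bg] := hk _ d0; exists ((tn z : X -> E n.+1) \o g \o otimes1 (hip y : E m -> E 0)).
  elim/lspan_ind: gS {bg} => [|b s v [x [x' [hx hx' ->]]] _ IH].
    rewrite (_ : _ \o _ = 0); first exact: lspan0.
    by apply/funext => w /=; exact: (lin0 (tens_linr z)).
  rewrite (_ : _ \o (b *: theta x x' + v) \o _ = b *: theta (tn z x) (tn y x') +
    ((tn z : X -> E n.+1) \o v \o otimes1 (hip y : E m -> E 0))).
    by apply: lspan_cons => //; exists (tn z x), (tn y x'); split; [exact: hz|exact: hy|].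
  by rewrite -tens_theta; apply/funext => w; rewrite /= (tens_linr z).
have [[_ [M M0 hM] _ _] _ hb] := otimes1_adm (adm_sym (adm_vec y)).
have hby : obd (otimes1 (hip y : E m -> E 0)) (nr y) by apply: hb; [exact: nr_ge0|move=> w; exact: CS].
move=> w; set u := otimes1 _ in hby *.
rewrite (_ : _ w = tn z ((k - g) (u w))); last by rewrite /= (linB (tens_linr z)).
rewrite (le_trans (tens_nr _ _)) //.
apply: (@le_trans _ _ (nr z * (e / (1 + c) * (nr y * nr w)))).
  rewrite ler_wpM2l ?nr_ge0 // (le_trans (bg _)) // ler_wpM2l ?(ltW d0) //; exact: hby.
rewrite (_ : _ * _ = e / (1 + c) * c * nr w); last by rewrite /c; ring.
by rewrite ler_wpM2r ?nr_ge0 //; apply: frac_small => //; exact: ltW.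
Qed.

End AdmFacts.

(** * Tensor powers of a representation of XI *)

Section IRep.
Variables (R : realType) (A : cstarAlg R) (X : corr A A) (T : tensor_powers X).
Variables (I : set A) (B : cstarAlg R) (pi : A -> B) (t : X -> B).
Local Notation E := (tpow T).
Local Notation tn := (@tens R A X T).

(* A representation of the restricted correspondence [XI] over [I]. *)
Record irep : Prop := IRepI {
  ir_hom : hom_on I pi;
  ir_mod : modrep I pi (modI X I) t;
  ir_lact : forall a x, I a -> modI X I x -> t (lact a x) = pi a ** t x }.

(** The tensor powers of the correspondence XI over I, realised as closed subspaces of the powers of
    X. Degree 1 is treated apart: it is XI itself, whereas the general clause would give the closed
    span of phi(I) XI, which may be smaller. *)
Fixpoint zpow (n : nat) : set (E n) :=
  match n return set (E n) with
  | 0 => I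
  | k.+1 =>
    match k return set (E k) -> set (E k.+1) with
    | 0 => fun _ => modI X I
    | k'.+1 => fun W => approx (lspan [set z | exists y x, [/\ W y, modI X I x & z = tn y x]])
    end (@zpow k)
  end.
Arguments zpow : clear implicits.

Definition tstep n (s : E n.+1 -> B) : set (E n.+2 -> B) :=
  [set s' | modrep I pi (zpow n.+2) s' /\
            forall y x, zpow n.+1 y -> modI X I x -> s' (tn y x) = s y ** t x].

(** The maps x_1 (x) ... (x) x_n |-> t(x_1) ... t(x_n), chosen degree by degree; [tstep_exists]
    shows that the default of [xget] is never taken. *)
Fixpoint tpowr (n : nat) : E n -> B :=
  match n return E n -> B with
  | 0 => pi
  | k.+1 =>
    match k return (E k -> B) -> (E k.+1 -> B) with
    | 0 => fun _ => t
    | k'.+1 => fun s => xget (fun=> 0) (tstep s)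
    end (@tpowr k)
  end.

Hypotheses (hI : cstar_ideal I) (hr : irep).
Let hpi := ir_hom hr.

Lemma modI_lact a (x : X) : modI X I x -> modI X I (lact a x).
Proof. by move=> [w [i [Ii ->]]]; rewrite lact_ract; exact: modI_ractI. Qed.

(** On sums of elementary tensors the map y (x) x |-> s(y) t(x) carries the inner product to [pi] of
    it ([ipS]), since t(x)^* pi(<y, y'>) t(x') = pi(<x, <y, y'> x'>). It is therefore contractive
    and extends, and the modrep identities follow by density. *)
Lemma tstep_exists n (s : E n.+1 -> B) : modrep I pi (zpow n.+1) s -> tstep s !=set0.
Proof.
move=> hs.
pose S : set (E n.+2 * B)%type :=
  [set p | exists y x, [/\ zpow n.+1 y, modI X I x & p = (tn y x, s y ** t x)]].
pose bd (v : E n.+2) (N : R) := nr v <= N.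
have b0 : bd 0 0 by rewrite /bd nr0.
have bD u v K N : bd u K -> bd v N -> bd (u + v) (K + N).
  by rewrite /bd => h h'; rewrite (le_trans (nrD _ _)) // lerD.
have bZ k u K : bd u K -> bd (k *: u) (cabs k * K).
  by rewrite /bd => h; rewrite nrZ ler_wpM2l ?cabs_ge0.
have bW u K N : bd u K -> K <= N -> bd u N by rewrite /bd => h h'; exact: le_trans h h'.
have ipS p q : lspan S p -> lspan S q -> I (hip p.1 q.1) /\ cstar p.2 ** q.2 = pi (hip p.1 q.1).
  move=> hp hq; elim/lspan_ind: hp => [|c u v [y [x [hy hx ->]]] _ [IH1 IH2]].
    by rewrite hip0l cstar0 cmul0l (ho0 (ideal_sub hI) hpi); split=> //; exact: (id_0 hI).
  have [e1 e2] : I (hip (tn y x) q.1) /\ cstar (s y ** t x) ** q.2 = pi (hip (tn y x) q.1).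
    elim/lspan_ind: hq {IH1 IH2} => [|d u' w [y' [x' [hy' hx' ->]]] _ [IH1 IH2]].
      by rewrite hip0r cmul0r (ho0 (ideal_sub hI) hpi); split=> //; exact: (id_0 hI).
    have Iyy := mr_I hs hy hy'.
    have Ixx : I (hip (tn y x) (tn y' x')).
      by rewrite tens_ip; exact: (proj1 (modIPl hI _) hx).
    have exx : cstar (s y ** t x) ** (s y' ** t x') = pi (hip (tn y x) (tn y' x')).
      rewrite tens_ip -(mr_ip (ir_mod hr)) //; last exact: modI_lact.
      by rewrite (ir_lact hr) // -(mr_ip hs) // cstarM -!cmulA.
    split=> /=.
      by rewrite hipDr hipZr; apply: (id_add hI) => //; apply: (id_scale hI).
    by rewrite hipDr hipZr (ho_lin hpi) // -IH2 cmulDr cmulZr -exx.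
  split=> /=.
    by rewrite hipDl hipZl; apply: (id_add hI) => //; apply: (id_scale hI).
  rewrite hipDl hipZl (ho_lin hpi) // cstarD cstarZc cmulDl cmulZl.
  by congr (_ *: _ + _).
have hS (x : E n.+2 * B) : lspan S x -> forall N, 0 <= N -> bd x.1 N -> nr x.2 <= N.
  move=> xS N N0 bN; apply: le_trans bN; have [Ix ex] := ipS _ _ xS xS.
  rewrite -(ler_pXn2r (n := 2)) ?nnegrE ?nr_ge0 // -nr_starM ex -nr_hip.
  exact: (hom_on_contractive (ideal_sub hI) hpi Ix).
have [p hp] := ext_exists bD bZ bW hS.
have spanS v : lspan [set z | exists y x, [/\ zpow n.+1 y, modI X I x & z = tn y x]] v ->
    exists2 x : E n.+2 * B, lspan S x & x.1 = v.
  elim/lspan_ind => [|c u w [y [x [hy hx ->]]] _ [q qS <-]]; first by exists 0; [exact: lspan0|].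
  exists (c *: ((tn y x, s y ** t x) : E n.+2 * B) + q)%R => //.
  by apply: lspan_cons => //; exists y, x.
have spanS' x : lspan S x -> zpow n.+2 x.1.
  move=> xS; apply: approx_mem; elim/lspan_ind: xS => [|c u w [y [x' [hy hx ->]]] _ IH]; first exact: lspan0.
  by apply: lspan_cons => //; exists y, x'.
have dom v : zpow n.+2 v -> ext_dom bd S v.
  move=> hv e e0; have [u uS hu] := hv _ e0.
  by have [x xS xu] := spanS _ uS; exists x => //; rewrite /bd xu.
have pS x : lspan S x -> p x.1 = x.2.
  move=> xS; apply/eqP; rewrite -subr_eq0; apply/eqP/nr_le0.
  apply: (ext_close bD bZ hS hp) => //; first exact/dom/spanS'.
  by rewrite subrr.
have pl k u v : zpow n.+2 u -> zpow n.+2 v -> p (k *: u + v) = k *: p u + p v.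
  by move=> hu hv; apply: (ext_lin bD bZ bW hS hp); exact: dom.
have pb v : zpow n.+2 v -> nr (p v) <= nr v.
  move=> hv; apply: (ext_bd bD bZ hS hp); [exact: dom|exact: nr_ge0|by rewrite /bd].
exists p; split; last first.
  by move=> y x hy hx; apply: (ext_gen b0 bD bZ bW hS hp); exists y, x.
have ZD := @approx_lspan_D R (E n.+2); have ZZ := @approx_lspan_Z R (E n.+2).
have Zr u a : zpow n.+2 u -> I a -> zpow n.+2 (ract u a).
  move=> hu Ia e e0; have d0 : 0 < e / (1 + nr a) by rewrite divr_gt0 // ltr_pwDl // nr_ge0.
  have [v vS hv] := hu _ d0; exists (ract v a).
    elim/lspan_ind: vS {hv} => [|c s' w [y [x [hy hx ->]]] _ IH]; first by rewrite ract0l; exact: lspan0.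
    rewrite ractDl ractZl tens_ract; apply: lspan_cons => //; exists y, (ract x a).
    by split=> //; apply: modI_ract.
  rewrite -ractBl (le_trans (nr_ract _ _)) // (le_trans (ler_wpM2r (nr_ge0 _) hv)) //.
  by apply: frac_small; rewrite ?nr_ge0 // ltW.
have ZI u : zpow n.+2 u -> modI (E n.+2) I u.
  move=> hu; apply: (modI_closed hI) => e /hu[v vS hv]; exists v => //.
  elim/lspan_ind: vS {hv} => [|c s' w [y [x [_ [x' [k [Ik ->]]] ->]]] _ IH]; first exact: modI0.
  by apply: modID => //; apply: modIZ => //; rewrite -tens_ract; exact: modI_ractI.
have ipI u v : zpow n.+2 u -> I (hip u v) by move=> /ZI hu; exact: (proj1 (modIPl hI u) hu).
have gZ y x : zpow n.+1 y -> modI X I x -> zpow n.+2 (tn y x).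
  by move=> hy hx; apply/approx_mem/lspan_gen; exists y, x.
have pg y x : zpow n.+1 y -> modI X I x -> p (tn y x) = s y ** t x.
  by move=> hy hx; apply: (ext_gen b0 bD bZ bW hS hp); exists y, x.
have flip u v : zpow n.+2 u -> cstar (p u) ** p v = pi (hip u v) -> cstar (p v) ** p u = pi (hip v u).
  by move=> hu e; rewrite -[LHS]cstarK cstarM cstarK e -(ho_star hpi) ?hip_star //; exact: ipI.
have agr v : zpow n.+2 v ->
    (forall y x, zpow n.+1 y -> modI X I x -> cstar (p v) ** p (tn y x) = pi (hip v (tn y x))) ->
    forall u, zpow n.+2 u -> cstar (p v) ** p u = pi (hip v u).
  move=> hv h; apply: (span_agree (F := fun u => cstar (p v) ** p u) (G := fun u => pi (hip v u)) (C := nr (p v)) (D := nr v)).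
  - by move=> c u w hu hw; rewrite pl // cmulDr cmulZr.
  - by move=> c u w hu hw; rewrite hip_lin (ho_lin hpi) //; exact: ipI.
  - by move=> u hu; rewrite (le_trans (nrM _ _)) // nr_star ler_wpM2l ?nr_ge0 // pb.
  - by move=> u hu; rewrite (le_trans (hom_on_contractive (ideal_sub hI) hpi _)) ?CS //; exact: ipI.
  - by move=> _ [y [x [hy hx ->]]]; exact: h.
split=> //.
- by apply: approx_mem; exact: lspan0.
- by move=> u v; exact: ZD.
- by move=> k u; exact: ZZ.
- by move=> v; exact: approx_approx.
- by move=> u v hu _; exact: ipI.
- move=> u a hu Ia; move: u hu.
  apply: (span_agree (F := fun u => p (ract u a)) (G := fun u => p u ** pi a) (C := nr a) (D := nr (pi a))).
  - by move=> c u w hu hw; rewrite ractDl ractZl pl //; exact: Zr.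
  - by move=> c u w hu hw; rewrite pl // cmulDl cmulZl.
  - by move=> u hu; rewrite (le_trans (pb _ (Zr _ _ hu Ia))) // mulrC nr_ract.
  - by move=> u hu; rewrite (le_trans (nrM _ _)) // mulrC ler_wpM2l ?nr_ge0 // pb.
  - move=> _ [y [x [hy hx ->]]]; rewrite tens_ract !pg //; last exact: modI_ract.
    by rewrite -cmulA -(mr_ract (ir_mod hr)).
- move=> u v hu hv; apply: (agr u hu _ v hv) => y x hy hx; apply: flip; first exact: gZ.
  apply: (agr _ (gZ _ _ hy hx) _ u hu) => y' x' hy' hx'; rewrite !pg //.
  have g1 : lspan S (tn y x, s y ** t x) by apply: lspan_gen; exists y, x.
  have g2 : lspan S (tn y' x', s y' ** t x') by apply: lspan_gen; exists y', x'.
  exact: (proj2 (ipS _ _ g1 g2)).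
Qed.

Lemma tpowr_rep n : modrep I pi (zpow n) (@tpowr n).
Proof.
elim: n => [|n IH].
  have cI := ideal_calg hI; split=> //=; [exact: (id_0 hI)|exact: (id_add hI)|exact: (id_scale hI)|
    exact: idl_approx| | |exact: (ho_lin hpi)|exact: (ho_mul hpi)|].
  - by move=> u a Iu _; apply: (id_mulr hI).
  - by move=> u v _; apply: (id_mull hI).
  - by move=> u v Iu Iv; rewrite -(ho_star hpi) // -(ho_mul hpi) //; exact: ideal_star.
case: n IH => [|n] IH; first exact: (ir_mod hr).
rewrite [@tpowr _]/=; case: xgetP => [s' _ []//|h].
by have [s' /h] := tstep_exists IH.
Qed.

Lemma tpowr_tens n y x : zpow n y -> modI X I x -> tpowr (tn y x) = tpowr y ** t x.
Proof.
case: n y => [|n] y; first exact: (ir_lact hr).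
rewrite [@tpowr n.+2]/=; case: xgetP => [s' _ [_ h]|h]; first exact: h.
by have [s' /h] := tstep_exists (tpowr_rep n.+1).
Qed.

End IRep.
Arguments zpow {R A X T} I n _.

Section Kap.
Variables (R : realType) (A : cstarAlg R) (X : corr A A) (T : tensor_powers X).
Variables (I : set A) (B : cstarAlg R) (pi : A -> B) (t : X -> B).
Local Notation E := (tpow T).
Local Notation tn := (@tens R A X T).
Local Notation Z := (@zpow R A X T I).
Local Notation s := (@tpowr R A X T I B pi t _).
Hypotheses (hI : cstar_ideal I) (hr : irep I pi t).
Let hpi := ir_hom hr.
Let rep n := @tpowr_rep R A X T I B pi t hI hr n.

Definition kap n m : (E m -> E n) -> B := kmap hI hpi (rep m) (rep n).

Lemma kap_cont n m : kcont (Z n) (Z m) (@kap n m).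
Proof. exact: kmap_cont. Qed.
Lemma kap_theta n m z y : Z n z -> Z m y -> kap (theta z y) = s z ** cstar (s y).
Proof. exact: kmap_theta. Qed.
Lemma kap_act n m f y : kset (Z n) (Z m) f -> Z m y -> kap f ** s y = s (f y).
Proof. exact: kmap_act. Qed.
Lemma kap_star n m f f' : kset (Z n) (Z m) f -> is_adjoint f f' -> cstar (kap f) = kap f'.
Proof. exact: kmap_star. Qed.
Lemma kap_bd n m f M : kset (Z n) (Z m) f -> 0 <= M -> obd f M -> nr (kap f) <= M.
Proof. exact: kmap_bd. Qed.

Lemma zpow_tens n y x : Z n y -> modI X I x -> Z n.+1 (tn y x).
Proof.
case: n y => [|n] y hy hx; first exact: modI_lact.
by apply/approx_mem/lspan_gen; exists y, x.
Qed.

Lemma kap_vec n xi : Z n xi -> kset (Z n) (Z 0) (vec xi) /\ kap (vec xi) = s xi.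
Proof.
move=> hx; have [w [i [hw Ii si xE]]] := mr_fact hI (rep n) hx.
have vE : vec xi = theta w (i : E 0) by rewrite theta_vec si -xE.
rewrite vE; split; first exact: kset_theta.
by rewrite kap_theta //= -(ho_star hpi) // si -(mr_ract (rep n)) // -xE.
Qed.

Lemma kset_zvec n f : kset (Z n) (Z 0) f -> exists2 xi, Z n xi & f = vec xi.
Proof.
apply: kset_vec; [exact: (mr_cl (rep n))|exact: (mr_0 (rep n))|exact: (mr_D (rep n))|exact: (mr_Z (rep n))|].
by move=> z y hz hy; apply: (mr_r (rep n)) => //; exact: ideal_star.
Qed.

Definition acts n m (f : E m -> E n) (b : B) :=
  forall v, Z m v -> Z n (f v) /\ b ** s v = s (f v).

(** The extra condition in degree 0: there [otimes1] depends on the vector, and [b] has to be the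
    image of that vector. *)
Definition isvecr n m : (E m -> E n) -> B -> Prop :=
  match m return (E m -> E n) -> B -> Prop with
  | 0 => fun f b => exists2 xi, Z n xi & f = vec xi /\ b = s xi
  | _ => fun _ _ => True
  end.

(** If b implements f, then b s(y) t(x) = s(f y) t(x), so the same b implements f (x) 1. This is the
    reason why [kap] is a right tensor representation. *)
Lemma otimes1_acts n m (f : E m -> E n) f' b : adm f f' -> acts f b -> isvecr f b -> acts (otimes1 f) b.
Proof.
move=> hf ha hv; have [[_ [M M0 hM] _ _] fe _] := otimes1_adm hf.
case: m f f' hf ha hv M M0 hM fe => [|m] f f' hf ha hv M M0 hM fe.
  have [xi hx [-> ->]] := hv; rewrite otimes1_vec => v hv1; split; first exact: zpow_tens.
  by rewrite (@tpowr_tens _ _ _ T _ _ _ _ hI hr).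
have fl : linear (otimes1 f) by have [[h _ _ _] _ _] := otimes1_adm hf; exact: adj_lin h.
have span u : lspan [set z | exists y x, [/\ Z m.+1 y, modI X I x & z = tn y x]] u ->
    [/\ Z m.+2 u, Z n.+1 (otimes1 f u) & b ** s u = s (otimes1 f u)].
  elim/lspan_ind => [|c w v [y [x [hy hx ->]]] _ [Zv Zf e]].
    rewrite (lin0 fl) !(mr_s0 (rep _)) cmul0r; split=> //; exact: (mr_0 (rep _)).
  have [Zfy ey] := ha y hy; rewrite fl fe.
  have Zt := zpow_tens hy hx; have Zft := zpow_tens Zfy hx.
  rewrite (mr_lin (rep _)) // (mr_lin (rep _)) // -e cmulDr cmulZr.
  rewrite (tpowr_tens hI hr hy hx) (tpowr_tens hI hr Zfy hx) cmulA ey; split=> //.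
    by apply: (mr_D (rep m.+2)) => //; exact: (mr_Z (rep m.+2)).
  by apply: (mr_D (rep n.+1)) => //; exact: (mr_Z (rep n.+1)).
move=> v hv'.
have Zf : Z n.+1 (otimes1 f v).
  apply: (mr_cl (rep n.+1)) => e e0.
  have d0 : 0 < e / (1 + M) by rewrite divr_gt0 // ltr_pwDl.
  have [u /span[_ Zu _] hu] := hv' _ d0; exists (otimes1 f u) => //.
  rewrite -(linB fl) (le_trans (hM _)) // mulrC (le_trans (ler_wpM2r M0 hu)) //.
  by apply: frac_small => //; exact: ltW.
split=> //; apply: eq_nr => e e0; pose c := nr b + M.
have c0 : 0 <= c by rewrite addr_ge0 ?nr_ge0.
have d0 : 0 < e / (1 + c) by rewrite divr_gt0 // ltr_pwDl.
have [u /span[Zu Zfu eu] hu] := hv' _ d0.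
have -> : b ** s v - s (otimes1 f v) = b ** s (v - u) - s (otimes1 f (v - u)).
  rewrite (linB fl) !(mr_sB (rep _)) // cmulBr eu; lmodule R.
have Zvu : Z m.+2 (v - u) by apply: (mr_D (rep m.+2)) => //; exact: (mr_N (rep m.+2)).
have Zfvu : Z n.+1 (otimes1 f (v - u)).
  by rewrite (linB fl); apply: (mr_D (rep n.+1)) => //; exact: (mr_N (rep n.+1)).
apply: (@le_trans _ _ (c * nr (v - u))).
  rewrite mulrDl (le_trans (nrB _ _)) // lerD //.
    by rewrite (le_trans (nrM _ _)) // ler_wpM2l ?nr_ge0 //; exact: (mr_nr hI hpi (rep _)).
  by apply: (le_trans (mr_nr hI hpi (rep _) Zfvu)).
rewrite mulrC (le_trans (ler_wpM2r c0 hu)) //.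
by apply: frac_small => //; exact: ltW.
Qed.

Lemma kap_acts n m f k : kset (Z n) (Z m) f -> acts (otimes1k f (k := k)) (kap f).
Proof.
move=> kf; have [f' kf' af] := kset_adm kf.
elim: k => [|k IH]; first by move=> v hv; split; [exact: (kset_maps (rep m) (rep n))|exact: kap_act].
apply: otimes1_acts (otimes1k_adm k af) IH _.
case: k => [|k]; last by []; case: m f kf f' kf' af => [|m] f kf f' kf' af //.
by have [xi hx ->] := kset_zvec kf; exists xi => //; split=> //; have [] := kap_vec hx.
Qed.

Lemma kap_mul k l m n (a : E m -> E n) (b : E l -> E (k + m)%N) : kset (Z n) (Z m) a ->
  kset (Z (k + m)) (Z l) b ->
  kset (Z (k + n)) (Z l) (otimes1k a (k := k) \o b) /\ kap a ** kap b = kap (otimes1k a (k := k) \o b).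
Proof.
move=> ka kb; have [a' ka' aa] := kset_adm ka; have [h1 h2 _ _] := otimes1k_adm k aa.
apply: (kmap_mul hI hpi (rep l) (rep (k + m)) (rep (k + n)) _ h2 _ _ kb).
- by move=> z hz; have [] := kap_acts ka hz.
- by exists (otimes1k a' (k := k)).
- by move=> z hz; have [] := kap_acts ka hz.
Qed.

(* The condition [j] in [J' <= J(XI)] and [pi j = pi_11 (phi j)]. *)
Definition icoiso (J' : set A) := forall j, J' j ->
  kset (modI X I) (modI X I) (lact (c := X) j) /\ pi j = @kap 1 1 (lact (c := X) j).

Lemma tens_kap n m z y k : Z n z -> Z m y -> kset (modI X I) (modI X I) k ->
  kset (Z n.+1) (Z m.+1) ((tn z : X -> E n.+1) \o k \o otimes1 (hip y : E m -> E 0)) /\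
  @kap n.+1 m.+1 ((tn z : X -> E n.+1) \o k \o otimes1 (hip y : E m -> E 0)) = s z ** @kap 1 1 k ** cstar (s y).
Proof.
move=> hz hy kk.
have kt k' : kset (modI X I) (modI X I) k' ->
    kset (Z n.+1) (Z m.+1) ((tn z : X -> E n.+1) \o k' \o otimes1 (hip y : E m -> E 0)).
  by apply: tens_kset => x hx; exact: zpow_tens.
split; first exact: kt.
apply: (@kc_eq _ _ X X (modI X I) (modI X I) B
  (fun k => @kap n.+1 m.+1 ((tn z : X -> E n.+1) \o k \o otimes1 (hip y : E m -> E 0)))
  (fun k => s z ** @kap 1 1 k ** cstar (s y))) => //.
- split=> [c f g kf kg|].
    rewrite -(kc_lin (@kap_cont n.+1 m.+1)) //; try exact: kt.
    by congr kap; apply/funext => w; rewrite /= (tens_linr z).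
  exists (nr z * nr y) => [|f M kf M0 fM]; first by rewrite mulr_ge0 ?nr_ge0.
  apply: kap_bd; [exact: kt|by rewrite !mulr_ge0 ?nr_ge0|].
  have [_ _ hb] := otimes1_adm (adm_sym (adm_vec y)).
  have hby : obd (otimes1 (hip y : E m -> E 0)) (nr y) by apply: hb; [exact: nr_ge0|move=> w; exact: CS].
  move=> w /=; rewrite (le_trans (tens_nr _ _)) // -!mulrA ler_wpM2l ?nr_ge0 //.
  rewrite (le_trans (fM _)) // [leRHS]mulrCA ler_wpM2l //; exact: hby.
- by apply: kc_mulr; apply: kc_mull; exact: (@kap_cont 1 1).
- move=> x x' hx hx'; rewrite tens_theta (@kap_theta 1 1) // kap_theta; [|exact: zpow_tens|exact: zpow_tens].
  by rewrite !(tpowr_tens hI hr) // cstarM !cmulA.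
Qed.

(** On rank-one operators theta (w j) y with j in J' one has s(w) pi(j) s(y)^* = s(w) kap(phi(j))
    s(y)^*, and the right side is the image of T_w phi(j) T_y^*, the amplification
    ([otimes1_thetaJ]). Both sides are continuous. *)
Lemma kap_coiso J' : cstar_ideal J' -> J' `<=` I -> icoiso J' -> forall n m a,
  kset (Z n `&` modI (E n) J') (Z m) a ->
  kset (Z n.+1) (Z m.+1) (otimes1 a) /\ kap a = @kap n.+1 m.+1 (otimes1 a).
Proof.
move=> hJ JI hc n m; pose ZJ := Z n `&` modI (E n) J'.
have sub : kset ZJ (Z m) `<=` kset (Z n) (Z m) by move=> f; apply: kset_sub => // z [].
have fact z y : ZJ z -> Z m y -> exists w j, [/\ Z n w, J' j & theta z y = theta (ract w j) y].
  move=> [hz Jz] hy.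
  have [w [j [hw Jj _ zE]]] : exists w j, [/\ Z n w, J' j, cstar j = j & z = ract w j].
    apply: (modI_fact hJ) => //; [exact: (mr_cl (rep n))|exact: (mr_D (rep n))|exact: (mr_Z (rep n))|].
    by move=> u a hu /JI Ia; exact: (mr_r (rep n)).
  by exists w, j; rewrite zE.
have th z y : ZJ z -> Z m y -> kset (Z n.+1) (Z m.+1) (otimes1 (theta z y)) /\
    kap (theta z y) = @kap n.+1 m.+1 (otimes1 (theta z y)).
  move=> hz hy; have [w [j [hw Jj ->]]] := fact z y hz hy.
  have [kj pj] := hc j Jj; have [h1 h2] := tens_kap hw hy kj.
  rewrite otimes1_thetaJ h2 -pj kap_theta //; last by apply: (mr_r (rep n)) => //; exact: JI.
  by rewrite (mr_ract (rep n)) //; exact: JI.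
have kt f : kset ZJ (Z m) f -> kset (Z n.+1) (Z m.+1) (otimes1 f).
  move=> kf; apply: kset_closed => e e0; have [g gS bg] := kf _ e0.
  have kg := kset_span gS; have [f' _ af] := kset_adm kf; have [g' _ ag] := kset_adm kg.
  exists (otimes1 g); last first.
    have := adm_lin (-1) ag af; rewrite !scaleN1r => h.
    have [_ _ b] := otimes1_adm h; have := otimes1_lin (-1) ag af; rewrite !scaleN1r => h1.
    rewrite addrC -h1; apply: b; first exact: ltW.
    by rewrite addrC.
  elim/lspan_ind: gS {bg kg g' ag} => [|c u v [z [y [hz hy ->]]] vS IH].
    have -> : (0 : E m -> E n) = vec 0 \o hip 0 by apply/funext => w /=; rewrite /vec ract0l.
    rewrite -[vec 0 \o _]/(theta 0 0) otimes1_theta.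
    rewrite (_ : _ \o _ = 0); first exact: kset0.
    by apply/funext => w /=; exact: (lin0 (tens_linl _)).
  have [t' _ at_] := kset_adm (kset_theta hz hy); have [v' _ av] := kset_adm (kset_span vS).
  rewrite (otimes1_lin c at_ av); apply: ksetD => //; apply: ksetZ.
  by have [] := th z y hz hy.
move=> a ka; split; first exact: kt.
apply: (@kc_eq _ _ _ _ ZJ (Z m) B (@kap n m) (fun a => @kap n.+1 m.+1 (otimes1 a))) => //.
- have [l [C C0 b]] := kap_cont n m; split=> [c f g /sub kf /sub kg|]; first exact: l.
  by exists C => // f M /sub; exact: b.
- split=> [c f g kf kg|].
    have [f' _ af] := kset_adm kf; have [g' _ ag] := kset_adm kg.
    by rewrite (otimes1_lin c af ag) (kc_lin (@kap_cont n.+1 m.+1)) //; exact: kt.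
  exists 1 => // f M kf M0 fM; rewrite mul1r; apply: kap_bd => //; first exact: kt.
  by have [f' _ af] := kset_adm kf; have [_ _ b] := otimes1_adm af; exact: b.
- by move=> z y hz hy; have [] := th z y hz hy.
Qed.

End Kap.

(** * Homomorphisms, generated ideals and coisometric representations *)

Section StarHoms.
Variables (R : realType).
Implicit Types (A B D : cstarAlg R).

Lemma star_hom_comp A B D (f : A -> B) (g : B -> D) : star_hom f -> star_hom g -> star_hom (g \o f).
Proof.
move=> hf hg; split=> [k a b|a b|a] /=.
- by rewrite (sh_lin hf) (sh_lin hg).
- by rewrite (sh_mul hf) (sh_mul hg).
- by rewrite (sh_star hf) (sh_star hg).
Qed.

Lemma star_hom_id A : star_hom (fun a : A => a).
Proof. by []. Qed.

Lemma ker_ideal A B (f : A -> B) : star_hom f -> cstar_ideal [set a | f a = 0].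
Proof.
move=> hf; have fl := sh_lin hf; split=> /=.
- apply/closedP => x hx /=; apply: nr_le0; apply/ler_addgt0Pr => e e0; rewrite add0r.
  have [y /= fy hy] := hx e e0.
  by rewrite -[f x]subr0 -fy -(linB fl) (le_trans (star_hom_contractive _ hf)).
- exact: lin0.
- by move=> a b ha hb; rewrite (linD fl) ha hb addr0.
- by move=> k a ha; rewrite (linZ fl) ha scaler0.
- by move=> a b hb; rewrite (sh_mul hf) hb cmul0r.
- by move=> a b ha; rewrite (sh_mul hf) ha cmul0l.
Qed.

Lemma gen_sub (A : cstarAlg R) (S : set A) : S `<=` ideal_gen S.
Proof. by move=> a Sa K _; exact. Qed.

Lemma ideal_genP (A : cstarAlg R) (S : set A) : cstar_ideal (ideal_gen S).
Proof.
split.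
- apply/closedP => x hx K hK SK; apply: (idl_approx hK); apply: approx_sub hx => y hy; exact: hy.
- by move=> K hK _; exact: (id_0 hK).
- by move=> a b ha hb K hK SK; apply: (id_add hK); [exact: ha|exact: hb].
- by move=> k a ha K hK SK; apply: (id_scale hK); exact: ha.
- by move=> a b hb K hK SK; apply: (id_mull hK); exact: hb.
- by move=> a b ha K hK SK; apply: (id_mulr hK); exact: ha.
Qed.

Lemma star_hom_eq A B (S : set A) (f g : A -> B) : generated_by S -> star_hom f -> star_hom g ->
  (forall a, S a -> f a = g a) -> f =1 g.
Proof.
move=> gen hf hg e a; suff h : [set a | f a = g a] = setT by have : [set: A] a by []; rewrite -h.
have fl := sh_lin hf; have gl := sh_lin hg.
apply: gen => //; split=> /=.
- apply/closedP => x hx /=; apply: eq_nr => d d0; have d2 : 0 < d / 2 by rewrite divr_gt0.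
  have [y /= fy hy] := hx _ d2.
  have -> : f x - g x = f (x - y) - g (x - y) by rewrite (linB fl) (linB gl) fy; lmodule R.
  rewrite [leRHS]splitr (le_trans (nrB _ _)) // lerD //.
    by rewrite (le_trans (star_hom_contractive _ hf)).
  by rewrite (le_trans (star_hom_contractive _ hg)).
- by rewrite (lin0 fl) (lin0 gl).
- by move=> u v hu hv; rewrite (linD fl) (linD gl) hu hv.
- by move=> k u hu; rewrite (linZ fl) (linZ gl) hu.
- by move=> u v hu hv; rewrite (sh_mul hf) (sh_mul hg) hu hv.
- by move=> u hu; rewrite (sh_star hf) (sh_star hg) hu.
Qed.

Lemma quot_factor A B D (L : set A) (d : A -> D) (g : A -> B) : is_quotient_alg L d -> star_hom g ->
  (forall a, L a -> g a = 0) -> exists2 f : D -> B, star_hom f & forall a, f (d a) = g a.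
Proof.
move=> [hd ds dk] hg gk; have dl := sh_lin hd; have gl := sh_lin hg.
have /choice[r rE] y : exists a, d a = y.
  by have : range d y by [rewrite ds]; case=> a _ <-; exists a.
have gr a : g (r (d a)) = g a.
  by apply/eqP; rewrite -subr_eq0 -(linB gl) gk //; apply/dk; rewrite (linB dl) rE subrr.
exists (g \o r) => //; split=> [k a b|a b|a] /=; rewrite -{1}[a]rE.
- by rewrite -{1}[b]rE -dl gr gl.
- by rewrite -{1}[b]rE -(sh_mul hd) gr (sh_mul hg).
- by rewrite -(sh_star hd) gr (sh_star hg).
Qed.

End StarHoms.

Section KXFacts.
Variables (R : realType) (A : cstarAlg R) (X : corr A A) (T : tensor_powers X).
Local Notation E := (tpow T).

Lemma KXE (I : set A) n m : @KX _ _ _ T I n m = kset (modI (E n) I) setT.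
Proof. exact: compactsE. Qed.

Lemma modIT (Y : hilbMod A) : modI Y setT = setT.
Proof. by apply/seteqP; split=> // y _; apply/(modI_hip (@idealT _ _)). Qed.

Lemma zpowT n : zpow (X := X) (T := T) setT n = setT.
Proof.
apply/seteqP; split=> // z _; case: n z => [//|n]; elim: n => [|n IH] z.
  by rewrite [zpow _ _]/= modIT.
apply: approx_sub (elem_dense z) => u uS.
elim/lspan_ind: uS => [|c s v [y [x ->]] _ IHs]; first exact: lspan0.
apply: lspan_cons => //; exists y, x; split=> //; [exact: IH|by rewrite modIT].
Qed.

Lemma KXTE n m : @KX _ _ _ T setT n m = kset setT setT.
Proof. by rewrite KXE modIT. Qed.

End KXFacts.

Section Rep.
Variables (R : realType) (A : cstarAlg R) (X : corr A A) (B : cstarAlg R) (pi : A -> B) (t : X -> B).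
Hypothesis hr : is_rep pi t.

Lemma rep_irep : irep setT pi t.
Proof.
have [h1 h2 h3 h4 h5] := hr; split=> //; first exact: hom_onT.
rewrite modIT; split=> //; by move=> k u v _ _; exact: h2.
Qed.

Definition repP : set ((X -> X) * B)%type := [set u | exists x y, u = (theta x y, t x ** cstar (t y))].

Lemma span_theta (k : X -> X) : lspan (kgen setT setT) k -> exists2 u, lspan repP u & u.1 = k.
Proof.
elim/lspan_ind => [|c s v [z [y [_ _ ->]]] _ [x xS <-]]; first by exists 0; [exact: lspan0|].
exists (c *: ((theta z y, t z ** cstar (t y)) : (X -> X) * B) + x)%R => //.
by apply: lspan_cons => //; exists z, y.
Qed.

Lemma pi11_of (p : (X -> X) -> B) : kcont setT setT p ->
  (forall f M, kset setT setT f -> 0 <= M -> obd f M -> nr (p f) <= M) ->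
  (forall x y, p (theta x y) = t x ** cstar (t y)) -> is_pi11 t p.
Proof.
move=> pc pb pt; split; rewrite ?compactsE //.
  by move=> c u v ku kv; apply: (kc_lin pc).
move=> a M ka M0; have MR : M = (complex.Re M)%:C by case: M M0 => x y /ger0_Im /= ->.
rewrite MR => /opboundP hM; rewrite nrE lecR; apply: pb => //.
by rewrite -lecR -MR.
Qed.

Lemma rep_pi11 : exists p, is_pi11 t p.
Proof.
have [h1 m _] := rep_irep; exists (kmap (@idealT _ _) h1 m m); rewrite modIT in m *.
apply: pi11_of; [exact: kmap_cont|exact: kmap_bd|by move=> x y; exact: kmap_theta].
Qed.

Section Pi11.
Variables (p : (X -> X) -> B).
Hypothesis hp : is_pi11 t p.

Lemma pi11_lin' c u v : kset setT setT u -> kset setT setT v -> p (c *: u + v) = c *: p u + p v.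
Proof. by rewrite -compactsE; exact: (pi11_lin hp). Qed.

Lemma pi11_bd u (M : R) : kset setT setT u -> 0 <= M -> obd u M -> nr (p u) <= M.
Proof.
move=> ku M0 hM; rewrite -lecR -nrE; apply: (pi11_bound hp); rewrite ?compactsE ?ler0c //.
exact/opboundP.
Qed.

Lemma pi11B u v : kset setT setT u -> kset setT setT v ->
  kset setT setT (u - v) /\ p (u - v) = p u - p v.
Proof.
move=> ku kv; split; last by rewrite addrC -scaleN1r pi11_lin' // scaleN1r addrC.
by rewrite addrC -scaleN1r; apply: ksetD => //; exact: ksetZ.
Qed.

Lemma span_rep u : lspan repP u -> kset setT setT u.1 /\ p u.1 = u.2.
Proof.
elim/lspan_ind => [|c s v [x [y ->]] _ [kv e]].
  by split; [exact: kset0|exact: lin_on0 (@kset0 _ _ _ _ _ _) pi11_lin'].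
have kt : kset setT setT (theta x y : X -> X) by exact: kset_theta.
split=> /=; first by apply: ksetD => //; exact: ksetZ.
by rewrite pi11_lin' // e (pi11_theta hp).
Qed.

End Pi11.

(** Coisometry at [a] expressed without the induced map on K(X): phi(a) and pi(a) are approximated
    simultaneously by the two components of one finite sum. In this form it passes through
    homomorphisms and through changes of the correspondence. *)
Definition approx_coiso (a : A) := forall e : R, 0 < e ->
  exists2 u, lspan repP u & obd (lact (c := X) a - u.1) e /\ nr (pi a - u.2) <= e.

Lemma approx_coiso_kset a : approx_coiso a -> kset setT setT (lact (c := X) a).
Proof.
move=> h e e0; have [u uS [b _]] := h e e0; exists u.1 => //.
elim/lspan_ind: uS {b} => [|c s v [x [y ->]] _ IH]; first exact: lspan0.
by apply: lspan_cons => //; exists x, y.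
Qed.

Lemma coisoP (J : set A) : coisometric J pi t -> J `<=` Jideal X -> J `<=` approx_coiso.
Proof.
move=> [p hp pJ] JX a Ja e e0; have := JX a Ja; rewrite /Jideal /= compactsE => ka.
have [g gS bg] := ka _ e0; have [u uS ug] := span_theta gS; exists u => //; rewrite ug; split=> //.
have [ku <-] := span_rep hp uS; rewrite ug in ku *.
have [k1 e1] := pi11B hp ka ku; rewrite pJ // -e1.
by apply: (pi11_bd hp) => //; exact: ltW.
Qed.

Lemma approx_coisoE p a : is_pi11 t p -> approx_coiso a -> pi a = p (lact (c := X) a).
Proof.
move=> hp h; have ka := approx_coiso_kset h; apply: eq_nr => e e0.
have e2 : 0 < e / 2 by rewrite divr_gt0.
have [u uS [b nb]] := h _ e2; rewrite (le_trans (nr_tri u.2 _ _)) // [leRHS]splitr lerD //.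
have [ku <-] := span_rep hp uS; have [k1 e1] := pi11B hp ka ku; rewrite nrC -e1.
by apply: (pi11_bd hp) => //; exact: ltW.
Qed.

Lemma approx_coisometric (J : set A) : J `<=` approx_coiso -> coisometric J pi t.
Proof.
move=> h; have [p hp] := rep_pi11; exists p => // a /h.
exact: approx_coisoE.
Qed.

Variable T : tensor_powers X.
Local Notation E := (tpow T).

(** The case I = A of [kap]; for the universal representation it is the map [iota] of the
    theorem. *)
Definition tensor_rep n m : (E m -> E n) -> B := kap (T := T) (@idealT _ _) rep_irep (n := n) (m := m).

Lemma tensor_rep_theta n m (z : E n) (y : E m) : tensor_rep (theta z y) = tpowr setT pi t z ** cstar (tpowr setT pi t y) :> B.
Proof. by apply: kap_theta; rewrite zpowT. Qed.

Lemma tensor_rep_vec n (z : E n) : tensor_rep (vec z) = tpowr setT pi t z.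
Proof. by apply: (proj2 (@kap_vec _ _ _ T _ _ _ _ (@idealT _ _) rep_irep n z _)); rewrite zpowT. Qed.

Lemma tensor_rep_cont n m : kcont setT setT (@tensor_rep n m).
Proof. by have := @kap_cont _ _ _ T _ _ _ _ (@idealT _ _) rep_irep n m; rewrite !zpowT. Qed.

Lemma tensor_rep_bd n m f M : kset setT setT f -> 0 <= M -> obd f M -> nr (@tensor_rep n m f) <= M.
Proof. by move=> kf; apply: kap_bd; rewrite !zpowT. Qed.

Lemma tensor_rep_rtr : is_rtr setT tensor_rep.
Proof.
split=> [n m|n m a b|k l m n a b]; rewrite ?KXTE.
- by move=> c u v ku kv; apply: (kc_lin (@tensor_rep_cont n m)).
- by move=> ka ab; apply: kap_star => //; rewrite !zpowT.
- move=> ka kb; by apply: (proj2 (@kap_mul _ _ _ T _ _ _ _ (@idealT _ _) rep_irep k l m n a b _ _)); rewrite !zpowT.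
Qed.

Lemma tensor_rep_ext : tensor_extension pi t tensor_rep.
Proof.
split; [exact: tensor_rep_rtr|by move=> a; rewrite tensor_rep_vec|by move=> x; rewrite tensor_rep_vec].
Qed.

Lemma tensor_rep_coiso (J : set A) : cstar_ideal J -> J `<=` approx_coiso -> rtr_coisometric J tensor_rep.
Proof.
move=> hJ h n m a; rewrite KXE => ka.
apply: (proj2 (@kap_coiso _ _ _ T _ _ _ _ (@idealT _ _) rep_irep J hJ _ _ n m a _)); rewrite ?zpowT ?setTI //.
move=> j /h hj; rewrite modIT; split; first exact: approx_coiso_kset.
apply: approx_coisoE hj; apply: pi11_of; [exact: (@tensor_rep_cont 1 1)|exact: (@tensor_rep_bd 1 1)|exact: (@tensor_rep_theta 1 1)].
Qed.

End Rep.

(** * The quotient of O(J,X) by O(I) *)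

Section QuotientIso.
Variables (R : realType) (A : cstarAlg R) (X : corr A A).

(* With [1 - T*T = (1 - y)^2], the difference [<x, x> - <Tx, Tx>] is positive, hence so is its image under [q]. *)
Lemma quot_corr_bd (K : set A) (Q : cstarAlg R) (q : A -> Q) (XQ : corr Q Q) (p : X -> XQ) :
  star_hom q -> is_quotient_corr K q p -> forall (f g : X -> X) (M : R), is_adjoint f g -> 0 <= M ->
  obd f M -> forall x, nr (p (f x)) <= M * nr (p x).
Proof.
move=> hq [pl ps _ pip _ _] f g M fg M0 hM x.
suff h1 (S : LOp (@CS R A X)) : nr S <= 1 -> nr (p (lapp S x)) <= nr (p x).
  have [F FE] : exists F : LOp (@CS R A X), lapp F = f by exact: LOp_mk fg hM.
  apply/ler_addgt0Pr => e e0; pose c := M + e / (1 + nr (p x)).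
  have d0 : 0 < e / (1 + nr (p x)) by rewrite divr_gt0 // ltr_pwDl // nr_ge0.
  have c0 : 0 < c by rewrite ltr_wpDl.
  have hc : nr ((c^-1)%:C *: F) <= 1.
    rewrite nrZr gtr0_norm ?invr_gt0 // ler_pdivrMl // mulr1.
    by apply: lapp_bound => [|y]; rewrite ?FE ?(ltW c0) // (le_trans (hM y)) // ler_wpM2r ?nr_ge0 // lerDl ltW.
  have := h1 _ hc; rewrite lappZ FE (linZ pl) nrZr gtr0_norm ?invr_gt0 // ler_pdivrMl // => h.
  apply: (le_trans h); rewrite mulrDl lerD2l; apply: frac_small; [exact: ltW|exact: nr_ge0].
move=> S1; have [||y [ys yE _ _]] := @sqrt_one_minus R (LOp (@CS R A X)) (cstar S ** S).
- by rewrite cstarM cstarK.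
- by rewrite nr_starM expr_le1 // nr_ge0.
have aS := lapp_adj S; have ay := lapp_adj y; rewrite ys in ay.
have e1 : hip (lapp S x) (lapp S x) = hip x x - hip (x - lapp y x) (x - lapp y x).
  rewrite aS -lappM !(hipBl, hipBr) !ay -lappM.
  have := congr1 (fun u => hip x (lapp u x)) yE; rewrite !lappD !hipDr => h.
  by apply: (eq_diff (esym h)); lmodule R.
rewrite -(ler_pXn2r (n := 2)) ?nnegrE ?nr_ge0 // -!nr_hip.
apply: cpos_le; first exact: hip_pos.
rewrite !pip e1 (linB (sh_lin hq)) opprB addrC subrK -pip; exact: hip_pos.
Qed.

(** Composing the quotient maps with the universal representation of X/XK gives a representation of
    X, hence g on O(J,X), which kills the image of K. Conversely the universal representation of X
    modulo the ideal factors through A/K and X/XK. The two induced homomorphisms are inverse on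
    generators; both coisometry conditions are checked through [approx_coiso]. *)
Lemma quotient_iso (J : set A) (O : cstarAlg R) (iA : A -> O) (iX : X -> O) (K : set A) :
  J `<=` Jideal X -> is_relCP J iA iX -> cstar_ideal K ->
  natural_iso_quotient J iA iX K (ideal_gen (iA @` K)).
Proof.
move=> JX [iR iC iG iU] hK Q q XQ p O' jA jX D d hq hp [jR jC jG jU] hd.
have [hqh qs qk] := hq; have [pl ps pk pip pr pla] := hp; have ql := sh_lin hqh.
have [jh jl jr ji jla] := jR; have [ih il ir ii ila] := iR; have [hdh ds dk] := hd; have dl := sh_lin hdh.
(* A finite-rank operator on X pushes forward along [p] to one on X/XK, with the same value in the
   algebra. *)
have tr (P : cstarAlg R) (t : XQ -> P) (t' : X -> P) u : linear t -> (forall x, t (p x) = t' x) ->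
    lspan (repP t') u -> exists2 v, lspan (repP t) v & v.2 = u.2 /\ forall x, v.1 (p x) = p (u.1 x).
  move=> tl tt; elim/lspan_ind => [|c s w [x [y ->]] _ [v vS [v2 v1]]].
    by exists 0; [exact: lspan0|split=> // x /=; rewrite (lin0 pl)].
  exists (c *: ((theta (p x) (p y), t (p x) ** cstar (t (p y))) : (XQ -> XQ) * P) + v)%R.
    by apply: lspan_cons => //; exists (p x), (p y).
  split=> [|z] /=; first by rewrite v2 !tt.
  change (c *: theta (p x) (p y) (p z) + v.1 (p z) = p (c *: theta x y z + w.1 z)).
  by rewrite pl v1 /theta pip pr.
have adjP (P : cstarAlg R) (t : X -> P) u : lspan (repP t) u -> exists g, is_adjoint u.1 g.
  elim/lspan_ind => [|c s w [x [y ->]] _ [g wg]].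
    by exists 0 => a b /=; rewrite hip0l hip0r.
  exists (conjc c *: theta y x + g) => a b /=.
  by rewrite hipDl hipDr hipZl hipZr theta_adj wg.
(* The estimate on phi(a) minus a finite-rank operator descends to the quotient with the same
   constant, by [quot_corr_bd]. *)
have obdQ a (P : cstarAlg R) (t : XQ -> P) (t' : X -> P) (u : (X -> X) * P) (v : XQ -> XQ) (e : R) : 0 <= e -> lspan (repP t') u ->
    (forall x, v (p x) = p (u.1 x)) -> obd (lact (c := X) a - u.1) e -> obd (lact (c := XQ) (q a) - v) e.
  move=> e0 /adjP[g ug] vp b y; have : range p y by rewrite ps.
  case=> x _ <-; change (nr (lact (q a) (p x) - v (p x)) <= e * nr (p x)).
  rewrite -pla vp -(linB pl).
  apply: (quot_corr_bd hqh hp (f := lact (c := X) a - u.1) (g := lact (cstar a) - g)) => //.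
  by move=> w z; rewrite /= hipBl hipBr lact_adj ug.
have rep1 : is_rep (jA \o q) (jX \o p).
  split=> /=; first exact: star_hom_comp.
  - by move=> c x y; rewrite /= pl jl.
  - by move=> x a; rewrite pr jr.
  - by move=> x y; rewrite ji pip.
  - by move=> a x; rewrite pla jla.
have co1 : coisometric J (jA \o q) (jX \o p).
  case: jC => p' hp' p'J.
  apply: approx_coisometric => // a Ja e e0.
  have := JX a Ja; rewrite /Jideal /= compactsE => ka.
  have [g gS bg] := ka _ e0; have [u uS ug] := span_theta (jX \o p) gS.
  exists u => //; rewrite ug; split=> //.
  have [v vS [<- v1]] := tr _ jX _ _ jl (fun=> erefl) uS.
  have [kv <-] := span_rep hp' vS.
  have bv : obd (lact (c := XQ) (q a) - v.1) e.
    by apply: (obdQ a _ jX (jX \o p) u) => //; [exact: ltW|rewrite ug].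
  have kq : kset setT setT (lact (c := XQ) (q a)).
    move=> e' e0'; have [g' g'S bg'] := ka _ e0'; have [u' u'S ug'] := span_theta (jX \o p) g'S.
    have [v' v'S [_ v1']] := tr _ jX _ _ jl (fun=> erefl) u'S; exists v'.1.
      elim/lspan_ind: v'S {v1'} => [|c s w [x [y ->]] _ IH]; first exact: lspan0.
      by apply: lspan_cons => //; exists x, y.
    by apply: (obdQ a _ jX (jX \o p) u') => //; [exact: ltW|rewrite ug'].
  have [k1 e1] := pi11B hp' kq kv.
  rewrite /= p'J -?e1; last by exists a.
  by apply: (pi11_bd hp') => //; exact: ltW.
have [g gh [gA gX]] := iU _ _ _ rep1 co1.
have gk a : ideal_gen (iA @` K) a -> g a = 0.
  move=> /(_ _ (ker_ideal gh)); apply=> _ [k /qk qk0 <-] /=.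
  by rewrite gA /= qk0 (lin0 (sh_lin jh)).
have [Phi Ph PE] := quot_factor hd gh gk.
have [pi' pi'h pi'E] : exists2 f : Q -> D, star_hom f & forall a, f (q a) = (d \o iA) a.
  apply: (quot_factor hq (star_hom_comp ih hdh)) => a Ka /=; apply/dk.
  by apply: gen_sub; exists a.
have /choice[r rE] y : exists x, p x = y by have : range p y by [rewrite ps]; case=> x _ <-; exists x.
have dX x : d (iX (r (p x))) = d (iX x).
  apply/eqP; rewrite -subr_eq0 -(linB dl) -(linB il); apply/eqP/dk.
  have /pk[w [k [Kk ->]]] : p (r (p x) - x) = 0 by rewrite (linB pl) rE subrr.
  by rewrite ir; apply: (id_mull (ideal_genP _)); apply: gen_sub; exists k.
pose t' := d \o iX \o r.
have t'p x : t' (p x) = d (iX x) by exact: dX.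
have rep2 : is_rep pi' t'.
  split=> // [c x y|x a|x y|a x].
  - by rewrite -[x]rE -[y]rE -pl !t'p il dl.
  - have [b _ <-] : range q a by rewrite qs.
    by rewrite -[x]rE -pr !t'p ir (sh_mul hdh) pi'E.
  - by rewrite -[x]rE -[y]rE !t'p -(sh_star hdh) -(sh_mul hdh) ii pip pi'E.
  - have [b _ <-] : range q a by rewrite qs.
    by rewrite -[x]rE -pla !t'p ila (sh_mul hdh) pi'E.
have co2 : coisometric (q @` J) pi' t'.
  apply: approx_coisometric => // _ [a Ja <-] e e0.
  have [u uS [b nb]] := coisoP iC JX Ja e0.
  have [u' u'S [u'1 u'2]] : exists2 u', lspan (repP (d \o iX)) u' & u'.1 = u.1 /\ u'.2 = d u.2.
    elim/lspan_ind: uS {b nb} => [|c s w [x [y ->]] _ [v vS [v1 v2]]].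
      by exists 0; [exact: lspan0|rewrite (lin0 dl)].
    exists (c *: ((theta x y, (d \o iX) x ** cstar ((d \o iX) y)) : (X -> X) * D) + v)%R.
      by apply: lspan_cons => //; exists x, y.
    by rewrite /= v1 v2 dl (sh_mul hdh) (sh_star hdh).
  have [v vS [v2 v1]] := tr _ t' _ _ (rep_lin rep2) t'p u'S.
  exists v => //; split.
    by apply: (obdQ a _ t' (d \o iX) u') => //; [exact: ltW|rewrite u'1].
  by rewrite v2 u'2 pi'E /= -(linB dl) (le_trans (star_hom_contractive _ hdh)).
have [h hh [hA hX]] := jU _ _ _ rep2 co2.
exists Phi; last by split=> x; rewrite PE ?gA ?gX.
split=> //; exists h => y.
  have [o _ <-] : range d y by rewrite ds.
  rewrite PE; apply: (star_hom_eq iG (f := h \o g) (g := d)) => [|//|a [] [z _ <-] /=].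
  - exact: star_hom_comp.
  - by rewrite gA /= hA pi'E.
  - by rewrite gX /= hX t'p.
apply: (star_hom_eq jG (f := Phi \o h) (g := id)) => [|//|a [] [z _ <-] /=].
- exact: star_hom_comp.
- by have [b _ <-] : range q z by [rewrite qs]; rewrite hA pi'E PE gA.
- by have [x _ <-] : range p z by [rewrite ps]; rewrite hX t'p PE gX.
Qed.

End QuotientIso.

(** * Limits of sequences and Hilbert sums of modules *)

Section Nlim.
Variables (R : realType) (V W : normedModType R[i]).

Lemma nlim_uniq (u : nat -> V) l l' : nlim u l -> nlim u l' -> l = l'.
Proof.
move=> h h'; apply: eq_nr => e e0; have e2 : 0 < e / 2 by rewrite divr_gt0.
have [N hN] := h _ e2; have [M hM] := h' _ e2.
apply: (le_trans (nr_tri (u (maxn N M)) _ _)); rewrite [leRHS]splitr lerD //.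
  by apply: hN; rewrite leq_maxl.
by rewrite nrC; apply: hM; rewrite leq_maxr.
Qed.

Lemma nlimD (u v : nat -> V) l m : nlim u l -> nlim v m -> nlim (fun n => u n + v n) (l + m).
Proof.
move=> h h' e e0; have e2 : 0 < e / 2 by rewrite divr_gt0.
have [N hN] := h _ e2; have [M hM] := h' _ e2; exists (maxn N M) => n; rewrite geq_max => /andP[Nn Mn].
rewrite (_ : _ - _ = (l - u n) + (m - v n)); last by lmodule R.
by rewrite [leRHS]splitr (le_trans (nrD _ _)) // lerD ?hN ?hM.
Qed.

Lemma nlim_map (L : V -> W) (C : R) (u : nat -> V) l : 0 <= C ->
  (forall x y, nr (L x - L y) <= C * nr (x - y)) -> nlim u l -> nlim (fun n => L (u n)) (L l).
Proof.
move=> C0 hL h e e0; have d0 : 0 < e / (1 + C) by rewrite divr_gt0 // ltr_pwDl.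
have [N hN] := h _ d0; exists N => n /hN hn; rewrite (le_trans (hL _ _)) // mulrC.
by rewrite (le_trans (ler_wpM2r C0 hn)) //; apply: frac_small => //; exact: ltW.
Qed.

Lemma nlimZ (k : R[i]) (u : nat -> V) l : nlim u l -> nlim (fun n => k *: u n) (k *: l).
Proof.
move=> h e e0; have d0 : 0 < e / (1 + cabs k) by rewrite divr_gt0 // ltr_pwDl // cabs_ge0.
have [N hN] := h _ d0; exists N => n /hN hn; rewrite -scalerBr nrZ mulrC.
by rewrite (le_trans (ler_wpM2r (cabs_ge0 _) hn)) //; apply: frac_small; rewrite ?cabs_ge0 // ltW.
Qed.

Lemma nlim_nr (u : nat -> V) l (C : R) : nlim u l -> (forall n, nr (u n) <= C) -> nr l <= C.
Proof.
move=> h hC; apply/ler_addgt0Pr => e e0; have [N hN] := h e e0.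
by apply: (le_trans (nr_distl l (u N))); rewrite lerD ?hC ?hN.
Qed.

Lemma nlim_cst (l : V) : nlim (fun=> l) l.
Proof. by move=> e e0; exists 0%N => n _; rewrite subrr nr0 ltW. Qed.

Lemma nlim_ext (u v : nat -> V) l : u =1 v -> nlim u l -> nlim v l.
Proof. by move=> uv h e /h[N hN]; exists N => n; rewrite -uv; exact: hN. Qed.

Lemma nlim_sum (I : Type) (r : seq I) (u : I -> nat -> V) (l : I -> V) : (forall k, nlim (u k) (l k)) ->
  nlim (fun n => \sum_(k <- r) u k n) (\sum_(k <- r) l k).
Proof.
move=> h; elim: r => [|i r IH].
  by rewrite big_nil; apply: nlim_ext (nlim_cst 0) => n; rewrite big_nil.
by rewrite big_cons; apply: nlim_ext (nlimD (h i) IH) => n; rewrite big_cons.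
Qed.

End Nlim.

Section L2.
Variables (R : realType) (A : cstarAlg R) (Y : nat -> hilbMod A).
Local Notation fam := (forall n, Y n).
Implicit Types (f g h : fam) (a b N M k : nat).

Definition psd f g a b : A := \sum_(a <= k < b) hip (f k) (g k).
Definition faD f g : fam := fun n => f n + g n.
Definition faN f : fam := fun n => - f n.
Definition faZ (c : R[i]) f : fam := fun n => c *: f n.
Definition far f (c : A) : fam := fun n => ract (f n) c.

Lemma psd_pos f a b : cpositive (psd f f a b).
Proof. by apply: big_ind => [|x y|k _]; [exact: cpos0|exact: cposD|exact: hip_pos]. Qed.

Lemma psdDr f g h a b : psd f (faD g h) a b = psd f g a b + psd f h a b.
Proof. by rewrite -big_split; apply: eq_bigr => k _; rewrite hipDr. Qed.
Lemma psdDl f g h a b : psd (faD f g) h a b = psd f h a b + psd g h a b.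
Proof. by rewrite -big_split; apply: eq_bigr => k _; rewrite hipDl. Qed.
Lemma psdZr c f g a b : psd f (faZ c g) a b = c *: psd f g a b.
Proof. by rewrite /psd scaler_sumr; apply: eq_bigr => k _; rewrite hipZr. Qed.
Lemma psdZl c f g a b : psd (faZ c f) g a b = conjc c *: psd f g a b.
Proof. by rewrite /psd scaler_sumr; apply: eq_bigr => k _; rewrite hipZl. Qed.
Lemma psdrr f g c a b : psd f (far g c) a b = psd f g a b ** c.
Proof.
rewrite /psd; elim/big_rec2: _ => [|k x y _ ->]; first by rewrite cmul0l.
by rewrite cmulDl hip_ract.
Qed.
Lemma psd_star f g a b : cstar (psd f g a b) = psd g f a b.
Proof.
rewrite /psd; elim/big_rec2: _ => [|k x y _ <-]; first by rewrite cstar0.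
by rewrite cstarD hip_star.
Qed.
Lemma psd_cat f g a b N : (a <= b)%N -> (b <= N)%N -> psd f g a N = psd f g a b + psd f g b N.
Proof. by move=> ab bN; rewrite /psd (big_cat_nat ab bN). Qed.

Lemma psd_sub f a b a' b' : (a' <= a)%N -> (b <= b')%N -> cpositive (psd f f a' b' - psd f f a b).
Proof.
move=> ha hb; have [ba|ab] := leqP b a.
  by rewrite /psd [X in _ - X]big_geq // subr0; exact: psd_pos.
rewrite (@psd_cat _ _ a' a b') ?(@psd_cat _ _ a b b') //; try lia.
rewrite (_ : _ - _ = psd f f a' a + psd f f b b'); last by lmodule R.
by apply: cposD; exact: psd_pos.
Qed.

Lemma psd_mono f a b a' b' : (a' <= a)%N -> (b <= b')%N -> nr (psd f f a b) <= nr (psd f f a' b').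
Proof. by move=> ha hb; apply: cpos_le; [exact: psd_pos|exact: psd_sub]. Qed.

(* [b (a + b) |f|^2 + a (a + b) |g|^2 - a b |f + g|^2 = |b f - a g|^2]. *)
Lemma psd_tri f g a b (x y : R) : 0 < x -> 0 < y -> nr (psd f f a b) <= x ^+ 2 -> nr (psd g g a b) <= y ^+ 2 ->
  nr (psd (faD f g) (faD f g) a b) <= (x + y) ^+ 2.
Proof.
move=> x0 y0 hf hg.
have e1 : (y * (x + y))%:C *: psd f f a b + (x * (x + y))%:C *: psd g g a b - (x * y)%:C *: psd (faD f g) (faD f g) a b =
    psd (faD (faZ y%:C f) (faZ (- x%:C) g)) (faD (faZ y%:C f) (faZ (- x%:C) g)) a b.
  have -> : (y * (x + y))%:C = y%:C * (x%:C + y%:C) by rewrite rmorphM rmorphD.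
  have -> : (x * (x + y))%:C = x%:C * (x%:C + y%:C) by rewrite rmorphM rmorphD.
  have -> : (x * y)%:C = x%:C * y%:C by rewrite rmorphM.
  have cx : conjc (- x%:C) = - x%:C by rewrite -[- x%:C](rmorphN (real_complex R)); exact: conjc_real.
  rewrite !(psdDl, psdDr, psdZl, psdZr) cx conjc_real.
  by move: (x%:C) (y%:C) => p q; lmodule R.
have q1 : 0 < y * (x + y) by rewrite mulr_gt0 // addr_gt0.
have q2 : 0 < x * (x + y) by rewrite mulr_gt0 // addr_gt0.
have q3 : 0 < x * y by rewrite mulr_gt0.
rewrite -(ler_pM2l q3) -{1}[x * y]gtr0_norm // -nrZr.
apply: (@le_trans _ _ (nr ((y * (x + y))%:C *: psd f f a b + (x * (x + y))%:C *: psd g g a b))).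
  apply: cpos_le; first by apply: cposZ; [exact: ltW|exact: psd_pos].
  by rewrite e1; exact: psd_pos.
rewrite (le_trans (nrD _ _)) // !nrZr !gtr0_norm //.
have -> : x * y * (x + y) ^+ 2 = y * (x + y) * x ^+ 2 + x * (x + y) * y ^+ 2 by ring.
by apply: lerD; rewrite ler_pM2l.
Qed.

Lemma psd_add f g a b : nr (psd (faD f g) (faD f g) a b) <= 2 * nr (psd f f a b) + 2 * nr (psd g g a b).
Proof.
have e1 : 2%:C *: psd f f a b + 2%:C *: psd g g a b - psd (faD f g) (faD f g) a b =
    psd (faD f (faZ (-1) g)) (faD f (faZ (-1) g)) a b.
  by rewrite !(psdDl, psdDr, psdZl, psdZr) rmorphN1 rmorph_nat; lmodule R.
apply: (@le_trans _ _ (nr (2%:C *: psd f f a b + 2%:C *: psd g g a b))).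
  by apply: cpos_le; [exact: psd_pos|rewrite e1; exact: psd_pos].
by rewrite (le_trans (nrD _ _)) // !nrZr !gtr0_norm.
Qed.

(** Polarisation: 2 <f, g> is a combination of the inner squares of f + g, f + j g, f and g, with j
    the imaginary unit. The constant is crude but suffices for Cauchy tails. *)
Lemma psd_bound f g a b : nr (psd f g a b) <= 3 * (nr (psd f f a b) + nr (psd g g a b)).
Proof.
have [j [jj cj jn]] : exists j : R[i], [/\ j * j = -1, conjc j = - j & cabs j = 1].
  exists 'i%C; split; first by rewrite -expr2 sqr_i.
    by apply/eqP; rewrite eq_complex /= oppr0 !eqxx.
  by rewrite /cabs normc_def /= expr0n expr1n add0r sqrtr1.
have e1 : 2%:C *: psd f g a b = (psd (faD f g) (faD f g) a b - psd f f a b - psd g g a b)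
    - j *: (psd (faD f (faZ j g)) (faD f (faZ j g)) a b - psd f f a b - psd g g a b).
  rewrite !(psdDl, psdDr, psdZl, psdZr) cj rmorph_nat.
  have jjl (u : A) : j *: (j *: u) = - u by rewrite scalerA jj scaleN1r.
  by rewrite !(scalerDr, scalerN, scaleNr, jjl); lmodule R.
have h1 := psd_add f g a b; have h2 := psd_add f (faZ j g) a b.
have hj : nr (psd (faZ j g) (faZ j g) a b) = nr (psd g g a b).
  by rewrite psdZl psdZr !nrZ cabsJ jn !mul1r.
rewrite hj in h2; set F := nr (psd f f a b) in h1 h2 *; set G := nr (psd g g a b) in h1 h2 *.
have h3 : 2 * nr (psd f g a b) = nr (2%:C *: psd f g a b) by rewrite nrZr gtr0_norm.
have b1 (u : A) (C : R) : nr u <= C -> nr (u - psd f f a b - psd g g a b) <= C + F + G.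
  by move=> hu; rewrite (le_trans (nrB _ _)) // lerD // (le_trans (nrB _ _)) // lerD.
have := nrB (psd (faD f g) (faD f g) a b - psd f f a b - psd g g a b)
  (j *: (psd (faD f (faZ j g)) (faD f (faZ j g)) a b - psd f f a b - psd g g a b)).
rewrite -e1 -h3 nrZ jn mul1r; have := b1 _ _ h1; have := b1 _ _ h2; lra.
Qed.

(** Norm convergence in A of the sum of the <f_n, f_n>, which is weaker than summability of the
    |f_n|^2. *)
Definition summ f := forall e : R, 0 < e -> exists N, forall n, (N <= n)%N -> nr (psd f f N n) <= e.

Lemma summ0 : summ (fun n => 0).
Proof. by move=> e e0; exists 0%N => n _; rewrite /psd big1 ?nr0 ?ltW // => k _; rewrite hip0l. Qed.

Lemma summD f g : summ f -> summ g -> summ (faD f g).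
Proof.
move=> hf hg e e0; have e4 : 0 < e / 4 by rewrite divr_gt0.
have [N hN] := hf _ e4; have [M hM] := hg _ e4; exists (maxn N M) => n hn.
have [Nn Mn] : (N <= n)%N /\ (M <= n)%N by move: hn; rewrite geq_max => /andP.
apply: (le_trans (psd_add _ _ _ _)).
have := le_trans (psd_mono f (leq_maxl N M) (leqnn n)) (hN _ Nn).
have := le_trans (psd_mono g (leq_maxr N M) (leqnn n)) (hM _ Mn); lra.
Qed.

Lemma summZ c f : summ f -> summ (faZ c f).
Proof.
move=> hf e e0; have d0 : 0 < e / (1 + cabs c ^+ 2) by rewrite divr_gt0 // ltr_pwDl // sqr_ge0.
have [N hN] := hf _ d0; exists N => n /hN hn.
rewrite psdZl psdZr !nrZ cabsJ mulrA -expr2 mulrC (le_trans (ler_wpM2r (sqr_ge0 _) hn)) //.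
by apply: frac_small; rewrite ?sqr_ge0 // ltW.
Qed.

Lemma summN f : summ f -> summ (faN f).
Proof.
move=> /(summZ (-1)); rewrite (_ : faZ (-1) f = faN f) //.
by apply: functional_extensionality_dep => n; exact: scaleN1r.
Qed.

Lemma summr f c : summ f -> summ (far f c).
Proof.
move=> hf e e0; have d0 : 0 < e / (1 + nr c ^+ 2) by rewrite divr_gt0 // ltr_pwDl // sqr_ge0.
have [N hN] := hf _ d0; exists N => n /hN hn.
rewrite psdrr -[X in X ** c]psd_star psdrr cstarM psd_star.
rewrite (le_trans (nrM _ _)) // (le_trans (ler_wpM2r (nr_ge0 _) (nrM _ _))) // nr_star mulrAC -expr2 mulrC.
rewrite (le_trans (ler_wpM2r (sqr_ge0 _) hn)) //.
by apply: frac_small; rewrite ?sqr_ge0 // ltW.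
Qed.

Record l2 := L2El { l2v :> fam; l2P : summ l2v }.
HB.instance Definition _ := gen_eqMixin l2.
HB.instance Definition _ := gen_choiceMixin l2.

Lemma l2_ext (f g : l2) : (forall n, l2v f n = l2v g n) -> f = g.
Proof.
case: f g => f pf [g pg] /= e; have e' := functional_extensionality_dep e.
by case: _ / e' pg => pg; congr L2El; exact: Prop_irrelevance.
Qed.

Let add (f g : l2) := L2El (summD (l2P f) (l2P g)).
Let opp (f : l2) := L2El (summN (l2P f)).
Let zero := L2El summ0.
Let scale c (f : l2) := L2El (summZ c (l2P f)).

Let addA : associative add.
Proof. by move=> f g h; apply: l2_ext => n /=; rewrite /faD addrA. Qed.
Let addC : commutative add.
Proof. by move=> f g; apply: l2_ext => n /=; rewrite /faD addrC. Qed.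
Let add0 : left_id zero add.
Proof. by move=> f; apply: l2_ext => n /=; rewrite /faD add0r. Qed.
Let addN : left_inverse zero opp add.
Proof. by move=> f; apply: l2_ext => n /=; rewrite /faD /faN addNr. Qed.
HB.instance Definition _ := GRing.isZmodule.Build l2 addA addC add0 addN.

Let scA (a b : R[i]) (f : l2) : scale a (scale b f) = scale (a * b) f.
Proof. by apply: l2_ext => n /=; rewrite /faZ scalerA. Qed.
Let sc1 : left_id 1 scale.
Proof. by move=> f; apply: l2_ext => n /=; rewrite /faZ scale1r. Qed.
Let scDr : right_distributive scale +%R.
Proof. by move=> k f g; apply: l2_ext => n /=; rewrite /faZ /faD scalerDr. Qed.
Let scDl (f : l2) : {morph scale^~ f : a b / (a + b)%R}.
Proof. by move=> a b; apply: l2_ext => n /=; rewrite /faZ /faD scalerDl. Qed.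
HB.instance Definition _ := GRing.Zmodule_isLmodule.Build R[i] l2 scA sc1 scDr scDl.

Lemma psd_tail f g N n : (N <= n)%N -> psd f g 0 n - psd f g 0 N = psd f g N n.
Proof. by move=> Nn; rewrite (@psd_cat _ _ 0 N n) // addrAC subrr add0r. Qed.

Lemma lhip_ex (f g : l2) : exists l, nlim (psd f g 0) l.
Proof.
apply: nr_complete => e e0; have e6 : 0 < e / 6 by rewrite divr_gt0.
have [N hN] := l2P f e6; have [M hM] := l2P g e6; exists (maxn N M) => n hn.
have [Nn Mn] : (N <= n)%N /\ (M <= n)%N by move: hn; rewrite geq_max => /andP.
rewrite psd_tail // (le_trans (psd_bound _ _ _ _)) //.
have := le_trans (psd_mono f (leq_maxl N M) (leqnn n)) (hN _ Nn).
have := le_trans (psd_mono g (leq_maxr N M) (leqnn n)) (hM _ Mn); lra.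
Qed.

Definition lhip (f g : l2) : A := proj1_sig (cid (lhip_ex f g)).
Lemma lhipP (f g : l2)  : nlim (psd f g 0) (lhip f g).
Proof. by rewrite /lhip; case: cid. Qed.

Lemma lhip_eq (f g : l2) l : nlim (psd f g 0) l -> lhip f g = l.
Proof. exact: (nlim_uniq (lhipP f g)). Qed.

Lemma lhip_lin (f : l2)  : linear (lhip f).
Proof.
move=> c g h; apply: lhip_eq; apply: nlim_ext (nlimD (nlimZ c (lhipP f g)) (lhipP f h)) => n.
by rewrite -psdZr -psdDr.
Qed.

Lemma lhip_star (f g : l2)  : cstar (lhip f g) = lhip g f.
Proof.
apply/esym/lhip_eq; apply: nlim_ext (nlim_map ler01 _ (lhipP f g)) => [n|x y]; first exact: psd_star.
by rewrite -cstarB nr_star mul1r.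
Qed.

Lemma lhip_sub (f : l2) a b : cpositive (lhip f f - psd f f a b).
Proof.
apply: cpos_closed => e e0; have [N hN] := lhipP f f e0.
exists (psd f f 0 (maxn N b) - psd f f a b); first by apply: psd_sub => //; rewrite leq_maxr.
by rewrite opprB addrA subrK; apply: hN; rewrite leq_maxl.
Qed.

Lemma lhip_pos (f : l2)  : cpositive (lhip f f).
Proof. by have := @lhip_sub f 0 0; rewrite /psd big_geq // subr0. Qed.

Definition l2N (f : l2) : R := Num.sqrt (nr (lhip f f)).

Lemma l2N_sq (f : l2)  : l2N f ^+ 2 = nr (lhip f f).
Proof. by rewrite sqr_sqrtr // nr_ge0. Qed.
Lemma l2N_ge0 (f : l2)  : 0 <= l2N f. Proof. exact: sqrtr_ge0. Qed.

Lemma l2N_psd (f : l2) a b : nr (psd f f a b) <= l2N f ^+ 2.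
Proof. by rewrite l2N_sq; apply: cpos_le; [exact: psd_pos|exact: lhip_sub]. Qed.

Lemma l2N_comp (f : l2) n : nr (f n) <= l2N f.
Proof.
rewrite -(ler_pXn2r (n := 2)) ?nnegrE ?nr_ge0 ?l2N_ge0 // -nr_hip.
by have := @l2N_psd f n n.+1; rewrite /psd big_nat1.
Qed.

Lemma l2N_le (f : l2) (C : R) : 0 <= C -> (forall n, nr (psd f f 0 n) <= C ^+ 2) -> l2N f <= C.
Proof.
move=> C0 h; rewrite -(ler_pXn2r (n := 2)) ?nnegrE ?l2N_ge0 // l2N_sq.
exact: nlim_nr (lhipP f f) h.
Qed.

Lemma l2N_D (f g : l2) : l2N (f + g) <= l2N f + l2N g.
Proof.
apply/ler_addgt0Pr => e e0; have e2 : 0 < e / 2 by rewrite divr_gt0.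
have p1 : 0 < l2N f + e / 2 by rewrite ltr_wpDl // l2N_ge0.
have p2 : 0 < l2N g + e / 2 by rewrite ltr_wpDl // l2N_ge0.
rewrite (_ : _ + e = (l2N f + e / 2) + (l2N g + e / 2)); last by lra.
apply: l2N_le => [|n]; first by rewrite addr_ge0 // ltW.
apply: psd_tri => //; apply: (le_trans (l2N_psd _ _ _)).
  by rewrite ler_pXn2r ?nnegrE ?l2N_ge0 ?(ltW p1) // lerDl ltW.
by rewrite ler_pXn2r ?nnegrE ?l2N_ge0 ?(ltW p2) // lerDl ltW.
Qed.

Lemma l2N_Z c (f : l2) : l2N (c *: f) = cabs c * l2N f.
Proof.
apply/eqP; rewrite -(eqrXn2 (n := 2)) ?mulr_ge0 ?cabs_ge0 ?l2N_ge0 // exprMn !l2N_sq.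
have -> : lhip (c *: f) (c *: f) = (conjc c * c) *: lhip f f.
  apply: lhip_eq; apply: nlim_ext (nlimZ _ (lhipP f f)) => n.
  by rewrite [RHS]psdZl psdZr scalerA.
by rewrite nrZ cabsM cabsJ -expr2.
Qed.

Lemma psd_lim (v : nat -> fam) (w : fam) (C : R) a b : (forall n, nlim (fun i => v i n) (w n)) ->
  (forall i, nr (psd (v i) (v i) a b) <= C) -> nr (psd w w a b) <= C.
Proof.
move=> hv hC; apply: (@nlim_nr _ _ (fun i => psd (v i) (v i) a b)) => //.
apply: (@nlim_sum _ _ _ _ (fun k i => hip (v i k) (v i k)) (fun k => hip (w k) (w k))) => k e e0.
pose c := 2 * nr (w k) + 1; have c0 : 0 <= c by rewrite addr_ge0 ?mulr_ge0 ?nr_ge0.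
pose d := Num.min 1 (e / (1 + c)).
have d0 : 0 < d by rewrite lt_min ltr01 divr_gt0 // ltr_pwDl.
have [N hN] := hv k _ d0; exists N => i /hN hi.
have -> : hip (w k) (w k) - hip (v i k) (v i k) = hip (w k - v i k) (w k) + hip (v i k) (w k - v i k).
  by rewrite hipBl hipBr; lmodule R.
have d1 : d <= 1 by rewrite ge_min lexx.
have vn : nr (v i k) <= nr (w k) + 1 by have := nr_distl (v i k) (w k); rewrite [nr (v i k - _)]nrC; lra.
apply: (le_trans (nrD _ _)); apply: (le_trans (lerD (CS _ _) (CS _ _))).
apply: (@le_trans _ _ (d * c)); last first.
  apply: (@le_trans _ _ (e / (1 + c) * c)); first by rewrite ler_wpM2r // ge_min lexx orbT.
  by apply: frac_small => //; exact: ltW.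
have := ler_wpM2r (nr_ge0 (w k)) hi; have := ler_wpM2r (nr_ge0 (w k - v i k)) vn.
have := ler_wpM2l (addr_ge0 (nr_ge0 (w k)) ler01) hi; rewrite /c; lra.
Qed.

Lemma l2_banach : banach_norm l2N.
Proof.
split=> [f g|c f|f f0|u hu]; [exact: l2N_D|exact: l2N_Z| |].
- by apply: l2_ext => n; apply: nr_le0; rewrite -f0; exact: l2N_comp.
- have hc n : exists l, nlim (fun j => u j n) l.
    apply: nr_complete => e /hu[M hM]; exists M => j /hM; apply: le_trans.
    exact: (l2N_comp (u j - u M) n).
  pose l : fam := fun n => proj1_sig (cid (hc n)).
  have hl n : nlim (fun j => u j n) (l n) by rewrite /l; case: cid.
  have key (e : R) : 0 < e -> exists M, forall j, (M <= j)%N -> forall a b,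
      nr (psd (faD l (faN (u j))) (faD l (faN (u j))) a b) <= e ^+ 2.
    move=> e0; have e2 : 0 < e / 2 by rewrite divr_gt0.
    have [M hM] := hu _ e2; exists M => j Mj a b.
    apply: (@psd_lim (fun i => faD (u (i + M)%N) (faN (u j)))) => [n|i].
      apply: nlimD; last exact: nlim_cst.
      move=> d /(hl n)[P hP]; exists P => i Pi; apply: hP; exact: leq_trans Pi (leq_addr _ _).
    apply: (le_trans (@l2N_psd (u (i + M)%N - u j) a b)).
    rewrite ler_pXn2r ?nnegrE ?l2N_ge0 ?(ltW e0) //.
    rewrite (_ : _ - _ = (u (i + M)%N - u M) + (-1) *: (u j - u M)); last first.
      by rewrite scaleN1r opprB addrA subrK.
    apply: (le_trans (l2N_D _ _)); rewrite l2N_Z -[-1](rmorphN1 (real_complex R)) cabs_real normrN1 mul1r.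
    by rewrite [leRHS]splitr lerD // hM // leq_addl.
  have ls : summ l.
    move=> e e0; have e8 : 0 < Num.sqrt (e / 4) by rewrite sqrtr_gt0 divr_gt0.
    have [M /(_ M (leqnn _)) hM] := key _ e8; rewrite sqr_sqrtr ?divr_ge0 ?(ltW e0) // in hM.
    have e4 : 0 < e / 4 by rewrite divr_gt0.
    have [N hN] := l2P (u M) e4; exists N => n /hN hn.
    rewrite (_ : l = faD (faD l (faN (u M))) (u M)).
      have := psd_add (faD l (faN (u M))) (u M) N n; have := hM N n; lra.
    by apply: functional_extensionality_dep => k; rewrite /faD /faN subrK.
  exists (L2El ls) => e e0; have [M hM] := key _ e0; exists M => n /hM hn.
  by apply: l2N_le => [|k]; [exact: ltW|exact: hn].
Qed.

Definition l2B := banach l2_banach.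

Lemma l2_nr (f : l2B) : nr f = l2N f.
Proof. exact: nr_banach. Qed.

Definition l2ract (f : l2B) (c : A) : l2B := L2El (summr c (l2P f)).

Lemma l2ractA (f : l2B) (c d : A) : l2ract f (c ** d) = l2ract (l2ract f c) d.
Proof. by apply: l2_ext => n; exact: ractA. Qed.
Lemma l2ract_linl (c : A) : linear (fun f : l2B => l2ract f c).
Proof. by move=> k f g; apply: l2_ext => n; exact: ract_linl. Qed.
Lemma l2ract_linr (f : l2B) : linear (l2ract f).
Proof. by move=> k c d; apply: l2_ext => n; exact: ract_linr. Qed.
Lemma lhip_ract (f g : l2B) (c : A) : lhip f (l2ract g c) = lhip f g ** c.
Proof.
apply: lhip_eq; have hL (x y : A) : nr (x ** c - y ** c) <= nr c * nr (x - y) by rewrite -cmulBl mulrC nrM.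
apply: nlim_ext (nlim_map (nr_ge0 c) hL (lhipP f g)) => n.
exact/esym/psdrr.
Qed.
Lemma lhip_norm (f : l2B) : `|f| ^+ 2 = `|lhip f f|.
Proof. by rewrite !nrE l2_nr -rmorphXn l2N_sq. Qed.

Definition l2sum : hilbMod A :=
  @HilbMod R A l2B l2ract lhip l2ractA l2ract_linl l2ract_linr lhip_lin lhip_ract lhip_star lhip_pos lhip_norm.

Definition co (n : nat) (f : l2sum) : Y n := l2v f n.

Lemma co_ext (f g : l2sum) : (forall n, co n f = co n g) -> f = g.
Proof. exact: l2_ext. Qed.
Lemma co_lin n : linear (@co n). Proof. by []. Qed.
Lemma coB n (f g : l2sum) : co n (f - g) = co n f - co n g. Proof. by []. Qed.
Lemma co_ract n (f : l2sum) c : co n (ract f c) = ract (co n f) c. Proof. by []. Qed.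
Lemma co_nr n (f : l2sum) : nr (co n f) <= nr f. Proof. by rewrite l2_nr; exact: l2N_comp. Qed.
Lemma hip_co (f g : l2sum) : nlim (fun n => \sum_(0 <= k < n) hip (co k f) (co k g)) (hip f g).
Proof. exact: lhipP. Qed.

(** The window of summation may grow by one index on each side, so that the criterion covers
    diagonal operators and shifts in both directions. *)
Lemma l2_dom (f : l2sum) (h : fam) (M : R) : 0 <= M ->
  (forall a c, nr (psd h h a c) <= M ^+ 2 * nr (psd (co^~ f) (co^~ f) a.-1 c.+1)) ->
  exists2 g : l2sum, (forall n, co n g = h n) & nr g <= M * nr f.
Proof.
move=> M0 hM.
have hs : summ h.
  move=> e e0; have d0 : 0 < e / (1 + M ^+ 2) by rewrite divr_gt0 // ltr_pwDl // sqr_ge0.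
  have [N hN] := l2P f d0; exists N.+1 => n Nn; apply: (le_trans (hM _ _)).
  have hn : nr (psd f f N n.+1) <= e / (1 + M ^+ 2) by apply: hN; lia.
  by rewrite mulrC (le_trans (ler_wpM2r (sqr_ge0 _) hn)) //; apply: frac_small; rewrite ?sqr_ge0 // ltW.
exists (L2El hs : l2sum) => //; rewrite !l2_nr; apply: l2N_le => [|n]; first by rewrite mulr_ge0 ?l2N_ge0.
rewrite exprMn (le_trans (hM _ _)) // ler_wpM2l ?sqr_ge0 //; exact: l2N_psd.
Qed.

Lemma inj_summ n (y : Y n) : summ (dfwith (fun k => 0 : Y k) y).
Proof.
move=> e e0; exists n.+1 => m _; rewrite /psd big_nat_cond big1 ?nr0 ?(ltW e0) // => k /andP[/andP[nk _] _].
by rewrite dfwith_out ?hip0l //; lia.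
Qed.

Definition l2in n (y : Y n) : l2sum := L2El (inj_summ y).

Lemma co_inj n y : co n (l2in y) = y. Proof. by rewrite /co /= dfwith_in. Qed.
Lemma co_inj0 n k (y : Y n) : k != n -> co k (l2in y) = 0.
Proof. by rewrite eq_sym => h; rewrite /co /= dfwith_out. Qed.

Lemma hip_inj_co n (y : Y n) (f : l2sum) : hip (l2in y) f = hip y (co n f).
Proof.
apply: (nlim_uniq (hip_co _ _)) => e e0; exists n.+1 => m nm.
rewrite (bigD1_seq n) ?mem_index_iota ?iota_uniq // co_inj big1; last by move=> k kn; rewrite co_inj0 // hip0l.
by have -> : forall u : A, u - (u + 0) = 0 by [move=> u; rewrite addr0 subrr]; rewrite nr0 ltW.
Qed.

Lemma inj_lin n : linear (@l2in n).
Proof.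
move=> c u v; apply: co_ext => k; rewrite co_lin; have [->|kn] := eqVneq k n; first by rewrite !co_inj.
by rewrite !co_inj0 // scaler0 addr0.
Qed.

Lemma inj_ract n (y : Y n) c : ract (l2in y) c = l2in (ract y c).
Proof.
apply: co_ext => k; rewrite co_ract; have [->|kn] := eqVneq k n; first by rewrite !co_inj.
by rewrite !co_inj0 // ract0l.
Qed.

Lemma inj_nr n (y : Y n) : nr (l2in y) = nr y.
Proof.
by apply/eqP; rewrite -(eqrXn2 (n := 2)) ?nr_ge0 // -!nr_hip hip_inj_co co_inj.
Qed.

End L2.

(* With [f^* f = M^2 (1 - (1 - y)^2)], the difference is [M^2 <x - y x, x - y x>]. *)
Lemma op_cpos (R : realType) (A : cstarAlg R) (Y Z : hilbMod A) (f : Y -> Z) f' (M : R) :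
  is_adjoint f f' -> 0 <= M -> obd f M ->
  forall x, cpositive ((M ^+ 2)%:C *: hip x x - hip (f x) (f x)).
Proof.
move=> ff' M0 hM x; have [Mp|Mz] := ltP 0 M; last first.
  have {Mz M0} M0 : M = 0 by apply/eqP; rewrite eq_le Mz M0.
  have -> : f x = 0 by apply: nr_le0; rewrite (le_trans (hM x)) // M0 mul0r.
  rewrite M0 expr0n hip0l scale0r subr0; exact: cpos0.
have [F FE] : exists F : LOp (@CS R A Y), lapp F = (fun y => ((M ^+ 2)^-1)%:C *: f' (f y)).
  apply: (@LOp_mk _ _ _ (@CS R A Y) _ (fun y => ((M ^+ 2)^-1)%:C *: f' (f y)) 1).
    by move=> y z; rewrite hipZl hipZr conjc_real (adj_sym ff') ff'.
  move=> y; rewrite nrZr gtr0_norm ?invr_gt0 ?exprn_gt0 // ler_pdivrMl ?exprn_gt0 // mul1r.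
  by rewrite (le_trans (obd_adj M0 ff' hM _)) // expr2 -mulrA ler_wpM2l.
have [||S [Ss SE _ _]] := @sqrt_one_minus R (LOp (@CS R A Y)) F.
- apply: lapp_ext => y; congr (_ y); apply: (adj_uniq (lapp_adj F)).
  by rewrite FE => v w; rewrite hipZl hipZr conjc_real (adj_sym ff') ff'.
- apply: lapp_bound => // y; rewrite FE mul1r nrZr gtr0_norm ?invr_gt0 ?exprn_gt0 //.
  rewrite ler_pdivrMl ?exprn_gt0 //.
  by rewrite (le_trans (obd_adj M0 ff' hM _)) // expr2 -mulrA ler_wpM2l.
have aS := lapp_adj S; rewrite Ss in aS.
have -> : (M ^+ 2)%:C *: hip x x - hip (f x) (f x) = (M ^+ 2)%:C *: hip (x - lapp S x) (x - lapp S x).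
  have e1 : hip (f x) (f x) = (M ^+ 2)%:C *: hip x (lapp F x).
    rewrite FE hipZr -ff' scalerA -rmorphM mulfV ?scale1r //.
    by rewrite gt_eqF // exprn_gt0.
  rewrite e1 -scalerBr; congr (_ *: _).
  rewrite !(hipBl, hipBr) !aS -lappM.
  have := congr1 (fun Q => hip x (lapp Q x)) SE; rewrite !lappD !hipDr => h.
  by apply: (eq_diff h); lmodule R.
by apply: cposZ; [exact: sqr_ge0|exact: hip_pos].
Qed.

Section L2Ops.
Variables (R : realType) (A : cstarAlg R) (Y : nat -> hilbMod A).
Local Notation F := (l2sum Y).
Local Notation FL := (LOp (@CS R A F)).

Lemma psd_dom (f h : forall n, Y n) (M : R) a c :
  (forall n, cpositive ((M ^+ 2)%:C *: hip (f n) (f n) - hip (h n) (h n))) ->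
  nr (psd h h a c) <= M ^+ 2 * nr (psd f f a c).
Proof.
move=> hM; rewrite -[M ^+ 2]ger0_norm ?sqr_ge0 // -nrZr; apply: cpos_le; first exact: psd_pos.
rewrite /psd scaler_sumr -sumrB; apply: big_ind => [|x y|k _]; [exact: cpos0|exact: cposD|exact: hM].
Qed.

Lemma diag_op (d d' : forall n, Y n -> Y n) (M : R) : 0 <= M -> (forall n, is_adjoint (d n) (d' n)) ->
  (forall n, obd (d n) M) -> exists D : FL, [/\ forall f n, co n (lapp D f) = d n (co n f),
    forall f n, co n (lapp (cstar D) f) = d' n (co n f) & nr D <= M].
Proof.
move=> M0 ad bd.
have half (s s' : forall n, Y n -> Y n) : (forall n, is_adjoint (s n) (s' n)) ->
    (forall n, obd (s n) M) -> exists g : F -> F, (forall f n, co n (g f) = s n (co n f)) /\ forall f, nr (g f) <= M * nr f.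
  move=> as_ bs; have /choice[g hg] f : exists g : F, (forall n, co n g = s n (co n f)) /\ nr g <= M * nr f.
    have [a c|g g1 g2] := @l2_dom _ _ _ f (fun n => s n (co n f)) M M0; last by exists g.
    apply: le_trans (psd_dom _ _ (f := fun n => co n f) (M := M) _) _.
      by move=> n; apply: op_cpos (as_ n) M0 (bs n) _.
    by rewrite ler_wpM2l ?sqr_ge0 //; apply: psd_mono; lia.
  by exists g; split=> f; have [] := hg f.
have bd' n : obd (d' n) M by move=> z; exact: obd_adj M0 (ad n) (bd n) z.
have [g [g1 g2]] := half _ _ ad bd; have [g' [g'1 g'2]] := half _ _ (fun n => adj_sym (ad n)) bd'.
have gg' : is_adjoint g g'.
  move=> u v; apply: (nlim_uniq (hip_co (g u) v)); apply: nlim_ext (hip_co u (g' v)) => n.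
  by apply: eq_bigr => k _; rewrite g1 g'1 ad.
have [D DE] := LOp_mk (@CS R A F) gg' g2.
exists D; have aD := lapp_adj D; rewrite DE in aD.
split; [by rewrite DE|by rewrite -(adj_uniq gg' aD)|].
by apply: lapp_bound; rewrite ?DE.
Qed.

Lemma shift_op (s : forall n, Y n -> Y n.+1) (s' : forall n, Y n.+1 -> Y n) (M : R) : 0 <= M ->
  (forall n, is_adjoint (s n) (s' n)) -> (forall n, obd (s n) M) ->
  exists D : FL, [/\ forall f, co 0 (lapp D f) = 0, forall f n, co n.+1 (lapp D f) = s n (co n f) &
    forall f n, co n (lapp (cstar D) f) = s' n (co n.+1 f)].
Proof.
move=> M0 ad bd.
have bd' n z : nr (s' n z) <= M * nr z by exact: obd_adj M0 (ad n) (bd n) z.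
have /choice[g hg] f : exists g : F, [/\ co 0 g = 0, forall n, co n.+1 g = s n (co n f) & nr g <= M * nr f].
  pose h : forall n, Y n := fun n => match n return Y n with 0 => 0 | k.+1 => s k (co k f) end.
  have key a c : nr (psd h h a.+1 c) <= M ^+ 2 * nr (psd (fun k => co k f) (fun k => co k f) a c.-1).
    rewrite /psd big_add1 -[M ^+ 2]ger0_norm ?sqr_ge0 // -nrZr.
    apply: cpos_le; first by apply: (big_ind (@cpositive R A)) => [|x y|k _]; [exact: cpos0|exact: cposD|exact: hip_pos].
    rewrite scaler_sumr -sumrB; apply: (big_ind (@cpositive R A)) => [|x y|k _]; [exact: cpos0|exact: cposD|].
    exact: op_cpos (ad k) M0 (bd k) _.
  have [a c|g g1 g2] := @l2_dom _ _ _ f h M M0; last by exists g; split=> // n; rewrite g1.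
  case: a => [|a]; last first.
    by apply: (le_trans (key _ _)); rewrite ler_wpM2l ?sqr_ge0 //; apply: psd_mono; lia.
  case: c => [|c]; first by rewrite /psd big_geq // nr0 mulr_ge0 ?sqr_ge0 ?nr_ge0.
  have -> : psd h h 0 c.+1 = psd h h 1 c.+1.
    by rewrite /psd big_ltn // [hip (h 0%N) _]hip0l; exact: add0r.
  by apply: (le_trans (key _ _)); rewrite ler_wpM2l ?sqr_ge0 //; apply: psd_mono; lia.
have /choice[g' hg'] f : exists g : F, (forall n, co n g = s' n (co n.+1 f)).
  have [a c|p p1 p2] := @l2_dom _ _ _ f (fun n => s' n (co n.+1 f)) M M0; last by exists p.
  apply: (@le_trans _ _ (M ^+ 2 * nr (psd (fun k => co k f) (fun k => co k f) a.+1 c.+1))); last first.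
    by rewrite ler_wpM2l ?sqr_ge0 //; apply: psd_mono; lia.
  rewrite /psd big_add1 /= -[M ^+ 2]ger0_norm ?sqr_ge0 // -nrZr.
  apply: cpos_le; first by apply: (big_ind (@cpositive R A)) => [|x y|k _]; [exact: cpos0|exact: cposD|exact: hip_pos].
  rewrite scaler_sumr -sumrB; apply: (big_ind (@cpositive R A)) => [|x y|k _]; [exact: cpos0|exact: cposD|].
  exact: op_cpos (adj_sym (ad k)) M0 (bd' k) _.
have gg' : is_adjoint g g'.
  move=> u v; have [g0 g1 _] := hg u.
  have h : nlim (fun n => \sum_(0 <= k < n) hip (co k u) (co k (g' v))) (hip (g u) v).
    move=> e /(hip_co (g u) v)[N hN]; exists N => n Nn.
    have := hN n.+1 (leqW Nn); rewrite big_ltn // big_add1 /= g0 hip0l.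
    rewrite (_ : \sum_(0 <= i < n) _ = \sum_(0 <= k < n) hip (co k u) (co k (g' v))); last first.
      by apply: eq_bigr => k _; rewrite g1 hg' ad.
    by rewrite (_ : forall w : A, 0 + w = w) //; exact: add0r.
  exact: (nlim_uniq h (hip_co _ _)).
have [D DE] : exists D : FL, lapp D = g by apply: (LOp_mk (M := M) (@CS R A F) gg') => y; have [_ _ h] := hg y; exact: h.
exists D; have aD := lapp_adj D; rewrite DE in aD *.
split; [by move=> f; have [] := hg f|by move=> f n; have [_ h _] := hg f; exact: h|].
by rewrite -(adj_uniq gg' aD).
Qed.

End L2Ops.

(** * Compact operators form ideals *)

Section KsetComp.
Variables (R : realType) (A : cstarAlg R).

Lemma kset_compl (Y Z U : hilbMod A) (NY : set Y) (NZ : set Z) (NU : set U) (f : Z -> U) f' (M : R) g :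
  (forall z, NZ z -> NU (f z)) -> 0 <= M -> obd f M -> is_adjoint f f' -> kset NZ NY g -> kset NU NY (f \o g).
Proof.
move=> fN M0 fM ff' kg; have fl := adj_lin ff'.
have ft z y : f \o theta z y = theta (f z) y.
  by apply/funext => w; rewrite /theta /= (adj_ract ff').
move=> e e0; have d0 : 0 < e / (1 + M) by rewrite divr_gt0 // ltr_pwDl.
have [h hS bh] := kg _ d0; exists (f \o h).
  elim/lspan_ind: hS {bh} => [|c s v [z [y [hz hy ->]]] _ IH].
    by rewrite (_ : f \o 0 = 0); [exact: lspan0|apply/funext => y /=; exact: lin0 fl].
  rewrite (_ : f \o (c *: theta z y + v) = c *: theta (f z) y + (f \o v)).
    by apply: lspan_cons => //; exists (f z), y; split=> //; exact: fN.
  by rewrite -ft; apply/funext => w; rewrite /= fl.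
move=> y; rewrite (_ : ((f \o g) - (f \o h)) y = f ((g - h) y)); last by rewrite /= (linB fl).
rewrite (le_trans (fM _)) // (le_trans (ler_wpM2l M0 (bh y))) // mulrA ler_wpM2r ?nr_ge0 // mulrC.
by apply: frac_small => //; exact: ltW.
Qed.

Lemma kset_compr (Y Z U : hilbMod A) (NY : set Y) (NZ : set Z) (NU : set U) (f : U -> Y) f' (M : R) g :
  (forall y, NY y -> NU (f' y)) -> 0 <= M -> obd f M -> is_adjoint f f' -> kset NZ NY g -> kset NZ NU (g \o f).
Proof.
move=> fN M0 fM ff' kg; have [g' kg' gg'] := kset_adj kg.
have fM' : obd f' M by move=> z; exact: obd_adj M0 ff' fM z.
have k1 : kset NU NZ (f' \o g') by exact: kset_compl fN M0 fM' (adj_sym ff') kg'.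
have [h kh ah] := kset_adj k1.
have a2 : is_adjoint (f' \o g') (g \o f).
  by move=> z u; rewrite /= (adj_sym ff') (adj_sym gg').
by rewrite -(adj_uniq ah a2).
Qed.

Lemma kset_lop (Y : hilbMod A) (NZ NY : set Y) :
  let M := [set D : LOp (@CS R A Y) | kset NZ NY (lapp D)] in
  [/\ approx M `<=` M, M 0, forall D D', M D -> M D' -> M (D + D') & forall (c : R[i]) D, M D -> M (c *: D)].
Proof.
rewrite /mkset; split=> [D hD||D D' k k'|c D k].
- apply: kset_closed => e e0; have [D' kD' hD'] := hD _ e0.
  exists (lapp D') => // y; rewrite (_ : _ y = lapp (D - D') y); last by rewrite lappB.
  by rewrite (le_trans (lapp_le _ _)) // ler_wpM2r ?nr_ge0.
- by rewrite (_ : lapp 0 = 0); [exact: kset0|apply/funext => y; exact: lapp0].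
- rewrite (_ : lapp (D + D') = lapp D + lapp D'); first exact: ksetD.
  by apply/funext => y; rewrite lappD.
- rewrite (_ : lapp (c *: D) = c *: lapp D); first exact: ksetZ.
  by apply/funext => y; rewrite lappZ.
Qed.

Lemma kset_ideal (Y : hilbMod A) (J : set A) : cstar_ideal J ->
  cstar_ideal [set D : LOp (@CS R A Y) | kset (modI Y J) setT (lapp D)].
Proof.
move=> hJ; pose K D := kset (modI Y J) setT (lapp (D : LOp (@CS R A Y))); rewrite -/K; split.
- by apply/closedP; case: (kset_lop (modI Y J) setT).
- by case: (kset_lop (modI Y J) setT).
- by case: (kset_lop (modI Y J) setT).
- by case: (kset_lop (modI Y J) setT).
- move=> D D' k; rewrite /K /mkset (_ : lapp (D ** D') = lapp D \o lapp D'); last by apply/funext => y; rewrite lappM.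
  apply: (kset_compl (M := nr D) _ (nr_ge0 _) (lapp_le D) (lapp_adj D) k).
  by move=> z [w [j [Jj ->]]]; rewrite (adj_ract (lapp_adj D)); exact: modI_ractI.
- move=> D D' k; rewrite /K /mkset (_ : lapp (D ** D') = lapp D \o lapp D'); last by apply/funext => y; rewrite lappM.
  exact: (kset_compr (M := nr D') _ (nr_ge0 _) (lapp_le D') (lapp_adj D') k).
Qed.

End KsetComp.

(** * The Fock representation *)

Section Fock.
Variables (R : realType) (A : cstarAlg R) (X : corr A A) (T : tensor_powers X).
Local Notation E := (tpow T).
Local Notation tn := (@tens R A X T).
Definition fock := l2sum (fun n => E n : hilbMod A).
Local Notation F := fock.
Local Notation FL := (LOp (@CS R A F)).
Local Notation finj := (@l2in R A (fun k => E k : hilbMod A)).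

(** Left creation by [x]. The tensor powers are built by adding factors on the right, so tensoring
    on the left is defined by amplifying the operator [vec x]; [ann] is its adjoint. *)
Fixpoint cre (x : X) (n : nat) : E n -> E n.+1 :=
  match n return E n -> E n.+1 with
  | 0 => @vec R A X T 1 x
  | k.+1 => otimes1 (@cre x k)
  end.
Fixpoint ann (x : X) (n : nat) : E n.+1 -> E n :=
  match n return E n.+1 -> E n with
  | 0 => fun z : X => hip x z
  | k.+1 => otimes1 (@ann x k)
  end.

Lemma cre_adm x n : adm (@cre x n) (@ann x n).
Proof. by elim: n => [|n IH]; [exact: (@adm_vec _ _ _ T 1 x)|have [] := otimes1_adm IH]. Qed.

Lemma cre_bd x n : obd (@cre x n) (nr x).
Proof.
elim: n => [|n IH]; first exact: (@vec_bd _ _ _ T 1 x).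
by have [_ _ h] := otimes1_adm (cre_adm x n); apply: h => //; exact: nr_ge0.
Qed.

Lemma cre_tens x n y z : cre x (tn y z) = tn (@cre x n y) z.
Proof. by have [_ h _] := otimes1_adm (cre_adm x n); exact: h. Qed.

Lemma lact_adm n a : adm (lact (c := E n) a) (lact (cstar a)).
Proof.
split; [exact: lact_is_adj|by exists (nr a); [exact: nr_ge0|move=> y; exact: lact_bd]| |].
  by case: n => //; exists a.
by case: n => //; exists (cstar a).
Qed.

Lemma otimes1_lact n a : otimes1 (lact (c := E n) a) = lact (c := E n.+1) a.
Proof.
case: n => [|n]; first exact: (@otimes1_vec _ _ _ T 0 a).
by apply: otimes1_S => [|y x]; [exists (lact (cstar a)); exact: lact_is_adj|rewrite tens_lact].
Qed.

Lemma ann_cre x y n : @ann x n \o @cre y n = lact (c := E n) (hip x y).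
Proof.
elim: n => [|n IH]; first by apply/funext => a; rewrite /= /vec hip_ract.
by rewrite /= -(otimes1_comp (adm_sym (cre_adm x n)) (cre_adm y n)) IH otimes1_lact.
Qed.

Lemma lact_cre a x n : lact (c := E n.+1) a \o @cre x n = @cre (lact a x) n.
Proof.
elim: n => [|n IH]; first by apply/funext => b; rewrite /= /vec lact_ract.
transitivity (otimes1 (lact (c := E n.+1) a \o @cre x n)); last by rewrite IH.
by rewrite (otimes1_comp (lact_adm n.+1 a) (cre_adm x n)) otimes1_lact.
Qed.

Lemma cre_lact a x n : @cre x n \o lact (c := E n) a = @cre (ract x a) n.
Proof.
elim: n => [|n IH]; first by apply/funext => b; rewrite /= /vec ractA.
transitivity (otimes1 (@cre x n \o lact (c := E n) a)); last by rewrite IH.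
by rewrite (otimes1_comp (cre_adm x n) (lact_adm n a)) otimes1_lact.
Qed.

Lemma cre_lin k x y n : @cre (k *: x + y) n = k *: @cre x n + @cre y n.
Proof.
elim: n => [|n IH]; first exact: (@vec_lin _ _ _ T 1).
by rewrite /= -(otimes1_lin k (cre_adm x n) (cre_adm y n)) IH.
Qed.

Lemma fpi_ex a : exists D : FL, forall f n, co n (lapp D f) = lact (c := E n) a (co n f).
Proof.
have [||D [h _ _]] := @diag_op R A (fun n => E n) (fun n => lact a) (fun n => lact (cstar a)) (nr a) (nr_ge0 a).
- by move=> n; exact: lact_is_adj.
- by move=> n y; exact: lact_bd.
- by exists D.
Qed.
Definition fpi a : FL := proj1_sig (cid (fpi_ex a)).
Lemma fpiE a f n : co n (lapp (fpi a) f) = lact (c := E n) a (co n f).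
Proof. by rewrite /fpi; case: cid. Qed.

Lemma ft_ex x : exists D : FL, [/\ forall f, co 0 (lapp D f) = 0, forall f n, co n.+1 (lapp D f) = cre x (co n f) &
  forall f n, co n (lapp (cstar D) f) = ann x (co n.+1 f)].
Proof.
apply: (shift_op (nr_ge0 x)) => n; [by have [] := cre_adm x n|exact: cre_bd].
Qed.
Definition ft x : FL := proj1_sig (cid (ft_ex x)).
Lemma ft0 x f : co 0 (lapp (ft x) f) = 0.
Proof. by rewrite /ft; case: cid => D []. Qed.
Lemma ftS x f n : co n.+1 (lapp (ft x) f) = cre x (co n f).
Proof. by rewrite /ft; case: cid => D []. Qed.
Lemma ft_star x f n : co n (lapp (cstar (ft x)) f) = ann x (co n.+1 f).
Proof. by rewrite /ft; case: cid => D []. Qed.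

Lemma FL_ext (D D' : FL) : (forall f n, co n (lapp D f) = co n (lapp D' f)) -> D = D'.
Proof. by move=> h; apply: lapp_ext => f; apply: co_ext => n. Qed.

Lemma fock_rep : is_rep fpi ft.
Proof.
split.
- split=> [k a b|a b|a].
  + by apply: FL_ext => f n; rewrite lappD lappZ !(co_lin, fpiE) lact_lin.
  + by apply: FL_ext => f n; rewrite lappM !fpiE lactM.
  + apply: lapp_ext => f; congr (_ f); apply: adj_uniq (lapp_adj (fpi a)) => u v.
    apply: (nlim_uniq (hip_co _ _)); apply: nlim_ext (hip_co _ _) => n.
    by apply: eq_bigr => k _; rewrite !fpiE lact_adj.
- move=> k x y; apply: FL_ext => f [|n]; rewrite lappD lappZ !co_lin ?ft0 ?ftS ?cre_lin //.
  by rewrite scaler0 addr0.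
- by move=> x a; apply: FL_ext => f [|n]; rewrite lappM ?ft0 ?ftS // fpiE -cre_lact.
- move=> x y; apply: FL_ext => f n; rewrite lappM ft_star ftS fpiE.
  exact: (congr1 (fun h => h _) (ann_cre x y n)).
- move=> a x; apply: FL_ext => f [|n]; rewrite lappM fpiE ?ft0 ?ftS.
    by rewrite (lin0 (lact_linr a)).
  by rewrite -lact_cre.
Qed.

Fixpoint oti (h : X -> X) (n : nat) : E n.+1 -> E n.+1 :=
  match n return E n.+1 -> E n.+1 with 0 => h | k.+1 => otimes1 (@oti h k) end.

Lemma oti_adm h h' : is_adjoint h h' -> (exists2 M, 0 <= M & obd h M) -> forall n, adm (@oti h n) (@oti h' n).
Proof. by move=> hh' b; elim=> [|n IH] //=; have [] := otimes1_adm IH. Qed.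

Lemma oti_bd h h' (M : R) : is_adjoint h h' -> 0 <= M -> obd h M -> forall n, obd (@oti h n) M.
Proof.
move=> hh' M0 hM; elim=> [|n IH] //=; have [|_ _ b] := otimes1_adm (oti_adm hh' _ n); first by exists M.
exact: b.
Qed.

Lemma oti_lact a n : @oti (lact a) n = lact (c := E n.+1) a.
Proof. by elim: n => // n IH; transitivity (otimes1 (lact (c := E n.+1) a)); [rewrite -IH|exact: otimes1_lact]. Qed.

(** The operator that the Fock representation assigns to a finite-rank k on X is zero on the summand
    A and k (x) 1^n on X^(n+1). *)
Lemma rep_oti u : lspan (repP ft) u -> exists h', [/\ is_adjoint u.1 h', exists2 M, 0 <= M & obd u.1 M,
  forall f, co 0 (lapp u.2 f) = 0 & forall f n, co n.+1 (lapp u.2 f) = oti u.1 (co n.+1 f)].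
Proof.
elim/lspan_ind => [|c s v [x [y ->]] _ [h' [ah [M M0 hM] v0 vS]]].
  exists 0; split=> [a b|||f n].
  - by rewrite /= hip0l hip0r.
  - by exists 0 => //; exact: obd0.
  - by move=> f; change (co 0 (lapp (0 : FL) f) = 0); rewrite lapp0.
  - transitivity (0 : E n.+1); first by change (co n.+1 (lapp (0 : FL) f) = 0); rewrite lapp0.
    suff -> : (0 : (X -> X) * FL).1 = lact (c := X) (0 : A) by rewrite oti_lact lact0l.
    by apply/funext => z; rewrite lact0l.
have ath := @theta_adj _ _ _ _ x y; have bth : exists2 M, 0 <= M & obd (theta x y) M.
  by exists (nr x * nr y); [rewrite mulr_ge0 ?nr_ge0|exact: theta_bd].
have e2 f : lapp (c *: ((theta x y, ft x ** cstar (ft y)) : (X -> X) * FL) + v).2 f =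
    c *: lapp (ft x) (lapp (cstar (ft y)) f) + lapp v.2 f.
  by change (lapp (c *: (ft x ** cstar (ft y)) + v.2) f = c *: lapp (ft x) (lapp (cstar (ft y)) f) + lapp v.2 f);
    rewrite lappD lappZ lappM.
exists (conjc c *: theta y x + h'); split.
- by move=> a b /=; rewrite hipDl hipDr hipZl hipZr ath ah.
- exists (cabs c * (nr x * nr y) + M); first by rewrite addr_ge0 // !mulr_ge0 ?nr_ge0 ?cabs_ge0.
  by apply: obdD => //; apply: obdZ; exact: theta_bd.
- by move=> f; rewrite e2 co_lin ft0 v0 scaler0 addr0.
- move=> f n; rewrite e2 co_lin ftS ft_star vS.
  have -> : @oti (c *: theta x y + v.1) n = c *: @oti (theta x y) n + @oti v.1 n.
    have bv : exists2 M, 0 <= M & obd v.1 M by exists M.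
    elim: n => // n IH; transitivity (otimes1 (c *: @oti (theta x y) n + @oti v.1 n)); first by rewrite -IH.
    exact: (otimes1_lin c (oti_adm ath bth n) (oti_adm ah bv n)).
  have -> : @oti (theta x y) n = @cre x n \o @ann y n.
    elim: n => // n IH; transitivity (otimes1 (@cre x n \o @ann y n)); first by rewrite -IH.
    exact: (otimes1_comp (cre_adm x n) (adm_sym (cre_adm y n))).
  by [].
Qed.

(* [pi(j) - pi_11(phi(j))] is [j] acting on the summand [A]. *)
Lemma fock_coiso (J : set A) (B : cstarAlg R) (q : FL -> B) : cstar_ideal J -> J `<=` Jideal X -> star_hom q ->
  (forall D, kset (modI F J) setT (lapp D) -> q D = 0) ->
  is_rep (q \o fpi) (q \o ft) /\ J `<=` approx_coiso (X := X) (q \o fpi) (q \o ft).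
Proof.
move=> hJ JX hq qJ; have ql := sh_lin hq; have [h1 h2 h3 h4 h5] := fock_rep; split.
  split=> /=; first exact: star_hom_comp.
  - by move=> k x y; rewrite /= h2 ql.
  - by move=> x a; rewrite h3 (sh_mul hq).
  - by move=> x y; rewrite -(sh_star hq) -(sh_mul hq) h4.
  - by move=> a x; rewrite h5 (sh_mul hq).
move=> j Jj e e0; have := JX j Jj; rewrite /Jideal /= compactsE => kj.
have [g gS bg] := kj _ e0; have [u uS ug] := span_theta ft gS; rewrite -ug in bg.
have [h' [ah bh u0 uSn]] := rep_oti uS.
exists (u.1, q u.2).
  elim/lspan_ind: uS {ug bg ah bh u0 uSn} => [|c s w [x [y ->]] _ IH]; first by rewrite (lin0 ql); exact: lspan0.
  rewrite [in X in lspan _ X]/= ql (sh_mul hq) (sh_star hq).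
  by apply: (lspan_cons c (s := (theta x y, (q \o ft) x ** cstar ((q \o ft) y))) _ IH); exists x, y.
split=> //=.
have ad : is_adjoint (lact (c := X) j - u.1) (lact (cstar j) - h').
  by move=> a b; rewrite /= hipBl hipBr lact_adj ah.
have oS n : @oti (lact (c := X) j - u.1) n = lact (c := E n.+1) j - @oti u.1 n.
  elim: n => [|n IH] //=; rewrite IH -(otimes1_lact n.+1 j).
  have := otimes1_lin (-1) (oti_adm ah bh n) (lact_adm n.+1 j).
  by rewrite !scaleN1r addrC => ->; exact: addrC.
(* [d] is (phi(j) - [u.1]) (x) 1 in positive degrees and 0 on A. The diagonal operator [D] it
   defines has norm at most [e]. *)
have [d dE] : exists d : forall n, E n -> E n, (d 0%N = fun=> 0) /\ forall n, d n.+1 = @oti (lact (c := X) j - u.1) n.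
  by exists (fun n => match n return E n -> E n with 0 => fun=> 0 | k.+1 => @oti (lact (c := X) j - u.1) k end).
have [d' d'E] : exists d' : forall n, E n -> E n, (d' 0%N = fun=> 0) /\ forall n, d' n.+1 = @oti (lact (cstar j) - h') n.
  by exists (fun n => match n return E n -> E n with 0 => fun=> 0 | k.+1 => @oti (lact (cstar j) - h') k end).
have [||D [DE _ Dn]] := @diag_op R A (fun n => E n) d d' e (ltW e0).
- case=> [|n]; first by rewrite dE.1 d'E.1 => y z; rewrite hip0l hip0r.
  rewrite dE.2 d'E.2; have [|] := oti_adm ad _ n; last by [].
  by exists e => //; exact: ltW.
- case=> [|n]; first by rewrite dE.1 => y; rewrite nr0 mulr_ge0 ?nr_ge0 // ltW.
  by rewrite dE.2; apply: (oti_bd ad) => //; exact: ltW.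
suff -> : q (fpi j) - q u.2 = q D by rewrite (le_trans (star_hom_contractive _ hq)).
apply/eqP; rewrite -subr_eq0 -(linB ql) -(linB ql); apply/eqP/qJ.
have [b [c [Jb Jc cs jE]]] := ideal_fact hJ Jj.
have [b1 [b2 [_ Jb2 _ bE]]] := ideal_fact hJ Jb.
(* What remains is j acting on the summand A alone, a rank-one operator because j = b c with c
   self-adjoint; the further factor [b2] in [J] places it in K(F, FJ). *)
have -> : lapp (fpi j - u.2 - D) = theta (finj (b : E 0%N)) (finj (c : E 0%N)).
  apply/funext => f; apply: co_ext => -[|n].
    rewrite !lappB !coB fpiE u0 DE dE.1 !subr0.
    rewrite /theta inj_ract co_inj hip_inj_co /= /self_ip cs cmulA -jE.
    by [].
  rewrite !lappB !coB fpiE uSn DE dE.2 oS.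
  by rewrite /theta inj_ract co_inj0 // [X in _ - X](_ : _ = lact j (co n.+1 f) - oti u.1 (co n.+1 f)) // subrr.
apply: kset_theta => //; rewrite bE (_ : finj _ = ract (finj (b1 : E 0%N)) b2); first exact: modI_ractI.
by rewrite inj_ract.
Qed.

End Fock.

Section FockPowers.
Variables (R : realType) (A : cstarAlg R) (X : corr A A) (T : tensor_powers X).
Local Notation E := (tpow T).
Local Notation tn := (@tens R A X T).
Local Notation F := (fock T).
Local Notation FL := (LOp (@CS R A F)).
Local Notation finj := (@l2in R A (fun k => E k : hilbMod A)).
Local Notation pi := (@fpi R A X T).
Local Notation t := (@ft R A X T).
Let hr := rep_irep (@fock_rep R A X T).
Let mr n : modrep setT pi setT (@tpowr R A X T setT FL pi t n).
Proof. by have := tpowr_rep T (@idealT _ _) hr n; rewrite zpowT. Qed.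

Definition tT n (u : E n) : FL := tpowr setT pi t u.

Lemma tT_lin n : linear (@tT n).
Proof. by move=> k u v; exact: (mr_lin (mr n)). Qed.
Lemma tT_nr n (u : E n) : nr (tT u) <= nr u.
Proof. exact: (mr_nr (@idealT _ _) (ir_hom hr) (mr n)). Qed.
Lemma tT_tens n (y : E n) x : tT (tn y x) = tT y ** t x.
Proof. by apply: (tpowr_tens (@idealT _ _) hr); rewrite ?zpowT ?modIT. Qed.
Lemma tT_ract n (u : E n) a : tT (ract u a) = tT u ** pi a.
Proof. exact: (mr_ract (mr n)). Qed.

Lemma tT_app_lin n f : linear (fun u : E n => lapp (tT u) f).
Proof. by move=> k u v; rewrite tT_lin lappD lappZ. Qed.
Lemma tT_app_bd n (u : E n) f : nr (lapp (tT u) f) <= nr f * nr u.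
Proof. by rewrite mulrC (le_trans (lapp_le _ _)) // ler_wpM2r ?nr_ge0 // tT_nr. Qed.

Lemma cre0 x n : @cre _ _ _ T x n 0 = 0.
Proof. by have [h _ _ _] := @cre_adm _ _ _ T x n; exact: (lin0 (adj_lin h)). Qed.

Lemma zero_lin (V W : lmodType R[i]) : linear (fun _ : V => 0 : W).
Proof. by move=> k u v; rewrite scaler0 addr0. Qed.

Lemma tT_low n (u : E n) f j : (forall i, (i < j)%N -> co i f = 0) ->
  forall i, (i < j + n)%N -> co i (lapp (tT u) f) = 0.
Proof.
have h1 x g k : (forall i, (i < k)%N -> co i g = 0) -> forall i, (i < k.+1)%N -> co i (lapp (t x) g) = 0.
  by move=> hg [|i] hi; rewrite ?ft0 // ftS hg // cre0.
elim: n u f j => [|[|n] IH] u f j hf i hi.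
- by rewrite addn0 in hi; rewrite fpiE hf // (lin0 (lact_linr _)).
- by rewrite addn1 in hi; exact: (h1 u f j hf i hi).
apply: (@dense_eq _ _ _ _ _ _ (fun u => co i (lapp (tT u) f)) (fun=> 0) (nr f) 0) => [| | | |y x].
- by move=> k v w; rewrite tT_app_lin co_lin.
- exact: zero_lin.
- by move=> z; rewrite (le_trans (co_nr _ _)) // tT_app_bd.
- by move=> z; rewrite nr0 mul0r.
- rewrite tT_tens lappM; apply: (IH y (lapp (t x) f) j.+1); last by rewrite addSnnS.
  exact: h1.
Qed.

(* [f'] is the right creation by [z] applied to [f]. *)
Definition rcre z (f f' : F) := co 0 f' = 0 /\ forall l, co l.+1 f' = tn (co l f) z.

Lemma tT_rcre n (u : E n) z f f' : rcre z f f' -> rcre z (lapp (tT u) f) (lapp (tT u) f').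
Proof.
have h1 x g g' : rcre z g g' -> rcre z (lapp (t x) g) (lapp (t x) g').
  move=> [g0 gS]; split=> [|[|l]]; first exact: ft0.
    by rewrite ftS ft0 g0 cre0 (lin0 (tens_linl _)).
  by rewrite !ftS gS cre_tens.
elim: n u f f' => [|[|n] IH] u f f' hf; last 1 first.
- have e0 : co 0 (lapp (tT u) f') = 0.
    apply: (@dense_eq _ _ _ _ _ _ (fun u => co 0 (lapp (tT u) f')) (fun=> 0) (nr f') 0) => [| | | |y x].
    + by move=> k v w; rewrite tT_app_lin co_lin.
    + exact: zero_lin.
    + by move=> w; rewrite (le_trans (co_nr _ _)) // tT_app_bd.
    + by move=> w; rewrite nr0 mul0r.
    + by rewrite tT_tens lappM; have [] := IH y _ _ (h1 x _ _ hf).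
  split=> // l.
  apply: (@dense_eq _ _ _ _ _ _ (fun u => co l.+1 (lapp (tT u) f')) (fun u => tn (co l (lapp (tT u) f)) z)
    (nr f') (nr f * nr z)) => [| | | |y x].
  + by move=> k v w; rewrite tT_app_lin co_lin.
  + by move=> k v w; rewrite tT_app_lin co_lin (tens_linl z).
  + by move=> w; rewrite (le_trans (co_nr _ _)) // tT_app_bd.
  + move=> w; rewrite (le_trans (tens_nr _ _)) // mulrAC ler_wpM2r ?nr_ge0 //.
    by rewrite (le_trans (co_nr _ _)) // tT_app_bd.
  + by rewrite tT_tens !lappM; have [_ hS] := IH y _ _ (h1 x _ _ hf); exact: hS.
- have [f0 fS] := hf; split=> [|l]; first by rewrite fpiE f0 (lin0 (lact_linr _)).
  by rewrite !fpiE fS tens_lact.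
- exact: h1.
Qed.

Lemma pi_inj n a (w : E n) : lapp (pi a) (finj w) = finj (lact (c := E n) a w).
Proof.
apply: co_ext => k; rewrite fpiE; have [->|kn] := eqVneq k n; first by rewrite !co_inj.
by rewrite !co_inj0 // (lin0 (lact_linr _)).
Qed.

Lemma t_inj n x (w : E n) : lapp (t x) (finj w) = finj (cre x w).
Proof.
apply: co_ext => -[|k]; first by rewrite ft0 co_inj0.
rewrite ftS; have [->|kn] := eqVneq k n; first by rewrite !co_inj.
by rewrite !co_inj0 // cre0.
Qed.

Lemma rcre_inj n (y : E n) z : rcre z (finj y) (finj (tn y z)).
Proof.
split=> [|l]; first by rewrite co_inj0.
have [->|ln] := eqVneq l n; first by rewrite !co_inj.
by rewrite !co_inj0 // (lin0 (tens_linl _)).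
Qed.

(** Applying [tT u] commutes with right creation ([tT_rcre]), so its effect on degree 1 follows from
    that on degree 0 after writing u = w b; this is [Q1]. For u = y (x) x one then applies t(x)
    first and [Q1] to y. *)
Lemma tT_inj n (u : E n) (c : E 0) : lapp (tT u) (finj c) = finj (ract u (c : A)).
Proof.
elim: n u c => [|n IH] u c; first exact: pi_inj.
have Q1 (y : E n) (z : E 1) : lapp (tT y) (finj z) = finj (tn y (z : X)).
  have : modI (E n) setT y by rewrite modIT.
  move=> [w [b [_ ->]]]; rewrite tT_ract lappM pi_inj.
  have [h0 hS] := tT_rcre w (@rcre_inj 0 b z); have [g0 gS] := rcre_inj (ract w b) (z : X).
  rewrite IH in h0 hS; apply: co_ext => -[|l]; first by rewrite g0; exact: h0.
  by rewrite gS; exact: hS.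
case: n u IH Q1 => [|n] u IH Q1; first exact: t_inj.
apply: (@dense_eq _ _ _ _ _ _ (fun u => lapp (tT u) (finj c)) (fun u => finj (ract u (c : A))) (nr (finj c)) (nr c)).
- exact: tT_app_lin.
- by move=> k v w; rewrite ractDl ractZl inj_lin.
- by move=> z; exact: tT_app_bd.
- by move=> z; rewrite inj_nr mulrC nr_ract.
- move=> y x; rewrite tT_tens lappM t_inj tens_ract; exact: Q1.
Qed.

Definition fock_iota n m : (E m -> E n) -> FL := @tensor_rep R A X FL pi t (@fock_rep R A X T) T n m.
Local Notation iota := fock_iota.

Lemma iota_tT n m j (a : E m -> E n) (v : E (j + m)%N) : kset setT setT a ->
  iota a ** tT v = tT (otimes1k a (k := j) v).
Proof.
move=> ka; have [] := @kap_acts _ _ _ T _ _ _ _ (@idealT _ _) hr n m a j _ v; rewrite ?zpowT //.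
Qed.

Lemma iota_inj k j (a : E k -> E k) (u : E (j + k)%N) : kset setT setT a ->
  lapp (iota a) (finj u) = finj (otimes1k a (k := j) u).
Proof.
move=> ka; have : modI (E (j + k)%N) setT u by rewrite modIT.
move=> [w [c [_ ->]]]; rewrite -(tT_inj w (c : E 0)) -lappM iota_tT // tT_inj.
have [a' _ aa] := kset_adm ka; have [h _ _ _] := otimes1k_adm j aa.
by rewrite (adj_ract h).
Qed.

(** [tT w] with w in X^k raises degrees by k, so its adjoint kills the summands of degree below
    k. *)
Lemma iota_low k m (a : E k -> E k) (u : E m) : kset setT setT a -> (m < k)%N ->
  lapp (iota a) (finj u) = 0.
Proof.
move=> ka mk; apply: (@kc_eq _ _ _ _ setT setT _ (fun a => lapp (iota a) (finj u)) (fun=> 0)) ka.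
- apply: (kc_comp (L := fun D : FL => lapp D (finj u)) (D := nr (finj u))); [exact: tensor_rep_cont| | |].
  + by move=> c D D'; rewrite lappD lappZ.
  + exact: nr_ge0.
  + by move=> D; rewrite mulrC lapp_le.
- split=> [c f g _ _|]; first by rewrite scaler0 addr0.
  by exists 0 => // f M _ _ _; rewrite nr0 mul0r.
move=> v w _ _; rewrite /iota tensor_rep_theta -/(tT v) -/(tT w) lappM.
suff -> : lapp (cstar (tT w)) (finj u) = 0 by rewrite (lin0 (lapp_lin _)).
apply: hip_inj => f; rewrite -(lapp_adj (tT w)) hip0r -[LHS]hip_star hip_inj_co.
by rewrite (@tT_low _ w f 0) ?hip0r ?cstar0.
Qed.

(** The m-th diagonal component. For the image of a in K(X^k) it is zero when m < k and a (x)
    1^(m-k) otherwise. *)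
Definition cmp (m : nat) (D : FL) (u : E m) : E m := co m (lapp D (finj u)).

Lemma cmp_adj m D : is_adjoint (@cmp m D) (cmp (cstar D)).
Proof.
move=> u v; rewrite /cmp -[LHS]hip_star -(hip_inj_co v) hip_star -(hip_inj_co u).
exact: lapp_adj.
Qed.
Lemma cmp_bd m D : obd (@cmp m D) (nr D).
Proof. by move=> u; rewrite /cmp (le_trans (co_nr _ _)) // (le_trans (lapp_le _ _)) // inj_nr. Qed.
Lemma cmp_lin m k D D' : @cmp m (k *: D + D') = k *: cmp D + cmp D'.
Proof. by apply/funext => u; rewrite /cmp lappD lappZ co_lin. Qed.
Lemma cmp_fpi m a : @cmp m (pi a) = lact (c := E m) a.
Proof. by apply/funext => u; rewrite /cmp pi_inj co_inj. Qed.

Lemma cmp_iota_low k m (a : E k -> E k) : kset setT setT a -> (m < k)%N -> @cmp m (iota a) = 0.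
Proof. by move=> ka mk; apply/funext => u; rewrite /cmp iota_low. Qed.
Lemma cmp_iotak k j (a : E k -> E k) : kset setT setT a -> @cmp (j + k)%N (iota a) = otimes1k a (k := j).
Proof. by move=> ka; apply/funext => u; rewrite /cmp iota_inj // co_inj. Qed.
Lemma cmp_iotaS k m (a : E k -> E k) : kset setT setT a -> (k <= m)%N ->
  @cmp m.+1 (iota a) = otimes1 (@cmp m (iota a)).
Proof.
move=> ka km; rewrite -(subnK km) (cmp_iotak (m - k) ka).
exact: (cmp_iotak (m - k).+1 ka).
Qed.

Lemma hip_co_inj m (y : F) (u : E m) : hip y (finj u) = hip (co m y) u.
Proof. by rewrite -[LHS]hip_star hip_inj_co hip_star. Qed.

Section FJ.
Variable J : set A.

Lemma cmp_FJ D : kset (modI F J) setT (lapp D) -> forall m, kset (modI (E m) J) setT (@cmp m D).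
Proof.
move=> kD m; apply: kset_closed => e e0; have [g gS bg] := kD _ e0.
exists (fun u : E m => co m (g (finj u))).
  apply: kset_span; elim/lspan_ind: gS {bg} => [|c s v [z [y [[w [j [Jj ->]]] _ ->]]] _ IH]; first exact: lspan0.
  rewrite (_ : (fun u : E m => _) = c *: theta (ract (co m w) j) (co m y) + (fun u : E m => co m (v (finj u)))).
    apply: lspan_cons => //; exists (ract (co m w) j), (co m y); split=> //.
    exact: modI_ractI.
  apply/funext => u; change (co m (c *: ract (ract w j) (hip y (finj u)) + v (finj u)) =
    c *: ract (ract (co m w) j) (hip (co m y) u) + co m (v (finj u))).
  by rewrite hip_co_inj co_lin.
move=> u; rewrite (_ : _ u = co m ((lapp D - g) (finj u))) //.
by rewrite (le_trans (co_nr _ _)) // (le_trans (bg _)) // inj_nr.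
Qed.

(** The components of a rank-one operator theta z y are theta z_m y_m, and |z_m| tends to 0 by
    summability; finite sums and limits follow. *)
Lemma cmp_FJ_lim D : kset (modI F J) setT (lapp D) -> forall e : R, 0 < e ->
  exists N, forall m, (N <= m)%N -> obd (@cmp m D) e.
Proof.
move=> kD e e0; have e2 : 0 < e / 2 by rewrite divr_gt0.
have [g gS bg] := kD _ e2.
suff [N hN] : exists N, forall m, (N <= m)%N -> obd (fun u : E m => co m (g (finj u))) (e / 2).
  exists N => m /hN hm u; rewrite (_ : cmp D u = co m ((lapp D - g) (finj u)) + co m (g (finj u))).
    rewrite [e]splitr mulrDl (le_trans (nrD _ _)) // lerD ?hm //.
    by rewrite (le_trans (co_nr _ _)) // (le_trans (bg _)) // inj_nr.
  change (co m (lapp D (finj u)) = co m (lapp D (finj u) - g (finj u)) + co m (g (finj u))).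
  by rewrite coB subrK.
elim/lspan_ind: gS (e / 2) e2 {bg e0} => [|c s v [z [y [_ _ ->]]] _ IH] d d0.
  by exists 0%N => m _ u /=; rewrite nr0 mulr_ge0 ?nr_ge0 // ltW.
have d2 : 0 < d / 2 by rewrite divr_gt0.
have [N1 h1] := IH _ d2.
pose C := cabs c * nr y; have C0 : 0 <= C by rewrite mulr_ge0 ?cabs_ge0 ?nr_ge0.
have q0 : 0 < d / 2 / (1 + C) by rewrite divr_gt0 // ltr_pwDl.
have q1 : 0 < (d / 2 / (1 + C)) ^+ 2 by rewrite exprn_gt0.
have [N2 h2] := l2P z q1.
exists (maxn N1 N2) => m; rewrite geq_max => /andP[m1 m2] u.
have zm : nr (co m z) <= d / 2 / (1 + C).
  rewrite -(ler_pXn2r (n := 2)) ?nnegrE ?nr_ge0 ?(ltW q0) // -nr_hip.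
  have := h2 m.+1 (leqW m2); apply: le_trans.
  by have := psd_mono z m2 (leqnn m.+1); rewrite [X in nr X <= _]/psd big_nat1.
rewrite (_ : co m _ = c *: ract (co m z) (hip (co m y) u) + co m (v (finj u))); last first.
  by rewrite -hip_co_inj.
rewrite [d]splitr mulrDl (le_trans (nrD _ _)) // lerD ?h1 // nrZ.
apply: (@le_trans _ _ (d / 2 / (1 + C) * C * nr u)).
  rewrite /C (_ : _ * (cabs c * nr y) * nr u = cabs c * (d / 2 / (1 + cabs c * nr y) * (nr y * nr u))); last by ring.
  rewrite ler_wpM2l ?cabs_ge0 // (le_trans (nr_ract _ _)) //.
  apply: ler_pM; rewrite ?nr_ge0 // (le_trans (CS _ _)) // ler_wpM2r ?nr_ge0 //; exact: co_nr.
by rewrite ler_wpM2r ?nr_ge0 //; apply: frac_small => //; exact: ltW.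
Qed.

End FJ.

End FockPowers.

Lemma rangeI_ideal (R : realType) (A : cstarAlg R) (Y : hilbMod A) (S : set A) : cstar_ideal S ->
  cstar_ideal [set D : LOp (@CS R A Y) | forall y, modI Y S (lapp D y)].
Proof.
move=> hS; split.
- apply/closedP => D hD y; apply: (modI_closed hS) => e e0.
  have d0 : 0 < e / (1 + nr y) by rewrite divr_gt0 // ltr_pwDl // nr_ge0.
  have [D' hD' h] := hD _ d0; exists (lapp D' y); first exact: hD'.
  rewrite -lappB (le_trans (lapp_le _ _)) // (le_trans (ler_wpM2r (nr_ge0 _) h)) //.
  by apply: frac_small; rewrite ?nr_ge0 // ltW.
- by move=> y; rewrite lapp0; exact: modI0.
- by move=> D D' h h' y; rewrite lappD; apply: modID.
- by move=> k D h y; rewrite lappZ; apply: modIZ.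
- move=> D D' h y; rewrite lappM; have [w [i [Ii ->]]] := h y.
  by rewrite (adj_ract (lapp_adj D)); exact: modI_ractI.
- by move=> D D' h y; rewrite lappM.
Qed.

(** * The saturation is an invariant, saturated ideal *)

Section Saturation.
Variables (R : realType) (A : cstarAlg R) (X : corr A A) (J I : set A).
Hypotheses (hJ : cstar_ideal J) (hJX : J `<=` Jideal X) (hI : cstar_ideal I) (hinv : X_invariant X I).

Lemma modI_sub (Z : hilbMod A) (K K' : set A) : K `<=` K' -> modI Z K `<=` modI Z K'.
Proof. by move=> KK' z [w [i [/KK' Ki ->]]]; exists w, i. Qed.

Lemma sat_level (K : set A) : cstar_ideal K -> cstar_ideal [set a | J a /\ forall x : X, modI X K (lact a x)].
Proof.
move=> hK; split.
- apply/closedP => a ha; split; first by apply: (idl_approx hJ); apply: approx_sub ha => b [].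
  move=> x; apply: (modI_closed hK) => e e0.
  have d0 : 0 < e / (1 + nr x) by rewrite divr_gt0 // ltr_pwDl // nr_ge0.
  have [b [_ hb] h] := ha _ d0; exists (lact b x) => //.
  rewrite -lactBl (le_trans (lact_bd _ _)) // (le_trans (ler_wpM2r (nr_ge0 _) h)) //.
  by apply: frac_small; rewrite ?nr_ge0 // ltW.
- by split=> [|x]; [exact: (id_0 hJ)|rewrite lact0l; exact: modI0].
- move=> a b [Ja ha] [Jb hb]; split=> [|x]; first exact: (id_add hJ).
  by rewrite lactDl; apply: modID.
- move=> k a [Ja ha]; split=> [|x]; first exact: (id_scale hJ).
  by rewrite lactZl; apply: modIZ.
- move=> a b [Jb hb]; split=> [|x]; first exact: (id_mull hJ).
  by rewrite lactM; exact: modI_lact.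
- move=> a b [Ja ha]; split=> [|x]; first exact: (id_mulr hJ).
  by rewrite lactM.
Qed.

Local Notation S k := (sat_step X J I k).

Lemma sat_step_ideal k : cstar_ideal (S k).
Proof. by elim: k => //= k IH; apply: ideal_sum => //; exact: sat_level. Qed.

Lemma sat_stepS k : S k `<=` S k.+1.
Proof.
move=> a ha; exists 0; first exact: (id_0 (sat_level (sat_step_ideal k))).
by exists a; rewrite ?add0r.
Qed.

Lemma sat_step_mono k l : (k <= l)%N -> S k `<=` S l.
Proof.
move=> /subnK <-; elim: (l - k)%N => // n IH a /IH.
exact: sat_stepS.
Qed.

Lemma sat_step_inv k : X_invariant X (S k).
Proof.
elim: k => // k IH a x [b [Jb hb] [c hc <-]]; rewrite lactDl; apply: (modID (sat_step_ideal k.+1)).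
  by apply: modI_sub (hb x); exact: sat_stepS.
by apply: modI_sub (IH c x hc); exact: sat_stepS.
Qed.

Local Notation Sat := (saturation X J I).

Lemma sat_ideal : cstar_ideal Sat.
Proof.
apply: ideal_closure.
- by exists 0%N => //; exact: (id_0 hI).
- move=> a b [k _ ha] [l _ hb]; exists (maxn k l) => //; apply: (id_add (sat_step_ideal _)).
    by apply: sat_step_mono ha; rewrite leq_maxl.
  by apply: sat_step_mono hb; rewrite leq_maxr.
- by move=> c a [k _ ha]; exists k => //; apply: (id_scale (sat_step_ideal _)).
- by move=> a b [k _ ha]; exists k => //; apply: (id_mull (sat_step_ideal _)).
- by move=> a b [k _ ha]; exists k => //; apply: (id_mulr (sat_step_ideal _)).
Qed.

Lemma sat_step_sub k : S k `<=` Sat.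
Proof. by rewrite /saturation closureP => a ha; apply: approx_mem; exists k. Qed.

Lemma sat_approx a (e : R) : Sat a -> 0 < e -> exists k b, S k b /\ nr (a - b) <= e.
Proof. by rewrite /saturation closureP => h /h[b [k _ hb] hab]; exists k, b. Qed.

Lemma sat_inv : X_invariant X Sat.
Proof.
move=> a x ha; apply/(modIP sat_ideal) => w; apply: (idl_approx sat_ideal) => e e0.
pose c := nr w * nr x; have c0 : 0 <= c by rewrite mulr_ge0 ?nr_ge0.
have d0 : 0 < e / (1 + c) by rewrite divr_gt0 // ltr_pwDl.
have [k [b [hb hab]]] := sat_approx ha d0; exists (hip w (lact b x)).
  apply: (@sat_step_sub k); apply: (proj1 (modIP (sat_step_ideal k) _) (sat_step_inv x hb)).
rewrite -hipBr -lactBl (le_trans (CS _ _)) // (le_trans (ler_wpM2l (nr_ge0 _) (lact_bd _ _))) //.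
rewrite mulrCA (le_trans (ler_wpM2r c0 hab)) //; apply: frac_small => //; exact: ltW.
Qed.

Lemma sat_min (K : set A) : cstar_ideal K -> J_saturated X J K -> I `<=` K -> Sat `<=` K.
Proof.
move=> hK sK IK a; rewrite /saturation closureP => ha; apply: (idl_approx hK).
apply: approx_sub ha => b [k _]; elim: k b => [|k IH] b; first exact: IK.
move=> [c [Jc hc] [d hd <-]]; apply: (id_add hK); last exact: IH.
by apply: sK => // x; apply: modI_sub (hc x).
Qed.

Lemma lact_hom : exists2 rho : A -> LOp (@CS R A X), star_hom rho & forall a, lapp (rho a) = lact a.
Proof.
have /choice[rho hrho] a : exists D : LOp (@CS R A X), lapp D = lact a.
  by apply: (LOp_mk (M := nr a) (@CS R A X) (lact_is_adj a)) => y; exact: lact_bd.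
exists rho => //; split=> [k a b|a b|a]; apply: lapp_ext => y.
- by rewrite lappD lappZ !hrho lact_lin.
- by rewrite lappM !hrho lactM.
- rewrite hrho; congr (_ y); apply: (adj_uniq (f := lapp (rho a))); last exact: lapp_adj.
  by rewrite hrho; exact: lact_is_adj.
Qed.

(* [phi(h)] for [h = (a*a)^2] is a limit of operators with range in some [X S_k]; cutting down [h] gives
   elements of [S_{k+1}] close to [h]. *)
Lemma sat_saturated : J_saturated X J Sat.
Proof.
move=> a Ja hX; have hS := sat_ideal; pose b := cstar a ** a; pose h := cstar b ** b.
have Jb : J b by exact: (id_mull hJ).
have hb x : modI X Sat (lact b x) by rewrite lactM; exact: modI_lact.
apply: (ideal_sq hS); apply: (ideal_sq hS); rewrite -/b -/h.
have [rho hrho rhoE] := lact_hom.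
have bs : cstar b = b by rewrite /b cstarM cstarK.
apply: (idl_approx hS) => e e0; have ph : cpositive h by exists b.
have [c [pc cE hc cM]] := cut_down ph e0; exists c => //.
have Jc : J c by apply: (cM _ (ideal_calg hJ)); exact: (id_mull hJ).
have e2 : 0 < e / 2 by rewrite divr_gt0.
pose e4 := e / 4 / (1 + nr b); have p4 : 0 < e4 by rewrite !divr_gt0 // ltr_pwDl // nr_ge0.
have := hJX Jb; rewrite /Jideal /= compactsE => /(_ _ p4)[g gS bg].
(* Each phi(b) x = w i has i in the saturation, and i is a limit of elements of the steps S_k. So
   phi(b) times a finite-rank operator is approximated by operators with range in X S_k, a single k
   serving the finite sum. Of the two factors b in h, one is approximated by finite rank and the
   other is used here. *)
have [G GE key] : exists2 G : LOp (@CS R A X), lapp G = g & forall d : R, 0 < d -> exists k D,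
    (forall y, modI X (S k) (lapp D y)) /\ nr (rho b ** G - D) <= d.
  elim/lspan_ind: gS {bg} => [|s u v [x [y [_ _ ->]]] _ [G GE IH]].
    exists 0; first by apply/funext => y; exact: lapp0.
    move=> d d0; exists 0%N, 0; split; first by move=> y; rewrite lapp0; exact: modI0.
    by rewrite cmul0r subrr nr0 ltW.
  have mkth (z : X) : exists Th : LOp (@CS R A X), lapp Th = theta z y.
    apply: (LOp_mk (M := nr z * nr y) (@CS R A X) (@theta_adj _ _ _ _ z y)); exact: theta_bd.
  have [Th ThE] := mkth x; exists (s *: Th + G).
    by apply/funext => z; rewrite lappD lappZ ThE GE.
  move=> d d0; have [w [i [Si wE]]] := hb x.
  pose C := cabs s * (nr w * nr y); have C0 : 0 <= C by rewrite !mulr_ge0 ?cabs_ge0 ?nr_ge0.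
  have d2 : 0 < d / 2 by rewrite divr_gt0.
  have d1 : 0 < d / 2 / (1 + C) by rewrite divr_gt0 // ltr_pwDl.
  have [k1 [i' [Si' hi]]] := sat_approx Si d1; have [k2 [D [hD bD]]] := IH _ d2.
  have [Tw TwE] := mkth (ract w i').
  exists (maxn k1 k2), (s *: Tw + D); split.
    move=> z; rewrite lappD lappZ TwE; apply: (modID (sat_step_ideal _)).
      apply: (modIZ (sat_step_ideal _)); rewrite /theta; apply: (modI_ract (sat_step_ideal _)).
      by apply: modI_ractI; apply: sat_step_mono Si'; rewrite leq_maxl.
    by apply: modI_sub (hD z); apply: sat_step_mono; rewrite leq_maxr.
  have -> : rho b ** (s *: Th + G) - (s *: Tw + D) = s *: (rho b ** Th - Tw) + (rho b ** G - D).
    by rewrite cmulDr cmulZr; lmodule R.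
  rewrite [d]splitr (le_trans (nrD _ _)) // lerD // nrZ.
  have q : nr (rho b ** Th - Tw) <= d / 2 / (1 + C) * (nr w * nr y).
    apply: lapp_bound => [|z]; first by apply: mulr_ge0; [exact: ltW|rewrite mulr_ge0 ?nr_ge0].
    rewrite lappB lappM rhoE ThE TwE /theta lact_ract wE -ractBl -ractBr.
    rewrite (le_trans (nr_ract _ _)) // mulrA -mulrA.
    apply: ler_pM; rewrite ?nr_ge0 ?CS //.
    by rewrite (le_trans (nr_ract _ _)) // mulrC ler_wpM2r ?nr_ge0.
  apply: (le_trans (ler_wpM2l (cabs_ge0 s) q)).
  have -> : cabs s * (d / 2 / (1 + C) * (nr w * nr y)) = d / 2 / (1 + C) * C.
    by rewrite mulrCA.
  by apply: frac_small => //; exact: ltW.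
have q4 : 0 < e / 4 by rewrite divr_gt0.
have [k [D [hD bD]]] := key _ q4.
have hr : rho h = rho b ** rho b by rewrite /h bs (sh_mul hrho).
have rb : nr (rho b) <= nr b := star_hom_contractive b hrho.
have bG : nr (rho b - G) <= e4.
  apply: lapp_bound => [|z]; first exact: ltW.
  by rewrite lappB rhoE GE; exact: bg.
have nD : nr (rho h - D) < e.
  have -> : rho h - D = rho b ** (rho b - G) + (rho b ** G - D).
    by rewrite hr cmulBr; lmodule R.
  have h1 : nr (rho b ** (rho b - G)) <= e / 4.
    rewrite (le_trans (nrM _ _)) // mulrC (le_trans (ler_pM _ _ bG rb)) ?nr_ge0 //.
    by apply: frac_small; rewrite ?nr_ge0 // ltW.
  have := nrD (rho b ** (rho b - G)) (rho b ** G - D); lra.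
have Nc := @cut_ideal _ _ _ rho _ h c (rho h - D) e hrho (rangeI_ideal X (sat_step_ideal k)) pc cE.
have {}Nc y : modI X (S k) (lact c y).
  rewrite -rhoE; apply: Nc => //; rewrite opprB addrC subrK; exact: hD.
apply: (@sat_step_sub k.+1); exists c; first by split.
by exists 0; [exact: (id_0 (sat_step_ideal k))|rewrite addr0].
Qed.

End Saturation.

(** * Elements of A whose image lies in O(S) *)

Section SatKernel.
Variables (R : realType) (A : cstarAlg R) (X : corr A A) (T : tensor_powers X) (S : set A).
Hypotheses (hS : cstar_ideal S) (hinv : X_invariant X S).
Local Notation E := (tpow T).
Local Notation tn := (@tens R A X T).

Lemma tens_modI n (y : E n) x : modI (E n) S y -> modI (E n.+1) S (tn y x).
Proof.
move=> [w [s [Ss ->]]]; rewrite tens_bal; have [x' [s' [Ss' ->]]] := hinv x Ss.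
by rewrite -tens_ract; exact: modI_ractI.
Qed.

Lemma modI_dense n (V : normedModType R[i]) (f : V -> E n) (D : set V) (M : R) : linear f -> 0 <= M ->
  (forall v, nr (f v) <= M * nr v) -> (forall v, D v -> modI (E n) S (f v)) ->
  forall v, approx (lspan D) v -> modI (E n) S (f v).
Proof.
move=> fl M0 fM fD v hv; apply: (modI_closed hS) => e e0.
have d0 : 0 < e / (1 + M) by rewrite divr_gt0 // ltr_pwDl.
have [u uS hu] := hv _ d0; exists (f u).
  elim/lspan_ind: uS {hu} => [|c s w Ds _ IH]; first by rewrite (lin0 fl); exact: modI0.
  by rewrite fl; apply: (modID hS) => //; apply: (modIZ hS); exact: fD.
rewrite -(linB fl) (le_trans (fM _)) // mulrC (le_trans (ler_wpM2r M0 hu)) //.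
by apply: frac_small => //; exact: ltW.
Qed.

Lemma lact_modI n s (u : E n) : S s -> modI (E n) S (lact s u).
Proof.
move=> Ss; case: n u => [|n] u.
  by apply/(modIP hS) => w; apply: (id_mull hS); exact: (id_mulr hS).
elim: n u => [|n IH] u; first exact: hinv.
apply: (modI_dense (lact_linr s) (nr_ge0 s) (lact_bd s) _ (elem_dense u)) => v [y [x ->]].
by rewrite tens_lact; apply: tens_modI; exact: IH.
Qed.

Lemma otimes1_modI m n (f : E m -> E n) f' : adm f f' -> (forall y, modI (E n) S (f y)) ->
  forall u, modI (E n.+1) S (otimes1 f u).
Proof.
move=> hf fS; have [[h [M M0 hM] _ _] fe _] := otimes1_adm hf; have [_ _ v _] := hf.
case: m f f' hf fS v h M M0 hM fe => [|m] f f' hf fS v h M M0 hM fe u.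
  have [xi fE] := v; rewrite fE otimes1_vec; apply: tens_modI; apply: (modI_closed hS) => e e0.
  have [a [_ _ ha _ _]] := approx_unit xi e0; exists (ract xi a) => //.
  by have := fS (a : E 0); rewrite fE.
apply: (modI_dense (adj_lin h) M0 hM _ (elem_dense u)) => w [y [x ->]].
by rewrite fe; apply: tens_modI.
Qed.

Variables (J : set A).
Hypotheses (hJ : cstar_ideal J) (hJX : J `<=` Jideal X) (hsat : J_saturated X J S).

Lemma kset_in (Y Z : hilbMod A) (K : set A) (f : Y -> Z) : cstar_ideal K -> kset (modI Z K) setT f ->
  forall y, modI Z K (f y).
Proof.
move=> hK kf y; apply: (modI_closed hK) => e e0.
have d0 : 0 < e / (1 + nr y) by rewrite divr_gt0 // ltr_pwDl // nr_ge0.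
have [g gS bg] := kf _ d0; exists (g y).
  elim/lspan_ind: gS {bg} => [|c s v [z [y' [hz _ ->]]] _ IH] /=; first exact: modI0.
  by apply: (modID hK) => //; apply: (modIZ hK); apply: (modI_ract hK).
by rewrite (le_trans (bg y)) //; apply: frac_small; rewrite ?nr_ge0 // ltW.
Qed.

(** For a = <y', k y>, which lies in J, one has <x', a x> = <y' (x) x', (k (x) 1)(y (x) x)> in S.
    Hence phi(a) X is inside XS, and saturation puts a into S. *)
Lemma descend m (k : E m -> E m) : kset (modI (E m) J) setT k ->
  (forall u, modI (E m.+1) S (otimes1 k u)) -> forall y, modI (E m) S (k y).
Proof.
move=> kk hk y; have [k' _ ak] := kset_adm kk; have [_ ke _] := otimes1_adm ak.
apply/(modIP hS) => y'; apply: hsat.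
  by have /(modIP hJ) := kset_in hJ kk y; apply.
move=> x; apply/(modIP hS) => x'; rewrite -tens_ip -ke.
by have /(modIP hS) := hk (tn y x); apply.
Qed.

Variables (O : cstarAlg R) (iA : A -> O) (iX : X -> O).
Hypothesis hO : is_relCP J iA iX.

Local Notation FL := (LOp (@CS R A (fock T))).
Let NJ : set FL := [set D | kset (modI (fock T) J) setT (lapp D)].
Let NS : set FL := [set D | forall y, modI (fock T) S (lapp D y)].

Lemma fpi_modI s : S s -> NS (fpi T s).
Proof.
move=> Ss f; apply/(modIP hS) => w; apply: (idl_approx hS).
apply: (nlim_approx (hip_co w (lapp (fpi T s) f))) => n.
apply: big_ind => [|a b|k _]; [exact: (id_0 hS)|exact: (id_add hS)|].
rewrite fpiE; apply: (proj1 (modIP hS _)); exact: lact_modI.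
Qed.

(** Modulo the ideal [NJ] + [NS] of L(F) the Fock representation is coisometric on J, so it factors
    through O(J,X), and it kills S, hence O(S). *)
Lemma fock_decomp a : ideal_gen (iA @` S) (iA a) -> exists D D', [/\ NJ D, NS D' & fpi T a = D + D'].
Proof.
have hNJ : cstar_ideal NJ := kset_ideal (fock T) hJ.
have hNS : cstar_ideal NS := rangeI_ideal (fock T) hS.
have hK := ideal_sum hNJ hNS.
have [D [q [[hq _ qk] _]]] := quotient_alg hK.
have qJ (d : FL) : kset (modI (fock T) J) setT (lapp d) -> q d = 0.
  by move=> kd; apply/qk; exists d => //; exists 0; [exact: (id_0 hNS)|rewrite addr0].
have [rep co] := fock_coiso hJ hJX hq qJ.
have [h hh [hA _]] := cp_univ hO rep (approx_coisometric rep co).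
move=> /(_ _ (ker_ideal hh)) h0.
have : q (fpi T a) = 0.
  rewrite -[q _]hA; apply: h0 => _ [s Ss <-] /=; rewrite hA /=; apply/qk.
  by exists 0; [exact: (id_0 hNJ)|exists (fpi T s); [exact: fpi_modI|rewrite add0r]].
by move=> /qk[d hd [d' hd' e]]; exists d, d'.
Qed.

(* If [phi_m(c)] maps into [X^m S] for some [m], then [c] is in [S] by descending induction on [m]. *)
Lemma sat_kernel a : ideal_gen (iA @` S) (iA a) -> S a.
Proof.
move=> ha; pose b := cstar a ** a; have [ih _ _ _ _] := cp_rep hO.
pose OS := ideal_gen (iA @` S); have hOS : cstar_ideal OS := ideal_genP _.
have hP : cstar_ideal [set x | OS (iA x)].
  split.
  - apply/closedP => x hx; apply: (idl_approx hOS) => e /hx[y hy hxy]; exists (iA y) => //.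
    by rewrite -(linB (sh_lin ih)) (le_trans (star_hom_contractive _ ih)).
  - by rewrite /mkset (lin0 (sh_lin ih)); exact: (id_0 hOS).
  - by move=> x y hx hy; rewrite /mkset (linD (sh_lin ih)); apply: (id_add hOS).
  - by move=> k x hx; rewrite /mkset (linZ (sh_lin ih)); apply: (id_scale hOS).
  - by move=> x y hy; rewrite /mkset (sh_mul ih); apply: (id_mull hOS).
  - by move=> x y hx; rewrite /mkset (sh_mul ih); apply: (id_mulr hOS).
apply: (ideal_sq hS); rewrite -/b; apply: (idl_approx hS) => e e0.
have pb : cpositive b by exists a.
have [c [pc cE hc cM]] := cut_down pb e0; exists c => //.
have Ob : OS (iA b) by rewrite /b (sh_mul ih); apply: (id_mull hOS).
have Oc : OS (iA c) := cM _ (ideal_calg hP) Ob.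
pose P m := forall y : E m, modI (E m) S (lact c y).
(* For large N the component of D on X^N is at most e/2, so phi_N(b) is closer than e to an operator
   with range in X^N S. As c is b cut down at level e, [cut_ideal] puts phi_N(c) itself among such
   operators. *)
have top : exists m, P m.
  have [D [D' [kD kD' DE]]] := fock_decomp Ob.
  have e2 : 0 < e / 2 by rewrite divr_gt0.
  have [N hN] := cmp_FJ_lim kD e2; exists N.
  have [rho hrho rhoE] : exists2 rho : A -> LOp (@CS R A (E N)), star_hom rho & forall a, lapp (rho a) = lact a.
    have /choice[rho hrho] x : exists d : LOp (@CS R A (E N)), lapp d = lact x.
      by apply: (LOp_mk (M := nr x) (@CS R A (E N)) (lact_is_adj x)) => y; exact: lact_bd.
    exists rho => //; split=> [k x y|x y|x]; apply: lapp_ext => z.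
    - by rewrite lappD lappZ !hrho lact_lin.
    - by rewrite lappM !hrho lactM.
    - rewrite hrho; congr (_ z); apply: (adj_uniq (f := lapp (rho x))); last exact: lapp_adj.
      by rewrite hrho; exact: lact_is_adj.
  have [r rE] : exists r : LOp (@CS R A (E N)), lapp r = cmp D.
    by apply: (LOp_mk (M := nr D) (@CS R A (E N)) (cmp_adj D)) => y; exact: cmp_bd.
  have Nc := @cut_ideal _ _ _ rho _ b c r e hrho (rangeI_ideal (E N) hS) pc cE.
  move=> y; rewrite -rhoE; apply: Nc.
    move=> z; rewrite lappB rhoE rE -cmp_fpi DE; have := @cmp_lin _ _ _ T N 1 D D'; rewrite !scale1r => -> /=.
    rewrite addrC addKr.
    have /(modIP hS) h := kD' (l2in z : fock T); apply/(modIP hS) => w.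
    by rewrite /cmp -(hip_inj_co w); exact: h.
  apply: (@le_lt_trans _ _ (e / 2)); last by rewrite ltr_pdivrMr // ltr_pMr // ltr1n.
  by apply: lapp_bound => [|z]; [exact: ltW|rewrite rE; exact: hN].
(* Decompose pi(c) = D + D'. The amplified component of D is phi_{m+1}(c) minus that of D', and both
   have range in X^(m+1) S, so [descend] applies to the component of D. *)
have step m : P m.+1 -> P m.
  move=> hP1; have [D [D' [kD kD' DE]]] := fock_decomp Oc.
  have kk := cmp_FJ kD m; have nS y : modI (E m) S (cmp D' y).
    have /(modIP hS) h := kD' (l2in y : fock T); apply/(modIP hS) => w.
    by rewrite /cmp -(hip_inj_co w); exact: h.
  have e1 : lact (c := E m) c = cmp D + cmp D' by rewrite -cmp_fpi DE; have := @cmp_lin _ _ _ T m 1 D D'; rewrite !scale1r.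
  have [k' _ ak] := kset_adm kk; have al := @lact_adm _ _ _ T m c.
  have an : adm (@cmp _ _ _ T m D') (conjc (-1) *: k' + lact (cstar c)).
    have -> : @cmp _ _ _ T m D' = (-1) *: cmp D + lact (c := E m) c.
      by rewrite e1 scaleN1r addrA addNr add0r.
    exact: adm_lin.
  have ko u : modI (E m.+1) S (otimes1 (@cmp _ _ _ T m D) u).
    have -> : @cmp _ _ _ T m D = (-1) *: cmp D' + lact (c := E m) c.
      by rewrite e1 scaleN1r addrCA addNr addr0.
    rewrite (otimes1_lin (-1) an al) otimes1_lact /=; apply: (modID hS); last exact: hP1.
    by apply: (modIZ hS); exact: (otimes1_modI an nS).
  move=> y; rewrite e1 /=; apply: (modID hS); last exact: nS.
  exact: (descend kk ko).
have P0 : P 0%N by case: top => m; elim: m => // m IH /step.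
(* [P 0] evaluated at c itself says that <c c, c c> is in S, from which c is recovered by two
   applications of [ideal_sq]. *)
apply: (ideal_sq hS); rewrite (cpos_sa pc); apply: (ideal_sq hS).
exact: (proj1 (modI_hip hS _) (P0 c)).
Qed.

End SatKernel.

(** * Roots of unity, averaging and gauge-invariant uniqueness *)

Section RootsOfUnity.
Variable R : realType.
Local Notation C := (R[i]).

(** Repeated square roots starting from -1 keep the half power equal to -1, so the order is not a
    proper divisor. Averages need such roots of arbitrarily large order. *)
Lemma prim_root_pow2 k : exists w : C, (2 ^ k).-primitive_root w.
Proof.
have [w [w1 wh]] : exists w : C, w ^+ (2 ^ k) = 1 /\ (forall l, k = l.+1 -> w ^+ (2 ^ l) = -1).
  elim: k => [|k [w [w1 wh]]]; first by exists 1; split; rewrite ?expr1n.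
  case: k w1 wh => [|k] w1 wh.
    by exists (-1); split=> [|l [<-]]; rewrite ?expr1 // expn1 sqrrN expr1n.
  exists (sqrtc w); split=> [|l [<-]].
    by rewrite expnS exprM sqr_sqrtc.
  by rewrite expnS exprM sqr_sqrtc wh.
exists w; have N0 : (0 < 2 ^ k)%N by rewrite expn_gt0.
have [m hm dm] := prim_order_exists N0 w1.
have [e ek mE] := dvdn_pfactor _ _ (isT : prime 2) dm.
have [<- //|ek'] := eqVneq e k; first by rewrite -mE.
case: k w1 wh N0 dm ek ek' => [|k] w1 wh N0 dm ek ek'; first by move: ek ek'; rewrite leqn0 => ->.
have : w ^+ (2 ^ k) = 1.
  have ek2 : (e <= k)%N by rewrite -ltnS ltn_neqAle ek'.
  by rewrite -(subnK ek2) expnD mulnC -mE exprM (prim_expr_order hm) expr1n.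
rewrite (wh k) // => /eqP; rewrite eq_sym -subr_eq0 opprK.
by rewrite (_ : 1 + 1 = 2%:R) // pnatr_eq0.
Qed.

Lemma prim_cabs N (w : C) : (0 < N)%N -> w ^+ N = 1 -> cabs w = 1.
Proof.
move=> N0 wN; have h : cabs w ^+ N = 1.
  have cX n : cabs (w ^+ n) = cabs w ^+ n.
    elim: n => [|n IH]; first by rewrite !expr0 (cabs_real 1) normr1.
    by rewrite !exprS cabsM IH.
  by rewrite -cX wN (cabs_real 1) normr1.
by apply/eqP; rewrite -(pexpr_eq1 N0) ?cabs_ge0 // h.
Qed.

Lemma cabs_conj (z : C) : cabs z = 1 -> z * conjc z = 1.
Proof.
move=> h; have : `|z| ^+ 2 = z * z^*%C by exact: sqr_normc.
by rewrite cabsE h expr1n => <-.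
Qed.

Lemma root_sum N (w : C) n m : N.-primitive_root w -> (n < N)%N -> (m < N)%N ->
  \sum_(j < N) ((w ^+ j) ^+ n * (conjc (w ^+ j)) ^+ m) = (if n == m then N%:R else 0).
Proof.
move=> hw nN mN; have N0 := prim_order_gt0 hw; have wN := prim_expr_order hw.
have wc := cabs_conj (prim_cabs N0 wN).
pose z := w ^+ n * conjc w ^+ m.
have zE (j : nat) : (w ^+ j) ^+ n * conjc (w ^+ j) ^+ m = z ^+ j.
  by rewrite rmorphXn exprMn -!exprM mulnC [(j * m)%N]mulnC.
rewrite (eq_bigr (fun j : 'I_N => z ^+ j)) => [|j _]; last exact: zE.
case: eqVneq => [nm|nm].
  have -> : z = 1 by rewrite /z nm -exprMn wc expr1n.
  rewrite (eq_bigr (fun=> 1)) => [|j _]; last by rewrite expr1n.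
  by rewrite sumr_const card_ord.
have z1 : z != 1.
  apply/eqP => h; have : w ^+ n = w ^+ m.
    by rewrite -[RHS]mul1r -h /z -mulrA [conjc w ^+ m * _]mulrC -exprMn wc expr1n mulr1.
  move/eqP; rewrite (eq_prim_root_expr hw) !modn_small // => /eqP e.
  by rewrite e eqxx in nm.
have zN : z ^+ N = 1 by rewrite -zE !wN rmorph1 !expr1n mulr1.
have : (z - 1) * \sum_(j < N) z ^+ j = 0 by rewrite -subrX1 zN subrr.
by move/eqP; rewrite mulf_eq0 subr_eq0 (negbTE z1) => /eqP.
Qed.

Lemma cabsD (a b : C) : cabs (a + b) <= cabs a + cabs b.
Proof. by rewrite -lecR rmorphD -!cabsE ler_normD. Qed.

Lemma pow_near (z : C) n m : cabs z = 1 -> cabs (z ^+ n * conjc z ^+ m - 1) <= (n + m)%:R * cabs (z - 1).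
Proof.
move=> h; have step (a b : C) : cabs b = 1 -> cabs (b * a - 1) <= cabs (a - 1) + cabs (b - 1).
  move=> b1; have -> : b * a - 1 = b * (a - 1) + (b - 1) by ring.
  by rewrite (le_trans (cabsD _ _)) // cabsM b1 mul1r.
have cz : cabs (conjc z - 1) = cabs (z - 1).
  by rewrite -[X in _ - X](rmorph1 (@conjc R)) -rmorphB cabsJ.
elim: n => [|n IH].
  rewrite expr0 mul1r add0n; elim: m => [|m IH]; first by rewrite expr0 subrr mul0r (cabs_real 0) normr0.
  rewrite exprS -addn1 natrD mulrDl mul1r (le_trans (step _ _ _)) ?cabsJ // cz lerD2r.
  exact: IH.
by rewrite exprS -mulrA addSn -addn1 natrD mulrDl mul1r (le_trans (step _ _ _)) // lerD2r.
Qed.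

Lemma pigeonhole N (K : finType) (f : 'I_N -> K) : (0 < N)%N ->
  exists c, (N <= #|K| * #|[pred j | f j == c]|)%N.
Proof.
move=> N0; apply/existsP; rewrite -[X in is_true X]negbK negb_exists; apply/negP => /forallP h.
have e1 : (\sum_(c : K) #|[pred j | f j == c]| = N)%N.
  rewrite -[RHS](card_ord N) -sum1_card (partition_big f xpredT) //=.
  by apply: eq_bigr => c _; rewrite -sum1_card; apply: eq_bigl => j; rewrite inE.
have K0 : (0 < #|K|)%N by apply/card_gt0P; exists (f (Ordinal N0)).
have : (\sum_(c : K) #|K| * #|[pred j | f j == c]| <= \sum_(c : K) N.-1)%N.
  by apply: leq_sum => c _; have := h c; rewrite -ltnNge; lia.
rewrite -big_distrr /= e1 sum_nat_const leq_pmul2l //; clear -N0; lia.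
Qed.

(* Two of the [w^j] in the same cell of a grid are close; dividing by one of them gives roots close to [1]. *)
Lemma near_one (d : R) : 0 < d -> exists2 K, (0 < K)%N & forall N (w : C), N.-primitive_root w ->
  (N <= K * #|[pred j : 'I_N | (cabs (w ^+ j - 1) <= d)%R]|)%N.
Proof.
move=> d0.
have [L L0 hL] : exists2 L : nat, (0 < L)%N & 2 <= d * L%:R.
  exists (Num.truncn (2 / d)).+1 => //.
  have := truncnS_gt (2 / d); rewrite ltr_pdivrMr // mulrC => /ltW; exact.
pose T := 'I_((2 * L).+1); exists #|{: T * T}|; first by rewrite card_prod !card_ord muln_gt0.
move=> N w hw; have N0 := prim_order_gt0 hw; have wN := prim_expr_order hw.
have w1 := prim_cabs N0 wN.
pose cell (x : R) : T := inord (Num.truncn ((x + 1) * L%:R)).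
have cellP x y : -1 <= x <= 1 -> -1 <= y <= 1 -> cell x = cell y -> `|x - y| * L%:R <= 1.
  move=> /andP[x1 x2] /andP[y1 y2] /(congr1 val).
  have LR : 0 <= L%:R :> R by rewrite ler0n.
  have tb (u : R) : -1 <= u -> u <= 1 -> (Num.truncn ((u + 1) * L%:R) < (2 * L).+1)%N.
    move=> u1 u2; rewrite ltnS -(ler_nat R); apply: (@le_trans _ _ ((u + 1) * L%:R)).
      by rewrite truncn_le mulr_ge0 //; lra.
    by rewrite natrM ler_wpM2r //; lra.
  rewrite /= !inordK ?tb // => e.
  have u0 (u : R) : -1 <= u -> 0 <= (u + 1) * L%:R by move=> ?; rewrite mulr_ge0 //; lra.
  have := u0 _ x1; have := u0 _ y1; rewrite -!truncn_le.
  have := truncnS_gt ((x + 1) * L%:R); have := truncnS_gt ((y + 1) * L%:R).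
  rewrite e -[(Num.truncn _).+1]addn1 !natrD; move: (Num.truncn _)%:R => t.
  rewrite -[L%:R]ger0_norm // -normrM ger0_norm // ler_norml; lra.
have cre_im (z : C) : `|complex.Re z| <= cabs z /\ `|complex.Im z| <= cabs z.
  case: z => a b; rewrite /cabs normc_def /=; split; rewrite -sqrtr_sqr ler_sqrt ?addr_ge0 ?sqr_ge0 //.
    by rewrite lerDl sqr_ge0.
  by rewrite lerDr sqr_ge0.
have cle (z : C) : cabs z <= `|complex.Re z| + `|complex.Im z|.
  have h0 : 0 <= `|complex.Re z| + `|complex.Im z| by rewrite addr_ge0.
  rewrite -(ler_pXn2r (n := 2)) ?nnegrE ?cabs_ge0 //.
  case: z h0 => a b /= h0; rewrite /cabs normc_def /= sqr_sqrtr ?addr_ge0 ?sqr_ge0 //.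
  rewrite -[a ^+ 2]real_normK ?num_real // -[b ^+ 2]real_normK ?num_real //.
  have := normr_ge0 a; have := normr_ge0 b; nra.
pose f (j : 'I_N) : T * T := (cell (complex.Re (w ^+ j)), cell (complex.Im (w ^+ j))).
have [c hc] := pigeonhole f N0; apply: (leq_trans hc); rewrite leq_mul2l; apply/orP; right.
have [j0 /= /eqP fj0|h0] := pickP [pred j | f j == c]; last by rewrite (eq_card0 h0).
have wj (j : nat) : cabs (w ^+ j) = 1.
  by elim: j => [|j IH]; rewrite ?expr0 ?(cabs_real 1) ?normr1 // exprS cabsM w1 IH mulr1.
have rng (j : nat) : -1 <= complex.Re (w ^+ j) <= 1 /\ -1 <= complex.Im (w ^+ j) <= 1.
  by have [] := cre_im (w ^+ j); rewrite wj !ler_norml.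
have hj j : f j = c -> cabs (w ^+ j - w ^+ j0) <= d.
  move=> fj; have [r1 i1] := rng j; have [r2 i2] := rng j0.
  move: fj; rewrite -fj0 => -[/(cellP _ _ r1 r2) h1 /(cellP _ _ i1 i2) h2].
  have LR : 0 < L%:R :> R by rewrite ltr0n.
  rewrite -(ler_pM2r LR); apply: le_trans hL; apply: (le_trans (ler_wpM2r (ltW LR) (cle _))).
  by rewrite !raddfB mulrDl [leRHS](_ : 2 = 1 + 1) // lerD.
pose s (j : 'I_N) : 'I_N := Ordinal (ltn_pmod (j + (N - j0)) N0).
have sinj : injective s.
  move=> i j /(congr1 val) /= /eqP; rewrite eqn_modDr !modn_small // => /eqP; exact: val_inj.
rewrite -(card_image sinj); apply: subset_leq_card; apply/fintype.subsetP => _ /fintype.imageP[j hj' ->].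
move: hj'; rewrite !inE => /eqP /hj; apply: le_trans.
rewrite /= prim_expr_mod //.
have e1 : w ^+ (j + (N - j0)) - 1 = w ^+ (N - j0) * (w ^+ j - w ^+ j0).
  rewrite mulrBr -!exprD [(N - j0 + j0)%N]subnK; last exact: ltnW.
  by rewrite wN addnC.
by rewrite e1 cabsM wj mul1r.
Qed.

End RootsOfUnity.

Section Gauge.
Variables (R : realType) (P O : cstarAlg R) (g : P -> O) (alpha : R[i] -> P -> P).
Variables (G : nat -> nat -> set P) (C : set P).
Hypotheses (hg : star_hom g) (ha : forall z, cabs z = 1 -> star_hom (alpha z)).
Hypothesis (hker : forall z b, cabs z = 1 -> g b = 0 -> g (alpha z b) = 0).
Hypothesis (hG : forall n m z b, cabs z = 1 -> G n m b -> alpha z b = (z ^+ n * conjc z ^+ m) *: b).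
Hypothesis (hspan : forall b, approx (lspan [set b | exists n m, G n m b]) b).
Hypotheses (C0 : C 0) (Clin : forall (k : R[i]) c d, C c -> C d -> C (k *: c + d)).
Hypotheses (CG : forall n b, G n n b -> C b) (Ciso : forall c, C c -> nr c <= nr (g c)).

(** A finite substitute for the integral of the gauge action over the circle. For a primitive N-th
    root it is the exact projection onto the diagonal degrees on sums of elements of degrees (n, m)
    with n, m < N. *)
Definition avg N (w : R[i]) (b : P) : P := (N%:R)^-1 *: \sum_(j < N) alpha (w ^+ j) b.

Section Avg.
Variables (N : nat) (w : R[i]).
Hypothesis hw : N.-primitive_root w.

Let w1 (j : nat) : cabs (w ^+ j) = 1.
Proof.
apply: (prim_cabs (prim_order_gt0 hw)).
by rewrite -exprM mulnC exprM (prim_expr_order hw) expr1n.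
Qed.

Lemma avg_lin : linear (avg N w).
Proof.
move=> k b c; rewrite /avg scalerA mulrC -scalerA -scalerDr; congr (_ *: _).
rewrite scaler_sumr -big_split; apply: eq_bigr => j _; exact: (sh_lin (ha (w1 j))).
Qed.

Lemma avg_nr b : nr (avg N w b) <= nr b.
Proof.
have N0 : (0 < N%:R :> R) by rewrite ltr0n (prim_order_gt0 hw).
rewrite /avg -(rmorph_nat (real_complex R)) -fmorphV nrZr gtr0_norm ?invr_gt0 // ler_pdivrMl //.
rewrite (le_trans (nr_sum _ _ _)) // (le_trans (y := \sum_(j < N) nr b)) //.
  by apply: ler_sum => j _; exact: star_hom_contractive (ha (w1 j)).
by rewrite sumr_const card_ord mulr_natl.
Qed.

Lemma avg_core b D : (D <= N)%N -> lspan [set b | exists n m, [/\ G n m b, (n < D)%N & (m < D)%N]] b -> C (avg N w b).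
Proof.
move=> DN; have N0 : (N%:R : R[i]) != 0 by rewrite pnatr_eq0 -lt0n (prim_order_gt0 hw).
elim/lspan_ind => [|k c d [n [m [hc nD mD]]] _ IH]; first by rewrite (lin0 avg_lin).
rewrite avg_lin; apply: Clin => //; rewrite /avg.
rewrite (eq_bigr (fun j : 'I_N => ((w ^+ j) ^+ n * conjc (w ^+ j) ^+ m) *: c)) => [|j _]; last exact: hG.
rewrite -scaler_suml (root_sum hw (leq_trans nD DN) (leq_trans mD DN)).
have [nm|_] := eqVneq n m; last by rewrite scale0r scaler0.
by rewrite scalerA mulVf // scale1r; apply: (CG (n := n)); rewrite {2}nm.
Qed.

Lemma avg_ker b : g b = 0 -> g (avg N w b) = 0.
Proof.
move=> gb; have gl := sh_lin hg; rewrite /avg (linZ gl).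
suff -> : g (\sum_(j < N) alpha (w ^+ j) b) = 0 by rewrite scaler0.
apply: (big_ind (fun x => g x = 0)) => [|x y hx hy|j _]; [exact: lin0|by rewrite (linD gl) hx hy addr0|exact: hker].
Qed.

End Avg.

Lemma span_degree b : lspan [set b | exists n m, G n m b] b ->
  exists D, lspan [set b | exists n m, [/\ G n m b, (n < D)%N & (m < D)%N]] b.
Proof.
elim/lspan_ind => [|k c d [n [m hc]] _ [D hD]]; first by exists 0%N; exact: lspan0.
pose D' := maxn D (maxn n m).+1; exists D'; apply: lspan_cons.
  by exists n, m; split=> //; rewrite /D'; lia.
elim/lspan_ind: hD => [|l c' v [n' [m' [hx h1 h2]]] _ IH]; first exact: lspan0.
by apply: lspan_cons => //; exists n', m'; split=> //; rewrite /D'; lia.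
Qed.

Lemma alpha_near b : lspan [set b | exists n m, G n m b] b -> exists2 M : R, 0 <= M &
  forall z, cabs z = 1 -> nr (alpha z b - b) <= M * cabs (z - 1).
Proof.
elim/lspan_ind => [|k c d [n [m hc]] _ [M M0 hM]].
  by exists 0 => // z hz; rewrite (lin0 (sh_lin (ha hz))) subrr nr0 mul0r.
exists (cabs k * ((n + m)%:R * nr c) + M); first by rewrite addr_ge0 // !mulr_ge0 ?cabs_ge0 ?nr_ge0 ?ler0n.
move=> z hz; rewrite (sh_lin (ha hz)) (hG hz hc).
have -> : k *: ((z ^+ n * conjc z ^+ m) *: c) + alpha z d - (k *: c + d) =
    k *: ((z ^+ n * conjc z ^+ m - 1) *: c) + (alpha z d - d) by lmodule R.
rewrite mulrDl (le_trans (nrD _ _)) // lerD ?hM // nrZ nrZ -!mulrA ler_wpM2l ?cabs_ge0 //.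
rewrite [nr c * _]mulrC mulrA ler_wpM2r ?nr_ge0 //; exact: pow_near.
Qed.

(* The averages of [p] over the roots of unity dominate a fixed fraction of [p], since a fixed fraction of the roots
   moves [p] by at most [|p|/2]. *)
Lemma avg_lower p : cpositive p -> exists2 K : R, 0 <= K & forall N w, N.-primitive_root w -> nr p <= K * nr (avg N w p).
Proof.
move=> pp; have [p0|/nr_le0 ->] := ltP 0 (nr p); last by exists 0 => // N w _; rewrite nr0 mul0r.
have p8 : 0 < nr p / 8 by rewrite divr_gt0.
have [p1 /alpha_near[M M0 hM] hp1] := hspan p p8.
have d0 : 0 < nr p / 4 / (1 + M) by rewrite !divr_gt0 // ltr_pwDl.
have [K K0 hK] := near_one d0; exists (2 * K%:R); first by rewrite mulr_ge0.
move=> N w hw; have N0 := prim_order_gt0 hw; have := hK N w hw; set Q := [pred j | _] => hQ.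
have w1 (j : nat) : cabs (w ^+ j) = 1.
  by apply: (prim_cabs N0); rewrite -exprM mulnC exprM (prim_expr_order hw) expr1n.
have near j : Q j -> nr (alpha (w ^+ j) p - p) <= nr p / 2.
  move=> /= hj; have hj' := ha (w1 j).
  have -> : alpha (w ^+ j) p - p = alpha (w ^+ j) (p - p1) + (alpha (w ^+ j) p1 - p1) + (p1 - p).
    by rewrite (linB (sh_lin hj')); lmodule R.
  have a1 : nr (alpha (w ^+ j) (p - p1)) <= nr p / 8 by rewrite (le_trans (star_hom_contractive _ hj')).
  have a2 : nr (alpha (w ^+ j) p1 - p1) <= nr p / 4.
    rewrite (le_trans (hM _ (w1 j))) // mulrC (le_trans (ler_wpM2r M0 hj)) //.
    by apply: frac_small => //; rewrite divr_ge0 ?nr_ge0.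
  have a3 : nr (p1 - p) <= nr p / 8 by rewrite nrC.
  have := nrD (alpha (w ^+ j) (p - p1)) (alpha (w ^+ j) p1 - p1).
  have := nrD (alpha (w ^+ j) (p - p1) + (alpha (w ^+ j) p1 - p1)) (p1 - p); lra.
have lowQ : #|Q|%:R * (nr p / 2) <= nr (\sum_(j < N | Q j) alpha (w ^+ j) p).
  have : nr (\sum_(j < N | Q j) p) <= nr (\sum_(j < N | Q j) alpha (w ^+ j) p) + \sum_(j < N | Q j) (nr p / 2).
    apply: (le_trans (nr_distl _ (\sum_(j < N | Q j) alpha (w ^+ j) p))); rewrite lerD2l -sumrB.
    rewrite (le_trans (nr_sum _ _ _)) //; apply: ler_sum => j /near; by rewrite nrC.
  rewrite !sumr_const -scaler_nat -(rmorph_nat (real_complex R)) nrZr ger0_norm ?ler0n //.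
  rewrite -[(nr p / 2) *+ _]mulr_natl; lra.
have upQ : nr (\sum_(j < N | Q j) alpha (w ^+ j) p) <= nr (\sum_(j < N) alpha (w ^+ j) p).
  have pos (S : pred 'I_N) : cpositive (\sum_(j < N | S j) alpha (w ^+ j) p).
    apply: big_ind => [|x y|j _]; [exact: cpos0|exact: cposD|].
    have [c ->] := pp; exists (alpha (w ^+ j) c).
    by rewrite (sh_mul (ha (w1 j))) (sh_star (ha (w1 j))).
  apply: cpos_le; first exact: pos.
  by rewrite [X in cpositive (X - _)](bigID Q) /= addrAC subrr add0r; exact: pos.
have NR : 0 < N%:R :> R by rewrite ltr0n.
have avE : N%:R * nr (avg N w p) = nr (\sum_(j < N) alpha (w ^+ j) p).
  rewrite /avg -(rmorph_nat (real_complex R)) -fmorphV nrZr gtr0_norm ?invr_gt0 // mulrA mulfV ?mul1r //.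
  by rewrite gt_eqF.
have hQ' : N%:R <= K%:R * #|Q|%:R :> R by rewrite -natrM ler_nat.
rewrite -(ler_pM2l NR).
have KR : 0 < K%:R :> R by rewrite ltr0n.
have h1 := ler_wpM2r (nr_ge0 p) hQ'.
have h2 := ler_wpM2l (ltW KR) (le_trans lowQ upQ); rewrite -avE in h2.
have -> : N%:R * (2 * K%:R * nr (avg N w p)) = 2 * (K%:R * (N%:R * nr (avg N w p))) by ring.
lra.
Qed.

(** The averages of p = b^* b lie in the kernel of [g]. For N beyond the degrees of a finite
    approximant of p they are also close to core elements, on which [g] does not decrease norms, so
    they are small. [avg_lower] bounds p by their norm with a constant independent of N. *)
Lemma gauge_inj b : g b = 0 -> b = 0.
Proof.
move=> gb; pose p := cstar b ** b.
have gp : g p = 0 by rewrite /p (sh_mul hg) gb cmul0r.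
suff p0 : p = 0 by apply/nr_le0; rewrite -(ler_pXn2r (n := 2)) ?nnegrE ?nr_ge0 // -nr_starM -/p p0 nr0 expr0n.
have [K K0 hK] : exists2 K : R, 0 <= K & forall N w, N.-primitive_root w -> nr p <= K * nr (avg N w p).
  by apply: avg_lower; exists b.
apply/nr_le0/ler_addgt0Pr => e e0; rewrite add0r.
have d0 : 0 < e / (1 + 2 * K) by rewrite divr_gt0 // ltr_pwDl // mulr_ge0.
have [p2 p2S hp2] := hspan p d0; have [D hD] := span_degree p2S.
have [w hw] := prim_root_pow2 R D.
have DN : (D <= 2 ^ D)%N by apply: ltnW; exact: ltn_expl.
have Cp2 := avg_core hw DN hD; have gl := sh_lin hg.
have h1 : nr (avg (2 ^ D) w p - avg (2 ^ D) w p2) <= e / (1 + 2 * K).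
  by rewrite -(linB (avg_lin hw)) (le_trans (avg_nr hw _)).
have h2 : nr (avg (2 ^ D) w p2) <= e / (1 + 2 * K).
  apply: (le_trans (Ciso Cp2)); rewrite -nrN -[- g _]add0r -{1}(avg_ker hw gp) -(linB gl).
  by rewrite (le_trans (star_hom_contractive _ hg)).
apply: (le_trans (hK _ _ hw)).
have h3 := le_trans (nr_distl (avg (2 ^ D) w p) (avg (2 ^ D) w p2)) (lerD h2 h1).
apply: (le_trans (ler_wpM2l K0 h3)).
have -> : K * (e / (1 + 2 * K) + e / (1 + 2 * K)) = e / (1 + 2 * K) * (2 * K) by ring.
by apply: frac_small; [exact: ltW|rewrite mulr_ge0].
Qed.

End Gauge.

(** * Naturality, and the norm of core elements *)

Section Naturality.
Variables (R : realType) (A : cstarAlg R) (X : corr A A) (T : tensor_powers X).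
Variables (B D : cstarAlg R) (pi : A -> B) (t : X -> B) (pi' : A -> D) (t' : X -> D) (h : B -> D).
Hypotheses (hr : is_rep pi t) (hr' : is_rep pi' t') (hh : star_hom h).
Hypotheses (hpi : forall a, h (pi a) = pi' a) (ht : forall x, h (t x) = t' x).
Local Notation E := (tpow T).

Lemma tpowr_nat n (u : E n) : h (tpowr setT pi t u) = tpowr setT pi' t' u.
Proof.
have mr k : modrep setT pi setT (@tpowr _ _ _ T setT _ pi t k).
  by have := tpowr_rep T (@idealT _ _) (rep_irep hr) k; rewrite zpowT.
have mr' k : modrep setT pi' setT (@tpowr _ _ _ T setT _ pi' t' k).
  by have := tpowr_rep T (@idealT _ _) (rep_irep hr') k; rewrite zpowT.
have bd k v : nr (@tpowr _ _ _ T setT _ pi t k v) <= nr v.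
  exact: (mr_nr (@idealT _ _) (ir_hom (rep_irep hr)) (mr k)).
have bd' k v : nr (@tpowr _ _ _ T setT _ pi' t' k v) <= nr v.
  exact: (mr_nr (@idealT _ _) (ir_hom (rep_irep hr')) (mr' k)).
elim: n u => [|[|n] IH] u; [exact: hpi|exact: ht|].
apply: (@dense_eq _ _ _ _ _ _ (fun u => h (tpowr setT pi t u)) (fun u => tpowr setT pi' t' u) 1 1).
- by move=> k v w; rewrite (mr_lin (mr n.+2)) // (sh_lin hh).
- by move=> k v w; rewrite (mr_lin (mr' n.+2)).
- by move=> z; rewrite mul1r (le_trans (star_hom_contractive _ hh)).
- by move=> z; rewrite mul1r.
- move=> y x; rewrite (tpowr_tens (@idealT _ _) (rep_irep hr)) ?zpowT ?modIT //.
  by rewrite (tpowr_tens (@idealT _ _) (rep_irep hr')) ?zpowT ?modIT // (sh_mul hh) IH ht.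
Qed.

Lemma tensor_rep_nat n m (a : E m -> E n) : kset setT setT a ->
  h (tensor_rep hr a) = tensor_rep hr' a.
Proof.
move=> ka; apply: (@kc_eq _ _ _ _ setT setT _ (fun a => h (tensor_rep hr a)) (fun a => tensor_rep hr' a)) ka.
- exact: kc_hom (tensor_rep_cont _ _ _ _).
- exact: tensor_rep_cont.
- by move=> z y _ _; rewrite !tensor_rep_theta (sh_mul hh) (sh_star hh) !tpowr_nat.
Qed.

End Naturality.

Lemma adm0 (R : realType) (A : cstarAlg R) (X : corr A A) (T : tensor_powers X) m n :
  adm (0 : tpow T m -> tpow T n) 0.
Proof.
split; first by move=> y z; rewrite /= hip0l hip0r.
- by exists 0 => //; exact: obd0.
- by case: m => //; exists 0; apply/funext => a; rewrite /vec ract0l.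
- by case: n => //; exists 0; apply/funext => a; rewrite /vec ract0l.
Qed.

Lemma otimes1_0 (R : realType) (A : cstarAlg R) (X : corr A A) (T : tensor_powers X) k l :
  otimes1 (0 : tpow T k -> tpow T l) = 0.
Proof. by have := otimes1_lin (-1) (adm0 T k l) (adm0 T k l); rewrite scaleN1r addNr => ->; rewrite scaleN1r addNr. Qed.

Section Core.
Variables (R : realType) (A : cstarAlg R) (X : corr A A) (T : tensor_powers X) (J : set A).
Local Notation E := (tpow T).
Local Notation F := (fock T).
Local Notation FL := (LOp (@CS R A F)).
Local Notation iF := (@fock_iota R A X T _ _).
Variables (P : cstarAlg R) (W : forall k, set (E k -> E k)) (kappa : forall k, (E k -> E k) -> P).

Record core_sys : Prop := CoreSys {
  cs_k : forall k, @W k `<=` kset setT setT;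
  cs_0 : forall k, @W k 0;
  cs_linW : forall k (c : R[i]) a b, @W k a -> @W k b -> @W k (c *: a + b);
  cs_closed : forall k a, (forall e : R, 0 < e -> exists2 b, @W k b & obd (a - b) e) -> @W k a;
  cs_adj : forall k a, @W k a -> exists2 a', @W k a' & is_adjoint a a' /\ cstar (@kappa k a) = @kappa k a';
  cs_mul : forall k j a (b : E (j + k)%N -> E (j + k)%N), @W k a -> @W (j + k)%N b ->
    @W (j + k)%N (otimes1k a (k := j) \o b) /\ @kappa k a ** @kappa (j + k)%N b = @kappa (j + k)%N (otimes1k a (k := j) \o b);
  cs_lin : forall k (c : R[i]) a b, @W k a -> @W k b -> @kappa k (c *: a + b) = c *: @kappa k a + @kappa k b;
  cs_bd : forall k a M, @W k a -> 0 <= M -> obd a M -> nr (@kappa k a) <= M;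
  cs_coiso : forall k a, @W k a -> kset (modI (E k) J) setT a ->
    @W k.+1 (otimes1 a) /\ @kappa k.+1 (otimes1 a) = @kappa k a }.

Hypotheses (hJ : cstar_ideal J) (hJX : J `<=` Jideal X) (hc : core_sys).

Let fam := forall k, E k -> E k.
Implicit Types a b : fam.

Definition dsum (a : fam) n : FL := \sum_(k < n) iF (a k).
Definition csum (a : fam) n : P := \sum_(k < n) kappa (a k).

Lemma dsumS a n : dsum a n.+1 = dsum a n + iF (a n). Proof. exact: big_ord_recr. Qed.

Lemma iF_lin k (c : R[i]) (u v : E k -> E k) : kset setT setT u -> kset setT setT v ->
  iF (c *: u + v) = c *: iF u + iF v.
Proof. by apply: (kc_lin (@tensor_rep_cont _ _ _ _ _ _ _ T k k)). Qed.

Lemma iF0 k : iF (0 : E k -> E k) = 0.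
Proof. exact: lin_on0 (@kset0 _ _ _ _ _ _) (@iF_lin k). Qed.

Lemma kappa0 k : kappa (0 : E k -> E k) = 0.
Proof. exact: lin_on0 (cs_0 hc k) (@cs_lin hc k). Qed.

Lemma cmpD m D D' : @cmp _ _ _ T m (D + D') = cmp D + cmp D'.
Proof. by have := @cmp_lin _ _ _ T m 1 D D'; rewrite !scale1r. Qed.

Lemma cmp_iF_adm k m (u : E k -> E k) : kset setT setT u -> exists v, adm (@cmp _ _ _ T m (iF u)) v.
Proof.
move=> ku; have [u' ku' au] := kset_adm ku; have [mk|km] := ltnP m k.
  by rewrite cmp_iota_low //; exists 0; exact: adm0.
rewrite -(subnK km) cmp_iotak //; exists (otimes1k u' (k := (m - k)%N)); exact: otimes1k_adm.
Qed.

Section Fam.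
Variable a : fam.
Arguments a : clear implicits.
Hypothesis Wa : forall k, W (a k).
Let ka k : kset setT setT (a k) := cs_k hc (Wa k).

Lemma cmp_dsum_adm m n : exists v, adm (@cmp _ _ _ T m (dsum a n)) v.
Proof.
elim: n => [|n [v hv]].
  have -> : dsum a 0 = 0 by exact: big_ord0.
  have -> : @cmp _ _ _ T m 0 = 0 by apply/funext => u; rewrite /cmp lapp0.
  by exists 0; exact: adm0.
have [w hw] := cmp_iF_adm m (ka n).
rewrite dsumS cmpD -[cmp (dsum a n)]scale1r; exists (conjc 1 *: v + w); exact: adm_lin.
Qed.

Lemma cmp_dsum0 n : @cmp _ _ _ T 0 (dsum a n) = (if (0 < n)%N then a 0%N else 0).
Proof.
elim: n => [|n IH]; first by apply/funext => u; rewrite /dsum big_ord0 /cmp lapp0.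
rewrite dsumS cmpD IH; case: n {IH} => [|n] /=.
  by rewrite (@cmp_iotak _ _ _ T 0 0) // add0r.
by rewrite cmp_iota_low // addr0.
Qed.

(** Each term with index at most m acts on X^(m+1) as its action on X^m tensored with 1; only the
    term of index m + 1 is new, and those of higher index act by 0. *)
Lemma cmp_dsumS m n : @cmp _ _ _ T m.+1 (dsum a n) =
  otimes1 (@cmp _ _ _ T m (dsum a n)) + (if (m.+1 < n)%N then a m.+1 else 0).
Proof.
elim: n => [|n IH].
  have z m' : @cmp _ _ _ T m' (dsum a 0) = 0 by apply/funext => u; rewrite /dsum big_ord0 /cmp lapp0.
  by rewrite !z otimes1_0 addr0.
have [v hv] := cmp_dsum_adm m n; have [w hw] := cmp_iF_adm m (ka n).
have e1 : otimes1 (@cmp _ _ _ T m (dsum a n.+1)) = otimes1 (@cmp _ _ _ T m (dsum a n)) + otimes1 (@cmp _ _ _ T m (iF (a n))).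
  by rewrite dsumS cmpD; have := otimes1_lin 1 hv hw; rewrite !scale1r.
rewrite e1 dsumS cmpD IH.
have [nm|mn|nm] := ltngtP n m.+1.
- have f : (m.+1 < n.+1)%N = false by clear -nm; lia.
  by rewrite f cmp_iotaS // !addr0.
- have h1 : @cmp _ _ _ T m.+1 (iF (a n)) = 0 by exact: cmp_iota_low.
  have h2 : @cmp _ _ _ T m (iF (a n)) = 0 by apply: cmp_iota_low => //; exact: ltnW.
  by rewrite h1 h2 otimes1_0 !addr0 (leqW mn).
- subst n; have h1 : @cmp _ _ _ T m.+1 (iF (a m.+1)) = a m.+1 by exact: (@cmp_iotak _ _ _ T m.+1 0).
  have h2 : @cmp _ _ _ T m (iF (a m.+1)) = 0 by exact: cmp_iota_low.
  by rewrite h1 h2 otimes1_0 !addr0 ltnSn.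
Qed.

(* If [dsum a n] lies in [K(F, FJ)], its components satisfy [kappa_m (cmp m) = \sum_(k <= m) kappa (a k)]. *)
Lemma csum_kill n : kset (modI F J) setT (lapp (dsum a n)) -> csum a n = 0.
Proof.
move=> kD; have kJ := cmp_FJ kD.
have key m : W (@cmp _ _ _ T m (dsum a n)) /\
    kappa (@cmp _ _ _ T m (dsum a n)) = \sum_(k < n | (k <= m)%N) kappa (a k).
  elim: m => [|m [W1 k1]].
    rewrite cmp_dsum0; case: n {kD kJ} => [|n].
      by rewrite big_ord0; split; [exact: (cs_0 hc)|exact: kappa0].
    split; first exact: Wa.
    rewrite (big_pred1 ord0) // => k /=; by rewrite -val_eqE leqn0.
  have [W2 k2] := cs_coiso hc W1 (kJ m).
  have W3 : W (if (m.+1 < n)%N then a m.+1 else 0) by case: ifP => _; [exact: Wa|exact: (cs_0 hc)].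
  rewrite cmp_dsumS -[otimes1 _]scale1r; split; first exact: (cs_linW hc).
  rewrite (cs_lin hc) // scale1r k2 k1.
  case: ifP => hm.
    rewrite [RHS](bigD1 (Ordinal hm)) //= addrC; congr (_ + _).
    apply: eq_bigl => k; rewrite -val_eqE /=; lia.
  rewrite kappa0 addr0; apply: eq_bigl => k; have := ltn_ord k; lia.
apply/nr_le0/ler_addgt0Pr => e e0; rewrite add0r.
have [N hN] := cmp_FJ_lim kD e0; pose m := maxn N n.
have [W1 k1] := key m.
have -> : csum a n = kappa (@cmp _ _ _ T m (dsum a n)).
  by rewrite k1; apply: eq_bigl => k; have := ltn_ord k; rewrite /m; lia.
by apply: (cs_bd hc W1 (ltW e0)); apply: hN; rewrite leq_maxl.
Qed.

(* [a_k] is recovered from the components of [dsum a n]. *)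
Lemma coef_bd n k : (k < n)%N -> obd (a k) (2 * nr (dsum a n)).
Proof.
move=> kn; case: k kn => [|k] kn.
  have -> : a 0%N = @cmp _ _ _ T 0 (dsum a n) by rewrite cmp_dsum0 kn.
  by apply: obdW (@cmp_bd _ _ _ T _ _) _; have := nr_ge0 (dsum a n); lra.
have := cmp_dsumS k n; rewrite kn => e.
have -> : a k.+1 = cmp (dsum a n) - otimes1 (cmp (dsum a n)) by rewrite e addrC addKr.
have [v hv] := cmp_dsum_adm k n; have [_ _ b] := otimes1_adm hv.
rewrite mulr_natl mulr2n; apply: obdB; first exact: cmp_bd.
by apply: b; [exact: nr_ge0|exact: cmp_bd].
Qed.

End Fam.

Definition famlin (c : R[i]) a b : fam := fun k => c *: a k + b k.

Lemma dsum_lin c a b n : (forall k, W (a k)) -> (forall k, W (b k)) ->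
  [/\ forall k, W (@famlin c a b k), dsum (famlin c a b) n = c *: dsum a n + dsum b n &
      csum (famlin c a b) n = c *: csum a n + csum b n].
Proof.
move=> Wa Wb; split=> [k||]; first exact: (cs_linW hc).
- rewrite /dsum scaler_sumr -big_split; apply: eq_bigr => k _.
  by apply: iF_lin; apply: (cs_k hc).
- by rewrite /csum scaler_sumr -big_split; apply: eq_bigr => k _; exact: (cs_lin hc).
Qed.

(** The graph of a homomorphism [chi] from the Fock version of the core to P, kept as a relation
    until uniqueness is available; uniqueness is [csum_kill] for D = 0. *)
Definition drel n (D : FL) (c : P) := exists2 a, forall k, W (a k) & D = dsum a n /\ c = csum a n.

Lemma drel0 n : drel n 0 0.
Proof.
exists (fun k => 0); first exact: (cs_0 hc).
by split; rewrite /dsum /csum big1 // => k _; rewrite ?iF0 ?kappa0.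
Qed.

Lemma drel_lin n (k : R[i]) D c D' c' : drel n D c -> drel n D' c' -> drel n (k *: D + D') (k *: c + c').
Proof.
move=> [a Wa [-> ->]] [b Wb [-> ->]]; have [h1 h2 h3] := dsum_lin k n Wa Wb.
by exists (famlin k a b).
Qed.

Lemma drel_gen n k (u : E k -> E k) : (k < n)%N -> W u -> drel n (iF u) (kappa u).
Proof.
move=> kn Wu; pose a : fam := dfwith (fun l => 0 : E l -> E l) u.
have ao l : k != l -> a l = 0 by move=> kl; rewrite /a dfwith_out.
have ai : a k = u by rewrite /a dfwith_in.
exists a; first by move=> l; have [<-|kl] := eqVneq k l; rewrite ?ai // ao //; exact: (cs_0 hc).
by split; rewrite /dsum /csum (bigD1 (Ordinal kn)) //= ai big1 ?addr0 // => l;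
  rewrite -val_eqE /= eq_sym => kl; rewrite ao // ?iF0 ?kappa0.
Qed.

Lemma drel_sum n (I : Type) (r : seq I) (Q : pred I) (f : I -> FL) (g : I -> P) :
  (forall i, Q i -> drel n (f i) (g i)) -> drel n (\sum_(i <- r | Q i) f i) (\sum_(i <- r | Q i) g i).
Proof.
move=> h; elim/big_rec2: _ => [|i c D Qi IH]; first exact: drel0.
by have := drel_lin 1 (h i Qi) IH; rewrite !scale1r.
Qed.

Lemma iF_star k (u v : E k -> E k) : kset setT setT u -> is_adjoint u v -> cstar (iF u) = iF v.
Proof.
move=> ku uv; apply: (rtr_star (@tensor_rep_rtr _ _ _ _ _ _ _ T)) => //.
by rewrite KXTE.
Qed.

Lemma drel_star n D c : drel n D c -> drel n (cstar D) (cstar c).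
Proof.
move=> [a Wa [-> ->]].
have sumst (B : cstarAlg R) (f : 'I_n -> B) : cstar (\sum_(i < n) f i) = \sum_(i < n) cstar (f i).
  by apply: (big_morph (@cstar R B) (@cstarD R B) (@cstar0 R B)).
rewrite /dsum /csum !sumst; apply: drel_sum => k _.
have [v Wv [av kv]] := cs_adj hc (Wa k).
by rewrite (iF_star (cs_k hc (Wa k)) av) kv; apply: drel_gen.
Qed.

Lemma drel_mul_le n k l (u : E k -> E k) (v : E l -> E l) : (k <= l)%N -> (l < n)%N -> W u -> W v ->
  drel n (iF u ** iF v) (kappa u ** kappa v).
Proof.
move=> kl; have := subnK kl; move: (l - k)%N => j e; subst l => ln Wu Wv.
have [W1 ->] := cs_mul hc Wu Wv.
have -> : iF u ** iF v = iF (otimes1k u (k := j) \o v).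
  by apply: (rtr_mul (@tensor_rep_rtr _ _ _ _ _ _ _ T)); rewrite KXTE; exact: (cs_k hc).
exact: drel_gen.
Qed.

Lemma drel_mul n D c D' c' : drel n D c -> drel n D' c' -> drel n (D ** D') (c ** c').
Proof.
move=> [a Wa [-> ->]] [b Wb [-> ->]].
have dist (B : cstarAlg R) (f g : 'I_n -> B) : (\sum_(i < n) f i) ** (\sum_(i < n) g i) = \sum_(i < n) \sum_(j < n) f i ** g j.
  rewrite (big_morph (fun x => cmul x (\sum_(i < n) g i)) (fun x y => cmulDl x y _) (cmul0l _)).
  apply: eq_bigr => i _.
  by rewrite (big_morph (cmul (f i)) (fun x y => cmulDr x y _) (cmul0r _)).
rewrite /dsum /csum !dist; apply: drel_sum => k _; apply: drel_sum => l _.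
have [kl|lk] := leqP k l; first exact: drel_mul_le.
have [v Wv [av kv]] := cs_adj hc (Wa k); have [w Ww [aw kw]] := cs_adj hc (Wb l).
have := drel_star (drel_mul_le (ltnW lk) (ltn_ord k) Ww Wv).
rewrite -(iF_star (cs_k hc (Wa k)) av) -(iF_star (cs_k hc (Wb l)) aw) -kv -kw.
by rewrite -!cstarM !cstarK.
Qed.

Lemma drel_pad n N D c : (n <= N)%N -> drel n D c -> drel N D c.
Proof.
move=> nN [a Wa [-> ->]]; pose b : fam := fun k => if (k < n)%N then a k else 0.
exists b; first by move=> k; rewrite /b; case: ifP => _; [exact: Wa|exact: (cs_0 hc)].
split; rewrite /dsum /csum.
  rewrite (big_ord_widen N (fun k => iF (a k)) nN) big_mkcond; apply: eq_bigr => k _.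
  by rewrite /b; case: ifP; rewrite ?iF0 ?kappa0.
rewrite (big_ord_widen N (fun k => kappa (a k)) nN) big_mkcond; apply: eq_bigr => k _.
by rewrite /b; case: ifP; rewrite ?iF0 ?kappa0.
Qed.

Lemma drel_uniq n D c c' : drel n D c -> drel n D c' -> c = c'.
Proof.
move=> h h'; have [a Wa [aD aC]] := drel_lin (-1) h h'.
apply/eqP; rewrite eq_sym -subr_eq0 addrC -scaleN1r aC; apply/eqP/csum_kill => //.
rewrite -aD scaleN1r addNr (_ : lapp 0 = 0); first exact: kset0.
by apply/funext => f; exact: lapp0.
Qed.

Lemma drel_kill n D c : drel n D c -> kset (modI F J) setT (lapp D) -> c = 0.
Proof. by move=> [a Wa [-> ->]]; exact: csum_kill. Qed.

Lemma iF_bd k (u : E k -> E k) M : kset setT setT u -> 0 <= M -> obd u M -> nr (iF u) <= M.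
Proof. exact: tensor_rep_bd. Qed.

Definition dset n : set FL := [set D | exists c, drel n D c].

(** By [coef_bd], convergence of the sums forces convergence of each of the n coefficients, and each
    W_k is closed. Closedness is what makes [chi] contractive and keeps cut-down elements in the
    core. *)
Lemma dset_closed n : approx (dset n) `<=` dset n.
Proof.
move=> D hD; have h0 i : 0 < 1 / 2 ^+ i :> R by apply: halves.
have /choice[a ha] i : exists a : fam, (forall k, W (a k)) /\ nr (D - dsum a n) <= 1 / 2 ^+ i.
  by have [_ [c [a Wa [-> _]]] hd] := hD _ (h0 i); exists a.
have mono N i : (N <= i)%N -> 1 / 2 ^+ i <= 1 / 2 ^+ N :> R.
  by move=> Ni; rewrite ler_pM2l // lef_pV2 ?posrE ?exprn_gt0 // ler_eXn2l ?ltr1n.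
have hu0 k : exists u : E k -> E k, (k < n)%N ->
    W u /\ forall e : R, 0 < e -> exists N, forall i, (N <= i)%N -> obd (u - a i k) e.
  have [kn|nk] := ltnP k n; last by exists 0.
  have /choice[L LE] i : exists L : LOp (@CS R A (E k)), lapp L = a i k.
    have [v _ [av [M _ hM] _ _]] := kset_adm (cs_k hc (proj1 (ha i) k)).
    exact: (LOp_mk (M := M) (@CS R A (E k)) av hM).
  have dL i j : nr (L i - L j) <= 2 * nr (dsum (a i) n - dsum (a j) n).
    have [h1 h2 _] := dsum_lin (-1) n (proj1 (ha j)) (proj1 (ha i)).
    have := coef_bd h1 kn; rewrite h2 scaleN1r [- _ + _]addrC => b.
    apply: lapp_bound => [|y]; first by rewrite mulr_ge0 ?nr_ge0.
    rewrite lappB !LE (_ : a i k y - a j k y = @famlin (-1) (a j) (a i) k y); first exact: b.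
    change (a i k y - a j k y = (-1) *: a j k y + a i k y).
    by rewrite scaleN1r addrC.
  have cau : forall e : R, 0 < e -> exists N, forall i, (N <= i)%N -> nr (L i - L N) <= e.
    move=> e e0; have [//|N hN] := @half_small R 4 e e0; exists N => i Ni.
    apply: (le_trans (dL _ _)); apply: le_trans (hN N (leqnn _)).
    have := nr_tri D (dsum (a i) n) (dsum (a N) n); rewrite [nr (dsum (a i) n - D)]nrC.
    have := proj2 (ha i); have := proj2 (ha N); have := mono _ _ Ni.
    have -> : 4 / 2 ^+ N = 4 * (1 / 2 ^+ N) :> R by rewrite mul1r.
    move: (1 / 2 ^+ N) (1 / 2 ^+ i) (nr _) (nr _) (nr _) => p q r1 r2 r3; lra.
  have [l hl] := nr_complete cau; exists (lapp l) => _.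
  have lim (e : R) : 0 < e -> exists N, forall i, (N <= i)%N -> obd (lapp l - a i k) e.
    move=> /hl[N hN]; exists N => i /hN hi y; rewrite -LE; change (nr (lapp l y - lapp (L i) y) <= e * nr y).
    by rewrite -lappB (le_trans (lapp_le _ _)) // ler_wpM2r ?nr_ge0.
  split=> //; apply: (cs_closed hc) => e /lim[N hN]; exists (a N k); last exact: hN.
  exact: (proj1 (ha N)).
pose u k := proj1_sig (cid (hu0 k)); have hu k := proj2_sig (cid (hu0 k)); rewrite -/(u _) in hu.
pose u' : fam := fun k => if (k < n)%N then u k else 0.
have Wu' k : W (u' k) by rewrite /u'; case: ifP => [/hu[]//|_]; exact: (cs_0 hc).
exists (csum u' n), u' => //; split=> //.
apply: (@nlim_uniq _ _ (fun i => dsum (a i) n)).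
  move=> e e0; have [//|N hN] := @half_small R 1 e e0; exists N => i Ni.
  by apply: (le_trans (proj2 (ha i))); exact: hN.
apply: (@nlim_sum _ _ _ _ (fun (k : 'I_n) i => iF (a i k)) (fun k : 'I_n => iF (u' k))) => k e e0.
have [_ /(_ _ e0)[N hN]] := hu k (ltn_ord k); exists N => i /hN hi.
have k1 := cs_k hc (Wu' k); have k2 := cs_k hc (proj1 (ha i) k).
have := iF_lin (-1) k2 k1; rewrite !scaleN1r addrC [X in _ = X]addrC => <-.
apply: iF_bd; [|exact: ltW|by rewrite /u' ltn_ord].
by rewrite addrC -scaleN1r; apply: ksetD => //; exact: ksetZ.
Qed.

Lemma dset_sub n : cstar_sub (dset n).
Proof.
split.
- exact/closedP/dset_closed.
- by exists 0; exact: drel0.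
- by move=> D D' [c h] [c' h']; exists (c + c'); have := drel_lin 1 h h'; rewrite !scale1r.
- by move=> k D [c h]; exists (k *: c); have := drel_lin k h (drel0 n); rewrite !addr0.
- by move=> D D' [c h] [c' h']; exists (c ** c'); exact: drel_mul.
- by move=> D [c h]; exists (cstar c); exact: drel_star.
Qed.

Definition chi n (D : FL) : P := xget 0 (drel n D).

Lemma chiE n D c : drel n D c -> chi n D = c.
Proof. by move=> h; rewrite /chi; case: xgetP => [c' _ h'|/(_ c)//]; exact: drel_uniq h' h. Qed.

Lemma chi_hom n : hom_on (dset n) (chi n).
Proof.
split=> [k D D' [c h] [c' h']|D D' [c h] [c' h']|D [c h]].
- by rewrite (chiE (drel_lin k h h')) (chiE h) (chiE h').
- by rewrite (chiE (drel_mul h h')) (chiE h) (chiE h').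
- by rewrite (chiE (drel_star h)) (chiE h).
Qed.

(** L(F) modulo K(F, FJ) receives a homomorphism from O(J,X), so the class of D has norm at most
    |o|. Cut b = D^* D down just above |o|^2: the result d lies in K(F, FJ), so its value in P is 0
    ([drel_kill]). The value c^* c of b is thus that of b - d, whose norm exceeds |o|^2 by at most
    e. *)
Theorem core_bound (O : cstarAlg R) (iA : A -> O) (iX : X -> O) (hO : is_relCP J iA iX) (a : fam) n :
  (forall k, W (a k)) -> nr (csum a n) <= nr (\sum_(k < n) tensor_rep (cp_rep hO) (a k)).
Proof.
move=> Wa; set o := \sum_(k < n) _; pose D := dsum a n; pose c := csum a n.
have hD : drel n D c by exists a.
have hNJ := kset_ideal F hJ; have [Q [q [[hq _ qk] _]]] := quotient_alg hNJ.
have qJ d : kset (modI F J) setT (lapp d) -> q d = 0 by move=> kd; apply/qk.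
have [rep co] := fock_coiso hJ hJX hq qJ.
have [h hh [hA hX]] := cp_univ hO rep (approx_coisometric rep co).
have hq0 : q D = h o.
  rewrite /D /dsum /o (big_morph h (linD (sh_lin hh)) (lin0 (sh_lin hh))).
  rewrite (big_morph q (linD (sh_lin hq)) (lin0 (sh_lin hq))); apply: eq_bigr => k _.
  rewrite (tensor_rep_nat (cp_rep hO) rep hh hA hX (cs_k hc (Wa k))).
  exact: (tensor_rep_nat (@fock_rep _ _ _ T) rep hq (fun=> erefl) (fun=> erefl) (cs_k hc (Wa k))).
pose b := cstar D ** D; have hb : drel n b (cstar c ** c) by apply: drel_mul => //; exact: drel_star.
have qb : nr (q b) <= nr o ^+ 2.
  rewrite /b (sh_mul hq) (sh_star hq) nr_starM ler_pXn2r ?nnegrE ?nr_ge0 // hq0.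
  exact: star_hom_contractive.
rewrite -(ler_pXn2r (n := 2)) ?nnegrE ?nr_ge0 // -nr_starM -/c.
apply/ler_addgt0Pr => e e0; have p0 : 0 < nr o ^+ 2 + e by rewrite ltr_wpDl ?sqr_ge0.
have pb : cpositive b by exists D.
have [d [pd dE bd dM]] := cut_down pb p0.
have qd : q d = 0 by apply: (cut_hom hq pd dE); rewrite (le_lt_trans qb) // ltrDl.
have Dd : dset n d by apply: (dM _ (sub_calg (dset_sub n))); exists (cstar c ** c).
have [x hx] := Dd; have x0 : x = 0 by apply: (drel_kill hx); apply/qk.
rewrite x0 in hx; have := drel_lin (-1) hx hb; rewrite scaler0 add0r scaleN1r addrC => hbd.
rewrite -(chiE hbd); apply: le_trans bd.
by apply: (hom_on_contractive (dset_sub n) (chi_hom n)); eexists; exact: hbd.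
Qed.

End Core.

(** * Closed spans and the ideal generated by I *)

Section SpanAlgebra.
Variables (R : realType) (B : cstarAlg R).
Implicit Types (S V : set B).

Lemma approx_lspan_map (D : cstarAlg R) S (S' : set D) (f : B -> D) (C : R) : (forall a b, f (a + b) = f a + f b) ->
  (forall (k : R[i]) a, approx (lspan S') (f a) -> approx (lspan S') (f (k *: a))) -> 0 <= C ->
  (forall a b, nr (f a - f b) <= C * nr (a - b)) -> f 0 = 0 -> (forall a, S a -> approx (lspan S') (f a)) ->
  forall a, approx (lspan S) a -> approx (lspan S') (f a).
Proof.
move=> fD fZ C0 fC f0 fS a ha; apply: approx_approx => e e0.
have d0 : 0 < e / (1 + C) by rewrite divr_gt0 // ltr_pwDl.
have [u uS hu] := ha _ d0; exists (f u); last first.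
  rewrite (le_trans (fC _ _)) // mulrC (le_trans (ler_wpM2r C0 hu)) //.
  by apply: frac_small => //; exact: ltW.
elim/lspan_ind: uS {hu} => [|k s v Ss _ IH]; first by rewrite f0; apply: approx_mem; exact: lspan0.
by rewrite fD; apply: approx_lspan_D => //; apply: fZ; exact: fS.
Qed.

Lemma approx_lspan_lmul S V b : V = approx (lspan S) -> (forall a, S a -> V (b ** a)) -> forall a, V a -> V (b ** a).
Proof.
move=> -> bS; apply: (approx_lspan_map (C := nr b)) => //.
- by move=> x y; rewrite cmulDr.
- by move=> k x; rewrite cmulZr; exact: approx_lspan_Z.
- exact: nr_ge0.
- by move=> x y; rewrite -cmulBr nrM.
- by rewrite cmul0r.
Qed.

Lemma approx_lspan_rmul S V b : V = approx (lspan S) -> (forall a, S a -> V (a ** b)) -> forall a, V a -> V (a ** b).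
Proof.
move=> -> bS; apply: (approx_lspan_map (f := fun a => a ** b) (C := nr b)) => //.
- by move=> x y; rewrite cmulDl.
- by move=> k x; rewrite cmulZl; exact: approx_lspan_Z.
- exact: nr_ge0.
- by move=> x y; rewrite -cmulBl mulrC nrM.
- by rewrite cmul0l.
Qed.

Lemma approx_lspan_star S V : V = approx (lspan S) -> (forall a, S a -> V (cstar a)) -> forall a, V a -> V (cstar a).
Proof.
move=> -> bS; apply: (approx_lspan_map (f := @cstar R B) (C := 1)) => //.
- exact: cstarD.
- by move=> k x; rewrite cstarZc; exact: approx_lspan_Z.
- by move=> x y; rewrite -cstarB nr_star mul1r.
- exact: cstar0.
Qed.

Lemma approx_lspan_sub S (K : set B) : calg K -> S `<=` K -> approx (lspan S) `<=` K.
Proof.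
move=> hK SK a ha; apply: (ca_closed hK); apply: approx_sub ha => u.
by apply: lspan_sub; [exact: (ca_0 hK)|exact: (ca_D hK)|exact: (ca_Z hK)|].
Qed.

Lemma span_sub S : (forall a b, S a -> S b -> approx (lspan S) (a ** b)) ->
  (forall a, S a -> approx (lspan S) (cstar a)) -> cstar_sub (approx (lspan S)).
Proof.
move=> hM hs; split.
- by apply/closedP => x; exact: approx_approx.
- by apply: approx_mem; exact: lspan0.
- exact: approx_lspan_D.
- exact: approx_lspan_Z.
- move=> a b ha hb; apply: (approx_lspan_rmul (b := b) erefl _ ha) => c Sc.
  by apply: (approx_lspan_lmul (b := c) erefl _ hb) => d Sd; exact: hM.
- by apply: approx_lspan_star.
Qed.

End SpanAlgebra.

(** The product rule covers inner degrees m <= l; for l < m it is applied to the adjoint of the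
    product. *)
Lemma graded_sub (R : realType) (B : cstarAlg R) (G : nat -> nat -> set B) :
  (forall n m b, G n m b -> G m n (cstar b)) ->
  (forall k l m n a b, G n m a -> G (k + m)%N l b -> G (k + n)%N l (a ** b)) ->
  cstar_sub (approx (lspan [set b | exists n m, G n m b])).
Proof.
move=> Gs Gm.
have mle n m l p a b : (m <= l)%N -> G n m a -> G l p b -> exists n m, G n m (a ** b).
  move=> ml; have := subnK ml; move: (l - m)%N => k e; subst l => ka kb.
  by exists (k + n)%N, p; exact: Gm ka kb.
apply: span_sub => [a b [n [m ha]] [l [p hb]]|b [n [m hb]]]; apply/approx_mem/lspan_gen; last by exists m, n; exact: Gs.
have [ml|/ltnW lm] := leqP m l; first exact: mle ml ha hb.
rewrite -[a ** b]cstarK cstarM; have [n' [m' h]] := mle _ _ _ _ _ _ lm (Gs _ _ _ hb) (Gs _ _ _ ha).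
by exists m', n'; exact: Gs.
Qed.

(** Cutting b = a^* a down just above |f(b)| gives an element killed by f, hence 0; so |b| is barely
    above |f(b)|. *)
Lemma inj_isometric (R : realType) (B D : cstarAlg R) (f : B -> D) : star_hom f ->
  (forall a, f a = 0 -> a = 0) -> forall a, nr (f a) = nr a.
Proof.
move=> hf finj a; apply/eqP; rewrite eq_le star_hom_contractive //=.
rewrite -(ler_pXn2r (n := 2)) ?nnegrE ?nr_ge0 // -!nr_starM -(sh_star hf) -(sh_mul hf).
apply/ler_addgt0Pr => e e0; set b := cstar a ** a.
have p0 : 0 < nr (f b) + e by rewrite ltr_wpDl ?nr_ge0.
have pb : cpositive b by exists a.
have [c [pc cE bc _]] := cut_down pb p0.
have c0 : c = 0 by apply: finj; apply: (cut_hom hf pc cE); rewrite ltrDl.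
by rewrite c0 subr0 in bc.
Qed.

Lemma inj_range (R : realType) (B D : cstarAlg R) (f : B -> D) : star_hom f ->
  (forall a, f a = 0 -> a = 0) -> cstar_sub (range f).
Proof.
move=> hf finj; have iso := inj_isometric hf finj; have fl := sh_lin hf; split.
- apply/closedP => y hy.
  have /choice[u hu] n : exists a, nr (y - f a) <= 1 / 2 ^+ n.
    by have [_ [a _ <-] h] := hy _ (halves ltr01 n); exists a.
  have [l hl] : exists l, nlim u l.
    apply: nr_complete => e e0; have [//|N hN] := @half_small R 2 e e0; exists N => n Nn.
    rewrite -iso (linB fl) (le_trans (nr_tri y _ _)) // nrC.
    have := hu n; have := hu N; have := hN N (leqnn _); have := hN n Nn.
    rewrite -[2 / 2 ^+ N](_ : 2 * (1 / 2 ^+ N) = _) ?mul1r // -[2 / 2 ^+ n](_ : 2 * (1 / 2 ^+ n) = _) ?mul1r //.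
    move: (2 ^+ N)^-1 (2 ^+ n)^-1 (nr _) (nr _) => p q r1 r2; lra.
  exists l => //; apply: eq_nr => e e0; have e2 : 0 < e / 2 by rewrite divr_gt0.
  have [N1 h1] := hl _ e2; have [//|N2 h2] := @half_small R 1 _ e2; pose n := maxn N1 N2.
  rewrite (le_trans (nr_tri (f (u n)) _ _)) // [leRHS]splitr lerD //.
    by rewrite -(linB fl) iso; apply: h1; rewrite leq_maxl.
  by rewrite nrC (le_trans (hu n)) //; apply: h2; rewrite leq_maxr.
- by exists 0; rewrite ?(lin0 fl).
- by move=> _ _ [a _ <-] [b _ <-]; exists (a + b); rewrite ?(linD fl).
- by move=> k _ [a _ <-]; exists (k *: a); rewrite ?(linZ fl).
- by move=> _ _ [a _ <-] [b _ <-]; exists (a ** b); rewrite ?(sh_mul hf).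
- by move=> _ [a _ <-]; exists (cstar a); rewrite ?(sh_star hf).
Qed.

Section RepPowers.
Variables (R : realType) (A : cstarAlg R) (X : corr A A) (T : tensor_powers X).
Variables (B : cstarAlg R) (pi : A -> B) (t : X -> B) (hr : is_rep pi t).
Local Notation E := (tpow T).
Local Notation tn := (@tens R A X T).

Definition tp n (u : E n) : B := tpowr setT pi t u.

Let mr n : modrep setT pi setT (@tpowr R A X T setT B pi t n).
Proof. by have := tpowr_rep T (@idealT _ _) (rep_irep hr) n; rewrite zpowT. Qed.

Lemma tp_lin n : linear (@tp n).
Proof. by move=> k u v; exact: (mr_lin (mr n)). Qed.
Lemma tp_nr n (u : E n) : nr (tp u) <= nr u.
Proof. exact: (mr_nr (@idealT _ _) (ir_hom (rep_irep hr)) (mr n)). Qed.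
Lemma tp_tens n (y : E n) x : tp (tn y x) = tp y ** t x.
Proof. by apply: (tpowr_tens (@idealT _ _) (rep_irep hr)); rewrite ?zpowT ?modIT. Qed.
Lemma tp_ract n (u : E n) a : tp (ract u a) = tp u ** pi a.
Proof. exact: (mr_ract (mr n)). Qed.

Lemma tp_lact n a (u : E n) : pi a ** tp u = tp (lact a u).
Proof.
elim: n u => [|[|n] IH] u; [by rewrite /tp /= (sh_mul (rep_hom hr))|by rewrite /tp /= (rep_lact hr)|].
apply: (@dense_eq _ _ _ _ _ _ (fun u => pi a ** tp u) (fun u => tp (lact a u)) (nr (pi a)) (nr a)).
- by move=> k v w; rewrite tp_lin cmul_linr.
- by move=> k v w; rewrite lact_linr tp_lin.
- by move=> z; rewrite (le_trans (nrM _ _)) // ler_wpM2l ?nr_ge0 // tp_nr.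
- by move=> z; rewrite (le_trans (tp_nr _)) // lact_bd.
- by move=> y x; rewrite tens_lact !tp_tens cmulA IH.
Qed.

Lemma tp_cre n x (u : E n) : t x ** tp u = tp (cre x u).
Proof.
elim: n u => [|n IH] u; first by rewrite /tp /= -(rep_ract hr).
case: n IH u => [|n] IH u; last first.
  have [h _ _ _] := @cre_adm _ _ _ T x n.+2.
  apply: (@dense_eq _ _ _ _ _ _ (fun u => t x ** tp u) (fun u => tp (cre x u)) (nr (t x)) (nr x)).
  - by move=> k v w; rewrite tp_lin cmul_linr.
  - by move=> k v w; rewrite (adj_lin h) tp_lin.
  - by move=> z; rewrite (le_trans (nrM _ _)) // ler_wpM2l ?nr_ge0 // tp_nr.
  - by move=> z; rewrite (le_trans (tp_nr _)) //; exact: cre_bd.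
  - by move=> y z; rewrite cre_tens !tp_tens cmulA IH.
rewrite -[cre x u]/(otimes1 (@vec _ _ _ T 1 x) u) otimes1_vec; exact/esym/(@tp_tens 1).
Qed.

Lemma tp_ann n x (u : E n.+1) : cstar (t x) ** tp u = tp (ann x u).
Proof.
elim: n u => [|n IH] u; first exact: (rep_ip hr).
have [h _ _ _] := adm_sym (@cre_adm _ _ _ T x n.+1); have [_ e _] := otimes1_adm (adm_sym (@cre_adm _ _ _ T x n)).
apply: (@dense_eq _ _ _ _ _ _ (fun u => cstar (t x) ** tp u) (fun u => tp (ann x u)) (nr (t x)) (nr x)).
- by move=> k v w; rewrite tp_lin cmul_linr.
- by move=> k v w; rewrite (adj_lin h) tp_lin.
- by move=> z; rewrite (le_trans (nrM _ _)) // nr_star ler_wpM2l ?nr_ge0 // tp_nr.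
- move=> z; rewrite (le_trans (tp_nr _)) //.
  by have [a _ _ _] := @cre_adm _ _ _ T x n.+1; exact: (obd_adj (nr_ge0 x) a (@cre_bd _ _ _ T x n.+1)).
- move=> y z; rewrite tp_tens cmulA IH -tp_tens; congr tp; exact/esym/e.
Qed.

End RepPowers.

Section TensorSpan.
Variables (R : realType) (A : cstarAlg R) (X : corr A A) (T : tensor_powers X).
Variables (B : cstarAlg R) (pi : A -> B) (t : X -> B) (hr : is_rep pi t).
Local Notation E := (tpow T).
Local Notation tn := (@tens R A X T).
Local Notation tp := (@tp R A X T B pi t _).

Lemma tensor_rep_span n m (NZ : set (E n)) (NY : set (E m)) (S : set B) a :
  (forall z y, NZ z -> NY y -> S (tp z ** cstar (tp y))) -> kset NZ NY a ->
  approx (lspan S) (tensor_rep hr a).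
Proof.
move=> hS ka e e0; have [g gS bg] := ka e e0; have kg := kset_span gS.
have sT (f : E m -> E n) : kset NZ NY f -> kset setT setT f by apply: kset_sub.
exists (tensor_rep hr g).
  elim/lspan_ind: gS {bg kg} => [|c s v [z [y [hz hy ->]]] vS IH].
    rewrite (lin_on0 (@kset0 _ _ _ _ _ _) (kc_lin (@tensor_rep_cont _ _ _ _ _ _ hr T n m))); exact: lspan0.
  rewrite (kc_lin (@tensor_rep_cont _ _ _ _ _ _ hr T n m)) ?tensor_rep_theta; [|exact: kset_theta|exact/sT/kset_span].
  by apply: lspan_cons => //; exact: hS.
have := kc_lin (@tensor_rep_cont _ _ _ _ _ _ hr T n m) (-1) (sT _ kg) (sT _ ka); rewrite !scaleN1r addrC [X in _ = X]addrC => <-.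
apply: tensor_rep_bd; [|exact: ltW|exact: bg].
by rewrite addrC -scaleN1r; apply: ksetD; [exact/ksetZ/sT|exact: sT].
Qed.

Variable K : set A.
Hypotheses (hK : cstar_ideal K) (hinv : X_invariant X K) (gen : generated_by (range pi `|` range t)).

Definition idspan : set B := [set b | exists n m (z : E n) (y : E m), modI (E n) K z /\ b = tp z ** cstar (tp y)].
Local Notation V := (approx (lspan idspan)).

Lemma modI_self k : K k -> modI (self_hilbMod A) K k.
Proof. by move=> /(ideal_fact hK)[b [c [_ Kc _ ->]]]; exists b, c. Qed.

Let pis a : cstar (pi a) = pi (cstar a). Proof. by rewrite (sh_star (rep_hom hr)). Qed.

Lemma idspan_mem n m (z : E n) (y : E m) : modI (E n) K z -> V (tp z ** cstar (tp y)).
Proof. by move=> hz; apply/approx_mem/lspan_gen; exists n, m, z, y. Qed.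

Lemma idspan_mem2 n m (z : E n) (y : E m) : modI (E m) K y -> V (tp z ** cstar (tp y)).
Proof.
move=> [w [k [Kk ->]]]; rewrite (tp_ract hr) cstarM pis cmulA -(tp_ract hr).
by apply: idspan_mem; apply: modI_ractI; exact: ideal_star.
Qed.

Lemma idspan_star b : V b -> V (cstar b).
Proof.
apply: approx_lspan_star => // _ [n [m [z [y [hz ->]]]]].
by rewrite cstarM cstarK; exact: idspan_mem2.
Qed.

Lemma idspan_pi a b : V b -> V (pi a ** b).
Proof.
apply: approx_lspan_lmul => // _ [n [m [z [y [[w [k [Kk ->]]] ->]]]]].
by rewrite cmulA (tp_lact hr) lact_ract; apply: idspan_mem; exact: modI_ractI.
Qed.

Lemma idspan_t x b : V b -> V (t x ** b).
Proof.
apply: approx_lspan_lmul => // _ [n [m [z [y [[w [k [Kk ->]]] ->]]]]].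
rewrite cmulA (tp_cre hr); apply: idspan_mem.
by have [h _ _ _] := @cre_adm _ _ _ T x n; rewrite (adj_ract h); exact: modI_ractI.
Qed.

Lemma idspan_tstar x b : V b -> V (cstar (t x) ** b).
Proof.
apply: approx_lspan_lmul => // _ [[|n] [m [z [y [hz ->]]]]]; last first.
  rewrite cmulA (tp_ann hr); apply: idspan_mem; move: hz => [w [k [Kk ->]]].
  by have [h _ _ _] := adm_sym (@cre_adm _ _ _ T x n); rewrite (adj_ract h); exact: modI_ractI.
have Kz : K z by move: hz => [w [k [Kk ->]]]; exact: (id_mull hK).
have [w [k [Kk kE]]] := hinv x (ideal_star hK Kz).
have -> : cstar (t x) ** (tp z ** cstar (tp y)) = tp (cstar k : E 0) ** cstar (tp (tn y w)).
  rewrite -[LHS]cstarK -[RHS]cstarK; congr cstar; rewrite !cstarM !cstarK.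
  have e1 : cstar (tp z) ** t x = t w ** pi k by rewrite /tp /= pis -(rep_lact hr) kE (rep_ract hr).
  have e2 : cstar (tp (cstar k : E 0)) = pi k by rewrite /tp /= pis cstarK.
  by rewrite -cmulA e1 e2 cmulA -(tp_tens hr).
apply: idspan_mem; apply: (@modI_self (cstar k)); exact: ideal_star.
Qed.

Lemma idspan_ideal : cstar_ideal V.
Proof.
have left o : forall v, V v -> V (o ** v).
  pose M := [set o | (forall v, V v -> V (o ** v)) /\ (forall v, V v -> V (cstar o ** v))].
  suff Mo : M o by case: Mo => h _; exact: h.
  suff -> : M = setT by [].
  have vcl : approx V `<=` V by move=> x; exact: approx_approx.
  have cl (f : B -> B -> B) : (forall a b v, nr (f a v - f b v) <= nr (a - b) * nr v) ->
      forall u, approx [set a | forall v, V v -> V (f a v)] u -> forall v, V v -> V (f u v).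
    move=> hf u hu v hv; apply: vcl => e e0.
    have d0 : 0 < e / (1 + nr v) by rewrite divr_gt0 // ltr_pwDl // nr_ge0.
    have [a ha h] := hu _ d0; exists (f a v); first exact: ha.
    rewrite (le_trans (hf _ _ _)) // (le_trans (ler_wpM2r (nr_ge0 _) h)) //.
    by apply: frac_small; rewrite ?nr_ge0 // ltW.
  apply: gen; [split|].
  - apply/closedP => u hu; split.
      apply: (cl (@cmul R B)) => [a b v|]; first by rewrite -cmulBl nrM.
      by apply: approx_sub hu => a [].
    apply: (cl (fun a v => cstar a ** v)) => [a b v|]; first by rewrite -cmulBl -cstarB -[nr (a - b)]nr_star nrM.
    by apply: approx_sub hu => a [].
  - by split=> v _; rewrite ?cstar0 cmul0l; apply: approx_mem; exact: lspan0.
  - move=> a b [a1 a2] [b1 b2]; split=> v hv; rewrite ?cstarD cmulDl; apply: approx_lspan_D;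
      by [exact: a1|exact: a2|exact: b1|exact: b2].
  - move=> k a [a1 a2]; split=> v hv; rewrite ?cstarZc cmulZl; apply: approx_lspan_Z;
      by [exact: a1|exact: a2].
  - move=> a b [a1 a2] [b1 b2]; split=> v hv; rewrite ?cstarM -cmulA; by [apply/a1/b1|apply/b2/a2].
  - by move=> a [a1 a2]; split=> v hv; rewrite ?cstarK; [exact: a2|exact: a1].
  move=> _ [[a _ <-]|[x _ <-]]; split=> v hv.
  - exact: idspan_pi.
  - by rewrite pis; exact: idspan_pi.
  - exact: idspan_t.
  - exact: idspan_tstar.
split.
- by apply/closedP => x; exact: approx_approx.
- by apply: approx_mem; exact: lspan0.
- by move=> a b; exact: approx_lspan_D.
- by move=> k a; exact: approx_lspan_Z.
- by move=> a b; exact: left.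
- by move=> a b ha; rewrite -[a ** b]cstarK cstarM; apply/idspan_star/left/idspan_star.
Qed.

Lemma idspanE : ideal_gen (pi @` K) = V.
Proof.
apply/seteqP; split=> [b hb|b hb].
  apply: hb; first exact: idspan_ideal.
  move=> _ [k Kk <-]; have [b1 [b2 [K1 K2 sb ->]]] := ideal_fact hK Kk.
  have -> : pi (b1 ** b2) = tp (b1 : E 0) ** cstar (tp (b2 : E 0)).
    by rewrite /tp /= pis sb (sh_mul (rep_hom hr)).
  by apply: idspan_mem; exact: modI_self.
move=> L hL KL; apply: (approx_lspan_sub (ideal_calg hL) _ hb) => _ [n [m [z [y [[w [k [Kk ->]]] ->]]]]].
rewrite (tp_ract hr); apply: (id_mulr hL); apply: (id_mull hL); apply: KL.
by exists k.
Qed.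

End TensorSpan.

Lemma relCP_gauge (R : realType) (A : cstarAlg R) (X : corr A A) (J : set A) (O : cstarAlg R) (iA : A -> O) (iX : X -> O)
  (z : R[i]) : is_relCP J iA iX -> cabs z = 1 ->
  exists2 Ga : O -> O, star_hom Ga & (forall a, Ga (iA a) = iA a) /\ forall x, Ga (iX x) = z *: iX x.
Proof.
move=> [[ih il ir ii ila] [p [pl pb pt] pJ] _ iU] hz; apply: iU.
  split=> //.
  - by move=> k x y; rewrite il scalerDr !scalerA mulrC.
  - by move=> x a; rewrite ir cmulZl.
  - by move=> x y; rewrite cstarZc cmulZl cmulZr scalerA mulrC cabs_conj // scale1r ii.
  - by move=> a x; rewrite ila cmulZr.
exists p => //; split=> // x y.
by rewrite pt cstarZc cmulZl cmulZr scalerA cabs_conj // scale1r.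
Qed.

(** * O_X(I, J cap I) is isomorphic to O(I) *)

Section Psi.
Variables (R : realType) (A : cstarAlg R) (X : corr A A) (T : tensor_powers X) (J : set A).
Hypotheses (hJ : cstar_ideal J) (hJX : J `<=` Jideal X).
Local Notation E := (tpow T).
Local Notation tn := (@tens R A X T).

Lemma kset_adjI n m (K : set A) (a : E m -> E n) : cstar_ideal K -> kset (modI (E n) K) setT a ->
  exists2 a', kset (modI (E m) K) setT a' & is_adjoint a a'.
Proof.
move=> hK ka; have [a' ka' aa] := kset_adj ka; exists a' => // e /ka'[g gS bg]; exists g => //.
elim/lspan_ind: gS {bg} => [|c s v [y [z [_ [w [k [Kk ->]]] ->]]] _ IH]; first exact: lspan0.
rewrite (_ : theta y (ract w k) = theta (ract y (cstar k)) w).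
  by apply: lspan_cons => //; exists (ract y (cstar k)), w; split=> //; apply: modI_ractI; exact: ideal_star.
by apply/funext => u; rewrite /theta hip_ractl ractA.
Qed.

Lemma KX_otimes n m l k (K : set A) (a : E m -> E n) (b : E l -> E (k + m)%N) : kset (modI (E n) K) setT a ->
  kset (modI (E (k + m)%N) K) setT b -> kset (modI (E (k + n)%N) K) setT (otimes1k a (k := k) \o b).
Proof.
move=> ka kb; have [a' _ aa] := kset_adm ka; have [h [M M0 hM] _ _] := otimes1k_adm k aa.
apply: (kset_compl _ M0 hM h kb) => z [w [i [Ki ->]]].
by rewrite (adj_ract h); exact: modI_ractI.
Qed.

Section OX.
Variables (K : set A) (hK : cstar_ideal K).
Variables (P : cstarAlg R) (J' : set A) (kappa : forall n m, (E m -> E n) -> P).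
Hypothesis hP : is_OX K J' kappa.

Definition oxset n m : set P := [set b | exists2 a, @KX _ _ _ T K n m a & b = kappa a].
Definition oxall : set P := [set b | exists n m, oxset n m b].

Lemma oxset_star n m b : oxset n m b -> oxset m n (cstar b).
Proof.
move=> [a]; rewrite KXE => ka ->; have [a' ka' aa] := kset_adjI hK ka.
by exists a'; rewrite ?KXE // (rtr_star (ox_rtr hP) _ aa) // KXE.
Qed.

Lemma ox_span b : approx (lspan oxall) b.
Proof.
have h : cstar_sub (approx (lspan oxall)).
  apply: graded_sub oxset_star _ => k l m n _ _ [a ka ->] [c kc ->]; exists (otimes1k a (k := k) \o c).
    by rewrite KXE; apply: KX_otimes; rewrite -KXE.
  exact: (rtr_mul (ox_rtr hP)).
rewrite (ox_gen hP h) // => _ [n [m [a [ka ->]]]]; apply/approx_mem/lspan_gen.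
by exists n, m, a.
Qed.

Lemma ox_gauge z : cabs z = 1 -> exists2 al : P -> P, star_hom al &
  forall n m b, oxset n m b -> al b = (z ^+ n * conjc z ^+ m) *: b.
Proof.
move=> hz; have zz := cabs_conj hz; have [lin st mu] := ox_rtr hP.
have [al hal alE] : exists2 al : P -> P, star_hom al & forall n m a, KX K a ->
    al (kappa a) = (z ^+ n * conjc z ^+ m) *: @kappa n m a.
  apply: (ox_univ hP (pi := fun n m a => (z ^+ n * conjc z ^+ m) *: @kappa n m a)).
    split=> [n m|n m a b ka ab|k l m n a b ka kb].
    - by move=> c u v ku kv; rewrite lin // scalerDr !scalerA mulrC.
    - rewrite cstarZc (st _ _ _ _ ka ab); congr (_ *: _).
      by rewrite rmorphM !rmorphXn /= conjcK mulrC.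
    - rewrite cmulZl cmulZr scalerA mu //; congr (_ *: _).
      have zm : conjc z ^+ m * z ^+ m = 1 by rewrite -exprMn mulrC zz expr1n.
      rewrite !exprD; transitivity (z ^+ k * z ^+ n * conjc z ^+ l * (conjc z ^+ m * z ^+ m)); first by ring.
      by rewrite zm mulr1.
  move=> n m a ka; rewrite (ox_coiso hP ka) !exprS; congr (_ *: _).
  transitivity (z ^+ n * conjc z ^+ m * (z * conjc z)); first by rewrite zz mulr1.
  by ring.
by exists al => // n m b [a ka ->]; exact: alE.
Qed.

End OX.

(** In L(Y) the operator lies in two ideals, so it factors as B C inside their intersection. C is a
    limit of operators with range in YK, and B maps w i to B(w) i with B(w) in YJ and i in K. *)
Lemma kset_cap (Y : hilbMod A) (K : set A) (f : Y -> Y) : cstar_ideal K -> kset (modI Y J) setT f ->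
  kset (modI Y K) setT f -> kset (modI Y (J `&` K)) setT f.
Proof.
move=> hK fJ fK; have hJK := idealI hJ hK.
have [f' kf' ff'] := kset_adj fJ; have [M M0 hM] := kset_bd fJ.
have [D DE] := LOp_mk (@CS R A Y) ff' hM.
have D1 : ([set D : LOp (@CS R A Y) | kset (modI Y J) setT (lapp D)] `&`
    [set D : LOp (@CS R A Y) | kset (modI Y K) setT (lapp D)]) D by split; rewrite /mkset DE.
have [B [C [[BJ _] [_ CK] _ BC]]] := ideal_fact (idealI (kset_ideal Y hJ) (kset_ideal Y hK)) D1.
have -> : f = lapp B \o lapp C by rewrite -DE BC; apply/funext => y; rewrite lappM.
apply: (kset_compl _ (nr_ge0 B) (lapp_le B) (lapp_adj B) CK) => z [w [i [Ki ->]]].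
rewrite (adj_ract (lapp_adj B)); apply/(modIP hJK) => u; rewrite hip_ract; split; last exact: (id_mull hK).
by apply: (id_mulr hJ); have /(modIP hJ) := kset_in hJ BJ w; apply.
Qed.

Section Core.
Variables (K : set A) (hK : cstar_ideal K) (hinv : X_invariant X K).

(** Factor j = j1 j3 j4 with j1, j4 in K and j3 in J: phi(j3) is compact, and by invariance the
    outer factors push both legs of its rank-one approximants into XK. In particular J cap K is
    contained in J(XK). *)
Lemma lact_kset j : (J `&` K) j -> kset (modI X K) (modI X K) (lact (c := X) j).
Proof.
move=> Lj; have hL := idealI hJ hK.
have [j1 [j2 [[_ K1] L2 _ jE]]] := ideal_fact hL Lj.
have [j3 [j4 [[J3 _] [_ K4] _ j2E]]] := ideal_fact hL L2.
have := hJX J3; rewrite /Jideal /= compactsE => k3.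
have -> : lact (c := X) j = (lact j1 \o lact j3) \o lact j4.
  by apply/funext => x; rewrite jE j2E !lactM.
apply: (kset_compr (M := nr j4) _ (nr_ge0 _) (lact_bd j4) (lact_is_adj j4)).
  by move=> y _; apply: hinv; exact: ideal_star.
apply: (kset_compl (M := nr j1) _ (nr_ge0 _) (lact_bd j1) (lact_is_adj j1) k3).
by move=> z _; exact: hinv.
Qed.

Lemma KX_coiso n m (a : E m -> E n) : kset (modI (E n) (J `&` K)) setT a ->
  kset (modI (E n.+1) K) setT (otimes1 a).
Proof.
move=> ka; apply: kset_closed => e e0; have [g gS bg] := ka _ e0.
have kg := kset_span gS; have [f' _ af] := kset_adm ka; have [g' _ ag] := kset_adm kg.
exists (otimes1 g); last first.
  have h := adm_lin (-1) ag af; have [_ _ b] := otimes1_adm h; have h1 := otimes1_lin (-1) ag af.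
  rewrite !scaleN1r in h1 b; rewrite addrC -h1; apply: b; first exact: ltW.
  by rewrite addrC.
elim/lspan_ind: gS {bg kg g' ag} => [|c v w [z [y [[z' [j [Lj ->]]] _ ->]]] vS IH].
  rewrite otimes1_0; exact: kset0.
have kt : kset (modI (E n) (J `&` K)) setT (theta (ract z' j) y) by apply: kset_theta => //; exact: modI_ractI.
have [t' _ at_] := kset_adm kt; have [v' _ av] := kset_adm (kset_span vS).
rewrite (otimes1_lin c at_ av); apply: ksetD => //; apply: ksetZ; rewrite otimes1_thetaJ.
apply: (tens_kset (NX := modI X K) (NX' := modI X K)) (lact_kset Lj) => // x [x' [i [Ki ->]]].
by rewrite -tens_ract; exact: modI_ractI.
Qed.

Variables (P : cstarAlg R) (kappa : forall n m, (E m -> E n) -> P).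
Hypothesis hP : is_OX K (J `&` K) kappa.

(** A right tensor representation comes without norm bounds, but in degree (k, k) it is a
    homomorphism on an ideal of L(X^k), hence contractive. *)
Lemma ox_bd k (a : E k -> E k) M : kset (modI (E k) K) setT a -> 0 <= M -> obd a M -> nr (@kappa k k a) <= M.
Proof.
move=> ka M0 hM; have [a' ka' aa] := kset_adj ka.
have [D DE] := LOp_mk (@CS R A (E k)) aa hM.
have hI := kset_ideal (E k) hK; have [lin st mu] := ox_rtr hP.
have hom : hom_on [set D : LOp (@CS R A (E k)) | kset (modI (E k) K) setT (lapp D)] (fun D => @kappa k k (lapp D)).
  split=> [c u v hu hv|u v hu hv|u hu].
  - rewrite -lin ?KXE //; congr kappa; by apply/funext => y; rewrite lappD lappZ.
  - rewrite (mu 0%N k k k (lapp u) (lapp v)) ?KXE //; congr kappa; by apply/funext => y; rewrite lappM.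
  - by rewrite (st _ _ (lapp u) (lapp (cstar u))) ?KXE //; exact: lapp_adj.
have := hom_on_contractive (ideal_sub hI) hom (a := D); rewrite /mkset DE => /(_ ka) h.
by apply: (le_trans h); apply: lapp_bound; rewrite ?DE.
Qed.

Lemma ox_core : core_sys (T := T) J (fun k => kset (modI (E k) K) setT) (fun k => @kappa k k).
Proof.
have [lin st mu] := ox_rtr hP; split=> [k a|k|k c a b|k a|k a ka|k j a b ka kb|k c a b ka kb|k a M ka|k a ka kJ].
- by apply: kset_sub.
- exact: kset0.
- by move=> ka kb; apply: ksetD => //; exact: ksetZ.
- exact: kset_closed.
- have [a' ka' aa] := kset_adjI hK ka; exists a' => //; split=> //.
  by apply: st => //; rewrite KXE.
- split; first exact: KX_otimes.
  by rewrite (mu j (j + k)%N k k a b) ?KXE.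
- by apply: lin; rewrite KXE.
- exact: ox_bd.
- have kL := kset_cap hK kJ ka; split; first exact: KX_coiso.
  by rewrite -(ox_coiso hP) // KXE.
Qed.

Variables (O : cstarAlg R) (iA : A -> O) (iX : X -> O).
Hypothesis hO : is_relCP J iA iX.
Local Notation iota := (@tensor_rep R A X O iA iX (cp_rep hO) T).

Lemma KX_T n m (L : set A) (a : E m -> E n) : KX L a -> kset setT setT a.
Proof. by rewrite KXE; apply: kset_sub. Qed.

Lemma iota_gauge z Ga n m (a : E m -> E n) : cabs z = 1 -> star_hom Ga -> (forall a, Ga (iA a) = iA a) ->
  (forall x, Ga (iX x) = z *: iX x) -> kset setT setT a -> Ga (iota a) = (z ^+ n * conjc z ^+ m) *: iota a.
Proof.
move=> hz hG gA gX ka; have hr := cp_rep hO.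
have gt k (u : E k) : Ga (tp iA iX u) = z ^+ k *: tp iA iX u.
  elim: k u => [|[|k] IH] u; [by rewrite scale1r; exact: gA|exact: gX|].
  apply: (@dense_eq _ _ _ _ _ _ (fun u => Ga (tp iA iX u)) (fun u => z ^+ k.+2 *: tp iA iX u) 1 (cabs (z ^+ k.+2))).
  - by move=> c v w; rewrite (tp_lin hr) (sh_lin hG).
  - by move=> c v w; rewrite (tp_lin hr) scalerDr !scalerA mulrC.
  - by move=> v; rewrite mul1r (le_trans (star_hom_contractive _ hG)) // (tp_nr hr).
  - by move=> v; rewrite nrZ ler_wpM2l ?cabs_ge0 // (tp_nr hr).
  - by move=> y x; rewrite (tp_tens hr) (sh_mul hG) IH gX cmulZl cmulZr scalerA -exprSr.
apply: (@kc_eq _ _ _ _ setT setT _ (fun a => Ga (iota a)) (fun a => (z ^+ n * conjc z ^+ m) *: iota a)) ka.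
- exact: kc_hom (tensor_rep_cont _ _ _ _).
- apply: (kc_comp (L := fun b : O => (z ^+ n * conjc z ^+ m) *: b) (D := cabs (z ^+ n * conjc z ^+ m))).
  + exact: tensor_rep_cont.
  + by move=> c v w; rewrite scalerDr !scalerA mulrC.
  + exact: cabs_ge0.
  + by move=> w; rewrite nrZ.
move=> v w _ _; rewrite !tensor_rep_theta (sh_mul hG) (sh_star hG) !gt cstarZc cmulZl cmulZr scalerA.
by rewrite rmorphXn.
Qed.

Lemma iota_rtr (L : set A) : is_rtr L iota.
Proof.
have [lin st mu] := tensor_rep_rtr (cp_rep hO) T.
have sub n m (a : E m -> E n) : KX L a -> KX setT a by move=> /KX_T; rewrite KXTE.
split=> [n m c u v /sub ku /sub kv|n m a b /sub ka|k l m n a b /sub ka /sub kb]; [exact: lin|exact: st|exact: mu].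
Qed.

Lemma iota_coiso : rtr_coisometric J iota.
Proof. by apply: tensor_rep_coiso => //; exact: coisoP (cp_coiso hO) hJX. Qed.

(** The homomorphism exists because [iota] is coisometric on J. Its range is closed and contains the
    spanning elements of [idspan]; injectivity is [gauge_inj], with isometry on the core from
    [core_bound]. *)
Theorem ox_iso : exists2 Psi : P -> O, is_ideal_alg (ideal_gen (iA @` K)) Psi &
  forall n m a, KX K a -> Psi (@kappa n m a) = iota a.
Proof.
have co : rtr_coisometric (J `&` K) iota.
  by move=> n m a; rewrite KXE => ka; apply: iota_coiso; rewrite KXE; apply: kset_sub ka => // z [w [i [[Ji _] ->]]]; exists w, i.
have [Psi hPsi PE] := ox_univ hP (iota_rtr K) co.
have inj : forall b, Psi b = 0 -> b = 0.
  have /choice[al alP] (z : R[i]) : exists al : P -> P, cabs z = 1 -> star_hom al /\ forall n m b, oxset K kappa n m b -> al b = (z ^+ n * conjc z ^+ m) *: b.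
    have [hz|hz] := pselect (cabs z = 1); last by exists id.
    by have [al h1 h2] := ox_gauge hP hz; exists al.
  apply: (@gauge_inj R P O Psi al (oxset K kappa)
    [set c | exists n D, drel (T := T) (fun k => kset (modI (E k) K) setT) (fun k => @kappa k k) n D c] hPsi).
  - by move=> z /(alP z)[].
  - move=> z b hz b0; have [ha alE] := alP z hz.
    have [Ga hG [gA gX]] := relCP_gauge hO hz.
    (* Equivariance under the two gauge actions, checked on generators, makes the kernel gauge
       invariant. *)
    suff e : Psi \o al z =1 Ga \o Psi by rewrite [LHS]e /= b0 (lin0 (sh_lin hG)).
    apply: (star_hom_eq (ox_gen hP)); [exact: star_hom_comp|exact: star_hom_comp|].
    move=> _ [n [m [a [ka ->]]]] /=; rewrite (alE n m); last by exists a.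
    by rewrite (linZ (sh_lin hPsi)) PE // (iota_gauge hz hG gA gX (KX_T ka)).
  - by move=> n m z b hz; have [_] := alP z hz; apply.
  - move=> b; apply: approx_sub (ox_span hK hP b) => u; exact.
  - by exists 0%N, 0; apply: (drel0 ox_core).
  - move=> k c d [n [D hD]] [n' [D' hD']]; exists (maxn n n'), (k *: D + D').
    by apply: (drel_lin ox_core); [apply: (drel_pad ox_core _ hD)|apply: (drel_pad ox_core _ hD')]; rewrite ?leq_maxl ?leq_maxr.
  - move=> n b [a ka ->]; exists n.+1, (fock_iota a); apply: (drel_gen ox_core) => //.
    by rewrite -KXE.
  - move=> c [n [D [a Wa [_ ->]]]]; apply: (le_trans (core_bound hJ hJX ox_core hO n Wa)).
    rewrite /csum (big_morph Psi (linD (sh_lin hPsi)) (lin0 (sh_lin hPsi))).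
    rewrite [X in _ <= nr X](eq_bigr (fun k : 'I_n => iota (a k))) ?lexx // => k _.
    by rewrite PE // KXE.
exists Psi => //; split=> //.
  move=> a b ab; apply/eqP; rewrite -subr_eq0; apply/eqP/inj.
  by rewrite (linB (sh_lin hPsi)) ab subrr.
have hr := cp_rep hO; rewrite (idspanE T hr hK hinv (cp_gen hO)).
apply/seteqP; split=> [_ [b _ <-]|o ho].
  have hV := idspan_ideal T hr hK hinv (cp_gen hO).
  suff h : [set b | approx (lspan (idspan T iA iX K)) (Psi b)] = setT.
    by have : [set: P] b by []; rewrite -h.
  apply: (ox_gen hP).
    have hpl := sh_lin hPsi; split.
    - apply/closedP => x hx; apply: (idl_approx hV) => e /hx[y hy hxy]; exists (Psi y) => //.
      by rewrite -(linB hpl) (le_trans (star_hom_contractive _ hPsi)).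
    - by rewrite /mkset (lin0 hpl); exact: (id_0 hV).
    - by move=> x y hx hy; rewrite /mkset (linD hpl); apply: (id_add hV).
    - by move=> k x hx; rewrite /mkset (linZ hpl); apply: (id_scale hV).
    - by move=> x y hx hy; rewrite /mkset (sh_mul hPsi); apply: (id_mull hV).
    - by move=> x hx; rewrite /mkset (sh_star hPsi); apply: (ideal_star hV).
  move=> _ [n [m [a [ka ->]]]]; rewrite /mkset PE //; rewrite KXE in ka.
  apply: (@tensor_rep_span _ _ _ _ _ _ _ (cp_rep hO) n m (modI (E n) K) setT _ a _ ka) => z y hz _.
  by exists n, m, z, y.
have hR := inj_range hPsi inj.
apply: (approx_lspan_sub (sub_calg hR)) ho => _ [n [m [z [y [hz ->]]]]].
have kt : KX K (theta z y) by rewrite KXE; exact: kset_theta.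
by exists (kappa (theta z y)) => //; rewrite PE // tensor_rep_theta.
Qed.

End Core.
End Psi.

(** * The correspondence XI and its algebra inside O(J,X) *)

Section ZpowAgree.
Variables (R : realType) (A : cstarAlg R) (X : corr A A) (T : tensor_powers X).
Variables (I : set A) (B : cstarAlg R).
Local Notation E := (tpow T).
Local Notation tn := (@tens R A X T).
Local Notation Z := (@zpow R A X T I).

Lemma zpow_agree (F G : forall n, E n -> B) (C D : nat -> R) :
  (forall n (c : R[i]) u v, Z n u -> Z n v -> F n (c *: u + v) = c *: F n u + F n v) ->
  (forall n (c : R[i]) u v, Z n u -> Z n v -> G n (c *: u + v) = c *: G n u + G n v) ->
  (forall n u, Z n u -> nr (F n u) <= C n * nr u) -> (forall n u, Z n u -> nr (G n u) <= D n * nr u) ->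
  (forall a, I a -> F 0%N a = G 0%N a) -> (forall x, modI X I x -> F 1%N x = G 1%N x) ->
  (forall n y x, Z n.+1 y -> modI X I x -> F n.+1 y = G n.+1 y -> F n.+2 (tn y x) = G n.+2 (tn y x)) ->
  forall n u, Z n u -> F n u = G n u.
Proof.
move=> Fl Gl FC GD h0 h1 hS; elim=> [|[|n] IH] u hu; [exact: h0|exact: h1|].
apply: (span_agree (Fl n.+2) (Gl n.+2) (FC n.+2) (GD n.+2)) hu => _ [y [x [hy hx ->]]].
by apply: hS => //; exact: IH.
Qed.

End ZpowAgree.

Section Restricted.
Variables (R : realType) (A : cstarAlg R) (X : corr A A) (T : tensor_powers X) (I : set A).
Hypotheses (hI : cstar_ideal I) (hinv : X_invariant X I).
Local Notation E := (tpow T).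
Local Notation tn := (@tens R A X T).
Local Notation Z := (@zpow R A X T I).
Variables (EE : cstarAlg R) (i : EE -> A) (XI : corr EE EE) (j : XI -> X).
Hypotheses (hi : is_ideal_alg I i) (hj : is_restricted_corr I i j).
Let ih : star_hom i. Proof. by case: hi. Qed.
Let iinj : injective i. Proof. by case: hi. Qed.
Let il := sh_lin ih.
Let jl := rc_lin hj.

Lemma iI b : I (i b). Proof. by case: hi => _ _ <-; exists b. Qed.
Lemma jI y : modI X I (j y). Proof. by rewrite -(rc_range hj); exists y. Qed.

Definition iV a : EE := xget 0 [set b | i b = a].
Definition jV x : XI := xget 0 [set y | j y = x].

Lemma iVK a : I a -> i (iV a) = a.
Proof. case: hi => _ _ <- [b _ e]; rewrite /iV; case: xgetP => [b' _ //|/(_ b)]; by case. Qed.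
Lemma iK b : iV (i b) = b. Proof. by apply: iinj; rewrite iVK //; exact: iI. Qed.
Lemma jVK x : modI X I x -> j (jV x) = x.
Proof. rewrite -(rc_range hj) => -[y _ e]; rewrite /jV; case: xgetP => [y' _ //|/(_ y)]; by case. Qed.
Lemma jK y : jV (j y) = y. Proof. by apply: (rc_inj hj); rewrite jVK //; exact: jI. Qed.

Lemma i_nr b : nr (i b) = nr b.
Proof.
apply: inj_isometric => // c c0; apply: iinj; by rewrite c0 (lin0 il).
Qed.

Lemma j_nr y : nr (j y) = nr y.
Proof.
have /eqP : nr (j y) ^+ 2 = nr y ^+ 2 by rewrite -!nr_hip -(rc_ip hj) i_nr.
by rewrite eqrXn2 ?nr_ge0 // => /eqP.
Qed.

Variables (B : cstarAlg R) (pi : A -> B) (t : X -> B).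
Hypothesis hr : irep I pi t.
Local Notation kp n m := (@kap R A X T I B pi t hI hr n m).
Local Notation KI := (kset (modI X I) (modI X I)).

Lemma irep_comp : is_rep (pi \o i) (t \o j).
Proof.
have [ph [m0 mD mZ mc mr mI ml mra mip] la] := hr; split=> [|c x y|x a|x y|a x] /=.
- split=> [c a b|a b|a] /=; by rewrite ?il ?(sh_mul ih) ?(sh_star ih) ?(ho_lin ph) ?(ho_mul ph) ?(ho_star ph) //; exact: iI.
- by rewrite jl ml //; exact: jI.
- by rewrite (rc_ract hj) mra //; [exact: jI|exact: iI].
- by rewrite mip ?(rc_ip hj) //; exact: jI.
- by rewrite (rc_lact hj) la //; [exact: iI|exact: jI].
Qed.

(** The adjoint of f has range in XI, so its bound, and with it that of f on X, is already
    determined by f on XI. *)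
Lemma restr_bd (f : X -> X) (e : R) : KI f -> 0 <= e -> (forall y, nr (f (j y)) <= e * nr y) -> obd f e.
Proof.
move=> kf e0 hb; have [f' kf' ff'] := kset_adj kf.
have f'I := kset_in hI (kset_sub (NZ' := modI X I) (NY' := setT) (fun _ h => h) (fun _ _ => Logic.I) kf').
apply: (obd_adj e0 (adj_sym ff')) => w; have [->|w0] := eqVneq (f' w) 0; first by rewrite nr0 mulr_ge0 ?nr_ge0.
have wpos : 0 < nr (f' w) by rewrite lt_neqAle nr_ge0 andbT eq_sym; apply: contra_neq w0 => h; apply: nr_le0; rewrite h.
rewrite -(ler_pM2r wpos) -expr2 -nr_hip (adj_sym ff') (le_trans (CS _ _)) //.
have := hb (jV (f' w)); rewrite jVK // -j_nr jVK // => h.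
by rewrite [leRHS]mulrAC mulrC ler_wpM2r ?nr_ge0.
Qed.

Lemma lift_span u : lspan (repP (t \o j)) u -> exists f, [/\ KI f, forall y, f (j y) = j (u.1 y) & kp 1 1 f = u.2].
Proof.
have kc := @kap_cont _ _ _ T _ _ _ _ hI hr 1 1.
elim/lspan_ind => [|c s v [x [y ->]] _ [f [kf fj fE]]].
  by exists 0; split=> [|y|]; [exact: kset0|rewrite /= (lin0 jl)|exact: lin_on0 (@kset0 _ _ _ _ _ _) (kc_lin kc)].
have kt : KI (theta (j x) (j y)) by apply: kset_theta; exact: jI.
exists (c *: theta (j x) (j y) + f); split.
- by apply: ksetD => //; exact: ksetZ.
- move=> w; change (c *: theta (j x) (j y) (j w) + f (j w) = j (c *: theta x y w + v.1 w)).
  by rewrite jl fj /theta (rc_ract hj) (rc_ip hj).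
- rewrite (kc_lin kc) // fE; congr (_ *: _ + _).
  by rewrite (@kap_theta _ _ _ T _ _ _ _ hI hr 1 1) //; exact: jI.
Qed.

Lemma restr_span f : lspan (kgen (modI X I) (modI X I)) f ->
  exists2 u, lspan (repP (t \o j)) u & (forall y, f (j y) = j (u.1 y)) /\ kp 1 1 f = u.2.
Proof.
have kc := @kap_cont _ _ _ T _ _ _ _ hI hr 1 1.
elim/lspan_ind => [|c s v [z [w [hz hw ->]]] vS [u uS [uj uE]]].
  by exists 0; [exact: lspan0|split=> [y|]; [rewrite /= (lin0 jl)|exact: lin_on0 (@kset0 _ _ _ _ _ _) (kc_lin kc)]].
exists (c *: ((theta (jV z) (jV w), t z ** cstar (t w)) : (XI -> XI) * B) + u)%R.
  by apply: lspan_cons => //; exists (jV z), (jV w); rewrite /= !jVK.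
split=> [y|].
  change (c *: theta z w (j y) + v (j y) = j (c *: theta (jV z) (jV w) y + u.1 y)).
  by rewrite jl uj /theta (rc_ract hj) (rc_ip hj) !jVK.
rewrite (kc_lin kc) ?uE //; [|exact: kset_theta|exact: kset_span].
by congr (_ *: _ + _); rewrite (@kap_theta _ _ _ T _ _ _ _ hI hr 1 1).
Qed.

(** Translates coisometry for the abstract correspondence XI into an identity for [kap] inside X.
    Finite sums correspond on both sides ([lift_span], [restr_span]), and norms agree by
    [restr_bd]. *)
Lemma restr_coiso b : KI (lact (c := X) (i b)) ->
  approx_coiso (pi \o i) (t \o j) b <-> pi (i b) = kp 1 1 (lact (c := X) (i b)).
Proof.
move=> kb; have kc := @kap_cont _ _ _ T _ _ _ _ hI hr 1 1.
have kN f : KI f -> KI (lact (c := X) (i b) - f) /\ kp 1 1 (lact (c := X) (i b) - f) = kp 1 1 (lact (c := X) (i b)) - kp 1 1 f.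
  move=> kf; have := kc_lin kc (-1) kf kb; rewrite !scaleN1r addrC => ->; split; last exact: addrC.
  by rewrite addrC -scaleN1r; apply: ksetD => //; exact: ksetZ.
have dif f (u : (XI -> XI) * B) y : (forall y, f (j y) = j (u.1 y)) -> (lact (c := X) (i b) - f) (j y) = j ((lact (c := XI) b - u.1) y).
  move=> fj; change (lact (i b) (j y) - f (j y) = j (lact b y - u.1 y)).
  by rewrite (linB jl) fj (rc_lact hj).
split=> [h|h e e0].
  apply: eq_nr => e e0; have e2 : 0 < e / 2 by rewrite divr_gt0.
  have [u uS [ub un]] := h _ e2; have [f [kf fj fE]] := lift_span uS.
  rewrite (le_trans (nr_tri u.2 _ _)) // [leRHS]splitr lerD // nrC -fE -(proj2 (kN f kf)).
  apply: kap_bd; [exact: (proj1 (kN f kf))|exact: ltW|].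
  by apply: restr_bd; [exact: (proj1 (kN f kf))|exact: ltW|move=> y; rewrite (dif f u) // j_nr].
have [f fS bf] := kb _ e0; have [u uS [uj uE]] := restr_span fS; exists u => //.
have kf := kset_span fS; split.
  by move=> y; rewrite -j_nr -(dif f u) // -(j_nr y).
by rewrite /= h -uE -(proj2 (kN f kf)); apply: kap_bd => //; [exact: (proj1 (kN f kf))|exact: ltW].
Qed.

End Restricted.

Section KapNat.
Variables (R : realType) (A : cstarAlg R) (X : corr A A) (T : tensor_powers X) (I : set A).
Variables (B B' : cstarAlg R) (pi : A -> B) (t : X -> B).
Local Notation E := (tpow T).
Local Notation tn := (@tens R A X T).
Local Notation Z := (@zpow R A X T I).
Hypotheses (hI : cstar_ideal I) (hr : irep I pi t).
Local Notation kp n m := (@kap R A X T I B pi t hI hr n m).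
Local Notation s n := (@tpowr R A X T I B pi t n).
Let rep n := @tpowr_rep R A X T I B pi t hI hr n.

Lemma kc_sub (Y Y' : hilbMod A) (N N1 : set Y') (N' N1' : set Y) (W : normedModType R[i]) (F : (Y -> Y') -> W) :
  N `<=` N1 -> N' `<=` N1' -> kcont N1 N1' F -> kcont N N' F.
Proof.
move=> h h' [l [C C0 b]]; split=> [k f g kf kg|]; first by apply: l; [apply: kset_sub kf|apply: kset_sub kg].
by exists C => // f M kf; apply: b; apply: kset_sub kf.
Qed.

Variables (L : B -> B') (s' : forall n, E n -> B') (D : nat -> R).
Arguments s' : clear implicits.
Hypotheses (hL : star_hom L)
  (sl : forall n (c : R[i]) u v, Z n u -> Z n v -> s' n (c *: u + v) = c *: s' n u + s' n v)
  (sD : forall n u, Z n u -> nr (s' n u) <= D n * nr u)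
  (s0 : forall a, I a -> L (pi a) = s' 0%N a) (s1 : forall x, modI X I x -> L (t x) = s' 1%N x)
  (st : forall n y x, Z n.+1 y -> modI X I x -> s' n.+2 (tn y x) = s' n.+1 y ** s' 1%N x).

Lemma tpowr_natI n u : Z n u -> L (s n u) = s' n u.
Proof.
have hpi := ir_hom hr.
apply: (@zpow_agree _ _ _ T I B' (fun n u => L (s n u)) s' (fun=> 1) D) => //.
- by move=> m c v w hv hw; rewrite (mr_lin (rep m)) // (sh_lin hL).
- by move=> m v hv; rewrite mul1r (le_trans (star_hom_contractive _ hL)) // (mr_nr hI hpi (rep m)).
- by move=> m y x hy hx e; rewrite (tpowr_tens hI hr) // (sh_mul hL) e s1 // st.
Qed.

Lemma kap_nat n m (G : (E m -> E n) -> B') : kcont (Z n) (Z m) G ->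
  (forall z y, Z n z -> Z m y -> G (theta z y) = s' n z ** cstar (s' m y)) ->
  forall a, kset (Z n) (Z m) a -> L (kp n m a) = G a.
Proof.
move=> Gc Gt; apply: (kc_eq _ Gc); first exact: (kc_hom hL (@kap_cont _ _ _ T _ _ _ _ hI hr n m)).
move=> z y hz hy; rewrite (@kap_theta _ _ _ T _ _ _ _ hI hr n m) // Gt // (sh_mul hL) (sh_star hL).
by rewrite !tpowr_natI.
Qed.

(** [a] is a limit of products a u with u taken from the closed algebra of compact operators on
    [Z n]; composing a with a rank-one approximant of u moves its vector into [Z n] and X^n J at
    once. *)
Lemma kset_cut n (J : set A) (a : E n -> E n) : cstar_ideal J -> kset (modI (E n) J) setT a ->
  kset (Z n) (Z n) a -> kset (Z n `&` modI (E n) J) (Z n) a.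
Proof.
move=> hJ kJ ka; pose M := [set D : LOp (@CS R A (E n)) | kset (Z n) (Z n) (lapp D)].
have hM : calg M.
  have [c1 c2 c3 c4] := kset_lop (Z n) (Z n); split=> // b b' k k'.
  rewrite /M /mkset (_ : lapp (b ** b') = lapp b \o lapp b'); last by apply/funext => y; rewrite lappM.
  exact: (proj1 (@kap_mul _ _ _ T _ _ _ _ hI hr 0 n n n _ _ k k')).
have [a' ka' aa] := kset_adj ka; have [C C0 aC] := kset_bd ka.
have [b bE] := LOp_mk (@CS R A (E n)) aa aC.
have Mb : M b by rewrite /M /mkset bE.
have Mb' : M (cstar b).
  rewrite /M /mkset; have -> : lapp (cstar b) = a' by apply: (adj_uniq (f := a)) aa; rewrite -bE; exact: lapp_adj.
  exact: ka'.
apply: kset_closed => e e0; have [u [_ _ hu _ uM]] := @approx_unit _ _ (self_hilbMod (LOp (@CS R A (E n)))) b e e0.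
have Mu : M u := uM M hM (ca_M hM Mb' Mb).
exists (a \o lapp u).
  apply: (kset_compl _ C0 aC aa Mu) => z hz; split; last exact: kset_in hJ kJ z.
  by have [] := @kap_acts _ _ _ T _ _ _ _ hI hr n n a 0 ka z hz.
move=> y; change (nr (a y - a (lapp u y)) <= e * nr y).
rewrite (_ : a y - _ = lapp (b - b ** u) y); last by rewrite lappB lappM bE.
by rewrite (le_trans (lapp_le _ _)) // ler_wpM2r ?nr_ge0.
Qed.

End KapNat.

Lemma KX_vec (R : realType) (A : cstarAlg R) (X : corr A A) (T : tensor_powers X) (K : set A) n (z : tpow T n) :
  cstar_ideal K -> modI (tpow T n) K z -> KX K (vec z).
Proof.
move=> hK /(modI_fact2 hK)[w [k [wK Kk sk ->]]]; rewrite KXE.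
rewrite (_ : vec _ = theta w (k : tpow T 0)); first exact: kset_theta.
by apply/funext => a; rewrite /vec /theta -ractA /= /self_ip sk.
Qed.

Section Embed.
Variables (R : realType) (A : cstarAlg R) (X : corr A A) (T : tensor_powers X) (J I : set A).
Hypotheses (hJ : cstar_ideal J) (hJX : J `<=` Jideal X) (hI : cstar_ideal I) (hinv : X_invariant X I).
Local Notation E := (tpow T).
Local Notation tn := (@tens R A X T).
Local Notation Z := (@zpow R A X T I).
Variables (O : cstarAlg R) (iA : A -> O) (iX : X -> O) (hO : is_relCP J iA iX).
Variables (EE : cstarAlg R) (i : EE -> A) (XI : corr EE EE) (j : XI -> X).
Hypotheses (hi : is_ideal_alg I i) (hj : is_restricted_corr I i j).
Variables (O3 : cstarAlg R) (kA : EE -> O3) (kX : XI -> O3) (h3 : is_relCP (i @^-1` J) kA kX).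
Let ih : star_hom i. Proof. by case: hi. Qed.
Let hO' := cp_rep hO.
Local Notation iota := (@tensor_rep R A X O iA iX (cp_rep hO) T).

Lemma irepO : irep I iA iX.
Proof.
have [h l r ip la] := cp_rep hO; split=> [||a x _ _]; last exact: la.
  by split=> *; rewrite ?(sh_lin h) ?(sh_mul h) ?(sh_star h).
split=> [|u v|k u||u a hu Ia|u v hu _|k u v _ _|u a _ _|u v _ _]; rewrite ?l ?r ?ip //.
- exact: modI0.
- exact: modID.
- exact: modIZ.
- exact: modI_closed.
- exact: modI_ract.
- exact: (proj1 (modIPl hI u) hu).
Qed.

Local Notation iV := (iV i).
Local Notation jV := (jV j).
Let pi3 := kA \o iV.
Let t3 := kX \o jV.

Lemma irep3 : irep I pi3 t3.
Proof.
have [h l r ip la] := cp_rep h3.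
have iE a b : i a = i b -> a = b by case: hi => _ + _; apply.
have jE := rc_inj hj; have il := sh_lin ih; have jl := rc_lin hj.
have iK := iVK hi; have jK := jVK hj.
have Iip u v : modI X I u -> I (hip u v) by move=> hu; exact: (proj1 (modIPl hI u) hu).
split.
- split=> [k a b Ia Ib|a b Ia Ib|a Ia] /=; rewrite -?(sh_lin h) -?(sh_mul h) -?(sh_star h); congr kA; apply: iE.
  + by rewrite il !iK //; apply: (id_add hI) => //; exact: (id_scale hI).
  + by rewrite (sh_mul ih) !iK //; exact: (id_mull hI).
  + by rewrite (sh_star ih) !iK //; exact: ideal_star.
- split=> [|u v|k u||u a hu Ia|u v hu _|k u v hu hv|u a hu Ia|u v hu hv] /=.
  + exact: modI0.
  + exact: modID.
  + exact: modIZ.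
  + exact: modI_closed.
  + exact: modI_ract.
  + exact: Iip.
  + rewrite -l; congr kX; apply: jE; rewrite jl !jK //; apply: modID => //; exact: modIZ.
  + by rewrite -r; congr kX; apply: jE; rewrite (rc_ract hj) !jK ?iK //; exact: modI_ract.
  + rewrite ip; congr kA; apply: iE; rewrite (rc_ip hj) !jK ?iK //; exact: Iip.
- move=> a x Ia hx /=; rewrite -la; congr kX; apply: jE; rewrite (rc_lact hj) !jK ?iK //; exact: modI_lact.
Qed.

Local Notation kO n m := (@kap R A X T I O iA iX hI irepO n m).
Local Notation k3 n m := (@kap R A X T I O3 pi3 t3 hI irep3 n m).
Local Notation KZ n m := (kset (Z n) (Z m)).

Lemma tp_zpow (B : cstarAlg R) (pi : A -> B) (t : X -> B) (L : B -> O) (hr : irep I pi t) : star_hom L ->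
  (forall a, I a -> L (pi a) = iA a) -> (forall x, modI X I x -> L (t x) = iX x) ->
  forall n m a, KZ n m a -> L (@kap R A X T I B pi t hI hr n m a) = iota a.
Proof.
move=> hL hpi ht n m; apply: (@kap_nat _ _ _ T _ _ _ _ _ hI hr L (fun n => @tp _ _ _ T _ iA iX n) (fun=> 1)) => //.
- by move=> k c u v _ _; exact: (tp_lin hO').
- by move=> k u _; rewrite mul1r (tp_nr hO').
- by move=> k y x _ _; exact: (tp_tens hO').
- by apply: (kc_sub _ _ (tensor_rep_cont _ _ _ _)).
- by move=> z y _ _; exact: tensor_rep_theta.
Qed.

Let il3 b : J (i b) -> kset (modI X I) (modI X I) (lact (c := X) (i b)).
Proof. by move=> Jb; apply: (lact_kset hJ hJX hI hinv); split=> //; exact: (iI hi). Qed.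

(** The condition under which O(J cap I, XI) maps to O(J,X). It is the coisometry of [iota] in
    degree 0, read through [restr_coiso]. *)
Lemma restr_coisoO : i @^-1` J `<=` approx_coiso (iA \o i) (iX \o j).
Proof.
move=> b Jb; apply/(restr_coiso T hI hi hj irepO (il3 Jb)).
have -> := @tp_zpow O iA iX id irepO (@star_hom_id _ _) (fun _ _ => erefl) (fun _ _ => erefl) 1 1 _ (il3 Jb).
have kv := @KX_vec _ _ _ T J 0 (i b) hJ (modI_self hJ Jb).
have := iota_coiso hJ hJX hO kv; rewrite otimes1_vec => <-.
by rewrite tensor_rep_vec.
Qed.

Lemma restr_Jideal : i @^-1` J `<=` Jideal XI.
Proof. by move=> b /restr_coisoO/approx_coiso_kset; rewrite /Jideal /= compactsE. Qed.

Lemma icoiso3 : icoiso T hI irep3 (J `&` I).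
Proof.
move=> b [Jb Ib]; have kb := lact_kset hJ hJX hI hinv (conj Jb Ib); split=> //.
have e := iVK hi Ib; rewrite -[in LHS]e -[in RHS]e; rewrite -e in Jb kb.
apply/(restr_coiso T hI hi hj irep3 kb).
have -> : pi3 \o i = kA by apply/funext => c; rewrite /pi3 /= (iK hi).
have -> : t3 \o j = kX by apply/funext => c; rewrite /t3 /= (jK hj).
exact: (coisoP (cp_coiso h3) restr_Jideal).
Qed.

End Embed.

Section Embed2.
Variables (R : realType) (A : cstarAlg R) (X : corr A A) (T : tensor_powers X) (J I : set A).
Hypotheses (hJ : cstar_ideal J) (hJX : J `<=` Jideal X) (hI : cstar_ideal I) (hinv : X_invariant X I).
Local Notation E := (tpow T).
Local Notation tn := (@tens R A X T).
Local Notation Z := (@zpow R A X T I).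
Variables (O : cstarAlg R) (iA : A -> O) (iX : X -> O) (hO : is_relCP J iA iX).
Variables (EE : cstarAlg R) (i : EE -> A) (XI : corr EE EE) (j : XI -> X).
Hypotheses (hi : is_ideal_alg I i) (hj : is_restricted_corr I i j).
Variables (O3 : cstarAlg R) (kA : EE -> O3) (kX : XI -> O3) (h3 : is_relCP (i @^-1` J) kA kX).
Local Notation iota := (@tensor_rep R A X O iA iX (cp_rep hO) T).
Local Notation pi3 := (kA \o iV i).
Local Notation t3 := (kX \o jV j).
Local Notation hr3 := (irep3 hI hi hj h3).
Local Notation k3 n m := (@kap R A X T I O3 pi3 t3 hI hr3 n m).
Local Notation KZ n m := (kset (Z n) (Z m)).
Local Notation tq n := (@tp R A X T O iA iX n).
Let rep n := @tpowr_rep R A X T I O3 pi3 t3 hI hr3 n.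

Let G n m : set O3 := [set b | exists2 a, KZ n m a & b = k3 n m a].

Let Gs n m b : G n m b -> G m n (cstar b).
Proof.
move=> [a ka ->]; have [a' ka' aa] := kset_adj ka; exists a' => //.
exact: kap_star aa.
Qed.

Let Gm k l m n a b : G n m a -> G (k + m)%N l b -> G (k + n)%N l (a ** b).
Proof.
move=> [a' ka ->] [b' kb ->]; have [kc e] := @kap_mul _ _ _ T _ _ _ _ hI hr3 _ _ _ _ _ _ ka kb.
by exists (otimes1k a' (k := k) \o b').
Qed.

Let span3 b : approx (lspan [set b | exists n m, G n m b]) b.
Proof.
suff h : approx (lspan [set b | exists n m, G n m b]) = setT by rewrite h.
apply: (cp_gen h3); first exact: graded_sub.
move=> _ [[c _ <-]|[y _ <-]]; apply/approx_mem/lspan_gen.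
  have [kv e] := @kap_vec _ _ _ T _ _ _ _ hI hr3 0 (i c) (iI hi c).
  by exists 0%N, 0%N, (vec (i c : E 0)) => //; rewrite e /= (iK hi).
have [kv e] := @kap_vec _ _ _ T _ _ _ _ hI hr3 1 (j y) (jI hj y).
by exists 1%N, 0%N, (vec (j y : E 1)) => //; rewrite e /= (jK hj).
Qed.

Lemma zpow_modI n z : Z n z -> modI (E n) I z.
Proof. by move=> hz; apply/(modI_hip hI); exact: (mr_I (rep n)). Qed.

Let core3 : core_sys (T := T) J (fun k => KZ k k) (fun k => k3 k k).
Proof.
split=> [k a|k|k c a b ka kb|k a|k a ka|k l a b ka kb|k c a b ka kb|k a M ka|k a ka kJ].
- exact: kset_sub.
- exact: kset0.
- by apply: ksetD => //; exact: ksetZ.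
- exact: kset_closed.
- have [a' ka' aa] := kset_adj ka; exists a' => //; split=> //; exact: kap_star aa.
- exact: kap_mul.
- exact: (kc_lin (@kap_cont _ _ _ T _ _ _ _ hI hr3 k k)).
- exact: kap_bd.
- have kI : kset (modI (E k) I) setT a by apply: kset_sub ka => // z; exact: zpow_modI.
  have kJI := kset_cap hJ hI kJ kI; have hJI := idealI hJ hI.
  have [h <-] := kap_coiso hJI (@subIsetr _ J I) (icoiso3 T hJ hJX hI hinv hO hi hj h3) (kset_cut hI hr3 hJI kJI ka).
  by [].
Qed.

Let gauge3 (z : R[i]) : cabs z = 1 -> exists2 al : O3 -> O3, star_hom al &
  [/\ forall c, al (kA c) = kA c, forall y, al (kX y) = z *: kX y &
  forall n m b, G n m b -> al b = (z ^+ n * conjc z ^+ m) *: b].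
Proof.
move=> hz; have [al hal [alA alX]] := relCP_gauge h3 hz; exists al => //; split=> // n m _ [a ka ->].
apply: (@kap_nat _ _ _ T _ _ _ _ _ hI hr3 al (fun n u => z ^+ n *: @tpowr R A X T I O3 pi3 t3 n u) (fun n => cabs (z ^+ n)) hal _ _ _ _ _ n m (fun a => (z ^+ n * conjc z ^+ m) *: k3 n m a)) ka.
- by move=> k c u v hu hv; rewrite (mr_lin (rep k)) // scalerDr !scalerA mulrC.
- by move=> k u hu; rewrite nrZ ler_wpM2l ?cabs_ge0 // (mr_nr hI (ir_hom hr3) (rep k)).
- by move=> a0 _ /=; rewrite expr0 scale1r alA.
- by move=> x _ /=; rewrite expr1 alX.
- move=> k y x hy hx; rewrite (tpowr_tens hI hr3 hy hx) cmulZl cmulZr scalerA expr1 -exprSr.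
  by [].
- apply: (kc_comp (L := fun b : O3 => (z ^+ n * conjc z ^+ m) *: b) (D := cabs (z ^+ n * conjc z ^+ m))).
  + exact: kap_cont.
  + by move=> c v w; rewrite scalerDr !scalerA mulrC.
  + exact: cabs_ge0.
  + by move=> w; rewrite nrZ.
- move=> v w hv hw; rewrite (@kap_theta _ _ _ T _ _ _ _ hI hr3 n m) // cstarZc cmulZl cmulZr scalerA.
  by rewrite rmorphXn.
Qed.

Definition rspan : set O := [set o | exists n m (z : E n) (y : E m), [/\ Z n z, Z m y & o = tq n z ** cstar (tq m y)]].

(** Same pattern as for [ox_iso]: the core system is now made of the compact operators on the powers
    [zpow], and the range is the span [rspan] with both legs in these powers. *)
Theorem embed3 : exists2 g : O3 -> O, star_hom g &
  [/\ forall b, g (kA b) = iA (i b), forall y, g (kX y) = iX (j y),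
      forall b, g b = 0 -> b = 0 & range g = approx (lspan rspan)].
Proof.
have hrO := irepO hI hO.
have [g hg [gA gX]] := cp_univ h3 (irep_comp hi hj hrO) (approx_coisometric (irep_comp hi hj hrO) (restr_coisoO T hJ hJX hI hinv hO hi hj)).
have gk n m a : KZ n m a -> g (k3 n m a) = iota a.
  apply: (tp_zpow hI hO hr3) => // [b Ib|x hx] /=; first by rewrite gA /= (iVK hi).
  by rewrite gX /= (jVK hj).
have inj : forall b, g b = 0 -> b = 0.
  have /choice[al alP] (z : R[i]) : exists al : O3 -> O3, cabs z = 1 -> star_hom al /\
    [/\ forall c, al (kA c) = kA c, forall y, al (kX y) = z *: kX y &
  forall n m b, G n m b -> al b = (z ^+ n * conjc z ^+ m) *: b].
    have [hz|hz] := pselect (cabs z = 1); last by exists id.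
    by have [al h1 h2] := gauge3 hz; exists al.
  apply: (@gauge_inj R O3 O g al G
    [set c | exists n D, drel (T := T) (fun k => KZ k k) (fun k => k3 k k) n D c] hg).
  - by move=> z /(alP z)[].
  - move=> z b hz b0; have [ha [aA aX _]] := alP z hz.
    have [Ga hG [GA GX]] := relCP_gauge hO hz.
    suff e : g \o al z =1 Ga \o g by rewrite [LHS]e /= b0 (lin0 (sh_lin hG)).
    apply: (star_hom_eq (cp_gen h3)); [exact: star_hom_comp|exact: star_hom_comp|].
    move=> _ [[c _ <-]|[y _ <-]] /=; first by rewrite aA gA GA.
    by rewrite aX (linZ (sh_lin hg)) gX GX.
  - by move=> n m z b hz; have [_ [_ _]] := alP z hz; apply.
  - exact: span3.
  - by exists 0%N, 0; apply: (drel0 core3).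
  - move=> k c d [n [D hD]] [n' [D' hD']]; exists (maxn n n'), (k *: D + D').
    by apply: (drel_lin core3); [apply: (drel_pad core3 _ hD)|apply: (drel_pad core3 _ hD')]; rewrite ?leq_maxl ?leq_maxr.
  - by move=> n b [a ka ->]; exists n.+1, (fock_iota a); exact: (drel_gen core3).
  - move=> c [n [D [a Wa [_ ->]]]]; apply: (le_trans (core_bound hJ hJX core3 hO n Wa)).
    rewrite /csum (big_morph g (linD (sh_lin hg)) (lin0 (sh_lin hg))).
    rewrite [X in _ <= nr X](eq_bigr (fun k : 'I_n => iota (a k))) ?lexx // => k _.
    exact: gk.
exists g => //; split=> //; apply/seteqP; split=> [_ [b _ <-]|o ho].
  have gl := sh_lin hg.
  apply: (approx_lspan_map (C := 1) (linD gl) _ ler01 _ (lin0 gl)) (span3 b).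
  - by move=> k a; rewrite (linZ gl); exact: approx_lspan_Z.
  - by move=> a c; rewrite mul1r -(linB gl) star_hom_contractive.
  move=> _ [n [m [a ka ->]]]; rewrite gk //.
  apply: (@tensor_rep_span _ _ _ _ _ _ _ (cp_rep hO) n m (Z n) (Z m) _ a _ ka) => z y hz hy.
  by exists n, m, z, y.
apply: (approx_lspan_sub (sub_calg (inj_range hg inj))) ho => _ [n [m [z [y [hz hy ->]]]]].
have kt : KZ n m (theta z y) by exact: kset_theta.
by exists (k3 n m (theta z y)) => //; rewrite gk // tensor_rep_theta.
Qed.

End Embed2.

(** * The hereditary subalgebra and Morita equivalence *)

Section Corner.
Variables (R : realType) (A : cstarAlg R) (X : corr A A) (T : tensor_powers X) (J I : set A).
Hypotheses (hI : cstar_ideal I) (hinv : X_invariant X I).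
Local Notation E := (tpow T).
Local Notation tn := (@tens R A X T).
Local Notation Z := (@zpow R A X T I).
Variables (O : cstarAlg R) (iA : A -> O) (iX : X -> O) (hO : is_relCP J iA iX).
Let hr := cp_rep hO.
Local Notation tq n := (@tp R A X T O iA iX n).
Local Notation rs := (rspan T I iA iX).
Let hrI := irepO hI hO.
Let rep n := @tpowr_rep R A X T I O iA iX hI hrI n.

(** On y (x) x, write phi(c) y = w k with k in I by induction and move k across the tensor sign; k x
    lies in XI by invariance. *)
Lemma lact_zpow c n (u : E n) : I c -> Z n (lact c u).
Proof.
elim: n c u => [|[|n] IH] c u Ic; [exact: (id_mulr hI)|exact: hinv|].
apply: (mr_cl (rep n.+2)) => e e0; have [bd_ M0 hb] : exists2 M : R, 0 <= M & obd (lact (c := E n.+2) c) M.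
  by exists (nr c); [exact: nr_ge0|exact: lact_bd].
have d0 : 0 < e / (1 + bd_) by rewrite divr_gt0 // ltr_pwDl.
have [v vS hv] := elem_dense u d0; exists (lact c v).
  elim/lspan_ind: vS {hv} => [|k w v' [y [x ->]] _ IHv]; first by rewrite (lin0 (lact_linr _)); exact: (mr_0 (rep n.+2)).
  rewrite lact_linr; apply: (mr_D (rep n.+2)) => //; apply: (mr_Z (rep n.+2)).
  rewrite tens_lact; have [w' [k' [hw Ik _ ->]]] := mr_fact hI (rep n.+1) (IH c y Ic).
  by rewrite tens_bal; apply: (zpow_tens (n := n.+1)) => //; exact: hinv.
rewrite -(linB (lact_linr _)) (le_trans (hb _)) // mulrC (le_trans (ler_wpM2r M0 hv)) //.
by apply: frac_small => //; exact: ltW.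
Qed.

Let Tinv : X_invariant X [set: A]. Proof. by move=> a x _; rewrite modIT. Qed.

Lemma tp_span o : approx (lspan (idspan T iA iX setT)) o.
Proof.
have hV := idspan_ideal T hr (@idealT _ _) Tinv (cp_gen hO).
suff h : approx (lspan (idspan T iA iX setT)) = setT by rewrite h.
apply: (cp_gen hO); first exact: ideal_sub.
move=> _ [[a _ <-]|[x _ <-]].
  have [b [c [_ _ _ ->]]] := ideal_fact (@idealT _ A) (Logic.I : [set: A] a).
  rewrite (sh_mul (rep_hom hr)) -[iA c]cstarK -(sh_star (rep_hom hr)); apply: approx_mem; apply: lspan_gen.
  by exists 0%N, 0%N, b, (cstar c); rewrite modIT.
have hx : modI X setT x by rewrite modIT.
have [w [k [_ _ sk ->]]] := modI_fact2 (@idealT _ A) hx.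
rewrite (rep_ract hr) -sk (sh_star (rep_hom hr)); apply: approx_mem; apply: lspan_gen.
by exists 1%N, 0%N, w, k; rewrite modIT.
Qed.

Let R3 := approx (lspan rs).

Lemma corner_mid c b o : I c -> I b -> R3 (iA c ** o ** iA b).
Proof.
move=> Ic Ib; apply: (approx_lspan_map (f := fun o => iA c ** o ** iA b) (C := nr (iA c) * nr (iA b))) (tp_span o).
- by move=> x y; rewrite cmulDr cmulDl.
- by move=> k x; rewrite cmulZr cmulZl; exact: approx_lspan_Z.
- by rewrite mulr_ge0 ?nr_ge0.
- move=> x y; rewrite -cmulBl -cmulBr (le_trans (nrM _ _)) // mulrAC ler_wpM2r ?nr_ge0 //; exact: nrM.
- by rewrite cmul0r cmul0l.
move=> _ [n [m [u [v [_ ->]]]]]; apply/approx_mem/lspan_gen.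
exists n, m, (lact c u), (lact (cstar b) v); split; [exact: lact_zpow|by apply: lact_zpow; exact: ideal_star|].
by rewrite -!(tp_lact hr) cstarM -(sh_star (rep_hom hr)) cstarK !cmulA.
Qed.

Hypothesis hR : cstar_sub R3.
Let cR := sub_calg hR.
Let rsR x : rs x -> R3 x. Proof. by move=> h; apply/approx_mem/lspan_gen. Qed.

(** Vectors of [zpow] have right factors in I. Factoring them, and splitting each factor of I in
    two, writes the product as three factors in the span, the middle one by [corner_mid]. *)
Lemma corner_gen s0 s1 o : rs s0 -> rs s1 -> R3 (s0 ** o ** s1).
Proof.
move=> [n [m [z [y [hz hy ->]]]]] [n' [m' [z' [y' [hz' hy' ->]]]]].
have [y1 [c [hy1 Ic sc ->]]] := mr_fact hI (rep m) hy.
have [z1 [b [hz1 Ib _ ->]]] := mr_fact hI (rep n') hz'.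
have [c1 [c2 [Ic1 Ic2 _ cE]]] := ideal_fact hI Ic; have [b1 [b2 [Ib1 Ib2 _ bE]]] := ideal_fact hI Ib.
have hm := sh_mul (rep_hom hr); have hs := sh_star (rep_hom hr).
rewrite !(tp_ract hr) cstarM -hs sc cE bE !hm.
rewrite (_ : _ ** _ = (tq n z ** iA c1) ** (iA c2 ** (cstar (tq m y1) ** o ** tq n' z1) ** iA b1) ** (iA b2 ** cstar (tq m' y'))); last by rewrite !cmulA.
apply: (sub_mul hR); first apply: (sub_mul hR).
- apply: rsR; exists n, 0%N, z, (cstar c1); split=> //; first exact: ideal_star.
  by rewrite /tp /= hs cstarK.
- exact: corner_mid.
- by apply: rsR; exists 0%N, m', b2, y'.
Qed.

Lemma corner_her r r' o : R3 r -> R3 r' -> R3 (r ** o ** r').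
Proof.
have h s x : rs s -> R3 x -> forall o, R3 (s ** o ** x).
  by move=> hs hx p; apply: (approx_lspan_lmul (V := R3) erefl _ hx) => w hw; exact: corner_gen.
move=> hr0 hr'; rewrite -cmulA; apply: (approx_lspan_rmul (V := R3) erefl _ hr0) => w hw.
by rewrite cmulA; exact: h.
Qed.

Local Notation OI := (ideal_gen (iA @` I)).

Lemma corner_iA c : I c -> R3 (iA c).
Proof.
move=> Ic; have [b [k [Ib Ik sk ->]]] := ideal_fact hI Ic; apply: rsR; exists 0%N, 0%N, b, k; split=> //.
by rewrite (sh_mul (rep_hom hr)) /tp /= -(sh_star (rep_hom hr)) sk.
Qed.

Lemma corner_ideal r : R3 r -> OI r.
Proof.
have hOI := ideal_genP (iA @` I); move=> h3.
apply: (approx_lspan_sub (S := rs) (K := OI) (ideal_calg hOI) _ h3) => _ [n [m [z [y [hz hy ->]]]]].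
have [w [k [_ Ik _ ->]]] := mr_fact hI (rep n) hz.
by rewrite (tp_ract hr); apply: (id_mulr hOI); apply: (id_mull hOI); apply: gen_sub; exists k.
Qed.

(** The hypothesis puts X^n I inside [zpow n]: in (y (x) x) b1 b2 write x b1 = phi(a) x' and move a
    to y. Splitting the factor k of w k then puts both legs of a spanning element of O(I) into
    [zpow]. *)
Lemma corner_full : [set y : X | exists a x, I a /\ y = lact a x] = modI X I -> R3 = OI.
Proof.
move=> hX; apply/seteqP; split=> [r|o]; first exact: corner_ideal.
have modZ n (u : E n) b : I b -> Z n (ract u b).
  elim: n u b => [|[|n] IH] u b Ib; [exact: (id_mull hI)|exact: modI_ractI|].
  apply: (mr_cl (rep n.+2)) => e e0.
  have d0 : 0 < e / (1 + nr b) by rewrite divr_gt0 // ltr_pwDl // nr_ge0.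
  have [v vS hv] := elem_dense u d0; exists (ract v b).
    elim/lspan_ind: vS {hv} => [|k w v' [y [x ->]] _ IHv]; first by rewrite ract0l; exact: (mr_0 (rep n.+2)).
    rewrite ractDl ractZl; apply: (mr_D (rep n.+2)) => //; apply: (mr_Z (rep n.+2)).
    have [b1 [b2 [Ib1 Ib2 _ ->]]] := ideal_fact hI Ib.
    have : modI X I (ract x b1) by exact: modI_ractI.
    rewrite -hX => -[a [x' [Ia xE]]]; rewrite tens_ract ractA xE -lact_ract -tens_bal.
    by apply: (zpow_tens (n := n.+1)); [exact: IH|exact: modI_ractI].
  rewrite -ractBl (le_trans (nr_ract _ _)) // (le_trans (ler_wpM2r (nr_ge0 _) hv)) //.
  by apply: frac_small; rewrite ?nr_ge0 // ltW.
rewrite (idspanE T hr hI hinv (cp_gen hO)).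
apply: (approx_lspan_sub cR) => _ [n [m [z [y [[w [k [Ik ->]]] ->]]]]].
have [b1 [b2 [Ib1 Ib2 _ ->]]] := ideal_fact hI Ik; apply: rsR.
exists n, m, (ract w b1), (ract y (cstar b2)); split; [exact: modZ|by apply: modZ; exact: ideal_star|].
by rewrite !(tp_ract hr) (sh_mul (rep_hom hr)) cstarM -(sh_star (rep_hom hr)) cstarK !cmulA.
Qed.

End Corner.

(** * Imprimitivity bimodules from hereditary subalgebras *)

Section SubBanach.
Variables (R : realType) (V : completeNormedModType R[i]) (M : set V).
Hypotheses (M0 : M 0) (MD : forall u v, M u -> M v -> M (u + v)) (MZ : forall (k : R[i]) u, M u -> M (k *: u))
  (Mcl : approx M `<=` M).

Definition sbP : {pred V} := fun v => `[< M v >].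
Lemma sbP_submod : submod_closed sbP.
Proof.
split=> [|k u v]; rewrite -!topredE /= /sbP; first exact/asboolP.
by move=> /asboolP hu /asboolP hv; apply/asboolP; apply: MD => //; exact: MZ.
Qed.
HB.instance Definition _ := GRing.isSubmodClosed.Build R[i] V sbP sbP_submod.
Record sb := Sb { sbv : V; _ : sbv \in sbP }.
HB.instance Definition _ := [isSub for sbv].
HB.instance Definition _ := [Choice of sb by <:].
HB.instance Definition _ := [SubChoice_isSubLmodule of sb by <:].

Lemma sb_M (u : sb) : M (sbv u).
Proof. by case: u => v hv /=; apply/asboolP; exact: hv. Qed.

Lemma sb_ex v : M v -> exists u, sbv u = v.
Proof. by move=> hv; have h : v \in sbP by [exact/asboolP]; exists (Sb h). Qed.

Lemma sb_banach : banach_norm (fun u : sb => nr (sbv u)).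
Proof.
split=> [x y|k x|x|u hu].
- exact: nrD.
- exact: nrZ.
- by move=> /eqP; rewrite eq_le => /andP[h _]; apply: val_inj; exact: nr_le0.
have [l hl] := @nr_complete R V (fun n => sbv (u n)) hu.
have Ml : M l by apply: Mcl => e /hl[N hN]; exists (sbv (u N)); [exact: sb_M|exact: hN].
have [l' lE] := sb_ex Ml; exists l' => e /hl[N hN]; exists N => n Nn.
change (nr (sbv l' - sbv (u n)) <= e); rewrite lE; exact: hN.
Qed.

Lemma sub_banach : exists (W : completeNormedModType R[i]) (s : W -> V),
  [/\ linear s, forall w, nr (s w) = nr w, forall w, M (s w) & forall v, M v -> exists w, s w = v].
Proof.
exists (banach sb_banach), sbv; split=> //; [exact: sb_M|exact: sb_ex].
Qed.

End SubBanach.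

Section InjTransfer.
Variables (R : realType) (B D : cstarAlg R) (h : B -> D).
Hypotheses (hh : star_hom h) (inj : forall a, h a = 0 -> a = 0).

Lemma star_hom_inj a b : h a = h b -> a = b.
Proof. by move=> e; apply/eqP; rewrite -subr_eq0; apply/eqP/inj; rewrite (linB (sh_lin hh)) e subrr. Qed.

Lemma inj_cpos b : cpositive (h b) -> cpositive b.
Proof.
move=> hp; have [s [ss sE _ sM]] := cpos_sqrt hp.
have [c _ cE] : range h s by apply: sM; [exact/sub_calg/inj_range|exists b].
by exists c; apply: star_hom_inj; rewrite (sh_mul hh) (sh_star hh) cE ss sE.
Qed.

Lemma inj_dense (S : set B) : (forall b, approx (lspan (h @` S)) (h b)) -> closure (lspan S) = setT.
Proof.
move=> hS; rewrite closureP; apply/seteqP; split=> // b _ e e0; have [v vS hv] := hS b _ e0.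
have [u uS uE] : exists2 u, lspan S u & h u = v.
  elim/lspan_ind: vS {hv} => [|k _ w [s Ss <-] _ [u uS <-]]; first by exists 0; [exact: lspan0|exact: (lin0 (sh_lin hh))].
  by exists (k *: s + u); [exact: lspan_cons|rewrite (sh_lin hh)].
by exists u => //; rewrite -(inj_isometric hh inj) (linB (sh_lin hh)) uE.
Qed.

End InjTransfer.

Lemma calg_right_unit (R : realType) (O : cstarAlg R) (H : set O) r (e : R) : cstar_sub H -> H r -> 0 < e ->
  exists2 u, H u & nr (r - r ** u) <= e.
Proof.
move=> hH Hr e0; have [u [_ _ hu _ uM]] := @approx_unit _ _ (self_hilbMod O) r e e0.
by exists u => //; exact: (uM H (sub_calg hH) (sub_mul hH (sub_star hH Hr) Hr)).
Qed.

(** The bimodule is [M0], the closed span of O H, with inner products x^* y and x y^*. Heredity puts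
    x^* y into H, and x y^* lies in L because M0 does. The products x y^* span a closed ideal
    containing H, hence L, which is left fullness; right fullness follows from H being inside M0. *)
Theorem corner_imprimitivity (R : realType) (O F D : cstarAlg R) (L H : set O) (f : F -> O) (g : D -> O) :
  star_hom f -> (forall a, f a = 0 -> a = 0) -> range f = L ->
  star_hom g -> (forall a, g a = 0 -> a = 0) -> range g = H ->
  cstar_ideal L -> H `<=` L -> (forall r o r', H r -> H r' -> H (r ** o ** r')) ->
  (forall K, cstar_ideal K -> H `<=` K -> L `<=` K) -> morita_equivalent F D.
Proof.
move=> hf fi fL hg gi gH hL HL her gen.
have hH : cstar_sub H by rewrite -gH; exact: inj_range.
have cH := sub_calg hH.
pose S : set O := [set x | exists o r, H r /\ x = o ** r].
pose M0 := approx (lspan S).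
have SM x : S x -> M0 x by move=> h; exact/approx_mem/lspan_gen.
have M00 : M0 0 by apply: approx_mem; exact: lspan0.
have Mcl : approx M0 `<=` M0 by move=> x; exact: approx_approx.
have Ml o x : M0 x -> M0 (o ** x).
  by apply: (approx_lspan_lmul (V := M0) erefl) => _ [o' [r [Hr ->]]]; apply: SM; exists (o ** o'), r; rewrite cmulA.
have Mr x r : M0 x -> H r -> M0 (x ** r).
  move=> hx Hr; apply: (approx_lspan_rmul (V := M0) erefl _ hx) => _ [o [r' [Hr' ->]]].
  by apply: SM; exists o, (r' ** r); rewrite cmulA; split=> //; exact: sub_mul.
have HM r : H r -> M0 r.
  move=> Hr; apply: Mcl => e e0; have [u Hu hu] := calg_right_unit hH Hr e0; exists (r ** u) => //.
  by apply: SM; exists r, u.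
have ML : M0 `<=` L.
  by apply: (approx_lspan_sub (ideal_calg hL)) => _ [o [r [Hr ->]]]; apply: (id_mull hL); exact: HL.
have HS o r x : H r -> M0 x -> H (cstar (o ** r) ** x).
  move=> Hr hx.
  move=> Hr hx e e0 || idtac.
  have hy y : S y -> H (cstar (o ** r) ** y).
    move=> [o' [r' [Hr' ->]]]; rewrite cstarM cmulA -(cmulA (cstar r)); apply: her => //; exact: sub_star.
  apply: (ca_closed cH) => e e0; have d0 : 0 < e / (1 + nr (cstar (o ** r))) by rewrite divr_gt0 // ltr_pwDl // nr_ge0.
  have [y yS hxy] := hx _ d0; exists (cstar (o ** r) ** y).
    elim/lspan_ind: yS {hxy} => [|k s v Ss _ IH]; first by rewrite cmul0r; exact: (sub_0 hH).
    by rewrite cmulDr cmulZr; apply: (sub_add hH) => //; apply: (sub_scale hH); exact: hy.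
  rewrite -cmulBr (le_trans (nrM _ _)) // mulrC (le_trans (ler_wpM2r (nr_ge0 _) hxy)) //.
  by apply: frac_small; rewrite ?nr_ge0 // ltW.
have MH x y : M0 x -> M0 y -> H (cstar x ** y).
  move=> hx hy; apply: (ca_closed cH) => e e0.
  have d0 : 0 < e / (1 + nr y) by rewrite divr_gt0 // ltr_pwDl // nr_ge0.
  have [z zS hxz] := hx _ d0; exists (cstar z ** y).
    elim/lspan_ind: zS {hxz} => [|k _ v [o [r [Hr ->]]] _ IH]; first by rewrite cstar0 cmul0l; exact: (sub_0 hH).
    by rewrite cstarD cstarZc cmulDl cmulZl; apply: (sub_add hH) => //; apply: (sub_scale hH); exact: HS.
  rewrite -cmulBl -cstarB (le_trans (nrM _ _)) // nr_star (le_trans (ler_wpM2r (nr_ge0 _) hxz)) //.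
  by apply: frac_small; rewrite ?nr_ge0 // ltW.
have MLs x y : M0 x -> L (x ** cstar y) by move=> /ML hx; exact: (id_mulr hL).
have [W [s [sl sn sM sS]]] := sub_banach M00 (@approx_lspan_D _ _ _) (@approx_lspan_Z _ _ _) Mcl.
have si u v : s u = s v -> u = v.
  by move=> e; apply/eqP; rewrite -subr_eq0; apply/eqP/nr_le0; rewrite -sn (linB sl) e subrr nr0.
have /choice[sV sVK] v : exists w, M0 v -> s w = v.
  by have [/sS[w wE]|h] := pselect (M0 v); [exists w|exists 0].
have /choice[gV gVK] v : exists d, H v -> g d = v.
  by have [h|h] := pselect (H v); [move: h; rewrite -gH => -[d _ e]; exists d|exists 0].
have /choice[fV fVK] v : exists d, L v -> f d = v.
  by have [h|h] := pselect (L v); [move: h; rewrite -fL => -[d _ e]; exists d|exists 0].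
have gHd d : H (g d) by rewrite -gH; exists d.
have fLd d : L (f d) by rewrite -fL; exists d.
pose ra (w : W) (d : D) : W := sV (s w ** g d).
pose ip (w w' : W) : D := gV (cstar (s w) ** s w').
pose la (b : F) (w : W) : W := sV (f b ** s w).
pose lip (w w' : W) : F := fV (s w ** cstar (s w')).
have sra w d : s (ra w d) = s w ** g d by apply: sVK; exact: Mr.
have sla b w : s (la b w) = f b ** s w by apply: sVK; exact: Ml.
have gip w w' : g (ip w w') = cstar (s w) ** s w' by apply: gVK; exact: MH.
have flip w w' : f (lip w w') = s w ** cstar (s w') by apply: fVK; exact: MLs.
have ge := star_hom_inj hg gi; have fe := star_hom_inj hf fi.
have gl := sh_lin hg; have fl := sh_lin hf; have gm := sh_mul hg; have gs := sh_star hg.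
have raA x a b : ra x (a ** b) = ra (ra x a) b by apply: si; rewrite !sra gm cmulA.
have ral a : linear (fun x => ra x a) by move=> k x y; apply: si; rewrite sl !sra sl cmulDl cmulZl.
have rar x : linear (ra x) by move=> k a b; apply: si; rewrite sl !sra gl cmulDr cmulZr.
have ipl x : linear (ip x) by move=> k a b; apply: ge; rewrite gl !gip sl cmulDr cmulZr.
have ipr x y a : ip x (ra y a) = ip x y ** a by apply: ge; rewrite gm !gip sra cmulA.
have ips x y : cstar (ip x y) = ip y x by apply: ge; rewrite gs !gip cstarM cstarK.
have ipp x : cpositive (ip x x) by apply: (inj_cpos hg gi); rewrite gip; exists (s x).
have ipn x : `|x| ^+ 2 = `|ip x x|.
  by rewrite !nrE -rmorphXn -(inj_isometric hg gi) gip nr_starM sn.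
have lal x : linear (fun a => la a x) by move=> k a b; apply: si; rewrite sl !sla fl cmulDl cmulZl.
have laM a b x : la (a ** b) x = la a (la b x) by apply: si; rewrite !sla (sh_mul hf) cmulA.
have laa a x y : ip (la a x) y = ip x (la (cstar a) y).
  by apply: ge; rewrite !gip !sla (sh_star hf) cstarM cmulA.
pose N : corr F D := @Corr R F D (@HilbMod R D W ra ip raA ral rar ipl ipr ips ipp ipn) la lal laM laa.
exists N, lip; split.
- by move=> y k a b; apply: fe; rewrite fl !flip sl cmulDl cmulZl.
- by move=> b x y; apply: fe; rewrite (sh_mul hf) !flip sla cmulA.
- by move=> x y; apply: fe; rewrite (sh_star hf) !flip cstarM cstarK.
- by move=> x; apply: (inj_cpos hf fi); rewrite flip; exists (cstar (s x)); rewrite cstarK.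
- move=> x; rewrite !nrE -rmorphXn.
  by rewrite -(inj_isometric hf fi) flip -{1}[s x]cstarK nr_starM nr_star sn.
- by move=> x y d; apply: fe; rewrite !flip !sra gs cstarM cstarK cmulA.
- by move=> x y z; apply: si; rewrite sla sra flip gip cmulA.
- apply: (inj_dense hf fi) => b; pose V := approx (lspan (f @` [set b | exists x y, b = lip x y])).
  suff : L `<=` V by apply.
  have Vg x y : M0 x -> M0 y -> V (x ** cstar y).
    move=> /sS[w <-] /sS[w' <-]; apply/approx_mem/lspan_gen; exists (lip w w') => //; by exists w, w'.
  apply: gen => [|r Hr].
    split.
    + by apply/closedP => x; exact: approx_approx.
    + by apply: approx_mem; exact: lspan0.
    + by move=> a c; exact: approx_lspan_D.
    + by move=> k a; exact: approx_lspan_Z.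
    + move=> a c; apply: (approx_lspan_lmul (V := V) erefl) => _ [_ [x [y ->]] <-].
      by rewrite flip cmulA; apply: Vg => //; exact: Ml.
    + move=> a c ha; apply: (approx_lspan_rmul (V := V) erefl _ ha) => _ [_ [x [y ->]] <-].
      by rewrite flip -cmulA -[c]cstarK -cstarM; apply: Vg => //; exact: Ml.
  apply: approx_approx => e e0; have [u Hu hu] := calg_right_unit hH Hr e0; exists (r ** u) => //.
  by rewrite -[u]cstarK; apply: Vg; apply: HM => //; exact: sub_star.
- apply: (inj_dense hg gi) => d; apply: approx_approx => e e0.
  have [u Hu hu] := calg_right_unit hH (gHd d) e0; exists (g d ** u) => //.
  have [w wE] := sS _ (HM _ (sub_star hH (gHd d))); have [w' wE'] := sS _ (HM _ Hu).
  apply/approx_mem/lspan_gen; exists (ip w w'); first by exists w, w'.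
  by rewrite gip wE wE' cstarK.
Qed.

Lemma preim_ideal (R : realType) (A B : cstarAlg R) (h : A -> B) (L : set B) : star_hom h ->
  cstar_ideal L -> cstar_ideal (h @^-1` L).
Proof.
move=> hh hL; have hl := sh_lin hh; split=> [||a b|k a|a b|a b]; rewrite /preimage /mkset.
- apply/closedP => a ha; apply: (idl_approx hL) => e /ha[b hb hab]; exists (h b) => //.
  by rewrite -(linB hl) (le_trans (star_hom_contractive _ hh)).
- by rewrite (lin0 hl); exact: (id_0 hL).
- by rewrite (linD hl); exact: (id_add hL).
- by rewrite (linZ hl); exact: (id_scale hL).
- by rewrite (sh_mul hh); exact: (id_mull hL).
- by rewrite (sh_mul hh); exact: (id_mulr hL).
Qed.

Lemma ideal_gen_sub (R : realType) (A : cstarAlg R) (S S' : set A) : S `<=` S' -> ideal_gen S `<=` ideal_gen S'.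
Proof. by move=> h a ha K hK S'K; apply: ha => // x /h; exact: S'K. Qed.

(** * The saturation as a preimage, and the theorem *)

Section Saturation.
Variables (R : realType) (A : cstarAlg R) (X : corr A A) (J I : set A).
Hypotheses (hJ : cstar_ideal J) (hJX : J `<=` Jideal X) (hI : cstar_ideal I) (hinv : X_invariant X I).
Variables (O : cstarAlg R) (iA : A -> O) (iX : X -> O) (hO : is_relCP J iA iX).
Let hr := cp_rep hO.
Let hA := rep_hom hr.
Local Notation OI := (ideal_gen (iA @` I)).
Local Notation S := (saturation X J I).

(** Approximate a by a u with u in J, and iA(u) by a finite sum of iX(x) iX(y)^* using coisometry.
    Then iA(a) iX(x) = iX(phi(a) x) = iX(z) iA(k) with iA(k) in L. *)
Lemma preim_saturated (L : set O) : cstar_ideal L -> J_saturated X J (iA @^-1` L).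
Proof.
move=> hL a Ja hx; apply: (idl_approx hL) => e e0.
have e2 : 0 < e / 2 by rewrite divr_gt0.
have [u [Ju _ _ au _]] := ideal_unit hJ Ja e2.
have d0 : 0 < e / 2 / (1 + nr (iA a)) by rewrite divr_gt0 // ltr_pwDl // nr_ge0.
have [v vS [_ hv]] := coisoP (cp_coiso hO) hJX Ju d0; exists (iA a ** v.2).
  elim/lspan_ind: vS {hv} => [|c s w [x [y ->]] _ IH]; first by rewrite cmul0r; exact: (id_0 hL).
  rewrite cmulDr cmulZr; apply: (id_add hL) => //; apply: (id_scale hL).
  have [z [k [Kk e']]] := hx x; rewrite cmulA -(rep_lact hr) e' (rep_ract hr) -cmulA.
  by apply: (id_mull hL); exact: (id_mulr hL).
rewrite (_ : _ - _ = iA (a - a ** u) + iA a ** (iA u - v.2)); last first.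
  by rewrite (linB (sh_lin hA)) (sh_mul hA) cmulBr; lmodule R.
rewrite (le_trans (nrD _ _)) // [leRHS]splitr lerD ?(le_trans (star_hom_contractive _ hA)) //.
rewrite (le_trans (nrM _ _)) // mulrC (le_trans (ler_wpM2r (nr_ge0 _) hv)) //.
by apply: frac_small; rewrite ?nr_ge0 // ltW.
Qed.

Lemma sat_sub : I `<=` S.
Proof. by move=> a Ia; apply: subset_closure; exists 0%N. Qed.

Lemma sat_preim (T : tensor_powers X) : S = iA @^-1` OI.
Proof.
have hOI := ideal_genP (iA @` I); apply/seteqP; split=> [|a ha].
  apply: sat_min; [exact: preim_ideal|exact: preim_saturated|].
  by move=> a Ia; apply: gen_sub; exists a.
apply: (sat_kernel T (sat_ideal X hJ hI) (sat_inv hJ hI hinv) hJ hJX (sat_saturated hJ hJX hI) hO).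
apply: ideal_gen_sub ha => _ [b Ib <-]; exists b => //; exact: sat_sub.
Qed.

Lemma ideal_gen_sat (T : tensor_powers X) : OI = ideal_gen (iA @` S).
Proof.
apply/seteqP; split.
  by apply: ideal_gen_sub => _ [b Ib <-]; exists b => //; exact: sat_sub.
move=> o ho; apply: ho; first exact: ideal_genP.
by rewrite (sat_preim T) => _ [b Sb <-].
Qed.

End Saturation.

Theorem theorem6p20 (R : realType) (A : cstarAlg R) (X : corr A A)
    (T : tensor_powers X) (J I : set A)
    (hJ : cstar_ideal J) (hJX : J `<=` Jideal X)
    (hI : cstar_ideal I) (hinv : X_invariant X I)
    (O : cstarAlg R) (iA : A -> O) (iX : X -> O) (hO : is_relCP J iA iX) :
  let OI := ideal_gen (iA @` I) in
  let S := saturation X J I in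
  exists2 iota : forall n m, (tpow T m -> tpow T n) -> O,
    tensor_extension iA iX iota &
    [/\ natural_iso_ideal iota I (J `&` I) OI
        /\ natural_iso_quotient J iA iX I OI,
        (forall (E : cstarAlg R) (i : E -> A) (XI : corr E E) (j : XI -> X)
                (O3 : cstarAlg R) (kA : E -> O3) (kX : XI -> O3),
           is_ideal_alg I i -> is_restricted_corr I i j ->
           is_relCP (i @^-1` J) kA kX ->
           (forall (F : cstarAlg R) (f : F -> O),
              is_ideal_alg OI f -> morita_equivalent F O3)
           /\
           ([set y : X | exists a x, I a /\ y = lact a x] = modI X I ->
            forall (P : cstarAlg R)
                   (kappa : forall n m, (tpow T m -> tpow T n) -> P),
              is_OX I (J `&` I) kappa ->
              exists2 Psi : O3 -> P, star_iso Psi &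
                (forall b, Psi (kA b) = kappa 0%N 0%N (@vec _ _ _ T 0 (i b))) /\
                (forall y, Psi (kX y) = kappa 1%N 0%N (@vec _ _ _ T 1 (j y))))),
        [/\ cstar_ideal S, X_invariant X S, J_saturated X J S
          & S = iA @^-1` OI]
      & [/\ OI = ideal_gen (iA @` S),
            natural_iso_ideal iota S (J `&` S) OI
          & natural_iso_quotient J iA iX S OI]].
Proof.
move=> OI S; have hr := cp_rep hO.
have hS : cstar_ideal S := sat_ideal X hJ hI; have invS : X_invariant X S := sat_inv hJ hI hinv.
have hOI : cstar_ideal OI := ideal_genP _.
have OIS : OI = ideal_gen (iA @` S) := ideal_gen_sat hJ hJX hI hinv hO T.
have isoI K : cstar_ideal K -> X_invariant X K ->
  natural_iso_ideal (@tensor_rep R A X O iA iX (cp_rep hO) T) K (J `&` K) (ideal_gen (iA @` K)).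
  by move=> hK iK P kappa hP; exact: ox_iso.
have ext := tensor_rep_ext (cp_rep hO) T.
exists (@tensor_rep R A X O iA iX (cp_rep hO) T) => //; split.
- by split; [exact: isoI|exact: quotient_iso].
- move=> E i XI j O3 kA kX hi hj h3.
  have [g hg [gA gX ginj gR]] := embed3 T hJ hJX hI hinv hO hi hj h3.
  have ih : star_hom i by case: hi.
  have hR : cstar_sub (approx (lspan (rspan T I iA iX))) by rewrite -gR; exact: inj_range.
  split.
    move=> F f [hf fi fR].
    have f0 a : f a = 0 -> a = 0 by move=> a0; apply: fi; rewrite a0 (lin0 (sh_lin hf)).
    apply: (corner_imprimitivity hf f0 fR hg ginj gR hOI).
    + by move=> r; exact: (corner_ideal hI hO).
    + by move=> r o r'; exact: (corner_her hI hinv hO hR).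
    + move=> K hK RK o ho; apply: ho => // _ [b Ib <-]; apply: RK; exact: (corner_iA T hI hO).
  move=> hX P kappa hP; have [Psi [hPsi Pi PR] PE] := isoI I hI hinv P kappa hP.
  have {}PR : range Psi = OI := PR.
  (* Now [g] and [Psi] are injective homomorphisms with the same range O(I), so the isomorphism
     sought is [g] followed by the inverse of [Psi]. *)
  have R3E : _ = OI := corner_full hI hinv hO hR hX.
  have gOI c : OI (g c) by rewrite -R3E -gR; exists c.
  (* A right inverse of [Psi] on its range, with the irrelevant value 0 elsewhere. *)
  have /choice[Pv PvK] o : exists p, OI o -> Psi p = o.
    by have [h|h] := pselect (OI o); [move: h; rewrite -PR => -[p _ e]; exists p|exists 0].
  have PvE c : Psi (Pv (g c)) = g c by apply: PvK.
  have kE n (z : tpow T n) : modI (tpow T n) I z -> Psi (kappa n 0%N (vec z)) = tp iA iX z.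
    by move=> hz; rewrite PE; [exact: tensor_rep_vec|exact: KX_vec].
  exists (Pv \o g); last first.
    split=> [b|y] /=; apply: Pi; rewrite PvE.
      by rewrite gA kE //; apply: modI_self => //; exact: (iI hi).
    by rewrite gX kE //; exact: (jI hj y).
  split.
    split=> [k a b|a b|a] /=; apply: Pi.
    + by rewrite (sh_lin hPsi) !PvE (sh_lin hg).
    + by rewrite (sh_mul hPsi) !PvE (sh_mul hg).
    + by rewrite (sh_star hPsi) !PvE (sh_star hg).
  have /choice[gv gvK] p : exists c, g c = Psi p.
    have : OI (Psi p) by rewrite -PR; exists p.
    by rewrite -R3E -gR => -[c _ e]; exists c.
  exists gv => [c|p] /=; last by apply: Pi; rewrite PvE gvK.
  by apply: (star_hom_inj hg ginj); rewrite gvK PvE.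
- split=> //; [exact: sat_saturated|exact: (sat_preim hJ hJX hI hinv hO T)].
- by split=> //; rewrite OIS; [exact: isoI|exact: quotient_iso].
Qed.
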